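(* Let $\chi\in C_0^\infty(\mathbb R)$ with $\chi(t)\equiv1$ for $|t|\le\frac12$. (a) For $-\frac12<l<\frac12$ let $\mathcal J_{l+\frac12}$ be the operator on $\mathbb R^2$ $$\mathcal J_{l+\frac12}f(x)=\int_{\mathbb R} f(x_1-t,x_2-t^3)\,\frac{\chi(t)}{|t|^{l+\frac12}}\,dt .$$ Then $\mathcal J_{l+\frac12}\in I^{-\frac12,l}(\Delta,C_0)$, and the Sobolev exponent $r=\frac{2l-1}6$ (for which $\mathcal J_{l+\frac12}:H^s_{\mathrm{comp}}(\mathbb R^2)\to H^{s-r}_{\mathrm{loc}}(\mathbb R^2)$) cannot be improved: there are no $s\in\mathbb R$ and $r'<\frac{2l-1}6$ for which $\mathcal J_{l+\frac12}$ maps $H^s_{\mathrm{comp}}(\mathbb R^2)$ boundedly into $H^{s-r'}_{\mathrm{loc}}(\mathbb R^2)$. (b) The operator $\mathcal J_0f(x)=\int_{\mathbb R} f(x_1-t,x_2-t^3)\,\chi(t)\log|t|\,dt$ belongs to $I^{-\frac12,-\frac12}(\Delta,C_0)$ and does not map $H^s_{\mathrm{comp}}(\mathbb R^2)$ boundedly into $H^{s+\frac13}_{\mathrm{loc}}(\mathbb R^2)$.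
   Context: $\Delta=\{(x,\xi;x,\xi)\}$ is the diagonal relation of $T^*\mathbb R^2\setminus0$, and $C_0$ is the canonical relation such that $C_0'=\{(x,\xi;y,-\eta):(x,\xi;y,\eta)\in C_0\}$ is the conormal bundle of $\{x_2-y_2=(x_1-y_1)^3\}\subset\mathbb R^2\times\mathbb R^2$. For $p,l\in\mathbb R$, $I^{p,l}(\Delta,C_0)$ is the class of operators whose Schwartz kernel is, modulo kernels of elements of $I^{p+l}(\Delta)+I^p(C_0)$ (Hörmander's classes of Fourier integral operators), of the form $$\int_{\mathbb R^2}e^{i[(x_1-y_1)\theta_1+(x_2-y_2-(x_1-y_1)^3)\theta_2]}a(x,y;\theta_2;\theta_1)\,d\theta,$$ where $a\in S^{p+\frac12,l-\frac12}$, i.e., $a$ is smooth and $|\partial_{\theta_2}^{\alpha}\partial_{\theta_1}^{\beta}\partial_{x,y}^\gamma a|\le C\langle\theta_2,\theta_1\rangle^{p+\frac12-\alpha}\langle\theta_1\rangle^{l-\frac12-\beta}$ for $(x,y)$ in compact sets, with $\langle\cdot\rangle=(1+|\cdot|^2)^{1/2}$. $H^s_{\mathrm{comp}},H^s_{\mathrm{loc}}$ are the compactly supported and local $L^2$-Sobolev spaces. *)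

(* Defs.v *)
From HB Require Import structures.
From mathcomp Require Import all_boot all_order all_algebra.
From mathcomp Require Import complex.
From mathcomp Require Import all_classical all_reals all_analysis.
Set Implicit Arguments.
Unset Strict Implicit.
Unset Printing Implicit Defensive.
Import Order.TTheory GRing.Theory Num.Theory numFieldNormedType.Exports.
Local Open Scope classical_set_scope.
Local Open Scope ring_scope.
Local Open Scope complex_scope.

(* MathComp-Analysis, over an arbitrary [R : realType]; complex values live in
   [R[i]].  R^2 is [R * R] and R^2 x R^2 is [(R * R) * (R * R)]. *)

Section Smoothness.
Context {R : realType}.

(* [iterD [:: v1; ...; vk] f] is D_v1 (... (D_vk f)). *)
Definition iterD (U V : normedModType R) (vs : seq U) (f : U -> V) : U -> V :=
  foldr (fun v g => 'D_v g) f vs.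

(* C^oo on an open set O, for finite-dimensional U. *)
Definition smooth_on (U V : normedModType R) (O : set U) (f : U -> V) : Prop :=
  forall (vs : seq U) (x : U), O x -> differentiable (iterD vs f) x.

Definition re_fun (U : Type) (f : U -> R[i]) : U -> R :=
  fun x => complex.Re (f x).
Definition im_fun (U : Type) (f : U -> R[i]) : U -> R :=
  fun x => complex.Im (f x).

Definition csmooth (U : normedModType R) (f : U -> R[i]) : Prop :=
  smooth_on setT (re_fun f) /\ smooth_on setT (im_fun f).

Definition citerD (U : normedModType R) (vs : seq U) (f : U -> R[i]) :
    U -> R[i] :=
  fun x => iterD vs (re_fun f) x +i* iterD vs (im_fun f) x.

(* The norm of [R[i]] takes its values in [R[i]]; this is the real-valued
   modulus. *)
Definition cabs (z : R[i]) : R := ComplexField.Normc.normc z.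

Definition cis (t : R) : R[i] := cos t +i* sin t.

Definition compactly_supported (U : normedModType R) (V : zmodType)
    (f : U -> V) : Prop :=
  compact (closure [set x | f x != 0]).

Definition test_function (U : normedModType R) (f : U -> R[i]) : Prop :=
  csmooth f /\ compactly_supported f.

Definition cutoff (U : normedModType R) (rho : U -> R) : Prop :=
  [/\ smooth_on setT rho, compactly_supported rho &
      \forall x \near (0 : U), rho x = 1].

End Smoothness.

Section Integration.
Context {R : realType}.

Definition cint d (T : measurableType d) (mu : {measure set T -> \bar R})
    (f : T -> R[i]) : R[i] :=
  (\int[mu]_x complex.Re (f x)) +i* (\int[mu]_x complex.Im (f x)).

Definition cint1 (f : R -> R[i]) : R[i] := cint (@lebesgue_measure R) f.

Definition leb2 := (@lebesgue_measure R \x @lebesgue_measure R)%E.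

Definition cint2 (f : R * R -> R[i]) : R[i] := cint leb2 f.

(* Iterated integrals over R^2 x R^2 and over R^N; they are only applied to
   bounded, compactly supported integrands, or to products of a continuous
   function and a test function, so that Fubini applies. *)
Definition cint4 (f : (R * R) * (R * R) -> R[i]) : R[i] :=
  cint2 (fun x => cint2 (fun y => f (x, y))).

Fixpoint cintN (N : nat) : ('rV[R]_N -> R[i]) -> R[i] :=
  match N with
  | 0 => fun f => f 0
  | n.+1 => fun f =>
      cint1 (fun t => cintN (fun v : 'rV[R]_n =>
        f (row_mx (t%:M : 'rV[R]_1) v : 'rV[R]_(1 + n))))
  end.

Definition dot2 (x y : R * R) : R := x.1 * y.1 + x.2 * y.2.

Definition dot4 (z w : (R * R) * (R * R)) : R :=
  dot2 z.1 w.1 + dot2 z.2 w.2.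

Definition dotN (N : nat) (v w : 'rV[R]_N) : R := \sum_i v 0 i * w 0 i.

(* <v> = (1 + |v|^2)^(1/2) as a function of |v|^2. *)
Definition bracket (sqnorm : R) : R := Num.sqrt (1 + sqnorm).

End Integration.

Section Distributions.
Context {R : realType}.

(* A distribution is a functional of which only the values on test functions
   matter. *)
Definition functional (U : normedModType R) := (U -> R[i]) -> R[i].

Definition distribution (U : normedModType R) (u : functional U) : Prop :=
  (forall (c : R[i]) (phi psi : U -> R[i]),
     test_function phi -> test_function psi ->
     u (fun x => c * phi x + psi x) = c * u phi + u psi) /\
  (forall K : set U, compact K -> exists (C : R) (N : nat),
     forall phi, test_function phi -> [set x | phi x != 0] `<=` K ->
     forall M : R,
       (forall vs : seq U, (size vs <= N)%N ->
          (forall v, v \in vs -> `|v| <= 1) ->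
          forall x, cabs (citerD vs phi x) <= M) ->
       cabs (u phi) <= C * M).

Definition supported_in (U : normedModType R) (u : functional U) (K : set U)
    : Prop :=
  forall phi, test_function phi ->
    closure [set x | phi x != 0] `<=` ~` K -> u phi = 0.

(* Multiplication of a distribution by a smooth function. *)
Definition mul_dist (U : normedModType R) (g : U -> R[i]) (u : functional U) :
    functional U :=
  fun phi => u (fun x => g x * phi x).

Definition dist2_of_fun (f : R * R -> R[i]) :
    functional (R * R)%type :=
  fun phi => cint2 (fun x => f x * phi x).

Definition dist4_of_fun (f : (R * R) * (R * R) -> R[i]) :
    functional ((R * R) * (R * R))%type :=
  fun phi => cint4 (fun z => f z * phi z).

End Distributions.

Section Sobolev.
Context {R : realType}.

(* u is the inverse Fourier transform of F, where <xi>^s F is in L^2. *)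
Definition sobolev_transform (s : R) (u : functional (R * R)%type)
    (F : R * R -> R[i]) : Prop :=
  [/\ measurable_fun setT (re_fun F),
      measurable_fun setT (im_fun F),
      (\int[leb2]_xi
         ((bracket (dot2 xi xi) `^ (2 * s)) * cabs (F xi) ^+ 2)%:E < +oo)%E &
      forall phi, test_function phi ->
        u phi = (((2 * pi) ^+ 2)^-1)%:C *
          cint2 (fun xi =>
            F xi * cint2 (fun x => cis (dot2 x xi) * phi x))].

(* The H^s norm of u, in terms of its Fourier transform. *)
Definition sobolev_norm (s : R) (F : R * R -> R[i]) : R :=
  Num.sqrt (\int[leb2]_xi
              ((bracket (dot2 xi xi) `^ (2 * s)) * cabs (F xi) ^+ 2)).

(* T maps H^s_comp boundedly into H^s'_loc: for every compact K and every test
   function chi, u |-> chi T u is bounded from the elements of H^s supported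
   in K to H^s'. *)
Definition bounded_comp_loc
    (T : functional (R * R)%type -> functional (R * R)%type) (s s' : R)
    : Prop :=
  forall (K : set (R * R)) (chi : R * R -> R[i]),
    compact K -> test_function chi ->
    exists C : R, forall (u : functional (R * R)%type) (F : R * R -> R[i]),
      distribution u -> supported_in u K -> sobolev_transform s u F ->
      exists2 G, sobolev_transform s' (mul_dist chi (T u)) G &
                 sobolev_norm s' G <= C * sobolev_norm s F.

End Sobolev.

Section OscillatoryIntegrals.
Context {R : realType}.
Let X : normedModType R := ((R * R) * (R * R))%type.

(* A is the oscillatory integral with phase phi and amplitude a over
   X x Theta, the integral over Theta (an R^N) being [int]: the limit, as
   e -> 0+, of the integrals regularized by rho(e theta), whatever the cutoff
   function rho. *)
Definition oscillatory_integral (Theta : normedModType R)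
    (int : (Theta -> R[i]) -> R[i]) (phi : X * Theta -> R)
    (a : X * Theta -> R[i]) (A : functional X) : Prop :=
  forall (psi : X -> R[i]) (rho : Theta -> R),
    test_function psi -> cutoff rho ->
    (fun e : R => cabs (cint4 (fun z => int (fun theta =>
        cis (phi (z, theta)) * (rho (e *: theta))%:C * a (z, theta) * psi z))
      - A psi)) @ 0^'+ --> (0 : R).

End OscillatoryIntegrals.

Section LagrangianDistributions.
Context {R : realType}.
Let X : normedModType R := ((R * R) * (R * R))%type.

Section Phase.
Variable N : nat.
Let Theta : normedModType R := 'rV[R]_N.

Definition symbol (mu : R) (a : X * Theta -> R[i]) : Prop :=
  csmooth a /\
  forall (K : set X) (vs : seq X) (ws : seq Theta), compact K ->
    exists C : R, forall (z : X) (theta : Theta), K z ->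
      cabs (citerD ([seq (v, 0 : Theta) | v <- vs] ++
                    [seq (0 : X, w) | w <- ws]) a (z, theta))
      <= C * bracket (dotN theta theta) `^ (mu - (size ws)%:R).

(* The set where the phase is stationary in theta. *)
Definition critical (Gamma : set (X * Theta)) (phi : X * Theta -> R) :
    set (X * Theta) :=
  [set q | Gamma q /\ forall w : Theta, 'D_(0 : X, w) phi q = 0].

Definition phase_function (Gamma : set (X * Theta)) (phi : X * Theta -> R)
    : Prop :=
  [/\ open Gamma,
      (forall z theta, Gamma (z, theta) -> theta != 0 /\
         forall t : R, 0 < t ->
           Gamma (z, t *: theta) /\ phi (z, t *: theta) = t * phi (z, theta)),
      smooth_on Gamma phi &
      forall q, Gamma q -> exists v, 'D_v phi q != 0].

(* The differentials of d phi / d theta_j are linearly independent at each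
   critical point. *)
Definition nondegenerate (Gamma : set (X * Theta)) (phi : X * Theta -> R)
    : Prop :=
  forall q, critical Gamma phi q -> forall w : Theta,
    (forall v, 'D_v ('D_(0 : X, w) phi) q = 0) -> w = 0.

Definition gradX (phi : X * Theta -> R) (q : X * Theta) : X :=
  (('D_(((1, 0), (0, 0)) : X, 0 : Theta) phi q,
    'D_(((0, 1), (0, 0)) : X, 0 : Theta) phi q),
   ('D_(((0, 0), (1, 0)) : X, 0 : Theta) phi q,
    'D_(((0, 0), (0, 1)) : X, 0 : Theta) phi q)).

(* (z, theta) |-> (z, d_z phi) is a diffeomorphism from the critical set onto
   an open part of Lambda.  For a nondegenerate phase it is an immersion
   between manifolds of the same dimension, so injectivity suffices. *)
Definition parametrizes (Lambda : set (X * X)) (Gamma : set (X * Theta))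
    (phi : X * Theta -> R) : Prop :=
  {in critical Gamma phi &, injective (fun q => (q.1, gradX phi q))} /\
  exists2 O : set (X * X), open O &
    (fun q => (q.1, gradX phi q)) @` critical Gamma phi = Lambda `&` O.

(* Outside theta = 0 (a null set when N > 0), the support of a is contained in
   a closed conic subset of Gamma. *)
Definition cone_supported (Gamma : set (X * Theta)) (a : X * Theta -> R[i])
    : Prop :=
  exists F : set (X * Theta),
    [/\ closed F,
        (forall z theta (t : R), 0 < t -> F (z, theta) -> F (z, t *: theta)),
        (forall z theta, theta != 0 -> F (z, theta) -> Gamma (z, theta)) &
        (forall q, a q != 0 -> F q)].

End Phase.

(* The order convention is a in S^(m + (n - 2 N) / 4) with n = dim X = 4. *)
Definition lagrangian_piece (m : R) (Lambda : set (X * X)) (A : functional X)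
    : Prop :=
  exists (N : nat) (Gamma : set (X * 'rV[R]_N)) (phi : X * 'rV[R]_N -> R)
         (a : X * 'rV[R]_N -> R[i]),
    [/\ (0 < N)%N,
        [/\ phase_function Gamma phi, nondegenerate Gamma phi &
            parametrizes Lambda Gamma phi],
        symbol (m + (4 - 2 * N%:R) / 4) a,
        cone_supported Gamma a &
        oscillatory_integral (@cintN R N) phi a A].

(* I^m(X, Lambda): locally finite sums of oscillatory integrals with
   nondegenerate phase functions parametrizing Lambda, modulo C^oo. *)
Definition lagrangian_distribution (m : R) (Lambda : set (X * X))
    (u : functional X) : Prop :=
  distribution u /\
  exists (g : X -> R[i]) (A : nat -> functional X),
    [/\ csmooth g, (forall j, lagrangian_piece m Lambda (A j)) &
        forall K : set X, compact K -> exists n0 : nat, forall n : nat,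
          (n0 <= n)%N -> forall psi, test_function psi ->
          [set z | psi z != 0] `<=` K ->
          u psi = dist4_of_fun g psi + \sum_(j < n) A j psi].

End LagrangianDistributions.

Section CanonicalRelations.
Context {R : realType}.
Let R2 : normedModType R := (R * R)%type.
Let X : normedModType R := (R2 * R2)%type.

(* The conormal bundle (minus the zero section) of a submanifold S of X:
   nonzero covectors vanishing on the velocities of the curves drawn on S. *)
Definition conormal (S : set X) : set (X * X) :=
  [set q | [/\ S q.1, q.2 != 0 &
     forall gamma : R -> X, smooth_on setT gamma ->
       (forall t, S (gamma t)) -> gamma 0 = q.1 ->
       dot4 q.2 ('D_1 gamma 0) = 0]].

(* Relations between cotangent vectors are sets of pairs ((x, xi), (y, eta));
   the twist C' of C is the set of (x, y; xi, -eta), with (x, xi; y, eta)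
   in C. *)
Definition twist (C : set ((R2 * R2) * (R2 * R2))) : set (X * X) :=
  [set q | C ((q.1.1, q.2.1), (q.1.2, - q.2.2))].

Definition diagonal_relation : set ((R2 * R2) * (R2 * R2)) :=
  [set c | c.1 = c.2 /\ c.1.2 != 0].

Definition cubic_surface : set X :=
  [set z | z.1.2 - z.2.2 = (z.1.1 - z.2.1) ^+ 3].

(* The relation C_0, i.e. the one with [twist C_0 = conormal cubic_surface]. *)
Definition cubic_relation : set ((R2 * R2) * (R2 * R2)) :=
  [set c | conormal cubic_surface ((c.1.1, c.2.1), (c.1.2, - c.2.2))].

(* Kernels of the elements of I^m(C). *)
Definition FIO_kernel (m : R) (C : set ((R2 * R2) * (R2 * R2)))
    (K : functional X) : Prop :=
  lagrangian_distribution m (twist C) K.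

(* K is the Schwartz kernel of A. *)
Definition schwartz_kernel (A : (R2 -> R[i]) -> functional R2)
    (K : functional X) : Prop :=
  distribution K /\
  forall f psi, test_function f -> test_function psi ->
    K (fun z => psi z.1 * f z.2) = A f psi.

End CanonicalRelations.

Section PairedLagrangian.
Context {R : realType}.
Let R2 : normedModType R := (R * R)%type.
Let X : normedModType R := (R2 * R2)%type.

(* theta = (theta_1, theta_2) is stored as [q.2], with theta_1 = [q.2.1]. *)
Definition paired_phase (q : X * R2) : R :=
  let: ((x, y), theta) := q in
  (x.1 - y.1) * theta.1 + (x.2 - y.2 - (x.1 - y.1) ^+ 3) * theta.2.

(* S^(M, M'): order M in (theta_2, theta_1) and M' in theta_1. *)
Definition product_symbol (M M' : R) (a : X * R2 -> R[i]) : Prop :=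
  csmooth a /\
  forall (K : set X) (alpha beta : nat) (vs : seq X), compact K ->
    exists C : R, forall (z : X) (theta : R2), K z ->
      cabs (citerD (nseq alpha (0 : X, (0, 1) : R2) ++
                    nseq beta (0 : X, (1, 0) : R2) ++
                    [seq (v, 0 : R2) | v <- vs]) a (z, theta))
      <= C * bracket (dot2 theta theta) `^ (M - alpha%:R)
           * bracket (theta.1 ^+ 2) `^ (M' - beta%:R).

(* The class I^{p,l}(Delta, C_0). *)
Definition paired_class (p l : R) (A : (R2 -> R[i]) -> functional R2) : Prop :=
  exists K K0 K1 K2 : functional X,
    [/\ schwartz_kernel A K,
        (exists2 a, product_symbol (p + 2^-1) (l - 2^-1) a &
                    oscillatory_integral (@cint2 R) paired_phase a K0),
        FIO_kernel (p + l) diagonal_relation K1,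
        FIO_kernel p cubic_relation K2 &
        forall psi, test_function psi -> K psi = K0 psi + K1 psi + K2 psi].

End PairedLagrangian.

Section CurveOperators.
Context {R : realType}.

Definition curve_op (k : R -> R[i]) (f : R * R -> R[i]) : R * R -> R[i] :=
  fun x => cint1 (fun t => f (x.1 - t, x.2 - t ^+ 3) * k t).

(* The extension of [curve_op k] to distributions, by duality: the transpose
   of [curve_op k] is [curve_op] for the reflected weight k(-t). *)
Definition curve_op_dist (k : R -> R[i]) (u : functional (R * R)%type) :
    functional (R * R)%type :=
  fun phi => u (curve_op (fun t => k (- t)) phi).

Definition power_weight (chi : R -> R[i]) (b : R) : R -> R[i] :=
  fun t => chi t / (`|t| `^ b)%:C.

Definition log_weight (chi : R -> R[i]) : R -> R[i] :=
  fun t => chi t * (ln `|t|)%:C.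

End CurveOperators.

(* Main.v *)
(** The kernel of the operator is psi |-> int k(t) psi(x, (x1 - t, x2 - t^3)) dt dx, and Fourier
inversion at the points (t, 0) writes it as the oscillatory integral with amplitude (2
pi)^-2 k^(theta_1), k^ the Fourier transform of k. No further terms of I^(p+l)(Delta) or
I^p(C_0) are needed. On the Fourier side the operator is the multiplier int exp(-i(t xi_1 +
t^3 xi_2)) k(t) dt, which is O(|xi|^(-(1-b)/3)) for k = chi |t|^-b, by van der Corput; the
localization is a convolution with a rapidly decreasing function, harmless by Peetre's
inequality.

Conversely let u(x) = f(x1) w(x2 / e^3) and test the image of u against h(x1) w(x2 / e^3 -
a^3), w being an M-th derivative. Substituting t = e tau makes the pairing exactly const
e^(4-b) (respectively e^4 (const log e + const)), with leading constant different from 0,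
while boundedness from H^s to H^s' would make it O(e^(3 + 3(s' - s))). *)

(* The exponent is dictated by the inflection of the curve at t = 0. For xi_1 bounded and xi_2 of
   size e^-3 the phase t xi_1 + t^3 xi_2 does not oscillate over |t| <= e, so that the multiplier
   should have the size of the integral of |t|^-b there, e^(1-b). Hence examples squeezed by d = e^3
   in x2 alone. Such a function, with M derivatives in x2 to suppress low frequencies, has H^s norm
   at most of order d^(1/2-s); pairing its image with a similar function costs d^(1/2-s) d^(1/2+s')
   = e^(3+3(s'-s)). Against e^(4-b) this forces s' - s <= (1-b)/3. For the logarithm both powers are
   e^4 and only the factor log e decides. Two obstacles shape the work. The weight and its
   primitives are singular at 0, so that every integration by parts is made on e <= |t| <= T and
   passed to the limit, or is arranged to stay away from 0. And the leading constant is an integral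
   of oscillating M-th derivatives, without evident sign: it is traced back to a positive one.
   Integrals of non-integrable functions have default values, so each identity is accompanied by its
   integrability. *)
Require Import Defs.
From HB Require Import structures.
From mathcomp Require Import all_boot all_order all_algebra.
From mathcomp Require Import complex.
From mathcomp Require Import all_classical all_reals all_analysis.
From mathcomp Require Import measurable_realfun ring lra.
Set Implicit Arguments.
Unset Strict Implicit.
Unset Printing Implicit Defensive.
Import Order.TTheory GRing.Theory Num.Theory numFieldNormedType.Exports.
Local Open Scope classical_set_scope.
Local Open Scope ring_scope.
Local Open Scope complex_scope.
Local Notation smooth f := (smooth_on setT f).
Local Notation iterD := Defs.iterD.

(** * Integration of complex-valued functions *)

Section ComplexAlgebra.
Context {R : realType}.
Implicit Types z w : R[i].

Lemma cabsM z w : cabs (z * w) = cabs z * cabs w.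
Proof. exact: ComplexField.Normc.normcM. Qed.

Lemma cabsD z w : cabs (z + w) <= cabs z + cabs w.
Proof. exact: le_normcD. Qed.

Lemma cabsN z : cabs (- z) = cabs z.
Proof. exact: normcN. Qed.

Lemma cabsB z w : cabs (z - w) <= cabs z + cabs w.
Proof. by rewrite (le_trans (cabsD _ _))// cabsN. Qed.

Lemma cabs_ge0 z : 0 <= cabs z.
Proof. by case: z => a b; exact: sqrtr_ge0. Qed.

Lemma cabs0 : cabs (0 : R[i]) = 0.
Proof. exact: ComplexField.Normc.normc0. Qed.

Lemma cabs1 : cabs (1 : R[i]) = 1.
Proof. exact: ComplexField.Normc.normc1. Qed.

Lemma cabs_real (a : R) : cabs a%:C = `|a|.
Proof. by rewrite /cabs /= expr0n/= addr0 sqrtr_sqr. Qed.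

Lemma Re_le_cabs z : `|complex.Re z| <= cabs z.
Proof.
case: z => a b; rewrite /cabs/= -sqrtr_sqr ler_wsqrtr// lerDl sqr_ge0 //.
Qed.

Lemma Im_le_cabs z : `|complex.Im z| <= cabs z.
Proof.
case: z => a b; rewrite /cabs/= -sqrtr_sqr ler_wsqrtr// lerDr sqr_ge0 //.
Qed.

Lemma cabs_le_ReIm z : cabs z <= `|complex.Re z| + `|complex.Im z|.
Proof.
case: z => a b.
have -> : a +i* b = a%:C + 'i * b%:C.
  by apply/eqP; rewrite eq_complex /= !(mul0r,mulr0,mul1r,addr0,add0r,subr0) !eqxx.
rewrite [leRHS]/= !(mul0r,mulr0,mul1r,addr0,add0r,subr0).
rewrite (le_trans (cabsD _ _))// cabsM !cabs_real.
by rewrite [cabs 'i]/cabs /= expr0n/= expr1n add0r sqrtr1 mul1r.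
Qed.

Lemma cabs_cis (t : R) : cabs (cis t) = 1.
Proof. by rewrite /cabs /cis/= cos2Dsin2 sqrtr1. Qed.

Lemma cisD (s t : R) : cis (s + t) = cis s * cis t.
Proof.
rewrite /cis cosD sinD; apply/eqP; rewrite eq_complex /= eqxx/=.
by apply/eqP; rewrite addrC [_ * cos t]mulrC [X in X + _]mulrC.
Qed.

Lemma cReD z w : complex.Re (z + w) = complex.Re z + complex.Re w.
Proof. by case: z w => ? ? [? ?]. Qed.
Lemma cImD z w : complex.Im (z + w) = complex.Im z + complex.Im w.
Proof. by case: z w => ? ? [? ?]. Qed.
Lemma cReN z : complex.Re (- z) = - complex.Re z.
Proof. by case: z. Qed.
Lemma cImN z : complex.Im (- z) = - complex.Im z.
Proof. by case: z. Qed.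
Lemma cReM z w : complex.Re (z * w) =
  complex.Re z * complex.Re w - complex.Im z * complex.Im w.
Proof. by case: z w => ? ? [? ?]. Qed.
Lemma cImM z w : complex.Im (z * w) =
  complex.Re z * complex.Im w + complex.Im z * complex.Re w.
Proof. by case: z w => ? ? [? ?]. Qed.

Lemma complexP z w : complex.Re z = complex.Re w ->
  complex.Im z = complex.Im w -> z = w.
Proof. by case: z w => ? ? [? ?] /= -> ->. Qed.

End ComplexAlgebra.

Section ComplexIntegral.
Context d (T : measurableType d) (R : realType).
Variable mu : {measure set T -> \bar R}.
Implicit Types (f g : T -> R) (F G : T -> R[i]).

Definition itg f := mu.-integrable setT (EFin \o f).
Definition cmeas F := measurable_fun setT (re_fun F) /\
                      measurable_fun setT (im_fun F).
Definition citg F := itg (re_fun F) /\ itg (im_fun F).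

Lemma itg_meas f : itg f -> measurable_fun setT f.
Proof. by move=> /measurable_int /measurable_EFinP. Qed.

Lemma itg_dom f g : measurable_fun setT f -> itg g ->
  (forall x, `|f x| <= g x) -> itg f.
Proof.
move=> mf ig fg; apply: (le_integrable measurableT _ _ ig).
  exact/measurable_EFinP.
by move=> x _ /=; rewrite lee_fin (le_trans (fg x))// ler_norm.
Qed.

Lemma itg0 : itg (fun=> 0).
Proof. exact: integrable0. Qed.

Lemma itgD f g : itg f -> itg g -> itg (fun x => f x + g x).
Proof. by move=> jf jg; apply: (integrableD measurableT jf jg). Qed.

Lemma itgZ (c : R) f : itg f -> itg (fun x => c * f x).
Proof. by move=> jf; apply: (integrableZl measurableT c jf). Qed.

Lemma itgN f : itg f -> itg (fun x => - f x).
Proof.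
move=> /(itgZ (-1)); rewrite (_ : (fun _ => _) = fun x => - f x)//.
by apply/funext => x; rewrite mulN1r.
Qed.

Lemma itgB f g : itg f -> itg g -> itg (fun x => f x - g x).
Proof. by move=> jf /itgN; apply: itgD. Qed.

Lemma itg_norm f : itg f -> itg (fun x => `|f x|).
Proof. by move=> jf; exact: (integrable_norm jf). Qed.

Lemma le_Rint f g : itg f -> itg g -> (forall x, f x <= g x) ->
  \int[mu]_x f x <= \int[mu]_x g x.
Proof. by move=> jf jg fg; apply: le_Rintegral. Qed.

Lemma cmeas_cabs F : cmeas F -> measurable_fun setT (fun x => cabs (F x)).
Proof.
move=> [mr mi]; rewrite (_ : (fun _ => _) = fun x =>
   Num.sqrt (re_fun F x ^+ 2 + im_fun F x ^+ 2)); last first.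
  by apply/funext => x; rewrite /cabs /re_fun /im_fun; case: (F x).
apply: (measurableT_comp (f := @Num.sqrt R)).
  exact: (continuous_measurable_fun (@sqrt_continuous R)).
by apply: measurable_funD; apply: measurable_funX.
Qed.

Lemma cmeasD F G : cmeas F -> cmeas G -> cmeas (fun x => F x + G x).
Proof.
move=> [a b] [c e]; split.
  rewrite (_ : re_fun _ = fun x => re_fun F x + re_fun G x); last first.
    by apply/funext => x; rewrite /re_fun cReD.
  exact: measurable_funD.
rewrite (_ : im_fun _ = fun x => im_fun F x + im_fun G x); last first.
  by apply/funext => x; rewrite /im_fun cImD.
exact: measurable_funD.
Qed.

Lemma cmeasM F G : cmeas F -> cmeas G -> cmeas (fun x => F x * G x).
Proof.
move=> [a b] [c e]; split.
  rewrite (_ : re_fun _ = fun x => re_fun F x * re_fun G x - im_fun F x * im_fun G x); last first.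
    by apply/funext => x; rewrite /re_fun cReM.
  by apply: measurable_funB; apply: measurable_funM.
rewrite (_ : im_fun _ = fun x => re_fun F x * im_fun G x + im_fun F x * re_fun G x); last first.
  by apply/funext => x; rewrite /im_fun cImM.
by apply: measurable_funD; apply: measurable_funM.
Qed.

Lemma cmeas_cst (c : R[i]) : cmeas (fun=> c).
Proof. by split; exact: measurable_cst. Qed.

Lemma cmeas_real f : measurable_fun setT f -> cmeas (fun x => (f x)%:C).
Proof. by move=> mf; split => //=; exact: measurable_cst. Qed.

Lemma cmeas_cis f : measurable_fun setT f -> cmeas (fun x => cis (f x)).
Proof.
move=> mf; split.
  apply: (measurableT_comp (f := @cos R)) mf.
  exact: (continuous_measurable_fun (@continuous_cos R)).
apply: (measurableT_comp (f := @sin R)) mf.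
exact: (continuous_measurable_fun (@continuous_sin R)).
Qed.

Lemma citg_meas F : citg F -> cmeas F.
Proof. by move=> [a b]; split; exact: itg_meas. Qed.

Lemma citg_dom F g : cmeas F -> itg g -> (forall x, cabs (F x) <= g x) -> citg F.
Proof.
move=> [a b] ig Fg; split; apply: (itg_dom _ ig) => // x.
  exact: le_trans (Re_le_cabs _) (Fg x).
exact: le_trans (Im_le_cabs _) (Fg x).
Qed.

Lemma citg_cabs F : citg F -> itg (fun x => cabs (F x)).
Proof.
move=> JF; have [a b] := JF.
apply: (itg_dom (cmeas_cabs (citg_meas JF)) (itgD (itg_norm a) (itg_norm b))).
by move=> x; rewrite ger0_norm ?cabs_ge0// cabs_le_ReIm.
Qed.

Lemma citgD F G : citg F -> citg G -> citg (fun x => F x + G x).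
Proof.
move=> jF jG; apply: (citg_dom _ (itgD (citg_cabs jF) (citg_cabs jG))).
  by apply: cmeasD; exact: citg_meas.
by move=> x; exact: cabsD.
Qed.

Lemma citgM_bounded F G M : citg F -> cmeas G -> (forall x, cabs (G x) <= M) ->
  citg (fun x => G x * F x).
Proof.
move=> jF mG GM; apply: (citg_dom _ (itgZ M (citg_cabs jF))).
  by apply: cmeasM => //; exact: citg_meas.
by move=> x; rewrite cabsM ler_wpM2r ?cabs_ge0.
Qed.

Lemma citgZ (c : R[i]) F : citg F -> citg (fun x => c * F x).
Proof. by move=> jF; apply: (citgM_bounded (M := cabs c) jF (cmeas_cst c)). Qed.

Lemma citgN F : citg F -> citg (fun x => - F x).
Proof.
move=> /(citgZ (-1)); rewrite (_ : (fun _ => _) = fun x => - F x)//.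
by apply/funext => x; rewrite mulN1r.
Qed.

Lemma citgB F G : citg F -> citg G -> citg (fun x => F x - G x).
Proof. by move=> jF jG; apply: citgD => //; exact: citgN. Qed.

Lemma citg_real f : itg f -> citg (fun x => (f x)%:C).
Proof. by move=> jf; split => //; exact: itg0. Qed.

Lemma cintD F G : citg F -> citg G ->
  cint mu (fun x => F x + G x) = cint mu F + cint mu G.
Proof.
move=> [a b] [c e]; rewrite /cint; apply: complexP; rewrite ?cReD ?cImD /=.
  by rewrite -RintegralD//; apply: eq_Rintegral => x _; rewrite cReD.
by rewrite -RintegralD//; apply: eq_Rintegral => x _; rewrite cImD.
Qed.

Lemma cintZ (c : R[i]) F : citg F -> cint mu (fun x => c * F x) = c * cint mu F.
Proof.
move=> [a b]; rewrite /cint; apply: complexP; rewrite ?cReM ?cImM /=.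
  rewrite -!RintegralZl// -RintegralB//=; try exact: itgZ.
  by apply: eq_Rintegral => x _; rewrite cReM.
rewrite -!RintegralZl// -RintegralD//=; try exact: itgZ.
by apply: eq_Rintegral => x _; rewrite cImM.
Qed.

Lemma cintZr (c : R[i]) F : citg F -> cint mu (fun x => F x * c) = cint mu F * c.
Proof.
move=> jF; rewrite mulrC -cintZ//; congr cint; apply/funext => x.
by rewrite mulrC.
Qed.

Lemma cint0 : cint mu (fun=> 0) = 0.
Proof. by rewrite /cint /= Rintegral_cst// mul0r. Qed.

Lemma cintN F : citg F -> cint mu (fun x => - F x) = - cint mu F.
Proof.
move=> jF; rewrite -mulN1r -cintZ//; congr cint; apply/funext => x.
by rewrite mulN1r.
Qed.

Lemma cintB F G : citg F -> citg G ->
  cint mu (fun x => F x - G x) = cint mu F - cint mu G.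
Proof. by move=> jF jG; rewrite cintD// ?cintN//; exact: citgN. Qed.

Lemma cint_real f : cint mu (fun x => (f x)%:C) = (\int[mu]_x f x)%:C.
Proof. by rewrite /cint /= Rintegral_cst// mul0r. Qed.

Lemma eq_cint F G : F =1 G -> cint mu F = cint mu G.
Proof. by move=> /funext ->. Qed.

(** Reduces bounds for complex integrals to real ones: after multiplication by a constant of modulus
    1 the integral equals its own modulus, hence is the integral of a real part. *)
Lemma unimodular (z : R[i]) : exists2 u, cabs u = 1 & u * z = (cabs z)%:C.
Proof.
have [->|z0] := eqVneq z 0; first by exists 1; rewrite ?cabs1 ?mulr0 ?cabs0.
have nz : cabs z != 0 by apply: contra z0 => /eqP/ComplexField.Normc.eq0_normc ->.
exists ((cabs z)%:C / z); last by rewrite mulfVK.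
by rewrite cabsM cabs_real ger0_norm ?cabs_ge0// /cabs ComplexField.Normc.normcV mulfV.
Qed.

Lemma cint_norm F : citg F -> cabs (cint mu F) <= \int[mu]_x cabs (F x).
Proof.
move=> jF; have [u u1 uF] := unimodular (cint mu F).
have -> : cabs (cint mu F) = \int[mu]_x (complex.Re (u * F x)).
  by rewrite -[LHS]/(complex.Re (cabs (cint mu F))%:C) -uF -cintZ.
have [a _] := citgZ u jF.
apply: le_Rint => //; first exact: citg_cabs.
move=> x; rewrite (le_trans (ler_norm _))// (le_trans (Re_le_cabs _))//.
by rewrite cabsM u1 mul1r.
Qed.

Lemma cint_norm_le F g : citg F -> itg g -> (forall x, cabs (F x) <= g x) ->
  cabs (cint mu F) <= \int[mu]_x g x.
Proof.
move=> jF jg Fg; apply: le_trans (cint_norm jF) _.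
by apply: le_Rint => //; exact: citg_cabs.
Qed.

Lemma Rint_dct (f_ : nat -> T -> R) f g : (forall n, measurable_fun setT (f_ n)) ->
  (forall x, f_ ^~ x @ \oo --> f x) -> itg g -> (forall n x, `|f_ n x| <= g x) ->
  (fun n => \int[mu]_x f_ n x) @ \oo --> \int[mu]_x f x.
Proof.
move=> mf cf jg fg.
have mlim : measurable_fun setT f.
  by apply: (measurable_fun_cvg mf) => x _; exact: cf.
have [|||||jf _ cvgi] := @dominated_convergence _ T R mu setT measurableT
  (fun n => EFin \o f_ n) (EFin \o f) (EFin \o g).
- by move=> n; exact/measurable_EFinP.
- exact/measurable_EFinP.
- by apply: aeW => x _; apply: cvg_EFin; [exact: nearW|exact: cf].
- exact: jg.
- by apply: aeW => x n _ /=; rewrite lee_fin.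
have fin : (\int[mu]_x (f x)%:E)%E \is a fin_num by exact: integrable_fin_num.
apply: fine_cvg; rewrite /= fineK//.
Qed.

Lemma cint_dct (F_ : nat -> T -> R[i]) F g : (forall n, cmeas (F_ n)) ->
  (forall x, (fun n => complex.Re (F_ n x)) @ \oo --> complex.Re (F x)) ->
  (forall x, (fun n => complex.Im (F_ n x)) @ \oo --> complex.Im (F x)) ->
  itg g -> (forall n x, cabs (F_ n x) <= g x) ->
  ((fun n => complex.Re (cint mu (F_ n))) @ \oo --> complex.Re (cint mu F)) /\
  ((fun n => complex.Im (cint mu (F_ n))) @ \oo --> complex.Im (cint mu F)).
Proof.
move=> mF cR cI jg Fg; split; rewrite /cint /=; apply: (Rint_dct _ _ jg) => //.
- by move=> n; case: (mF n).
- by move=> n x; apply: le_trans (Fg n x); exact: Re_le_cabs.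
- by move=> n; case: (mF n).
- by move=> n x; apply: le_trans (Fg n x); exact: Im_le_cabs.
Qed.

End ComplexIntegral.

Section ComplexFubini.
Context d1 d2 (T1 : measurableType d1) (T2 : measurableType d2) (R : realType).
Variable m1 : {sigma_finite_measure set T1 -> \bar R}.
Variable m2 : {sigma_finite_measure set T2 -> \bar R}.
Implicit Types (f : T1 * T2 -> R) (F : T1 * T2 -> R[i]).
Local Notation mm := (m1 \x m2)%E.

(** Fubini's inner integral is an extended real, finite only almost everywhere, and [fine] makes a
    real function of it. The change on a null set affects neither integrability nor the integral. *)
Lemma Rint_eq_ae d (T : measurableType d) (mu : {measure set T -> \bar R})
    (f : T -> R) (h : T -> \bar R) :
  {ae mu, forall x, f x = fine (h x)} -> mu.-integrable setT h ->
  measurable_fun setT f ->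
  itg mu f /\ (\int[mu]_x (f x)%:E = \int[mu]_x h x)%E.
Proof.
move=> fh jh mf.
have aeq : ae_eq mu setT (EFin \o f) h.
  have := integrable_ae measurableT jh.
  apply: filterS2 fh => x /= fx /(_ I) hx _.
  by rewrite fx fineK.
split; last by apply: ae_eq_integral => //; [exact/measurable_EFinP|exact: measurable_int jh].
apply/integrableP; split; first exact/measurable_EFinP.
rewrite (_ : (\int[mu]_x `|(EFin \o f) x|)%E = (\int[mu]_x `|h x|)%E).
  by case/integrableP : jh.
apply: ae_eq_integral => //.
- by apply: measurableT_comp => //; exact/measurable_EFinP.
- by apply: measurableT_comp => //; exact: measurable_int jh.
- by apply: filterS aeq => x /= fx _; rewrite -(fx I).
Qed.

Lemma Rint_fubini1 f : itg mm f ->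
  itg m1 (fun x => \int[m2]_y f (x, y)) /\
  \int[mm]_z f z = \int[m1]_x \int[m2]_y f (x, y).
Proof.
move=> jf.
have h := integrable_fubini_F jf.
have [||] := @Rint_eq_ae _ T1 m1 (fun x => \int[m2]_y f (x, y)) _ _ h.
- by apply: aeW.
- apply: (measurableT_comp (@fine_measurable R setT measurableT)).
  exact: measurable_int h.
by move=> ji eqi; split => //; rewrite /Rintegral -integral12_prod_meas1// -eqi.
Qed.

Lemma Rint_fubini2 f : itg mm f ->
  itg m2 (fun y => \int[m1]_x f (x, y)) /\
  \int[mm]_z f z = \int[m2]_y \int[m1]_x f (x, y).
Proof.
move=> jf.
have mf : measurable_fun setT (EFin \o f) by exact: measurable_int jf.
have h : m2.-integrable setT (fubini_G m1 (EFin \o f)).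
  apply/integrableP; split; first exact: (measurable_fubini_G jf).
  have lt := (integrable21ltyP m1 m2 mf).1 jf.
  apply: (le_lt_trans _ lt).
  apply: ge0_le_integral => //.
  - by apply: measurableT_comp => //; exact: (measurable_fubini_G jf).
  - apply: (measurable_fun_fubini_tonelli_G (abse \o (EFin \o f))) => //=.
    exact: measurableT_comp.
  - move=> y _; apply: le_abse_integral => //.
    exact: (measurableT_comp mf (pair2_measurable y)).
have [||] := @Rint_eq_ae _ T2 m2 (fun y => \int[m1]_x f (x, y)) _ _ h.
- by apply: aeW.
- apply: (measurableT_comp (@fine_measurable R setT measurableT)).
  exact: measurable_int h.
by move=> ji eqi; split => //; rewrite /Rintegral -integral21_prod_meas1// -eqi.
Qed.

Lemma cint_fubini1 F : citg mm F ->
  citg m1 (fun x => cint m2 (fun y => F (x, y))) /\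
  cint mm F = cint m1 (fun x => cint m2 (fun y => F (x, y))).
Proof.
move=> [/Rint_fubini1[a ea] /Rint_fubini1[b eb]].
by split; [split|rewrite /cint; congr Complex].
Qed.

Lemma cint_fubini2 F : citg mm F ->
  citg m2 (fun y => cint m1 (fun x => F (x, y))) /\
  cint mm F = cint m2 (fun y => cint m1 (fun x => F (x, y))).
Proof.
move=> [/Rint_fubini2[a ea] /Rint_fubini2[b eb]].
by split; [split|rewrite /cint; congr Complex].
Qed.

Lemma cint_swap F : citg mm F ->
  cint m1 (fun x => cint m2 (fun y => F (x, y))) =
  cint m2 (fun y => cint m1 (fun x => F (x, y))).
Proof. by move=> jF; rewrite -(cint_fubini1 jF).2 -(cint_fubini2 jF).2. Qed.

Lemma itg_prod (f : T1 -> R) (g : T2 -> R) : itg m1 f -> itg m2 g ->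
  itg mm (fun z => f z.1 * g z.2).
Proof.
move=> jf jg; have mf := itg_meas jf; have mg := itg_meas jg.
have mfg : measurable_fun setT (fun z : T1 * T2 => f z.1 * g z.2).
  apply: measurable_funM.
    exact: (measurableT_comp mf measurable_fst).
  exact: (measurableT_comp mg measurable_snd).
apply/integrable12ltyP; first exact/measurable_EFinP.
rewrite (_ : (fun x => _) = fun x => (`|f x|%:E * (\int[m2]_y `|g y|)%:E)%E); last first.
  apply/funext => x; rewrite /Rintegral fineK; last first.
    exact: (integrable_fin_num measurableT (itg_norm jg)).
  rewrite -integralZl//; last exact: (itg_norm jg).
  by apply: eq_integral => y _ /=; rewrite normrM EFinM.
rewrite (integralZr measurableT (itg_norm jf)).
rewrite ltey_eq; apply/orP; left.
by rewrite fin_numM// (integrable_fin_num measurableT (itg_norm jf)).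
Qed.

Lemma itg_Tonelli f : measurable_fun setT f ->
  (forall x, itg m2 (fun y => f (x, y))) ->
  itg m1 (fun x => \int[m2]_y `|f (x, y)|) -> itg mm f.
Proof.
move=> mf j2 j1; apply/integrable12ltyP; first exact/measurable_EFinP.
case/integrableP : j1 => _; rewrite (_ : (fun x => _) = fun x => (\int[m2]_y `|(EFin \o f) (x, y)|)%E)//.
apply/funext => x /=; rewrite ger0_norm; last by apply: Rintegral_ge0.
by rewrite /Rintegral fineK//; apply: (integrable_fin_num measurableT (itg_norm (j2 x))).
Qed.

Lemma citg_prod (f : T1 -> R[i]) (g : T2 -> R[i]) : citg m1 f -> citg m2 g ->
  citg mm (fun z => f z.1 * g z.2).
Proof.
move=> jf jg; apply: (citg_dom _ (itg_prod (citg_cabs jf) (citg_cabs jg))).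
  apply: cmeasM; split.
  - exact: (measurableT_comp (citg_meas jf).1 measurable_fst).
  - exact: (measurableT_comp (citg_meas jf).2 measurable_fst).
  - exact: (measurableT_comp (citg_meas jg).1 measurable_snd).
  - exact: (measurableT_comp (citg_meas jg).2 measurable_snd).
by move=> z; rewrite cabsM.
Qed.

Lemma cint_prod (f : T1 -> R[i]) (g : T2 -> R[i]) : citg m1 f -> citg m2 g ->
  cint mm (fun z => f z.1 * g z.2) = cint m1 f * cint m2 g.
Proof.
move=> jf jg; rewrite (cint_fubini1 (citg_prod jf jg)).2 /=.
under eq_cint => x do rewrite cintZ//.
by rewrite cintZr.
Qed.

End ComplexFubini.

(** * Countable bases and Borel measurability on R^2 and R^4 *)

Section CountableBase.

(** The product sigma-algebra is generated by measurable rectangles. Second countability is what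
    makes an open set a countable union of them, and so makes continuous functions measurable. *)
Definition cbase (T : topologicalType) (B : nat -> set T) :=
  forall (x : T) (A : set T), nbhs x A -> exists2 n, B n x & B n `<=` A.

Definition cbase_prod (S T : topologicalType) (B : nat -> set S) (C : nat -> set T)
    (n : nat) : set (S * T) :=
  if unpickle n is Some (i, j) then B i `*` C j else set0.

Lemma cbase_prodP (S T : topologicalType) (B : nat -> set S) (C : nat -> set T) :
  cbase B -> cbase C -> cbase (cbase_prod B C).
Proof.
move=> bB bC [x y] A [[P Q] [/= nP nQ] PQA].
have [i Bi iP] := bB _ _ nP; have [j Cj jQ] := bC _ _ nQ.
exists (pickle (i, j)); rewrite /cbase_prod pickleK//.
move=> [u v] [/= Bu Cv]; apply: PQA; split => /=; [exact: iP|exact: jQ].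
Qed.

Lemma cbase_open (T : topologicalType) (B : nat -> set T) (A : set T) :
  cbase B -> open A -> A = \bigcup_(n in [set n | B n `<=` A]) B n.
Proof.
move=> bB oA; rewrite eqEsubset; split => [x Ax|x [n /= nA]]; last exact: nA.
have [n nx nA] := bB _ _ (open_nbhs_nbhs (conj oA Ax)).
by exists n.
Qed.

Definition rball {R : realType} (n : nat) : set R :=
  if unpickle n is Some (q, k) then ball (ratr q : R) (k : nat).+1%:R^-1 else set0.

Lemma rball_cbase {R : realType} : cbase (@rball R).
Proof.
move=> x A /nbhs_ballP[e /= e0 eA].
have [k ke] : exists k : nat, k.+1%:R^-1 < e / 2.
  have e2 : 0 < e / 2 by rewrite divr_gt0.
  exists (Num.trunc (e / 2)^-1).
  rewrite invf_plt ?posrE//.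
  exact: truncnS_gt.
have k0 : (0 : R) < k.+1%:R^-1 by rewrite invr_gt0.
have /rat_in_itvoo[q] : x - k.+1%:R^-1 < x by rewrite ltrBlDr ltrDl.
rewrite in_itv/= => /andP[q1 q2].
exists (pickle (q, k)); rewrite /rball pickleK.
  by rewrite /ball/= distrC ger0_norm ?subr_ge0 ?(ltW q2)// ltrBlDr addrC -ltrBlDr.
move=> y; rewrite /ball /= => yq; apply: eA; rewrite /ball/=.
rewrite -(subrK (ratr q) x) -addrA (le_lt_trans (ler_normD _ _))//.
rewrite [X in X + _]ger0_norm ?subr_ge0 ?(ltW q2)// [e]splitr.
by rewrite ltrD ?(lt_trans yq)// (lt_trans _ ke)// ltrBlDr addrC -ltrBlDr.
Qed.

Lemma rball_measurable {R : realType} n : measurable (@rball R n).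
Proof. by rewrite /rball; case: unpickle => [[q k]|//]; exact: measurable_ball. Qed.

End CountableBase.

Section BorelProduct.
Context {R : realType}.
Local Notation R2 := (R * R)%type.

Lemma rball2_cbase : cbase (cbase_prod (@rball R) (@rball R)).
Proof. by apply: cbase_prodP; exact: rball_cbase. Qed.

Lemma rball2_measurable n : measurable (cbase_prod (@rball R) (@rball R) n : set R2).
Proof.
rewrite /cbase_prod; case: unpickle => [[i j]|//].
by apply: measurableX; exact: rball_measurable.
Qed.

Lemma open_measurable2 (A : set R2) : open A -> measurable A.
Proof.
move=> /(cbase_open rball2_cbase) ->; rewrite bigcup_mkcond.
apply: bigcupT_measurable => n; case: ifPn => // _; exact: rball2_measurable.
Qed.

Lemma open_measurable4 (A : set (R2 * R2)) : open A -> measurable A.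
Proof.
move=> /(cbase_open (cbase_prodP rball2_cbase rball2_cbase)) ->; rewrite bigcup_mkcond.
apply: bigcupT_measurable => n; case: ifPn => // _.
rewrite /cbase_prod; case: unpickle => [[i j]|//].
by apply: measurableX; exact: rball2_measurable.
Qed.

Lemma continuous_measurable2 (f : R2 -> R) : continuous f -> measurable_fun setT f.
Proof.
move=> /continuousP cf; apply: (measurability _ (RGenOpens.measurableE R)).
move=> _ [_ [a [b ->] <-]]; rewrite setTI; apply: open_measurable2.
exact/cf/interval_open.
Qed.

Lemma continuous_measurable4 (f : R2 * R2 -> R) : continuous f -> measurable_fun setT f.
Proof.
move=> /continuousP cf; apply: (measurability _ (RGenOpens.measurableE R)).
move=> _ [_ [a [b ->] <-]]; rewrite setTI; apply: open_measurable4.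
exact/cf/interval_open.
Qed.

End BorelProduct.

(** * Affine changes of variables and shears *)

Lemma mule_lty {R : realType} (r : R) (x : \bar R) : 0 < r -> (0 <= x)%E ->
  (r%:E * x < +oo)%E -> (x < +oo)%E.
Proof.
move=> r0; case: x => [x _ _|_|//]; first by rewrite ltry.
by rewrite gt0_muley// lte_fin.
Qed.

Section ScaledTransfer.
Context d (T : measurableType d) {R : realType}.
Variable mu : {measure set T -> \bar R}.
Variables (phi : T -> T) (kappa : R).
Hypothesis k0 : 0 < kappa.
Hypothesis mphi : measurable_fun setT phi.
Hypothesis transfer : forall f : T -> \bar R, measurable_fun setT f ->
  (forall x, 0 <= f x)%E -> (\int[mu]_x f x = kappa%:E * \int[mu]_x f (phi x))%E.

Lemma itg_transfer (f : T -> R) : itg mu f -> itg mu (f \o phi).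
Proof.
move=> jf; have mf := itg_meas jf.
apply/integrableP; split; first exact/measurable_EFinP/(measurableT_comp mf mphi).
have := @transfer (fun x => `|(f x)%:E|)%E.
move=> /(_ (measurableT_comp (@abse_measurable R setT) (measurable_int _ jf)) (fun=> abse_ge0 _)) E.
case/integrableP : jf => _; rewrite [X in (X < _)%E -> _]E.
by apply: mule_lty => //; exact: integral_ge0.
Qed.

Lemma Rint_transfer (f : T -> R) : itg mu f ->
  \int[mu]_x f (phi x) = kappa^-1 * \int[mu]_x f x.
Proof.
move=> jf; have mf := itg_meas jf; have J := itg_transfer jf.
have c1 : kappa != 0 by rewrite gt_eqF.
apply: (mulfI c1); rewrite mulrA divff// mul1r.
have P g : itg mu g -> (forall x, 0 <= g x) ->
    kappa * \int[mu]_x g (phi x) = \int[mu]_x g x.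
  move=> jg g0; rewrite /Rintegral (@transfer (fun x => (g x)%:E))//.
  - by rewrite fineM//; exact: (integrable_fin_num measurableT (itg_transfer jg)).
  - by case/integrableP: jg.
have jp := itg_norm jf; have jpa := itg_norm J.
(* Here f = |f| - (|f| - f) is a difference of nonnegative integrable functions, to each of which
   the rule for nonnegative functions applies. *)
have -> : (\int[mu]_x f (phi x)) = \int[mu]_x (`|f (phi x)| - (`|f (phi x)| - f (phi x))).
  by apply: eq_Rintegral => x _; rewrite opprB addrCA subrr addr0.
have -> : (\int[mu]_x f x) = \int[mu]_x (`|f x| - (`|f x| - f x)).
  by apply: eq_Rintegral => x _; rewrite opprB addrCA subrr addr0.
have jq := itgB jp jf; have jqa := itgB jpa J.
rewrite RintegralB// [RHS]RintegralB// mulrBr (P (fun x => `|f x|))//.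
congr (_ - _).
by apply: (P (fun x => `|f x| - f x)) => // x; rewrite subr_ge0 ler_norm.
Qed.

Lemma cint_transfer (f : T -> R[i]) : citg mu f ->
  citg mu (f \o phi) /\ cint mu (f \o phi) = (kappa^-1)%:C * cint mu f.
Proof.
move=> [ja jb]; split; first by split; [exact: (itg_transfer ja)|exact: (itg_transfer jb)].
rewrite /cint; apply: complexP.
  by rewrite [LHS](Rint_transfer ja) /= mul0r subr0.
by rewrite [LHS](Rint_transfer jb) /= mul0r addr0.
Qed.

End ScaledTransfer.

Section AffineChange.
Context {R : realType}.
Local Notation leb := (@lebesgue_measure R).
Local Notation l2 := (@lebesgue_measure R \x @lebesgue_measure R)%E.

Lemma cint2E (f : R * R -> R[i]) : cint2 f = cint l2 f. Proof. by []. Qed.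

Local Notation MR := (measurableTypeR R).

Definition aff (c a : R) (x : R) : R := c * x + a.

Lemma measurable_aff c a : measurable_fun setT (aff c a : MR -> MR).
Proof.
apply: measurable_funD; last exact: measurable_cst.
by apply: measurable_funM => //; exact: measurable_cst.
Qed.

(** By uniqueness of Lebesgue measure only half-open intervals have to be compared. For c < 0 the
    preimage of such an interval is half-open at the other end, which leaves its length
    unchanged. *)
Lemma leb_aff (c a : R) : c != 0 -> forall A, measurable A ->
  (leb A = `|c|%:E * leb (aff c a @^-1` A))%E.
Proof.
move=> c0 A mA; pose k : {nonneg R} := NngNum (normr_ge0 c).
have mf := measurable_aff c a.
pose nu := measure_function_pushforward__canonical__measure_function_Measure leb mf.
pose nu' : {measure set (measurableTypeR R) -> \bar R} := mscale k nu.
rewrite (@lebesgue_measure_unique R nu')// => X [[u v] /= _ <-].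
rewrite /mscale /= /pushforward lebesgue_measure_itv /=.
have [cpos|cneg|] := ltgtP 0 c; last by move=> c00; rewrite -c00 eqxx in c0.
- rewrite (_ : _ @^-1` _ = `](u - a) / c, (v - a) / c]%classic); last first.
    apply/seteqP; split => x; rewrite /aff /= !in_itv/= ltr_pdivrMr// ler_pdivlMr// ltrBlDr lerBrDr [x * c]mulrC//.
  rewrite lebesgue_measure_itv /= !lte_fin ltr_pM2r ?invr_gt0// ltrD2r.
  case: ifP => _; last by rewrite mule0.
  rewrite -EFinB -EFinM; congr EFin; rewrite gtr0_norm//.
  by field; rewrite gt_eqF.
- rewrite (_ : _ @^-1` _ = `[(v - a) / c, (u - a) / c[%classic); last first.
    apply/seteqP; split => x; rewrite /aff /= !in_itv/= ltr_ndivlMr// ler_ndivrMr// ltrBlDr lerBrDr [x * c]mulrC andbC//.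
  rewrite lebesgue_measure_itv /= !lte_fin ltr_nM2r ?invr_lt0// ltrD2r.
  case: ifP => _; last by rewrite mule0.
  rewrite -EFinB -EFinM; congr EFin; rewrite ltr0_norm//.
  by field; rewrite lt_eqF.
Qed.

Lemma ge0_int_aff (c a : R) (f : R -> \bar R) : c != 0 ->
  measurable_fun setT f -> (forall x, 0 <= f x)%E ->
  (\int[leb]_x f x = `|c|%:E * \int[leb]_x f (c * x + a)%R)%E.
Proof.
move=> c0 mf f0.
have maff := measurable_aff c a.
pose k : {nonneg R} := NngNum (normr_ge0 c).
rewrite -(@ge0_integral_pushforward _ _ _ _ R _ maff leb setT f)//.
rewrite -(ge0_integral_mscale _ measurableT k)//.
apply: (@eq_measure_integral _ MR) => A mA _; exact: (leb_aff a c0 mA).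
Qed.

Lemma Rint_aff (c a : R) (f : R -> R) : c != 0 -> itg leb f ->
  itg leb (fun x => f (c * x + a)) /\
  \int[leb]_x f (c * x + a) = `|c|^-1 * \int[leb]_x f x.
Proof.
move=> c0 jf; have k0 : 0 < `|c| by rewrite normr_gt0.
have T := fun f => @ge0_int_aff c a f c0.
split; first exact: (@itg_transfer _ MR R leb (aff c a) `|c| k0 (measurable_aff c a) T f jf).
exact: (@Rint_transfer _ MR R leb (aff c a) `|c| k0 (measurable_aff c a) T f jf).
Qed.

Lemma cint_aff (c a : R) (f : R -> R[i]) : c != 0 -> citg leb f ->
  citg leb (fun x => f (c * x + a)) /\
  cint leb (fun x => f (c * x + a)) = (`|c|^-1)%:C * cint leb f.
Proof.
move=> c0 jf; have k0 : 0 < `|c| by rewrite normr_gt0.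
have T := fun f => @ge0_int_aff c a f c0.
exact: (@cint_transfer _ MR R leb (aff c a) `|c| k0 (measurable_aff c a) T f jf).
Qed.

Lemma measurable_shear (c1 c2 a : R) (g : R -> R) : measurable_fun setT g ->
  measurable_fun setT ((fun z => (c1 * z.1 + a, c2 * z.2 + g z.1)) : MR * MR -> MR * MR).
Proof.
move=> mg; apply: measurable_fun_pair.
  exact: (measurableT_comp (measurable_aff c1 a) measurable_fst).
apply: measurable_funD.
  apply: measurable_funM; [exact: measurable_cst|exact: measurable_snd].
exact: (measurableT_comp mg measurable_fst).
Qed.

(** For a fixed first coordinate the map is affine in the second, however irregular the measurable
    [g] is, so Tonelli reduces it to two affine changes on the line. With a cubic [g] it straightens
    the curves x2 - y2 = (x1 - y1)^3. *)
Lemma ge0_int2_shear (c1 c2 a : R) (g : R -> R) (f : R * R -> \bar R) :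
  c1 != 0 -> c2 != 0 -> measurable_fun setT g -> measurable_fun setT f ->
  (forall z, 0 <= f z)%E ->
  (\int[l2]_z f z =
   (`|c1| * `|c2|)%:E * \int[l2]_z f (c1 * z.1 + a, c2 * z.2 + g z.1)%R)%E.
Proof.
move=> c10 c20 mg mf f0.
have m' : measurable_fun setT (fun z : R * R => f (c1 * z.1 + a, c2 * z.2 + g z.1)%R).
  exact: (measurableT_comp mf (measurable_shear c1 c2 a mg)).
rewrite !fubini_tonelli1// /fubini_F.
pose h (x : R) : \bar R := (\int[leb]_y f (x, y))%E.
have h0 x : (0 <= h x)%E by exact: integral_ge0.
have mh : measurable_fun setT h by exact: (@measurable_fun_fubini_tonelli_F _ _ MR MR R leb f).
rewrite [LHS](ge0_int_aff a c10 mh h0).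
have E x : h (c1 * x + a) = (`|c2|%:E * (\int[leb]_y f (c1 * x + a, c2 * y + g x)%R))%E.
  rewrite /h (@ge0_int_aff c2 (g x) (fun y => f (c1 * x + a, y)%R) c20)//.
  exact: (measurableT_comp mf (pair1_measurable _)).
under eq_integral do rewrite E.
rewrite ge0_integralZl//; last 2 first.
  - exact: (@measurable_fun_fubini_tonelli_F _ _ MR MR R leb (fun z : R * R => f (c1 * z.1 + a, c2 * z.2 + g z.1)%R)).
  - by move=> x _; exact: integral_ge0.
by rewrite muleA -EFinM.
Qed.

Lemma cint2_shear (c1 c2 a : R) (g : R -> R) (f : R * R -> R[i]) : c1 != 0 -> c2 != 0 ->
  measurable_fun setT g -> citg l2 f ->
  citg l2 (fun z => f (c1 * z.1 + a, c2 * z.2 + g z.1)) /\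
  cint2 (fun z => f (c1 * z.1 + a, c2 * z.2 + g z.1)) =
    ((`|c1| * `|c2|)^-1)%:C * cint2 f.
Proof.
move=> c10 c20 mg jf.
have k0 : 0 < `|c1| * `|c2| by rewrite mulr_gt0 ?normr_gt0.
have T := fun f => @ge0_int2_shear c1 c2 a g f c10 c20 mg.
exact: (@cint_transfer _ (MR * MR)%type R l2 _ _ k0 (measurable_shear c1 c2 a mg) T f jf).
Qed.

Lemma Rint2_shear (c1 c2 a : R) (g : R -> R) (f : R * R -> R) : c1 != 0 -> c2 != 0 ->
  measurable_fun setT g -> itg l2 f ->
  itg l2 (fun z => f (c1 * z.1 + a, c2 * z.2 + g z.1)) /\
  \int[l2]_z f (c1 * z.1 + a, c2 * z.2 + g z.1) =
    (`|c1| * `|c2|)^-1 * \int[l2]_z f z.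
Proof.
move=> c10 c20 mg jf.
have k0 : 0 < `|c1| * `|c2| by rewrite mulr_gt0 ?normr_gt0.
have T := fun f => @ge0_int2_shear c1 c2 a g f c10 c20 mg.
split; first exact: (@itg_transfer _ (MR * MR)%type R l2 _ _ k0 (measurable_shear c1 c2 a mg) T f jf).
exact: (@Rint_transfer _ (MR * MR)%type R l2 _ _ k0 (measurable_shear c1 c2 a mg) T f jf).
Qed.

End AffineChange.

(** * Smooth functions and test functions *)

Section QuadraticRemainder.
Context {R : realType} {U : normedModType R}.

(** The way in which integrals depending on a parameter are differentiated below: a Taylor bound for
    the integrand, integrated, gives a quadratic remainder. *)
Lemma diff_quad (r : U -> R) (x : U) (C : R) :
  (forall h, `|r (h + x) - r x| <= C * `|h| ^+ 2) ->
  differentiable r x /\ ('d r x : U -> R) = \0.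
Proof.
move=> rC.
have E : r \o shift x = cst (r x) + (\0 : {linear U -> R}) +o_ 0 id.
  apply/eqaddoP => e e0.
  have [C0|C0] := leP C 0.
    near=> h; rewrite /= !fctE /= addr0 (le_trans (rC h))//.
    by rewrite (@le_trans _ _ 0) ?mulr_le0_ge0// mulr_ge0// ltW.
  have eC : (0 : R) < e / C by exact: (divr_gt0 e0 C0).
  near=> h; rewrite /= !fctE /= addr0 (le_trans (rC h))//.
  rewrite expr2 mulrA ler_wpM2r// mulrC -ler_pdivlMr//; apply: ltW; near: h.
have dE : ('d r x : U -> R) = \0.
  by apply: diff_unique => //; exact: cst_continuous.
split=> //; apply/diff_locallyP; rewrite dE; split; first exact: cst_continuous.
exact: E.
Unshelve. all: by end_near. Qed.

End QuadraticRemainder.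

Section Smooth.
Context {R : realType}.
Implicit Types U V W : normedModType R.

(** A coinduction principle: a class of differentiable functions that is closed under all
    directional derivatives contains only smooth functions. The induction peels off the last vector
    of the list, since [iterD] applies it first. *)
Lemma smooth_class U (S : (U -> R) -> Prop) :
  (forall f, S f -> (forall x, differentiable f x) /\ forall v, S ('D_v f)) ->
  forall f, S f -> smooth f.
Proof.
move=> HS f Sf vs; elim/last_ind: vs f Sf => [|vs v IH] f Sf x _.
  exact: (HS f Sf).1.
by rewrite /iterD foldr_rcons; apply: IH => //; exact: (HS f Sf).2.
Qed.

Lemma smooth_diff U (f : U -> R) : smooth f -> forall x, differentiable f x.
Proof. by move=> sf x; exact: (sf [::] x I). Qed.

Lemma smooth_cont U (f : U -> R) : smooth f -> continuous f.
Proof. by move=> sf x; apply: differentiable_continuous; exact: smooth_diff. Qed.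

Lemma smooth_D U (f : U -> R) v : smooth f -> smooth ('D_v f).
Proof. by move=> sf vs x _; have := sf (rcons vs v) x I; rewrite /iterD foldr_rcons. Qed.

(** Leibniz' rule turns a product into a sum of products and so leads out of most classes. In the
    algebra generated by a class it does not, and only the derivatives of the generators have to be
    expressed. *)
Inductive palg U (A : (U -> R) -> Prop) : (U -> R) -> Prop :=
| palg_gen f : A f -> palg A f
| palg_add f g : palg A f -> palg A g -> palg A (f + g)
| palg_mul f g : palg A f -> palg A g -> palg A (f * g).

Lemma palg_smooth U (A : (U -> R) -> Prop) :
  (forall f, A f -> (forall x, differentiable f x) /\ forall v, palg A ('D_v f)) ->
  forall f, palg A f -> smooth f.
Proof.
move=> HA; apply: smooth_class => f; elim => {f}.
- exact: HA.
- move=> f g _ [df Pf] _ [dg Pg]; split=> [x|v]; first exact: differentiableD.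
  rewrite (_ : 'D_v (f + g) = 'D_v f + 'D_v g); first exact: palg_add.
  by apply/funext => x; rewrite deriveD//; exact: diff_derivable.
- move=> f g Af [df Pf] Ag [dg Pg]; split=> [x|v]; first exact: differentiableM.
  rewrite (_ : 'D_v (f * g) = f * 'D_v g + g * 'D_v f).
    by apply: palg_add; exact: palg_mul.
  by apply/funext => x; rewrite deriveM//; exact: diff_derivable.
Qed.

Lemma palg_smooth_id U (f : U -> R) : palg (fun f => smooth f) f -> smooth f.
Proof.
apply: palg_smooth => {}f sf; split; first exact: smooth_diff.
by move=> v; apply: palg_gen; exact: smooth_D.
Qed.

Lemma smoothD U (f g : U -> R) : smooth f -> smooth g -> smooth (fun x => f x + g x).
Proof. by move=> sf sg; apply: (@palg_smooth_id _ (f + g)); apply: palg_add; exact: palg_gen. Qed.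

Lemma smoothM U (f g : U -> R) : smooth f -> smooth g -> smooth (fun x => f x * g x).
Proof. by move=> sf sg; apply: (@palg_smooth_id _ (f * g)); apply: palg_mul; exact: palg_gen. Qed.

Lemma smooth_cst U (c : R) : smooth (fun _ : U => c).
Proof.
apply: (smooth_class (S := fun f : U -> R => exists c, f = cst c)); last by exists c.
move=> _ [e ->]; split; first by move=> x; exact: differentiable_cst.
by move=> v; exists 0; apply/funext => x; rewrite derive_cst.
Qed.

Lemma smoothZ U (c : R) (f : U -> R) : smooth f -> smooth (fun x => c * f x).
Proof. by move=> sf; apply: smoothM => //; exact: smooth_cst. Qed.

Lemma smoothN U (f : U -> R) : smooth f -> smooth (fun x => - f x).
Proof.
by move=> /(smoothZ (-1)); rewrite (_ : (fun x => _) = fun x => - f x)//; apply/funext => x; rewrite mulN1r.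
Qed.

Lemma smoothB U (f g : U -> R) : smooth f -> smooth g -> smooth (fun x => f x - g x).
Proof. by move=> sf sg; apply: smoothD => //; exact: smoothN. Qed.

Lemma smoothX U (f : U -> R) n : smooth f -> smooth (fun x => f x ^+ n).
Proof.
move=> sf; elim: n => [|n IH]; first exact: smooth_cst.
rewrite (_ : (fun x => _) = fun x => f x * f x ^+ n); first exact: smoothM.
by apply/funext => x; rewrite exprS.
Qed.

Lemma derive_comp U W (f : U -> R) (Phi : W -> U) (x v : W) :
  differentiable Phi x -> differentiable f (Phi x) ->
  'D_v (f \o Phi) x = 'D_('d Phi x v) f (Phi x).
Proof.
move=> dP df; rewrite deriveE; last exact: differentiable_comp.
by rewrite diff_comp// deriveE.
Qed.

(** The differential is the same map [L] at every point, which makes [Phi] affine. Derivatives of f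
    o Phi are then again of this form, with the direction v replaced by [L v], and smoothness of the
    composition needs no higher chain rule. *)
Definition affine_map U W (Phi : W -> U) (L : W -> U) :=
  forall x, is_diff x Phi L.

Lemma derive_affine U W (f : U -> R) (Phi : W -> U) L (v : W) : affine_map Phi L ->
  smooth f -> 'D_v (fun x => f (Phi x)) = fun x => 'D_(L v) f (Phi x).
Proof.
move=> aP sf; apply/funext => x.
have [dP vP] := aP x.
by rewrite derive_comp ?vP//; exact: smooth_diff.
Qed.

Lemma smooth_affine U W (f : U -> R) (Phi : W -> U) L : affine_map Phi L ->
  smooth f -> smooth (fun x => f (Phi x)).
Proof.
move=> aP sf.
apply: (smooth_class (S := fun g : W -> R => exists2 f, smooth f & g = fun x => f (Phi x))); last by exists f.
move=> _ [g sg ->]; split => [x|v].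
  apply: differentiable_comp; first by have [] := aP x.
  exact: smooth_diff.
by exists ('D_(L v) g); [exact: smooth_D|exact: derive_affine].
Qed.

Lemma derive_scale (f : R -> R) (x v : R) : differentiable f x ->
  'D_v f x = v * 'D_1 f x.
Proof.
move=> df; rewrite !deriveE// -[v in LHS]mulr1.
by rewrite -[v * 1]/(v *: (1 : R)) linearZ.
Qed.

Lemma smooth_id : smooth (fun x : R => x).
Proof.
apply: (smooth_class (S := fun f : R -> R => exists a b, f = fun x => a * x + b)); last first.
  by exists 1, 0; apply/funext => x; rewrite mul1r addr0.
move=> _ [a [b ->]].
have dl x : differentiable (fun x : R => a * x + b) x.
  by apply: differentiableD => //; apply: differentiableM.
split=> // v; exists 0, (a * v); apply/funext => x.
rewrite derive_scale// deriveD//.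
by rewrite derive_cst addr0 deriveMl// derive_id mulr1 mul0r add0r mulrC.
Qed.

Lemma smooth_cos_sin (a b : R) : smooth (fun x : R => a * cos x + b * sin x).
Proof.
apply: (smooth_class (S := fun f : R -> R => exists a b, f = fun x => a * cos x + b * sin x)); last by exists a, b.
move=> _ [c [e ->]].
have dfc x : differentiable (@cos R) x by exact/derivable1_diffP.
have dfs x : differentiable (@sin R) x by exact/derivable1_diffP.
have dd x : differentiable (fun x => c * cos x + e * sin x) x.
  by apply: differentiableD; apply: differentiableM.
split=> // v; exists (v * e), (- v * c); apply/funext => x.
rewrite derive_scale// deriveD; [|by apply: diff_derivable; apply: differentiableM..].
rewrite !deriveMl//; try exact: diff_derivable.
by have [_ ->] := is_derive_cos x; have [_ ->] := is_derive_sin x; ring.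
Qed.

Lemma smooth_cos : smooth (@cos R).
Proof.
have := smooth_cos_sin 1 0; rewrite (_ : (fun x => _) = @cos R)//.
by apply/funext => x; rewrite mul1r mul0r addr0.
Qed.

Lemma smooth_sin : smooth (@sin R).
Proof.
have := smooth_cos_sin 0 1; rewrite (_ : (fun x => _) = @sin R)//.
by apply/funext => x; rewrite mul1r mul0r add0r.
Qed.

End Smooth.

Section ComplexSmooth.
Context {R : realType}.
Implicit Types U V W : normedModType R.

Definition cD U (v : U) (f : U -> R[i]) : U -> R[i] :=
  fun x => 'D_v (re_fun f) x +i* 'D_v (im_fun f) x.

Lemma re_funM U (f g : U -> R[i]) : re_fun (fun x => f x * g x) =
  fun x => re_fun f x * re_fun g x - im_fun f x * im_fun g x.
Proof. by apply/funext => x; rewrite /re_fun cReM. Qed.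
Lemma im_funM U (f g : U -> R[i]) : im_fun (fun x => f x * g x) =
  fun x => re_fun f x * im_fun g x + im_fun f x * re_fun g x.
Proof. by apply/funext => x; rewrite /im_fun cImM. Qed.
Lemma re_funD U (f g : U -> R[i]) : re_fun (fun x => f x + g x) =
  fun x => re_fun f x + re_fun g x.
Proof. by apply/funext => x; rewrite /re_fun cReD. Qed.
Lemma im_funD U (f g : U -> R[i]) : im_fun (fun x => f x + g x) =
  fun x => im_fun f x + im_fun g x.
Proof. by apply/funext => x; rewrite /im_fun cImD. Qed.

Lemma csmooth_cst U (c : R[i]) : csmooth (fun _ : U => c).
Proof. by split; exact: smooth_cst. Qed.

Lemma csmooth_real U (f : U -> R) : smooth f -> csmooth (fun x => (f x)%:C).
Proof. by move=> sf; split => //; exact: smooth_cst. Qed.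

Lemma csmoothD U (f g : U -> R[i]) : csmooth f -> csmooth g ->
  csmooth (fun x => f x + g x).
Proof.
by move=> [a b] [c e]; split; rewrite ?re_funD ?im_funD; exact: smoothD.
Qed.

Lemma csmoothM U (f g : U -> R[i]) : csmooth f -> csmooth g ->
  csmooth (fun x => f x * g x).
Proof.
move=> [a b] [c e]; split; rewrite ?re_funM ?im_funM.
  by apply: smoothB; exact: smoothM.
by apply: smoothD; exact: smoothM.
Qed.

Lemma csmooth_cD U (v : U) (f : U -> R[i]) : csmooth f -> csmooth (cD v f).
Proof. by move=> [a b]; split; exact: smooth_D. Qed.

Lemma csmooth_affine U W (f : U -> R[i]) (Phi : W -> U) L : affine_map Phi L ->
  csmooth f -> csmooth (fun x => f (Phi x)).
Proof. by move=> aP [a b]; split; [exact: (smooth_affine aP a)|exact: (smooth_affine aP b)]. Qed.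

Lemma csmooth_cis U (p : U -> R) L : affine_map p L -> csmooth (fun x => cis (p x)).
Proof.
by move=> aP; split; apply: (smooth_affine aP); [exact: smooth_cos|exact: smooth_sin].
Qed.

Lemma csmooth_re U (f : U -> R[i]) : csmooth f -> forall x, differentiable (re_fun f) x.
Proof. by move=> [a _]; exact: smooth_diff. Qed.
Lemma csmooth_im U (f : U -> R[i]) : csmooth f -> forall x, differentiable (im_fun f) x.
Proof. by move=> [_ a]; exact: smooth_diff. Qed.

Lemma cD_affine U W (f : U -> R[i]) (Phi : W -> U) L v : affine_map Phi L ->
  csmooth f -> cD v (fun x => f (Phi x)) = fun x => cD (L v) f (Phi x).
Proof.
move=> aP [a b]; apply/funext => x; apply: complexP.
  exact: (congr1 (@^~ x) (derive_affine v aP a)).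
exact: (congr1 (@^~ x) (derive_affine v aP b)).
Qed.

Lemma derive_mulR U (f g : U -> R) x v : derivable f x v -> derivable g x v ->
  'D_v (fun y => f y * g y) x = f x * 'D_v g x + 'D_v f x * g x.
Proof. by move=> df dg; rewrite [LHS](deriveM df dg) /GRing.scale/= [g x * _]mulrC. Qed.

Lemma derivable_mulR U (f g : U -> R) x v : derivable f x v -> derivable g x v ->
  derivable (fun y => f y * g y) x v.
Proof. by move=> df dg; exact: (derivableM df dg). Qed.

Lemma derive_addR U (f g : U -> R) x v : derivable f x v -> derivable g x v ->
  'D_v (fun y => f y + g y) x = 'D_v f x + 'D_v g x.
Proof. by move=> df dg; exact: (deriveD df dg). Qed.

Lemma derive_subR U (f g : U -> R) x v : derivable f x v -> derivable g x v ->
  'D_v (fun y => f y - g y) x = 'D_v f x - 'D_v g x.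
Proof. by move=> df dg; exact: (deriveB df dg). Qed.

Lemma derivable_ZR U (c : R) (f : U -> R) x v : derivable f x v ->
  derivable (fun y => c * f y) x v.
Proof. by move=> df; exact: (derivableZ (k := c) df). Qed.

Lemma derive_ZR U (c : R) (f : U -> R) x v : derivable f x v ->
  'D_v (fun y => c * f y) x = c * 'D_v f x.
Proof. by move=> df; exact: (deriveZ c df). Qed.

Lemma derive_lincomb U (a b : R) (f g : U -> R) x v : derivable f x v -> derivable g x v ->
  'D_v (fun y => a * f y + b * g y) x = a * 'D_v f x + b * 'D_v g x.
Proof.
move=> df dg; rewrite derive_addR; [|exact: derivable_ZR|exact: derivable_ZR].
by rewrite (derive_ZR a df) (derive_ZR b dg).
Qed.

Lemma cDM U (v : U) (f g : U -> R[i]) : csmooth f -> csmooth g ->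
  cD v (fun x => f x * g x) = fun x => f x * cD v g x + cD v f x * g x.
Proof.
move=> sf sg; apply/funext => x.
have rf := @diff_derivable _ _ _ _ x v (csmooth_re sf x); have mf := @diff_derivable _ _ _ _ x v (csmooth_im sf x).
have rg := @diff_derivable _ _ _ _ x v (csmooth_re sg x); have mg := @diff_derivable _ _ _ _ x v (csmooth_im sg x).
rewrite /cD re_funM im_funM; apply: complexP => /=.
  rewrite derive_subR; [|exact: derivable_mulR..].
  rewrite !derive_mulR// cReD !cReM /= /re_fun /im_fun; ring.
rewrite derive_addR; [|exact: derivable_mulR..].
rewrite !derive_mulR// cImD !cImM /= /re_fun /im_fun; ring.
Qed.

Lemma cD_cst U (v : U) (c : R[i]) : cD v (fun=> c) = fun=> 0.
Proof.
apply/funext => x; rewrite /cD -[re_fun _]/(cst (complex.Re c)) -[im_fun _]/(cst (complex.Im c)).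
by rewrite !derive_cst.
Qed.

Lemma cDZ U (v : U) (c : R[i]) (f : U -> R[i]) : csmooth f ->
  cD v (fun x => c * f x) = fun x => c * cD v f x.
Proof.
move=> sf; rewrite cDM//; last exact: csmooth_cst.
by rewrite cD_cst; apply/funext => x; rewrite mul0r addr0.
Qed.

Lemma cD_cis U (p : U -> R) L (v : U) : affine_map p L ->
  cD v (fun x => cis (p x)) = fun x => ('i * (L v)%:C) * cis (p x).
Proof.
move=> aP; rewrite (cD_affine (f := @cis R) v aP); last first.
  by split; [exact: smooth_cos|exact: smooth_sin].
apply/funext => x; rewrite /cD derive_scale; last exact: (smooth_diff (@smooth_cos R)).
rewrite [X in _ +i* X]derive_scale; last exact: (smooth_diff (@smooth_sin R)).
have [_ ec] := is_derive_cos (p x); have [_ es] := is_derive_sin (p x).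
rewrite [X in (L v * X) +i* _]ec [X in _ +i* (L v * X)]es.
by apply: complexP; rewrite /= !(mul0r, mul1r, subr0, sub0r, addr0, add0r); ring.
Qed.

Lemma csmooth_cmeas2 (f : R * R -> R[i]) : csmooth f -> cmeas f.
Proof. by move=> [a b]; split; apply: continuous_measurable2; exact: smooth_cont. Qed.

Lemma csmooth_cmeas1 (f : R -> R[i]) : csmooth f -> cmeas f.
Proof. by move=> [a b]; split; apply: continuous_measurable_fun; exact: smooth_cont. Qed.

Lemma csmooth_cmeas4 (f : (R * R) * (R * R) -> R[i]) : csmooth f -> cmeas f.
Proof. by move=> [a b]; split; apply: continuous_measurable4; exact: smooth_cont. Qed.

End ComplexSmooth.

Section CompactSupport.
Context {R : realType}.
Implicit Types U V W : normedModType R.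

Lemma compact_bound U (K : set U) : compact K -> exists2 A : R, 0 < A & forall x, K x -> `|x| <= A.
Proof.
move=> /compact_bounded [M [_ HM]]; exists (Num.max M 0 + 1).
  by rewrite ltr_wpDl// le_max lexx orbT.
move=> x Kx; apply: (HM (Num.max M 0 + 1)) => //.
by rewrite (@le_lt_trans _ _ (Num.max M 0)) ?le_max ?lexx// ltrDl.
Qed.

Lemma cs_bound U (V : zmodType) (f : U -> V) : compactly_supported f ->
  exists2 A : R, 0 < A & forall x, A < `|x| -> f x = 0.
Proof.
move=> /compact_bound[A A0 HA]; exists A => // x Ax.
apply/eqP; apply: contraTT Ax => fx; rewrite -leNgt.
by apply: HA; apply: subset_closure.
Qed.

Lemma cs_sub U (V V' : zmodType) (f : U -> V) (g : U -> V') : compactly_supported g ->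
  (forall x, f x != 0 -> closure [set x | g x != 0] x) -> compactly_supported f.
Proof.
move=> cg fg; apply: (subclosed_compact _ cg); first exact: closed_closure.
rewrite [X in _ `<=` X](closure_id _).1; last exact: closed_closure.
by apply: closureS => x /= /fg.
Qed.

Lemma cs_le U (V V' : zmodType) (f : U -> V) (g : U -> V') : compactly_supported g ->
  (forall x, g x = 0 -> f x = 0) -> compactly_supported f.
Proof.
move=> cg fg; apply: (cs_sub cg) => x fx; apply: subset_closure => /=.
by apply: contra fx => /eqP /fg ->.
Qed.

Lemma cD_supp U (v : U) (f : U -> R[i]) x : cD v f x != 0 ->
  closure [set x | f x != 0] x.
Proof.
move=> Dx; apply: contrapT => nx.
suff E : cD v f x = 0 by rewrite E eqxx in Dx.
have : nbhs x (~` closure [set x | f x != 0]).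
  by apply: open_nbhs_nbhs; split => //; exact/closed_openC/closed_closure.
move=> nb.
have f0 : \forall y \near x, f y = 0.
  apply: filterS nb => y /= ny; apply: contrapT => /eqP fy.
  by apply: ny; exact: subset_closure.
rewrite /cD (@near_eq_derive _ _ _ _ (cst 0)); last first.
  by apply: filterS f0 => y /=; rewrite /re_fun => ->.
rewrite derive_cst (@near_eq_derive _ _ _ _ (cst 0)) ?derive_cst//.
by apply: filterS f0 => y /=; rewrite /im_fun => ->.
Qed.

Lemma test_cD U (v : U) (f : U -> R[i]) : test_function f -> test_function (cD v f).
Proof.
move=> [sf cf]; split; first exact: csmooth_cD.
by apply: (cs_sub cf) => x; exact: cD_supp.
Qed.

Lemma testM U (f g : U -> R[i]) : csmooth f -> test_function g ->
  test_function (fun x => f x * g x).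
Proof.
move=> sf [sg cg]; split; first exact: csmoothM.
by apply: (cs_le cg) => x ->; rewrite mulr0.
Qed.

Lemma testZ U (c : R[i]) (f : U -> R[i]) : test_function f ->
  test_function (fun x => c * f x).
Proof. by apply: testM; exact: csmooth_cst. Qed.

Lemma testD U (f g : U -> R[i]) : test_function f -> test_function g ->
  test_function (fun x => f x + g x).
Proof.
move=> [sf cf] [sg cg]; split; first exact: csmoothD.
apply: (@subclosed_compact _ _ (closure [set x | f x != 0] `|` closure [set x | g x != 0])).
- exact: closed_closure.
- exact: compactU.
- rewrite -closureU; apply: closureS => x /= fg.
  have [fx|fx] := eqVneq (f x) 0; last by left.
  by right; apply: contra fg => /eqP gx; rewrite fx gx addr0.
Qed.

Lemma cs_of_compact U (V : zmodType) (f : U -> V) (K : set U) : compact K -> closed K ->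
  (forall x, f x != 0 -> K x) -> compactly_supported f.
Proof.
move=> cK clK fK; apply: (subclosed_compact _ cK); first exact: closed_closure.
by rewrite [X in _ `<=` X](closure_id _).1//; apply: closureS => x /= /fK.
Qed.

Definition ball1 (A : R) : set R := `[- A, A]%classic.

Lemma ball1E A (x : R) : ball1 A x <-> `|x| <= A.
Proof. by rewrite /ball1 /= in_itv/= ler_norml. Qed.

Lemma ball1_compact A : compact (ball1 A). Proof. exact: segment_compact. Qed.

Definition ball2 (A : R) : set (R * R) := ball1 A `*` ball1 A.
Lemma ball2_compact A : compact (ball2 A). Proof. by apply: compact_setX; exact: ball1_compact. Qed.
Lemma ball2E A (x : R * R) : ball2 A x <-> `|x| <= A.
Proof.
rewrite /ball2 /setX /= !ball1E prod_normE /= ge_max.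
by split => [[-> ->]|/andP].
Qed.

Lemma ball4_compact A : compact (ball2 A `*` ball2 A).
Proof. by apply: compact_setX; exact: ball2_compact. Qed.
Lemma ball4E A (x : (R * R) * (R * R)) : (ball2 A `*` ball2 A) x <-> `|x| <= A.
Proof.
have E : (`|x| <= A) = (`|x.1| <= A) && (`|x.2| <= A).
  by rewrite [`|x|]prod_normE ge_max.
rewrite -[(_ `*` _) x]/(ball2 A x.1 /\ ball2 A x.2) !ball2E E.
by split => [[-> ->]|/andP].
Qed.

Lemma cs_ball1 (V : zmodType) (f : R -> V) A : (forall x, A < `|x| -> f x = 0) ->
  compactly_supported f.
Proof.
move=> fA; apply: (cs_of_compact (K := (ball1 A))); first exact: ball1_compact.
  by apply: compact_closed; [exact: norm_hausdorff|exact: ball1_compact].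
by move=> x; apply: contraNP => /ball1E/negP; rewrite -ltNge => /fA ->.
Qed.

Lemma cs_ball2 (V : zmodType) (f : R * R -> V) A : (forall x, A < `|x| -> f x = 0) ->
  compactly_supported f.
Proof.
move=> fA; apply: (cs_of_compact (K := (ball2 A))); first exact: ball2_compact.
  by apply: compact_closed; [exact: norm_hausdorff|exact: ball2_compact].
by move=> x; apply: contraNP => /ball2E/negP; rewrite -ltNge => /fA ->.
Qed.

Lemma cs_ball4 (V : zmodType) (f : (R * R) * (R * R) -> V) A : (forall x, A < `|x| -> f x = 0) ->
  compactly_supported f.
Proof.
move=> fA; apply: (cs_of_compact (K := (ball2 A `*` ball2 A))); first exact: ball4_compact.
  by apply: compact_closed; [exact: norm_hausdorff|exact: ball4_compact].
by move=> x; apply: contraNP => /ball4E/negP; rewrite -ltNge => /fA ->.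
Qed.

Lemma continuous_bound U (f : U -> R) (K : set U) : continuous f -> compact K ->
  exists2 M : R, 0 < M & forall x, K x -> `|f x| <= M.
Proof.
move=> cf cK; have : compact (f @` K).
  by apply: continuous_compact => //; exact: continuous_subspaceT.
by move=> /compact_bound[M M0 HM]; exists M => // x Kx; apply: HM; exists x.
Qed.

Lemma test_bound U (f : U -> R[i]) : test_function f ->
  exists2 M : R, 0 < M & forall x, cabs (f x) <= M.
Proof.
move=> [[sr si] cf].
have [M1 M10 H1] := continuous_bound (smooth_cont sr) cf.
have [M2 M20 H2] := continuous_bound (smooth_cont si) cf.
exists (M1 + M2) => [|x]; first exact: addr_gt0.
have [->|fx] := eqVneq (f x) 0; first by rewrite cabs0 addr_ge0// ltW.
have Kx : closure [set x | f x != 0] x by exact: subset_closure.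
by rewrite (le_trans (cabs_le_ReIm _))// lerD//; [exact: H1|exact: H2].
Qed.

End CompactSupport.

(** * Second order Taylor bounds *)

Section Taylor.
Context {R : realType}.
Local Notation R2 := (R * R)%type.

Lemma affine_line (U : normedModType R) (x h : U) :
  affine_map (fun t : R => t *: h + x) (fun t => t *: h).
Proof.
move=> t.
have dl : differentiable (fun t : R => t *: h) t by apply: differentiableZl.
have E : (fun t : R => t *: h + x) = (fun t => t *: h) + cst x by [].
split; first by rewrite E; exact: differentiableD.
apply/funext => u; rewrite E -deriveE; last exact: differentiableD.
rewrite deriveD//; last exact: diff_derivable.
rewrite derive_cst addr0 deriveE//.
by rewrite (@diff_val _ _ _ _ _ _ _ (is_diff_scalel _ _)).
Qed.

Lemma derive_dirZ (U : normedModType R) (f : U -> R) (x h : U) (c : R) : differentiable f x ->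
  'D_(c *: h) f x = c * 'D_h f x.
Proof. by move=> df; rewrite !(deriveE _ df) linearZ. Qed.

Lemma derive_lin2 (f : R2 -> R) (x v : R2) : differentiable f x ->
  'D_v f x = v.1 * 'D_((1, 0) : R2) f x + v.2 * 'D_((0, 1) : R2) f x.
Proof.
move=> df; rewrite !deriveE//.
have {1}-> : v = v.1 *: ((1, 0) : R2) + v.2 *: ((0, 1) : R2).
  by case: v => a b; rewrite /= -[RHS]/((_, _) : R2) /=; congr pair; rewrite /GRing.scale/= ?mulr1 ?mulr0 ?addr0 ?add0r.
by rewrite linearD !linearZ.
Qed.

Lemma MVT01 (g g' : R -> R) : (forall t : R, is_derive t (1 : R) g (g' t)) ->
  exists2 c, `|c| <= 1 & g 1 - g 0 = g' c.
Proof.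
move=> dg.
have cg : {within `[0, 1], continuous g}.
  by apply: derivable_within_continuous => x _; have [] := dg x.
have [c] := MVT ltr01 (fun x _ => dg x) cg.
rewrite in_itv /= subr0 mulr1 => /andP[c0 c1] ->; exists c => //.
by rewrite ger0_norm ltW.
Qed.

Lemma line_derive (U : normedModType R) (f : U -> R) (x h : U) : smooth f ->
  forall t : R, is_derive t (1 : R) (fun t : R => f (t *: h + x)) ('D_h f (t *: h + x)).
Proof.
move=> sf t; have sg := smooth_affine (affine_line x h) sf.
split; first by apply: diff_derivable; exact: smooth_diff.
by rewrite [LHS](congr1 (@^~ t) (derive_affine (1 : R) (affine_line x h) sf)) scale1r.
Qed.

(** The mean value theorem twice: for t |-> f(x + t h) - t D_h f(x), then for D_h f along the
    segment up to the intermediate point c. The derivative D_h D_h f carries the factor of order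
    |h|^2 in the applications. *)
Lemma taylor2 (U : normedModType R) (f : U -> R) (x h : U) (M : R) : smooth f ->
  (forall y, `|'D_h ('D_h f) y| <= M) -> `|f (h + x) - f x - 'D_h f x| <= M.
Proof.
move=> sf HM.
pose g t := f (t *: h + x) - 'D_h f x * t.
have [c c1] : exists2 c, `|c| <= 1 & g 1 - g 0 = 'D_h f (c *: h + x) - 'D_h f x.
  apply: MVT01 => t.
  have [d1 d2] := line_derive x h sf t.
  have d0 : derivable (fun t : R => t) t (1 : R) by exact: derivable_id.
  have dm := derivable_ZR (c := 'D_h f x) d0.
  split; first exact: (derivableB d1 dm).
  rewrite [LHS](derive_subR d1 dm) d2 (derive_ZR _ d0).
  by rewrite (derive_id t (1 : R)) mulr1.
rewrite /g !scale1r !scale0r !add0r mulr1 mulr0 subr0 addrAC => ->.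
have sD := smooth_D h sf.
have dg (u : R) : is_derive u (1 : R) (fun t => 'D_h f ((t * c) *: h + x)) (c * 'D_h ('D_h f) ((u * c) *: h + x)).
  have E : (fun t => 'D_h f ((t * c) *: h + x)) = (fun t => 'D_h f (t *: (c *: h) + x)).
    by apply/funext => w; rewrite scalerA.
  rewrite E; have [d1 d2] := line_derive x (c *: h) sD u.
  split; first exact: d1.
  by rewrite d2 (derive_dirZ _ _ (smooth_diff sD _)) scalerA.
have [t t1] := MVT01 dg.
rewrite mul1r mul0r scale0r add0r => ->.
by rewrite normrM (le_trans _ (HM ((t * c) *: h + x)))// ler_piMl.
Qed.

Lemma test_taylor2 (f : R2 -> R) : smooth f -> compactly_supported f ->
  exists2 C : R, 0 < C & forall x h, `|f (h + x) - f x - 'D_h f x| <= C * `|h| ^+ 2.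
Proof.
move=> sf cf.
have test : test_function (fun x => (f x)%:C).
  split; first exact: csmooth_real.
  by apply: (cs_le cf) => x ->.
have b (v w : R2) : exists2 M : R, 0 < M & forall x, `|'D_v ('D_w f) x| <= M.
  have [M M0 HM] := test_bound (test_cD v (test_cD w test)).
  exists M => // x.
  have E : 'D_v ('D_w f) x = complex.Re (cD v (cD w (fun x => (f x)%:C)) x) by [].
  by rewrite E; exact: (le_trans (Re_le_cabs _) (HM x)).
pose e1 : R2 := (1, 0); pose e2 : R2 := (0, 1).
have [M11 p11 H11] := b e1 e1; have [M12 p12 H12] := b e1 e2.
have [M21 p21 H21] := b e2 e1; have [M22 p22 H22] := b e2 e2.
exists (M11 + M12 + M21 + M22); first by rewrite !addr_gt0.
move=> x h; apply: taylor2 => [|y]; first exact: sf.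
have df v z : differentiable ('D_v f) z by apply: smooth_diff; exact: smooth_D.
have ED : 'D_h f = fun z => h.1 * 'D_e1 f z + h.2 * 'D_e2 f z.
  by apply/funext => z; rewrite derive_lin2//; exact: smooth_diff.
have dd v w : derivable ('D_w f) y v by exact: (diff_derivable (df w y)).
have -> : 'D_h ('D_h f) y = h.1 * (h.1 * 'D_e1 ('D_e1 f) y + h.2 * 'D_e1 ('D_e2 f) y) +
    h.2 * (h.1 * 'D_e2 ('D_e1 f) y + h.2 * 'D_e2 ('D_e2 f) y).
  rewrite (derive_lin2 _ (df h y)) ED.
  by rewrite (derive_lincomb _ _ (dd e1 e1) (dd e1 e2)) (derive_lincomb _ _ (dd e2 e1) (dd e2 e2)).
have n1 : `|h.1| <= `|h| by rewrite [`|h|]prod_normE le_max lexx.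
have n2 : `|h.2| <= `|h| by rewrite [`|h|]prod_normE le_max lexx orbT.
have q (a c u M : R) : `|a| <= `|h| -> `|c| <= `|h| -> `|u| <= M -> `|a * (c * u)| <= M * `|h| ^+ 2.
  move=> ah ch uM; rewrite !normrM mulrA mulrC; apply: ler_pM => //.
  by rewrite expr2; apply: ler_pM.
rewrite !mulrDr !mulrDl (le_trans (ler_normD _ _))// -addrA lerD//.
  by rewrite (le_trans (ler_normD _ _))// lerD//; apply: q.
by rewrite (le_trans (ler_normD _ _))// lerD//; apply: q.
Qed.

End Taylor.

(** * Integrable majorants and the fundamental theorem on the line *)

Section Boxes.
Context {R : realType}.
Local Notation leb := (@lebesgue_measure R).
Local Notation l2 := (@lebesgue_measure R \x @lebesgue_measure R)%E.

Definition box (A : R) : R -> R := \1_(ball1 A).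

Lemma boxE A x : box A x = if `|x| <= A then 1 else 0.
Proof.
rewrite /box indicE; case: ifPn => xA; first by rewrite mem_set//; exact/ball1E.
by rewrite memNset//; move/ball1E; apply/negP.
Qed.

Lemma box_ge0 A x : 0 <= box A x.
Proof. by rewrite boxE; case: ifP. Qed.

Lemma itg_box A : itg leb (box A).
Proof. exact: integrable_indic_itv. Qed.

Lemma Rint_box A : 0 <= A -> \int[leb]_x box A x = 2 * A.
Proof.
move=> A0; rewrite /box /Rintegral integral_indic//; last exact: measurable_itv.
rewrite ?setIT ?setTI /ball1.
rewrite [X in fine X](lebesgue_measure_itv `[- A, A]%R) /= lte_fin; case: ifP => [_|/negbT].
  by rewrite -EFinD /= opprK mulr_natl mulr2n.
rewrite -leNgt => h; have -> : A = 0 by apply/eqP; rewrite eq_le A0 andbT; lra.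
by rewrite mulr0.
Qed.

Definition box2 (A : R) (z : R * R) : R := box A z.1 * box A z.2.

Lemma box2_ge0 A z : 0 <= box2 A z.
Proof. by rewrite mulr_ge0// box_ge0. Qed.

Lemma itg_box2 A : itg l2 (box2 A).
Proof. by apply: itg_prod; exact: itg_box. Qed.

Lemma box2E A z : box2 A z = if `|z| <= A then 1 else 0.
Proof.
rewrite /box2 !boxE prod_normE ge_max.
by case: ifP; case: ifP => //=; rewrite ?(mulr0, mul0r, mulr1).
Qed.

Lemma test_box1 (f : R -> R[i]) : test_function f ->
  exists A M : R, [/\ 0 < A, 0 < M & forall x, cabs (f x) <= M * box A x].
Proof.
move=> tf; have [M M0 HM] := test_bound tf; have [A A0 HA] := cs_bound tf.2.
exists A, M; split => // x; rewrite boxE; case: ifPn => [_|]; first by rewrite mulr1.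
by rewrite -ltNge => /HA ->; rewrite cabs0 mulr0.
Qed.

Lemma test_box2 (f : R * R -> R[i]) : test_function f ->
  exists A M : R, [/\ 0 < A, 0 < M & forall x, cabs (f x) <= M * box2 A x].
Proof.
move=> tf; have [M M0 HM] := test_bound tf; have [A A0 HA] := cs_bound tf.2.
exists A, M; split => // x; rewrite box2E; case: ifPn => [_|]; first by rewrite mulr1.
by rewrite -ltNge => /HA ->; rewrite cabs0 mulr0.
Qed.

Lemma test_citg1 (f : R -> R[i]) : test_function f -> citg leb f.
Proof.
move=> tf; have [A [M [_ _ H]]] := test_box1 tf.
apply: (citg_dom _ (itgZ M (itg_box A)) H); exact: csmooth_cmeas1 tf.1.
Qed.

Lemma test_citg2 (f : R * R -> R[i]) : test_function f -> citg l2 f.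
Proof.
move=> tf; have [A [M [_ _ H]]] := test_box2 tf.
apply: (citg_dom _ (itgZ M (itg_box2 A)) H); exact: csmooth_cmeas2 tf.1.
Qed.

Lemma Rint_derive0 (F : R -> R) (A : R) : smooth F -> (forall x, A < `|x| -> F x = 0) ->
  \int[leb]_x 'D_1 F x = 0.
Proof.
move=> sF FA; pose B := Num.max A 0 + 1.
have B0 : 0 < B by rewrite ltr_wpDl// le_max lexx orbT.
have AB : A < B by rewrite (@le_lt_trans _ _ (Num.max A 0)) ?le_max ?lexx// ltrDl.
have sD := smooth_D (1 : R) sF.
have out x : A < `|x| -> 'D_1 F x = 0.
  move=> Ax; rewrite (@near_eq_derive _ _ _ _ (cst 0)) ?derive_cst//.
  have oA : open [set y : R | A < `|y|].
    by apply: open_comp (@open_gt _ A) => y _; exact: norm_continuous.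
  apply: filterS (open_nbhs_nbhs (conj oA Ax)) => y /= Ay.
  exact: FA.
have -> : \int[leb]_x 'D_1 F x = \int[leb]_(x in `[- B, B]) 'D_1 F x.
  rewrite [RHS]Rintegral_mkcond; apply: eq_Rintegral => x _.
  rewrite patchE; case: ifPn => //; rewrite notin_setE /= in_itv/= => /negP.
  rewrite -ler_norml -ltNge => Bx; apply: out; exact: lt_trans Bx.
rewrite /Rintegral (@continuous_FTC2 _ _ F).
- have AB' : A < `|B| by rewrite gtr0_norm.
  by rewrite (FA _ AB') (FA (- B)); [rewrite -EFinB subrr|rewrite normrN].
- by rewrite (@lt_trans _ _ 0) ?oppr_lt0.
- by apply: continuous_subspaceT; exact: smooth_cont.
- split.
  + by move=> x _; apply: diff_derivable; exact: smooth_diff.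
  + by apply: cvg_at_right_filter; exact: smooth_cont.
  + by apply: cvg_at_left_filter; exact: smooth_cont.
- by move=> x _; rewrite derive1E.
Qed.

Lemma affine_slice1 (y : R) : affine_map (fun t : R => (t, y)) (fun t => (t, 0)).
Proof.
move=> t; have := is_diff_pair (is_diff_id t) (is_diff_cst y t).
by [].
Qed.

Lemma affine_slice2 (x : R) : affine_map (fun t : R => (x, t)) (fun t => (0, t)).
Proof.
move=> t; have := is_diff_pair (is_diff_cst x t) (is_diff_id t).
by [].
Qed.

Lemma cint2_derive0_1 (f : R * R -> R[i]) : test_function f -> cint2 (cD ((1, 0) : R * R) f) = 0.
Proof.
move=> tf; have tD := test_cD ((1, 0) : R * R) tf.
have [A A0 HA] := cs_bound tf.2.
rewrite cint2E (cint_fubini2 (test_citg2 tD)).2.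
rewrite (_ : (fun y => _) = fun=> 0); first by rewrite cint0.
apply/funext => y.
have zA (t : R) : A < `|t| -> f (t, y) = 0.
  by move=> At; apply: HA; rewrite prod_normE lt_max At.
have E g : smooth g -> (forall x, A < `|x| -> g x = 0) ->
    \int[leb]_x 'D_((1, 0) : R * R) g (x, y) = 0.
  move=> sg gA; have sF := smooth_affine (affine_slice1 y) sg.
  rewrite -[RHS](@Rint_derive0 (fun t => g (t, y)) A sF); last first.
    by move=> x Ax; apply: gA; rewrite prod_normE lt_max Ax.
  by rewrite (derive_affine (1 : R) (affine_slice1 y) sg).
rewrite /cint /cD; apply: complexP => /=.
  by rewrite E//; [exact: tf.1.1|move=> x /HA; rewrite /re_fun => ->].
by rewrite E//; [exact: tf.1.2|move=> x /HA; rewrite /im_fun => ->].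
Qed.

Lemma cint2_derive0_2 (f : R * R -> R[i]) : test_function f -> cint2 (cD ((0, 1) : R * R) f) = 0.
Proof.
move=> tf; have tD := test_cD ((0, 1) : R * R) tf.
have [A A0 HA] := cs_bound tf.2.
rewrite cint2E (cint_fubini1 (test_citg2 tD)).2.
rewrite (_ : (fun y => _) = fun=> 0); first by rewrite cint0.
apply/funext => y.
have E g : smooth g -> (forall x, A < `|x| -> g x = 0) ->
    \int[leb]_x 'D_((0, 1) : R * R) g (y, x) = 0.
  move=> sg gA; have sF := smooth_affine (affine_slice2 y) sg.
  rewrite -[RHS](@Rint_derive0 (fun t => g (y, t)) A sF); last first.
    by move=> x Ax; apply: gA; rewrite prod_normE lt_max Ax orbT.
  by rewrite (derive_affine (1 : R) (affine_slice2 y) sg).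
rewrite /cint /cD; apply: complexP => /=.
  by rewrite E//; [exact: tf.1.1|move=> x /HA; rewrite /re_fun => ->].
by rewrite E//; [exact: tf.1.2|move=> x /HA; rewrite /im_fun => ->].
Qed.

(** Meant for functions such as exp(-e|x|), with a corner at 0: only the formula [g] valid for x >=
    0 must have an explicit primitive, and evenness doubles the half-line integral. *)
Lemma even_FTC (f g F : R -> R) (l : R) : (forall x, 0 <= f x) -> continuous f ->
  (forall x, f (- x) = f x) -> (forall x, 0 <= x -> f x = g x) ->
  (forall x, is_derive x (1 : R) F (g x)) -> F x @[x --> +oo] --> l ->
  itg leb f /\ \int[leb]_x f x = 2 * (l - F 0).
Proof.
move=> f0 cf ef fg dF Fl.
have I0 : (\int[leb]_(x in `[0%R, +oo[) (f x)%:E = l%:E - (F 0)%:E)%E.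
  apply: ge0_continuous_FTC2y => //.
  - exact: continuous_subspaceT.
  - apply: cvg_at_right_filter; apply: differentiable_continuous.
    by apply/derivable1_diffP; have [] := dF 0.
  - move=> x; rewrite in_itv/= andbT => x0; rewrite derive1E fg ?ltW//.
    by have [_ ->] := dF x.
have I1 : (\int[leb]_x (f x)%:E = (2 * (l - F 0))%:E)%E.
  rewrite ge0_symfun_integralT//; last by move=> x; rewrite /= ef.
  by rewrite -set_itvcy I0 -EFinB -EFinM.
split; last by rewrite /Rintegral I1.
apply/integrableP; split; first by apply/measurable_EFinP; exact: continuous_measurable_fun.
by under eq_integral do rewrite /= ger0_norm//; rewrite I1 ltry.
Qed.

(** The Cauchy density without the factor 1/pi. It is the profile of the Poisson kernel and, through
    [w2], the standard integrable majorant. *)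
Definition w1 (t : R) : R := (1 + t ^+ 2)^-1.

Lemma w1_gt0 t : 0 < w1 t.
Proof. by rewrite invr_gt0 ltr_wpDr ?sqr_ge0. Qed.

Lemma w1_cont : continuous w1.
Proof.
move=> x; apply: cvgV; first by rewrite gt_eqF// ltr_wpDr ?sqr_ge0.
by apply: cvgD; [exact: cvg_cst|exact: exprn_continuous].
Qed.

Lemma w1_int : itg leb w1 /\ \int[leb]_x w1 x = pi.
Proof.
have ew x : w1 (- x) = w1 x by rewrite /w1 sqrrN.
have [J E] := even_FTC (fun x => ltW (w1_gt0 x)) w1_cont ew (fun _ _ => erefl)
  (@is_derive1_atan R) (@cvgy_atan R).
by split => //; rewrite E atan0 subr0 mulrC divfK.
Qed.

End Boxes.

Section DerivativeCalculus.
Context {R : realType}.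
Implicit Types (f g F : R -> R) (x a b : R).

Lemma is_derive_eqR f x a b : is_derive x (1 : R) f a -> a = b -> is_derive x (1 : R) f b.
Proof. by move=> h <-. Qed.

Lemma is_deriveDR f g x a b : is_derive x (1 : R) f a -> is_derive x (1 : R) g b ->
  is_derive x (1 : R) (fun y => f y + g y) (a + b).
Proof.
by move=> [df <-] [dg <-]; split; [exact: (derivableD df dg)|exact: (deriveD df dg)].
Qed.

Lemma is_deriveMR f g x a b : is_derive x (1 : R) f a -> is_derive x (1 : R) g b ->
  is_derive x (1 : R) (fun y => f y * g y) (f x * b + a * g x).
Proof.
by move=> [df <-] [dg <-]; split; [exact: (derivable_mulR df dg)|exact: (derive_mulR df dg)].
Qed.

Lemma is_deriveZR (c : R) f x a : is_derive x (1 : R) f a ->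
  is_derive x (1 : R) (fun y => c * f y) (c * a).
Proof.
by move=> [df <-]; split; [exact: (derivable_ZR df)|exact: (derive_ZR c df)].
Qed.

Lemma is_derive_idR x : is_derive x (1 : R) (fun y => y) 1.
Proof. by split; [exact: derivable_id|exact: derive_id]. Qed.

Lemma is_derive_compR F f x a b : is_derive (f x) (1 : R) F a -> is_derive x (1 : R) f b ->
  is_derive x (1 : R) (fun y => F (f y)) (a * b).
Proof. by move=> dF df; exact: (is_derive1_comp dF df). Qed.

Lemma is_derive_scaleM F (s : R) x a : is_derive (s * x) (1 : R) F a ->
  is_derive x (1 : R) (fun y => F (s * y)) (s * a).
Proof.
move=> dF; have := is_derive_compR (f := fun y => s * y) dF (is_deriveZR s (is_derive_idR x)).
by move=> h; apply: (is_derive_eqR h); rewrite mulr1 mulrC.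
Qed.

End DerivativeCalculus.

(** * The Poisson kernel and its Fourier transform *)

Section Poisson.
Context {R : realType}.
Local Notation leb := (@lebesgue_measure R).
Variable e : R.
Hypothesis e0 : 0 < e.

Lemma cvg_expRN : expR (- (e * x)) @[x --> +oo] --> (0 : R).
Proof.
apply: (cvg_comp (fun x => e * x) (fun y => expR (- y))); last exact: cvgr_expR.
exact: gt0_cvgMry.
Qed.

Lemma cvg_expRN_bounded (h : R -> R) (M : R) : (forall x, `|h x| <= M) ->
  expR (- (e * x)) * h x @[x --> +oo] --> (0 : R).
Proof.
move=> hM; apply/norm_cvg0P.
apply: (squeeze_cvgr (f := fun=> 0) (h := fun x => expR (- (e * x)) * M)).
- near=> x; rewrite normr_ge0/= normrM ger0_norm ?expR_ge0// ler_wpM2l// expR_ge0 //.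
- exact: cvg_cst.
- by rewrite -[X in _ --> X](mul0r M); apply: cvgMl; exact: cvg_expRN.
Unshelve. all: by end_near. Qed.

Lemma expR_abs_cont : continuous (fun x : R => expR (- (e * `|x|))).
Proof.
move=> x; apply: (@cvg_comp _ _ _ (fun x => - (e * `|x|)) (@expR R)); last exact: continuous_expR.
by apply: cvgN; apply: cvgM; [exact: cvg_cst|exact: norm_continuous].
Qed.

Lemma poisson_int : itg leb (fun x => expR (- (e * `|x|))) /\
  \int[leb]_x expR (- (e * `|x|)) = 2 / e.
Proof.
have dF x : is_derive x (1 : R) (fun x => - e^-1 * expR (- e * x)) (expR (- (e * x))).
  apply: (is_derive_eqR (is_deriveZR (- e^-1) (is_derive_scaleM (is_derive_expR (- e * x))))).
  by rewrite mulrA mulrNN mulVf ?gt_eqF// mul1r mulNr.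
have Fl : - e^-1 * expR (- e * x) @[x --> +oo] --> (0 : R).
  rewrite -[X in _ --> X](mulr0 (- e^-1)); apply: cvgMr.
  by under eq_fun do rewrite mulNr; exact: cvg_expRN.
have [J E] := even_FTC (g := fun x => expR (- (e * x))) (fun x => expR_ge0 _) expR_abs_cont
  (fun x => congr1 (fun u => expR (- (e * u))) (normrN x))
  (fun x x0 => congr1 (fun u => expR (- (e * u))) (ger0_norm x0)) dF Fl.
by split => //; rewrite E mulr0 expR0 mulr1 opprK add0r.
Qed.

(** The primitive of exp(-e x) cos(s x) is exp(-e x) (s sin(s x) - e cos(s x)) / (e^2 + s^2). Since
    [even_FTC] asks for a nonnegative integrand, 1 + cos is integrated and the integral of
    exp(-e|x|) subtracted. *)
Lemma poisson_cos (s : R) :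
  \int[leb]_x (expR (- (e * `|x|)) * cos (s * x)) = 2 * e / (e ^+ 2 + s ^+ 2).
Proof.
have K0 : e ^+ 2 + s ^+ 2 != 0 by rewrite gt_eqF// ltr_wpDr ?sqr_ge0// exprn_gt0.
have ne0 : e != 0 by rewrite gt_eqF.
pose K := (e ^+ 2 + s ^+ 2)^-1.
pose h x := s * sin (s * x) + - e * cos (s * x).
pose F x := K * (expR (- e * x) * h x) + - e^-1 * expR (- e * x).
have dF x : is_derive x (1 : R) F (expR (- (e * x)) * (cos (s * x) + 1)).
  have dE := is_derive_scaleM (is_derive_expR (- e * x)).
  have dC := is_derive_scaleM (is_derive_cos (s * x)).
  have dS := is_derive_scaleM (is_derive_sin (s * x)).
  have dh := is_deriveDR (is_deriveZR s dS) (is_deriveZR (- e) dC).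
  have d := is_deriveDR (is_deriveZR K (is_deriveMR dE dh)) (is_deriveZR (- e^-1) dE).
  apply: (is_derive_eqR d); rewrite /h /K -!mulNr.
  move: (expR _) (cos _) (sin _) => E C S; field.
  by rewrite ne0 K0.
have Fl : F x @[x --> +oo] --> (0 : R).
  rewrite /F -[X in _ --> X](addr0 (0 : R)); apply: cvgD.
    rewrite -[X in _ --> X](mulr0 K); apply: cvgMr.
    under eq_fun do rewrite mulNr.
    apply: (cvg_expRN_bounded (M := `|s| + `|e|)) => x.
    rewrite (le_trans (ler_normD _ _))// !normrM normrN.
    by rewrite lerD// ler_piMr// ler_norml ?sin_geN1 ?sin_le1 ?cos_geN1 ?cos_le1.
  rewrite -[X in _ --> X](mulr0 (- e^-1)); apply: cvgMr.
  by under eq_fun do rewrite mulNr; exact: cvg_expRN.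
pose f x := expR (- (e * `|x|)) * (cos (s * x) + 1).
have f0 x : 0 <= f x.
  by rewrite mulr_ge0 ?expR_ge0// -lerBlDr sub0r cos_geN1.
have cf : continuous f.
  move=> x; apply: cvgM; first exact: expR_abs_cont.
  apply: cvgD; last exact: cvg_cst.
  apply: (@cvg_comp _ _ _ (fun x => s * x) (@cos R)); last exact: continuous_cos.
  by apply: cvgM; [exact: cvg_cst|exact: cvg_id].
have ef x : f (- x) = f x by rewrite /f normrN mulrN cosN.
have fg x : 0 <= x -> f x = expR (- (e * x)) * (cos (s * x) + 1).
  by move=> x0; rewrite /f ger0_norm.
have [J E] := even_FTC f0 cf ef fg dF Fl.
have [J1 E1] := poisson_int.
have -> : \int[leb]_x (expR (- (e * `|x|)) * cos (s * x)) = \int[leb]_x (f x - expR (- (e * `|x|))).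
  by apply: eq_Rintegral => x _; rewrite /f mulrDr mulr1 addrK.
rewrite RintegralB// E E1 /F /h /K !mulr0 expR0 sin0 cos0; field.
by rewrite ne0 K0.
Qed.

Lemma poisson_sin (s : R) :
  \int[leb]_x (expR (- (e * `|x|)) * sin (s * x)) = 0.
Proof.
pose g x := expR (- (e * `|x|)) * sin (s * x).
have Jg : itg leb g.
  apply: (itg_dom _ poisson_int.1) => [|x].
    apply: measurable_funM; first by apply: continuous_measurable_fun; exact: expR_abs_cont.
    apply: continuous_measurable_fun => x.
    apply: (@cvg_comp _ _ _ (fun x => s * x) (@sin R)); last exact: continuous_sin.
    by apply: cvgM; [exact: cvg_cst|exact: cvg_id].
  rewrite normrM ger0_norm ?expR_ge0// ler_piMr ?expR_ge0//.
  by rewrite ler_norml sin_geN1 sin_le1.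
have N1 : (-1 : R) != 0 by rewrite oppr_eq0 oner_eq0.
have [_ E] := Rint_aff 0 N1 Jg.
have : \int[leb]_x g x = - \int[leb]_x g x.
  rewrite -[RHS]mulN1r -RintegralZl// -[LHS]mul1r -[X in X * _]invr1 -[X in X^-1 * _]normr1 -[X in X^-1 * _]normrN -E.
  apply: eq_Rintegral => x _.
  by rewrite /g addr0 mulN1r normrN mulrN sinN mulrN mulN1r.
by rewrite -/g; set I := \int[leb]_x g x; move=> h; lra.
Qed.

Lemma poisson_ft (s : R) :
  citg leb (fun x => cis (s * x) * (expR (- (e * `|x|)))%:C) /\
  cint leb (fun x => cis (s * x) * (expR (- (e * `|x|)))%:C) = (2 * e / (e ^+ 2 + s ^+ 2))%:C.
Proof.
split.
  apply: (citgM_bounded (M := 1) (citg_real poisson_int.1)).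
    apply: cmeas_cis; apply: measurable_funM => //; exact: measurable_cst.
  by move=> x; rewrite cabs_cis.
rewrite /cint; apply: complexP => /=.
  rewrite -poisson_cos; apply: eq_Rintegral => x _.
  by rewrite mulr0 subr0 mulrC.
rewrite -[RHS](poisson_sin s); apply: eq_Rintegral => x _.
by rewrite mulr0 add0r mulrC.
Qed.

End Poisson.

Section AffineMaps.
Context {R : realType}.
Implicit Types U V W : normedModType R.

Lemma affine_linear U V (L : {linear U -> V}) : continuous L -> affine_map L L.
Proof. by move=> cL x; split; [exact: linear_differentiable|exact: diff_lin]. Qed.

Lemma affine_fst U V : affine_map (@fst U V) (@fst U V).
Proof. by apply: (@affine_linear _ _ (@fst U V)) => x; exact: cvg_fst. Qed.

Lemma affine_snd U V : affine_map (@snd U V) (@snd U V).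
Proof. by apply: (@affine_linear _ _ (@snd U V)) => x; exact: cvg_snd. Qed.

Lemma affine_id U : affine_map (fun x : U => x) (fun x => x).
Proof. by move=> x; exact: is_diff_id. Qed.

Lemma affine_cst U V (c : V) : affine_map (fun _ : U => c) (fun _ => 0).
Proof. by move=> x; exact: is_diff_cst. Qed.

Lemma affine_comp U V W (f : V -> W) (g : U -> V) L M : affine_map f L -> affine_map g M ->
  affine_map (fun x => f (g x)) (fun x => L (M x)).
Proof.
move=> af ag x; have [df ef] := af (g x); have [dg eg] := ag x.
split; first exact: differentiable_comp.
by rewrite [LHS]diff_comp// ef eg.
Qed.

Lemma affine_pair U V W (f : U -> V) (g : U -> W) L M : affine_map f L -> affine_map g M ->
  affine_map (fun x => (f x, g x)) (fun x => (L x, M x)).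
Proof. by move=> af ag x; have := af x; have := ag x => dg df; exact: (is_diff_pair df dg). Qed.

Lemma affine_add U V (f g : U -> V) L M : affine_map f L -> affine_map g M ->
  affine_map (fun x => f x + g x) (fun x => L x + M x).
Proof.
move=> af ag x; have [df ef] := af x; have [dg eg] := ag x.
split; first exact: (differentiableD df dg).
by rewrite [LHS](diffD df dg) ef eg.
Qed.

Lemma affine_scale U (c : R) (f : U -> R) L : affine_map f L ->
  affine_map (fun x => c * f x) (fun x => c * L x).
Proof.
move=> af x; have [df ef] := af x; split; first exact: (differentiableZ c df).
by rewrite [LHS](diffZ c df) ef.
Qed.

Lemma affine_opp U (f : U -> R) L : affine_map f L ->
  affine_map (fun x => - f x) (fun x => - L x).
Proof.
move=> /(affine_scale (-1)).
by congr affine_map; apply/funext => x; rewrite mulN1r.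
Qed.

Lemma affine_dot2 (xi : R * R) : affine_map (fun x : R * R => dot2 x xi) (fun x => dot2 x xi).
Proof.
have H1 := affine_scale xi.1 (@affine_fst R R); have H2 := affine_scale xi.2 (@affine_snd R R).
have := affine_add H1 H2.
by congr affine_map; apply/funext => x; rewrite /dot2 [xi.1 * _]mulrC [xi.2 * _]mulrC.
Qed.

End AffineMaps.

Lemma smooth_cvg_seq (R : realType) (U : normedModType R) (g : U -> R) (u : nat -> U) (x : U) :
  smooth g -> u @ \oo --> x -> (fun n => g (u n)) @ \oo --> g x.
Proof.
move=> sg ux.
by apply: cvg_comp ux _; exact: smooth_cont.
Qed.

(** * The Fourier transform on the plane *)

Section FourierTransform.
Context {R : realType}.
Local Notation leb := (@lebesgue_measure R).
Local Notation l2 := (@lebesgue_measure R \x @lebesgue_measure R)%E.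
Local Notation R2 := (R * R)%type.
Local Notation R2m := (measurableTypeR R * measurableTypeR R)%type.
Local Notation e1 := ((1, 0) : R2).
Local Notation e2 := ((0, 1) : R2).

Lemma leb2_sigma_finite : sigma_finite setT l2.
Proof.
have /sigma_finiteP[F [TF ndF Foo]] := sigma_finiteT leb.
exists (fun n => F n `*` F n).
  rewrite -setXTT TF predeqE => -[x y]; split.
    move=> [/= [n _ Fnx] [k _ Gky]]; exists (maxn n k) => //; split.
    - by move: x Fnx; exact/subsetPset/ndF/leq_maxl.
    - by move: y Gky; exact/subsetPset/ndF/leq_maxr.
  by move=> [n _ []/= ? ?]; split; exists n.
move=> k; have [? ?] := Foo k.
split; first exact: measurableX.
by rewrite product_measure1E// lte_mul_pinfty// ge0_fin_numE.
Qed.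

(* The sigma-finite structure of MathComp-Analysis on product measures is masked by its
   sub-probability instance. *)
Definition lebR2 : {sigma_finite_measure set (measurableTypeR R * measurableTypeR R)%type -> \bar R} :=
  HB.pack (Measure.sort l2) (Measure_isSigmaFinite.Build _ _ _ l2 leb2_sigma_finite).

Lemma cint2L (f : R2 -> R[i]) : cint2 f = cint lebR2 f. Proof. by []. Qed.

(* The measurable structures that Lebesgue measure and R * R carry are convertible but
   distinct; these restatements fix the choice. *)
Lemma citg_dom2 (F : R2 -> R[i]) (g : R2 -> R) : cmeas F -> itg l2 g ->
  (forall x, cabs (F x) <= g x) -> citg l2 F.
Proof. by move=> mF jg H; exact: (@citg_dom _ R2m R l2 F g mF jg H). Qed.

Lemma citg_dom1 (F : R -> R[i]) (g : R -> R) : cmeas F -> itg leb g ->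
  (forall x, cabs (F x) <= g x) -> citg leb F.
Proof. by move=> mF jg H; exact: (@citg_dom _ (measurableTypeR R) R leb F g mF jg H). Qed.

Lemma citg_meas2 (F : R2 -> R[i]) : citg l2 F -> cmeas F.
Proof. by move=> jF; exact: (@citg_meas _ R2m R l2 F jF). Qed.

Lemma citg_meas1 (F : R -> R[i]) : citg leb F -> cmeas F.
Proof. by move=> jF; exact: (@citg_meas _ (measurableTypeR R) R leb F jF). Qed.

Lemma cint_dct2 (F_ : nat -> R2 -> R[i]) (F : R2 -> R[i]) (g : R2 -> R) : (forall n, cmeas (F_ n)) ->
  (forall x, (fun n => complex.Re (F_ n x)) @ \oo --> complex.Re (F x)) ->
  (forall x, (fun n => complex.Im (F_ n x)) @ \oo --> complex.Im (F x)) ->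
  itg l2 g -> (forall n x, cabs (F_ n x) <= g x) ->
  ((fun n => complex.Re (cint l2 (F_ n))) @ \oo --> complex.Re (cint l2 F)) /\
  ((fun n => complex.Im (cint l2 (F_ n))) @ \oo --> complex.Im (cint l2 F)).
Proof. by move=> mF cR cI jg H; exact: (@cint_dct _ R2m R l2 F_ F g mF cR cI jg H). Qed.

(** The sign + and the missing normalization are those of the transform of test functions in
    [sobolev_transform]. The transform of a distribution has the opposite sign there, which is the
    source of the reflections xi |-> -xi below. *)
Definition ft (f : R2 -> R[i]) (xi : R2) : R[i] :=
  cint2 (fun x => cis (dot2 x xi) * f x).

Lemma dot2C (x y : R2) : dot2 x y = dot2 y x.
Proof. by rewrite /dot2 mulrC [X in _ + X]mulrC. Qed.

Lemma dot2Nr (x y : R2) : dot2 x (- y) = - dot2 x y.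
Proof. by rewrite /dot2 /= !mulrN opprD. Qed.

Lemma dot2Dl (x y z : R2) : dot2 (x + y) z = dot2 x z + dot2 y z.
Proof. by rewrite /dot2 /=; ring. Qed.

Lemma dot2_ge0 (x : R2) : 0 <= dot2 x x.
Proof. by rewrite /dot2 -!expr2 addr_ge0 ?sqr_ge0. Qed.

Lemma measurable_dot2 d (T : measurableType d) (f g : T -> R2) :
  measurable_fun setT f -> measurable_fun setT g ->
  measurable_fun setT (fun z => dot2 (f z) (g z)).
Proof.
move=> mf mg.
have a := measurableT_comp measurable_fst mf; have b := measurableT_comp measurable_snd mf.
have c := measurableT_comp measurable_fst mg; have e := measurableT_comp measurable_snd mg.
by apply: measurable_funD; apply: measurable_funM.
Qed.

Lemma ft_citg (f : R2 -> R[i]) xi : citg l2 f -> citg l2 (fun x => cis (dot2 x xi) * f x).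
Proof.
move=> jf; apply: (citgM_bounded (M := 1) jf) => [|x]; last by rewrite cabs_cis.
by apply: cmeas_cis; apply: measurable_dot2 => //; exact: measurable_cst.
Qed.

Lemma ft_bound (f : R2 -> R[i]) xi : citg l2 f -> cabs (ft f xi) <= \int[l2]_x cabs (f x).
Proof.
move=> jf; rewrite /ft cint2E; apply: cint_norm_le; first exact: ft_citg.
  exact: citg_cabs.
by move=> x; rewrite cabsM cabs_cis mul1r.
Qed.

Lemma ft_mult_citg (f g : R2 -> R[i]) : citg l2 f -> citg l2 g ->
  citg (lebR2 \x lebR2)%E (fun z => cis (dot2 z.1 z.2) * (f z.1 * g z.2)).
Proof.
move=> jf jg; apply: (citgM_bounded (M := 1)) => [||x]; last by rewrite cabs_cis.
  exact: citg_prod.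
by apply: cmeas_cis; apply: measurable_dot2; [exact: measurable_fst|exact: measurable_snd].
Qed.

Lemma ft_mult (f g : R2 -> R[i]) : citg l2 f -> citg l2 g ->
  citg l2 (fun xi => ft f xi * g xi) /\
  cint2 (fun xi => ft f xi * g xi) = cint2 (fun x => f x * ft g x).
Proof.
move=> jf jg; have J := ft_mult_citg jf jg.
have [K E] := cint_fubini2 J; have [K1 E1] := cint_fubini1 J.
have F2 : (fun y => cint lebR2 (fun x => cis (dot2 (x, y).1 (x, y).2) * (f (x, y).1 * g (x, y).2))) =
    (fun xi => ft f xi * g xi).
  apply/funext => y; rewrite -cintZr; last exact: ft_citg.
  by apply: eq_cint => x; rewrite /= mulrA.
have F1 : (fun x => cint lebR2 (fun y => cis (dot2 (x, y).1 (x, y).2) * (f (x, y).1 * g (x, y).2))) =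
    (fun x => f x * ft g x).
  apply/funext => x; rewrite -cintZ; last exact: ft_citg.
  by apply: eq_cint => y; rewrite /= mulrCA dot2C.
split; first by rewrite -F2.
by rewrite !cint2L -F2 -F1 -E -E1.
Qed.

Lemma ft_cD1 (f : R2 -> R[i]) xi : test_function f ->
  ft (cD e1 f) xi = - ('i * xi.1%:C) * ft f xi.
Proof.
move=> tf; have sc := csmooth_cis (affine_dot2 xi).
have th := testM sc tf.
have := cint2_derive0_1 th; rewrite cDM//; last exact: tf.1.
rewrite (cD_cis e1 (affine_dot2 xi)) => E.
have J1 := ft_citg xi (test_citg2 (test_cD e1 tf)).
have J2 := ft_citg xi (test_citg2 tf).
apply/eqP; rewrite mulNr -addr_eq0; apply/eqP; rewrite -[RHS]E.
have -> : xi.1 = dot2 e1 xi by rewrite /dot2 /= !(mul1r, mul0r, addr0, add0r).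
rewrite /ft !cint2E -(cintZ _ J2) -(cintD J1 (citgZ _ J2)).
by apply: eq_cint => x; rewrite mulrA.
Qed.

Lemma ft_cD2 (f : R2 -> R[i]) xi : test_function f ->
  ft (cD e2 f) xi = - ('i * xi.2%:C) * ft f xi.
Proof.
move=> tf; have sc := csmooth_cis (affine_dot2 xi).
have th := testM sc tf.
have := cint2_derive0_2 th; rewrite cDM//; last exact: tf.1.
rewrite (cD_cis e2 (affine_dot2 xi)) => E.
have J1 := ft_citg xi (test_citg2 (test_cD e2 tf)).
have J2 := ft_citg xi (test_citg2 tf).
apply/eqP; rewrite mulNr -addr_eq0; apply/eqP; rewrite -[RHS]E.
have -> : xi.2 = dot2 e2 xi by rewrite /dot2 /= !(mul1r, mul0r, addr0, add0r).
rewrite /ft !cint2E -(cintZ _ J2) -(cintD J1 (citgZ _ J2)).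
by apply: eq_cint => x; rewrite mulrA.
Qed.

(** The operator 1 - D_v^2 - D_w^2, whose symbol is [jb] when v and w are the basis vectors of the
    plane: its powers give decay in all directions at once. The directions are parameters so that it
    can also act on the second factor of R^2 x R^2. *)
Definition lap (U : normedModType R) (v w : U) (f : U -> R[i]) : U -> R[i] :=
  fun x => f x + (-1 * cD v (cD v f) x + -1 * cD w (cD w f) x).

Lemma test_lap (U : normedModType R) (v w : U) f : test_function f -> test_function (lap v w f).
Proof.
by move=> tf; apply: testD => //; apply: testD; apply: testZ; do 2 apply: test_cD.
Qed.

(** The square of the bracket <xi>, so that exponents are halved: <xi>^(2s) is the power s of
    [jb xi]. *)
Definition jb (xi : R2) : R := 1 + dot2 xi xi.

Lemma jb_ge1 xi : 1 <= jb xi. Proof. by rewrite lerDl dot2_ge0. Qed.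
Lemma jb_gt0 xi : 0 < jb xi. Proof. exact: lt_le_trans ltr01 (jb_ge1 xi). Qed.

Lemma ftD (f g : R2 -> R[i]) xi : citg l2 f -> citg l2 g ->
  ft (fun x => f x + g x) xi = ft f xi + ft g xi.
Proof.
move=> jf jg; rewrite /ft !cint2E -cintD; [|exact: ft_citg..].
by apply: eq_cint => x; rewrite mulrDr.
Qed.

Lemma ftZ (f : R2 -> R[i]) c xi : citg l2 f -> ft (fun x => c * f x) xi = c * ft f xi.
Proof.
move=> jf; rewrite /ft !cint2E -cintZ; last exact: ft_citg.
by apply: eq_cint => x; rewrite mulrCA.
Qed.

Lemma ftDZ (f g h : R2 -> R[i]) c xi : citg l2 f -> citg l2 g -> citg l2 h ->
  ft (fun x => f x + (c * g x + c * h x)) xi = ft f xi + (c * ft g xi + c * ft h xi).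
Proof.
move=> jf jg jh.
rewrite (ftD xi jf (citgD (citgZ c jg) (citgZ c jh))).
by rewrite (ftD xi (citgZ c jg) (citgZ c jh)) (ftZ c xi jg) (ftZ c xi jh).
Qed.

Lemma ft_lap (f : R2 -> R[i]) xi : test_function f ->
  ft (lap e1 e2 f) xi = (jb xi)%:C * ft f xi.
Proof.
move=> tf; have t1 := test_cD e1 tf; have t2 := test_cD e2 tf.
have j1 := test_citg2 (test_cD e1 t1); have j2 := test_citg2 (test_cD e2 t2).
have jf := test_citg2 tf.
rewrite [LHS](ftDZ (-1) xi jf j1 j2).
have E1 := eq_trans (ft_cD1 xi t1) (congr1 (fun z => - ('i * xi.1%:C) * z) (ft_cD1 xi tf)).
have E2 := eq_trans (ft_cD2 xi t2) (congr1 (fun z => - ('i * xi.2%:C) * z) (ft_cD2 xi tf)).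
transitivity (ft f xi + (-1 * (- ('i * xi.1%:C) * (- ('i * xi.1%:C) * ft f xi)) +
    -1 * (- ('i * xi.2%:C) * (- ('i * xi.2%:C) * ft f xi)))).
  by congr (_ + (_ * _ + _ * _)); [exact: E1|exact: E2].
have -> : (jb xi)%:C = 1 + (xi.1%:C * xi.1%:C + xi.2%:C * xi.2%:C) :> R[i].
  by rewrite /jb /dot2 !rmorphD !rmorphM.
have i2 : 'i * 'i = -1 :> R[i] by rewrite -expr2 sqr_i.
have E (c F : R[i]) : -1 * (- ('i * c) * (- ('i * c) * F)) = c * c * F.
  transitivity (- ('i * 'i) * (c * c * F)); first by ring.
  by rewrite i2 opprK mul1r.
by rewrite !E; ring.
Qed.

Lemma iter_lap_ft (f : R2 -> R[i]) xi n : test_function f ->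
  ft (iter n (lap e1 e2) f) xi = ((jb xi) ^+ n)%:C * ft f xi.
Proof.
move=> tf; elim: n => [|n IH]; first by rewrite expr0 mul1r.
rewrite iterS ft_lap ?IH; last by elim: n {IH} => //= n; exact: test_lap.
by rewrite mulrA -rmorphM -exprS.
Qed.

Lemma test_iter_lap (U : normedModType R) (v w : U) f n : test_function f ->
  test_function (iter n (lap v w) f).
Proof. by move=> tf; elim: n => //= n; exact: test_lap. Qed.

Lemma ft_decay (f : R2 -> R[i]) n : test_function f ->
  exists2 C : R, 0 < C & forall xi, cabs (ft f xi) <= C * (jb xi ^+ n)^-1.
Proof.
move=> tf; have tl := test_iter_lap e1 e2 n tf; have jl := test_citg2 tl.
set I := \int[l2]_x cabs (iter n (lap e1 e2) f x).
have I0 : 0 <= I by apply: Rintegral_ge0 => x _; exact: cabs_ge0.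
exists (I + 1) => [|xi]; first by rewrite ltr_wpDl.
rewrite ler_pdivlMr ?exprn_gt0 ?jb_gt0//.
apply: (@le_trans _ _ I); last by rewrite lerDl.
rewrite mulrC -(ger0_norm (exprn_ge0 n (ltW (jb_gt0 xi)))) -cabs_real -cabsM -iter_lap_ft//.
exact: ft_bound.
Qed.

Definition w2 (x : R2) : R := w1 x.1 * w1 x.2.

Lemma itg_w2 : itg l2 w2.
Proof. by apply: itg_prod; exact: w1_int.1. Qed.

Lemma w2_ge0 x : 0 <= w2 x. Proof. by rewrite mulr_ge0// ltW// w1_gt0. Qed.

Lemma jb2_w2 xi : (jb xi ^+ 2)^-1 <= w2 xi.
Proof.
rewrite /w2 /w1 -invfM lef_pV2 ?posrE ?exprn_gt0 ?jb_gt0//; last first.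
  by rewrite mulr_gt0// ltr_wpDr ?sqr_ge0.
rewrite /jb /dot2 -!expr2.
have := sqr_ge0 xi.1; have := sqr_ge0 xi.2; set a := xi.1 ^+ 2; set b := xi.2 ^+ 2 => a0 b0.
nra.
Qed.

Lemma cmeas_w2_inv : cmeas (fun x : R2 => ((w2 x)^-1)%:C).
Proof.
apply: cmeas_real; apply: continuous_measurable2 => x.
have c1 : (fun x : R2 => w1 x.1) @ x --> w1 x.1.
  by apply: (@cvg_comp _ _ _ (@fst R R) (@w1 R)); [exact: cvg_fst|exact: w1_cont].
have c2 : (fun x : R2 => w1 x.2) @ x --> w1 x.2.
  by apply: (@cvg_comp _ _ _ (@snd R R) (@w1 R)); [exact: cvg_snd|exact: w1_cont].
by apply: cvgV; [rewrite mulf_neq0// gt_eqF// w1_gt0|exact: cvgM].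
Qed.

(** Measurability comes out of Fubini: by the multiplication formula [ft f] times [w2] is
    integrable, and the positive continuous [w2] can be divided out. *)
Lemma ft_meas (f : R2 -> R[i]) : citg l2 f -> cmeas (ft f).
Proof.
move=> jf; have [jw _] := ft_mult jf (citg_real itg_w2).
have := cmeasM (citg_meas jw) cmeas_w2_inv.
congr cmeas; apply/funext => x; rewrite -mulrA -rmorphM mulfV ?mulr1//.
by rewrite mulf_neq0// gt_eqF// w1_gt0.
Qed.

Lemma ft_test_citg (f : R2 -> R[i]) : test_function f -> citg l2 (ft f).
Proof.
move=> tf; have [C C0 HC] := ft_decay 2 tf.
apply: (citg_dom _ (itgZ C itg_w2)) => [|x]; first exact: (ft_meas (test_citg2 tf)).
apply: (le_trans (HC x)); apply: ler_wpM2l; [exact: ltW|exact: jb2_w2].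
Qed.

Lemma Rint_pi : @pi R != 0. Proof. by rewrite gt_eqF// pi_gt0. Qed.

(* Abel summation: multiply by the product Poisson kernel exp(-e|xi_1| - e|xi_2|). *)
Lemma poisson2_ft (e : R) (x y : R2) : 0 < e ->
  citg l2 (fun xi => cis (- dot2 x xi) * (expR (- (e * `|xi.1|)) * expR (- (e * `|xi.2|)))%:C) /\
  ft (fun xi => cis (- dot2 x xi) * (expR (- (e * `|xi.1|)) * expR (- (e * `|xi.2|)))%:C) y =
  ((2 * e / (e ^+ 2 + (y.1 - x.1) ^+ 2)) * (2 * e / (e ^+ 2 + (y.2 - x.2) ^+ 2)))%:C.
Proof.
move=> e0.
have P z : citg l2 (fun xi => cis (dot2 z xi) * (expR (- (e * `|xi.1|)) * expR (- (e * `|xi.2|)))%:C) /\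
   cint l2 (fun xi => cis (dot2 z xi) * (expR (- (e * `|xi.1|)) * expR (- (e * `|xi.2|)))%:C) =
   ((2 * e / (e ^+ 2 + z.1 ^+ 2)) * (2 * e / (e ^+ 2 + z.2 ^+ 2)))%:C.
  have [j1 E1] := poisson_ft e0 z.1; have [j2 E2] := poisson_ft e0 z.2.
  have E : (fun xi : R2 => cis (dot2 z xi) * (expR (- (e * `|xi.1|)) * expR (- (e * `|xi.2|)))%:C) =
     (fun xi : R2 => (cis (z.1 * xi.1) * (expR (- (e * `|xi.1|)))%:C) * (cis (z.2 * xi.2) * (expR (- (e * `|xi.2|)))%:C)).
    by apply/funext => xi; rewrite /dot2 cisD rmorphM; ring.
  rewrite E; split; first exact: (citg_prod j1 j2).
  by rewrite (cint_prod j1 j2) E1 E2 -rmorphM.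
have dE z : - dot2 x z = dot2 (- x) z by rewrite /dot2 /= !mulNr opprD.
split.
  have [J _] := P (- x); move: J; congr citg.
  by apply/funext => z; rewrite dE.
have [_ E] := P (y - x).
rewrite -[RHS]E /ft cint2E; apply: eq_cint => z.
by rewrite mulrA -cisD dE [dot2 z y]dot2C -dot2Dl.
Qed.

(** The Abel means of the inversion integral are averages of f around x: the multiplication formula
    moves the transform from f to the damped exponential, where it is a Poisson kernel, and y = x +
    e u rescales this kernel to 4 [w2]. *)
Lemma poisson_avg (f : R2 -> R[i]) (x : R2) (e : R) : 0 < e -> citg l2 f -> citg l2 (ft f) ->
  cint l2 (fun xi => (expR (- (e * `|xi.1|)) * expR (- (e * `|xi.2|)))%:C * (cis (- dot2 x xi) * ft f xi)) =
  cint l2 (fun u => (4 * w2 u)%:C * f (e * u.1 + x.1, e * u.2 + x.2)).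
Proof.
move=> e0 jf jF; have ne0 : e != 0 by rewrite gt_eqF.
pose G xi : R[i] := cis (- dot2 x xi) * (expR (- (e * `|xi.1|)) * expR (- (e * `|xi.2|)))%:C.
have JG : citg l2 G by have [] := poisson2_ft x x e0.
have [_ E] := ft_mult jf JG.
transitivity (cint2 (fun xi => ft f xi * G xi)).
  by rewrite cint2E; apply: eq_cint => xi; rewrite /G mulrCA mulrA mulrC.
rewrite E.
have J2 : citg l2 (fun y => f y * ft G y).
  apply: (citg_dom2 (g := fun y => \int[l2]_xi cabs (G xi) * cabs (f y))).
  - exact: (cmeasM (citg_meas2 jf) (ft_meas JG)).
  - by apply: itgZ; exact: citg_cabs.
  - by move=> y; rewrite cabsM mulrC ler_wpM2r ?cabs_ge0//; exact: ft_bound.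
have [_] := cint2_shear x.1 ne0 ne0 (measurable_cst x.2) J2.
have ee0 : (`|e| * `|e|)%:C != 0 :> R[i].
  by rewrite gtr0_norm// (inj_eq (@complexI R)) mulf_neq0.
move=> /(congr1 (fun z => (`|e| * `|e|)%:C * z)).
rewrite mulrA -rmorphM mulfV ?mul1r; last by rewrite mulf_neq0 ?normr_eq0.
rewrite -cint2E => <-.
rewrite !cint2E -cintZ; last first.
  by have [] := cint2_shear x.1 ne0 ne0 (measurable_cst x.2) J2.
apply: eq_cint => u; rewrite /G (poisson2_ft x _ e0).2 /= !addrK.
rewrite mulrCA -rmorphM mulrC; congr (_ * _); congr (_%:C).
have h0 (t : R) : 1 + t ^+ 2 != 0 by rewrite gt_eqF// ltr_wpDr ?sqr_ge0.
have h1 (t : R) : e ^+ 2 + (e * t) ^+ 2 != 0 by rewrite gt_eqF// ltr_wpDr ?sqr_ge0 ?exprn_gt0.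
rewrite gtr0_norm// /w2 /w1; move: (u.1) (u.2) => c d; field.
by rewrite !h0 !h1.
Qed.

(** Dominated convergence on both sides of [poisson_avg] as e tends to 0: the transform of a test
    function is integrable, f is bounded and [w2] integrable. The constant is 4 times the integral
    of [w2], that is 4 pi^2. *)
Lemma ft_inversion (f : R2 -> R[i]) (x : R2) : test_function f ->
  cint2 (fun xi => cis (- dot2 x xi) * ft f xi) = ((2 * pi) ^+ 2)%:C * f x.
Proof.
move=> tf; have jf := test_citg2 tf; have jF := ft_test_citg tf.
pose e (n : nat) : R := n.+1%:R^-1.
have e0 n : 0 < e n by rewrite invr_gt0.
have ecvg : e @ \oo --> (0 : R) by exact: cvg_harmonic.
pose P n (xi : R2) : R := expR (- (e n * `|xi.1|)) * expR (- (e n * `|xi.2|)).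
pose A n := cint l2 (fun xi => (P n xi)%:C * (cis (- dot2 x xi) * ft f xi)).
pose B n := cint l2 (fun u => (4 * w2 u)%:C * f (e n * u.1 + x.1, e n * u.2 + x.2)).
have AB n : A n = B n by exact: poisson_avg.
have cexp (a : R) : (fun n => expR (- (e n * a))) @ \oo --> (1 : R).
  rewrite -[X in _ --> X]expR0.
  apply: (@cvg_comp _ _ _ (fun n => - (e n * a)) (@expR R) _ (nbhs 0)); last exact: continuous_expR.
  by rewrite -oppr0 -[X in - X](mul0r a); apply: cvgN; apply: cvgM; [exact: ecvg|exact: cvg_cst].
have cP xi : (fun n => P n xi) @ \oo --> (1 : R).
  by rewrite -[X in _ --> X](mulr1 (1 : R)); apply: cvgM; exact: cexp.
have mcis : cmeas (fun xi : R2 => cis (- dot2 x xi)).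
  apply: cmeas_cis; apply: (measurableT_comp (@oppr_measurable R setT)).
  by apply: measurable_dot2 => //; exact: measurable_cst.
have mP n : measurable_fun setT (P n).
  have h : measurable_fun setT (fun t : R => expR (- (e n * `|t|))).
    by apply: continuous_measurable_fun; exact: expR_abs_cont.
  by apply: measurable_funM; apply: (measurableT_comp h); [exact: measurable_fst|exact: measurable_snd].
have P01 n xi : 0 <= P n xi <= 1.
  have h (t : R) : 0 <= expR (- (e n * `|t|)) <= 1.
    by rewrite expR_ge0/= -expR0 ler_expR oppr_le0 mulr_ge0// ltW.
  have /andP[a b] := h xi.1; have /andP[c d] := h xi.2.
  by rewrite mulr_ge0//= -[leRHS](mulr1 (1 : R)) ler_pM.
have cvg1 (u : nat -> R) b : u @ \oo --> (1 : R) -> (fun n => u n * b) @ \oo --> b.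
  by move=> u1; rewrite -[X in _ --> X]mul1r; apply: cvgM; [exact: u1|exact: cvg_cst].
have [AR AI] : ((fun n => complex.Re (A n)) @ \oo --> complex.Re (cint l2 (fun xi => cis (- dot2 x xi) * ft f xi))) /\
   ((fun n => complex.Im (A n)) @ \oo --> complex.Im (cint l2 (fun xi => cis (- dot2 x xi) * ft f xi))).
  apply: (cint_dct2 (g := fun xi => cabs (ft f xi))).
  - by move=> n; exact: (cmeasM (cmeas_real (mP n)) (cmeasM mcis (ft_meas jf))).
  - move=> xi; under eq_fun do rewrite cReM /= mul0r subr0.
    by apply: cvg1; exact: cP.
  - move=> xi; under eq_fun do rewrite cImM /= mul0r addr0.
    by apply: cvg1; exact: cP.
  - exact: citg_cabs.
  - move=> n xi; have /andP[a b] := P01 n xi.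
    by rewrite !cabsM cabs_cis mul1r cabs_real ger0_norm// ler_piMl// cabs_ge0.
have [M M0 HM] := test_bound tf.
have cx (g : R2 -> R) u : smooth g -> (fun n => g (e n * u.1 + x.1, e n * u.2 + x.2)) @ \oo --> g x.
  move=> sg.
  apply: (@smooth_cvg_seq _ _ g (fun n => (e n * u.1 + x.1, e n * u.2 + x.2) : R2) x sg).
  have cc (a b : R) : (fun n => e n * a + b) @ \oo --> b.
    rewrite -[X in _ --> X]add0r -[X in _ --> X + _](mul0r a).
    by apply: cvgD; [apply: cvgM; [exact: ecvg|exact: cvg_cst]|exact: cvg_cst].
  exact: (cvg_pair (cc u.1 x.1) (cc u.2 x.2)).
have [BR BI] : ((fun n => complex.Re (B n)) @ \oo --> complex.Re (cint l2 (fun u => (4 * w2 u)%:C * f x))) /\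
   ((fun n => complex.Im (B n)) @ \oo --> complex.Im (cint l2 (fun u => (4 * w2 u)%:C * f x))).
  apply: (cint_dct2 (g := fun u => (M * 4) * w2 u)).
  - move=> n; apply: cmeasM.
      by apply: cmeas_real; apply: measurable_funM; [exact: measurable_cst|exact: itg_meas itg_w2].
    have [ma mb] := csmooth_cmeas2 tf.1.
    have ms := measurable_shear (e n) (e n) x.1 (measurable_cst x.2).
    by split; [exact: (measurableT_comp ma ms)|exact: (measurableT_comp mb ms)].
  - move=> u; rewrite cReM /= mul0r subr0; under eq_fun do rewrite cReM /= mul0r subr0.
    by apply: cvgM; [exact: cvg_cst|exact: (cx (re_fun f) u tf.1.1)].
  - move=> u; rewrite cImM /= mul0r addr0; under eq_fun do rewrite cImM /= mul0r addr0.
    by apply: cvgM; [exact: cvg_cst|exact: (cx (im_fun f) u tf.1.2)].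
  - by apply: itgZ; exact: itg_w2.
  - move=> n u; have w40 : 0 <= 4 * w2 u by exact: (mulr_ge0 (ler0n _ 4) (w2_ge0 u)).
    rewrite cabsM cabs_real (ger0_norm w40) [leLHS]mulrC -mulrA; apply: ler_pM => //.
    exact: cabs_ge0.
transitivity (cint l2 (fun u => (4 * w2 u)%:C * f x)); last first.
  have jw : citg l2 (fun u => (4 * w2 u)%:C) by apply: citg_real; apply: itgZ; exact: itg_w2.
  rewrite cintZr// cint_real RintegralZl//; last exact: itg_w2.
  congr (_%:C * _).
  have [J E] := @w1_int R.
  have -> : \int[l2]_z w2 z = complex.Re (cint l2 (fun z => (w1 z.1)%:C * (w1 z.2)%:C)).
    by rewrite /cint /=; apply: eq_Rintegral => z _ /=; rewrite mulr0 subr0.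
  rewrite (cint_prod (citg_real J) (citg_real J)) !cint_real E /= mulr0 subr0.
  by ring.
have EA : A = B by apply/funext => n; exact: AB.
rewrite EA in AR AI.
rewrite cint2E; apply: complexP.
  exact: (cvg_unique (@Rhausdorff R) AR BR).
exact: (cvg_unique (@Rhausdorff R) AI BI).
Qed.

(** Parseval without conjugation: by inversion the transform of xi |-> [ft g (- xi)] is (2 pi)^2 g,
    and this function is put into the multiplication formula. *)
Lemma ft_test_mult (f g : R2 -> R[i]) : test_function f -> test_function g ->
  cint2 (fun xi => ft f (- xi) * ft g xi) = ((2 * pi) ^+ 2)%:C * cint2 (fun x => f x * g x).
Proof.
move=> tf tg.
have jf := test_citg2 tf; have jF := ft_test_citg tf; have jG := ft_test_citg tg.
have n1 : (-1 : R) != 0 by rewrite oppr_eq0 oner_eq0.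
have N (h : R2 -> R[i]) : citg l2 h -> citg l2 (fun x => h (- x)) /\ cint2 (fun x => h (- x)) = cint2 h.
  move=> jh; have [J E] := cint2_shear 0 n1 n1 (measurable_cst (0 : R)) jh.
  have EF : (fun z => h (-1 * z.1 + 0, -1 * z.2 + cst 0 z.1)) = (fun x => h (- x)).
    by apply/funext => z; rewrite /cst !addr0 !mulN1r.
  rewrite -EF; split => //.
  by rewrite E normrN normr1 mulr1 invr1 mul1r.
have [JN _] := N _ jG.
have [Jm Em] := ft_mult jf JN.
have [_ E] := N _ Jm.
have E2 : cint2 (fun xi => ft f (- xi) * ft g xi) = cint2 (fun xi => ft f xi * ft g (- xi)).
  by rewrite -E; congr cint2; apply/funext => x; rewrite opprK.
have jc x : citg l2 (fun xi => cis (- dot2 x xi) * ft g xi).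
  apply: (citgM_bounded (M := 1) jG) => [|z]; last by rewrite cabs_cis.
  apply: cmeas_cis; apply: (measurableT_comp (@oppr_measurable R setT)).
  by apply: measurable_dot2 => //; exact: measurable_cst.
have EQ x : ft (fun y => ft g (- y)) x = ((2 * pi) ^+ 2)%:C * g x.
  rewrite -(ft_inversion x tg) -(N _ (jc x)).2 /ft; congr cint2; apply/funext => xi.
  by rewrite dot2Nr opprK dot2C.
have Jp := test_citg2 (testM tf.1 tg).
rewrite E2 Em; apply: (eq_trans _ (cintZ _ Jp)).
by rewrite cint2E; apply: eq_cint => x; rewrite EQ mulrCA.
Qed.

End FourierTransform.

Section QuadraticAffine.
Context {R : realType} {U : normedModType R}.

Lemma diff_quad_affine (f Lam L : U -> R) (x : U) (C : R) : affine_map Lam L ->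
  (forall h, `|f (h + x) - f x - (Lam (h + x) - Lam x)| <= C * `|h| ^+ 2) ->
  differentiable f x /\ forall v, 'D_v f x = L v.
Proof.
move=> aL fC; pose r y := f y - Lam y.
have [dr dr0] : differentiable r x /\ ('d r x : U -> R) = \0.
  apply: (diff_quad (C := C)) => h; rewrite /r.
  by rewrite (_ : _ - _ - _ = f (h + x) - f x - (Lam (h + x) - Lam x))//; ring.
have fE : f = r + Lam by apply/funext => y; rewrite /r !fctE subrK.
have [dL eL] := aL x.
have df : differentiable f x by rewrite fE; exact: differentiableD.
split => // v; rewrite fE deriveD; [|exact: diff_derivable..].
by rewrite !deriveE// dr0 eL /= add0r.
Qed.

End QuadraticAffine.

(** * Fourier transform on the line; primitives that are singular at 0 *)

Section Fourier1.
Context {R : realType}.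
Local Notation leb := (@lebesgue_measure R).

Lemma cos_taylor (x : R) : `|cos x - 1| <= x ^+ 2.
Proof.
have D0 (h y : R) : 'D_h (@cos R) y = h * - sin y.
  by rewrite derive_scale; [rewrite derive_val|exact: smooth_diff smooth_cos y].
have := @taylor2 R R (@cos R) 0 x (x ^+ 2) smooth_cos.
rewrite addr0 cos0 D0 sin0 oppr0 mulr0 subr0; apply => y.
have E : 'D_x (@cos R) = fun y => - x * sin y.
  by apply/funext => z; rewrite D0 mulrN mulNr.
have ds := diff_derivable (v := x) (smooth_diff (@smooth_sin R) y).
rewrite E (derive_ZR (- x) ds) derive_scale; last exact: smooth_diff smooth_sin y.
rewrite derive_val mulrA mulNr -expr2 normrM normrN [X in X * _]ger0_norm ?sqr_ge0//.
by rewrite ler_piMr ?sqr_ge0// ler_norml cos_geN1 cos_le1.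
Qed.

Lemma sin_taylor (x : R) : `|sin x - x| <= x ^+ 2.
Proof.
have D0 (h y : R) : 'D_h (@sin R) y = h * cos y.
  by rewrite derive_scale; [rewrite derive_val|exact: smooth_diff smooth_sin y].
have := @taylor2 R R (@sin R) 0 x (x ^+ 2) smooth_sin.
rewrite addr0 sin0 D0 cos0 mulr1 subr0; apply => y.
have E : 'D_x (@sin R) = fun y => x * cos y.
  by apply/funext => z; rewrite D0.
have ds := diff_derivable (v := x) (smooth_diff (@smooth_cos R) y).
rewrite E (derive_ZR x ds) derive_scale; last exact: smooth_diff smooth_cos y.
rewrite derive_val mulrN mulrN mulrA -expr2 normrN normrM [X in X * _]ger0_norm ?sqr_ge0//.
by rewrite ler_piMr ?sqr_ge0// ler_norml sin_geN1 sin_le1.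
Qed.

Lemma cis_taylor (x : R) : cabs (cis x - 1 - 'i * x%:C) <= 2 * x ^+ 2.
Proof.
rewrite (le_trans (cabs_le_ReIm _))// mulr_natl mulr2n lerD//.
  rewrite !(cReD, cReN, cReM) /= !(mul0r, mul1r, mulr0, subr0, oppr0, addr0).
  exact: cos_taylor.
rewrite !(cImD, cImN, cImM) /= !(mul0r, mul1r, mulr0, subr0, oppr0, addr0, add0r).
exact: sin_taylor.
Qed.

Lemma cint1_derive0 (f : R -> R[i]) : test_function f -> cint leb (cD (1 : R) f) = 0.
Proof.
move=> tf; have [A A0 HA] := cs_bound tf.2; rewrite /cint /cD; apply: complexP => /=.
  by apply: (@Rint_derive0 R (re_fun f) A tf.1.1) => x /HA; rewrite /re_fun => ->.
by apply: (@Rint_derive0 R (im_fun f) A tf.1.2) => x /HA; rewrite /im_fun => ->.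
Qed.

(** The sign is minus here, because inversion of [ft] at the point (t, 0) produces exp(-i t
    theta_1). *)
Definition ftm (f : R -> R[i]) (theta : R) : R[i] := cint leb (fun t => cis (- (t * theta)) * f t).

Lemma affine_ftm (theta : R) : affine_map (fun t : R => - (t * theta)) (fun t => - (t * theta)).
Proof.
have := affine_opp (affine_scale theta (@affine_id R R)).
by congr affine_map; apply/funext => x; rewrite mulrC.
Qed.

Lemma ftm_citg (f : R -> R[i]) theta : citg leb f -> citg leb (fun t => cis (- (t * theta)) * f t).
Proof.
move=> jf; apply: (citgM_bounded (M := 1) jf) => [|x]; last by rewrite cabs_cis.
apply: cmeas_cis; apply: (measurableT_comp (@oppr_measurable R setT)).
by apply: measurable_funM => //; exact: measurable_cst.
Qed.

Lemma ftm_cD (f : R -> R[i]) theta : test_function f ->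
  ftm (cD (1 : R) f) theta = 'i * theta%:C * ftm f theta.
Proof.
move=> tf; have sc := csmooth_cis (affine_ftm theta).
have th := testM sc tf.
have := cint1_derive0 th; rewrite (cDM _ sc tf.1) (cD_cis (1 : R) (affine_ftm theta)) mul1r => E.
have J1 := ftm_citg theta (test_citg1 (test_cD (1 : R) tf)).
have J2 := ftm_citg theta (test_citg1 tf).
apply/eqP; rewrite -subr_eq0; apply/eqP; rewrite -[RHS]E /ftm -(cintZ _ J2).
rewrite -(cintB J1 (citgZ _ J2)).
apply: eq_cint => x; rewrite rmorphN /=; ring.
Qed.

Lemma ftm_bound (f : R -> R[i]) theta : citg leb f -> cabs (ftm f theta) <= \int[leb]_x cabs (f x).
Proof.
move=> jf; apply: cint_norm_le; [exact: ftm_citg|exact: citg_cabs|].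
by move=> x; rewrite cabsM cabs_cis mul1r.
Qed.

Lemma ftm_decay (f : R -> R[i]) n : test_function f ->
  exists2 C : R, 0 < C & forall theta, 1 <= `|theta| -> cabs (ftm f theta) <= C * `|theta| ^- n.
Proof.
move=> tf.
have tn : test_function (iter n (cD (1 : R)) f) by elim: n => //= n; exact: test_cD.
have E theta : ftm (iter n (cD (1 : R)) f) theta = ('i * theta%:C) ^+ n * ftm f theta.
  elim: n {tn} => [|n IH]; first by rewrite expr0 mul1r.
  rewrite iterS ftm_cD ?IH ?exprS ?mulrA//.
  by elim: n {IH} => //= n; exact: test_cD.
set I := \int[leb]_x cabs (iter n (cD (1 : R)) f x).
have I0 : 0 <= I by apply: Rintegral_ge0 => x _; exact: cabs_ge0.
exists (I + 1) => [|theta t1]; first by rewrite ltr_wpDl.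
have t0 : 0 < `|theta| by rewrite (lt_le_trans ltr01).
rewrite ler_pdivlMr ?exprn_gt0//.
have cn (z : R[i]) : cabs (z ^+ n) = cabs z ^+ n.
  by elim: n {tn E I I0} => [|n IH]; rewrite ?expr0 ?cabs1// !exprS cabsM IH.
have ci : cabs ('i * theta%:C) = `|theta|.
  by rewrite cabsM cabs_real /cabs /= expr0n /= expr1n add0r sqrtr1 mul1r.
rewrite mulrC -ci -cn -cabsM -E (@le_trans _ _ I) ?lerDl//.
exact: ftm_bound (test_citg1 tn).
Qed.

(** The fundamental theorem is applied on [-T, -e] and on [e, T] separately, so that [F] may be
    singular or jump at 0, as sign functions, powers of |t| and ln |t| do. *)
Lemma Rint_annulus (F f : R -> R) (e T : R) : 0 < e -> e < T -> measurable_fun setT f ->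
  (forall t, t != 0 -> is_derive t (1 : R) F (f t)) ->
  (forall t, t != 0 -> {for t, continuous f}) ->
  let g t := if e <= `|t| <= T then f t else 0 in
  itg leb g /\ \int[leb]_t g t = F (- e) - F (- T) + (F T - F e).
Proof.
move=> e0 eT mf dF cf g.
have cont a c : a < c -> (0 < a) || (c < 0) -> leb.-integrable `[a, c] (EFin \o f) /\
    \int[leb]_(t in `[a, c]) f t = F c - F a.
  move=> ac a0c.
  have t0 t : a <= t <= c -> t != 0.
    move=> /andP[at1 tc]; case/orP: a0c => h; first by rewrite gt_eqF// (lt_le_trans h).
    by rewrite lt_eqF// (le_lt_trans tc).
  have cF t : a <= t <= c -> {for t, continuous F}.
    move=> /t0 tn; apply: differentiable_continuous; apply/derivable1_diffP.
    by have [] := dF t tn.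
  have cfw : {within `[a, c], continuous f}.
    by apply: continuous_in_subspaceT => t; rewrite inE /= in_itv /= => /t0; exact: cf.
  split; first by apply: continuous_compact_integrable => //; exact: segment_compact.
  rewrite /Rintegral (@continuous_FTC2 _ f F a c ac cfw) //.
  - split.
    + move=> t; rewrite in_itv /= => /andP[/ltW at1 /ltW tc].
      have h : a <= t <= c by rewrite at1 tc.
      by have [] := dF t (t0 t h).
    + by apply: cvg_at_right_filter; apply: cF; rewrite lexx ltW.
    + by apply: cvg_at_left_filter; apply: cF; rewrite lexx ltW.
  - move=> t; rewrite in_itv /= => /andP[/ltW at1 /ltW tc]; rewrite derive1E.
    have h : a <= t <= c by rewrite at1 tc.
    by have [_ ->] := dF t (t0 t h).
have NeT : - T < - e by rewrite ltrN2.
have Ne0 : - e < 0 by rewrite oppr_lt0.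
have [j1 i1] := cont _ _ NeT (introT orP (or_intror Ne0)).
have [j2 i2] := cont _ _ eT (introT orP (or_introl e0)).
have patch a c : leb.-integrable `[a, c] (EFin \o f) -> itg leb (f \_ `[a, c]).
  by move=> jf; rewrite /itg -restrict_EFin; apply/(integrable_mkcond _ _).1.
have gE : g = fun t => (f \_ `[- T, - e]) t + (f \_ `[e, T]) t.
  apply/funext => t; rewrite !patchE /g !mem_setE !in_itv /=.
  rewrite -[point]/(0 : R); have [t0|t0] := ger0P t.
    have -> : (t <= - e) = false by apply/negbTE; rewrite -ltNge (lt_le_trans Ne0).
    by rewrite andbF add0r.
  have -> : (e <= t) = false by apply/negbTE; rewrite -ltNge (lt_trans t0).
  by rewrite /= addr0 lerNl lerNr andbC.
rewrite gE; split; first exact: itgD (patch _ _ j1) (patch _ _ j2).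
have := RintegralD measurableT (patch _ _ j1) (patch _ _ j2).
by rewrite -!Rintegral_mkcond i1 i2.
Qed.

(* The antiderivative F may have a corner at 0. *)
Lemma Rint_derive0_off0 (F f : R -> R) (T : R) : 0 < T ->
  (forall t, T <= `|t| -> F t = 0) -> (forall t, T <= `|t| -> f t = 0) ->
  itg leb f ->
  (forall t, t != 0 -> is_derive t (1 : R) F (f t)) ->
  (forall t, t != 0 -> {for t, continuous f}) ->
  F t @[t --> 0] --> (0 : R) ->
  \int[leb]_t f t = 0.
Proof.
move=> T0 FT fT jf dF cf F0.
(* With n + 2 in the denominator e n < T holds already for n = 0, as [Rint_annulus] requires. *)
pose e (n : nat) : R := T * n.+2%:R^-1.
have e0 n : 0 < e n by rewrite mulr_gt0 ?invr_gt0.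
have eT n : e n < T by rewrite /e gtr_pMr// invf_lt1// ltr1n.
have ecvg : e @ \oo --> (0 : R).
  rewrite /e -(mulr0 T); apply: cvgMr.
  have := @cvg_harmonic R; rewrite -(cvg_shiftS _) /=; exact.
pose fn n t := if e n <= `|t| <= T then f t else 0.
have mf := itg_meas jf.
have mfn n : measurable_fun setT (fn n).
  by have [/itg_meas] := Rint_annulus (e0 n) (eT n) mf dF cf.
have In n : \int[leb]_t fn n t = F (- e n) - F (e n).
  have [_ ->] := Rint_annulus (e0 n) (eT n) mf dF cf.
  have hT : T <= `|T| by exact: ler_norm.
  have hT' : T <= `|- T| by rewrite normrN.
  by rewrite (FT _ hT) (FT _ hT') subr0 sub0r.
(* At t = 0 all truncations vanish, so their pointwise limit is f with its value at 0 replaced by 0,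
   which changes f on a null set only. *)
pose f0 t := if t == 0 then 0 else f t.
have L : (fun n => \int[leb]_t fn n t) @ \oo --> \int[leb]_t f0 t.
  have hb n t : `|fn n t| <= `|f t| by rewrite /fn; case: ifP; rewrite ?normr0.
  suff hc t : fn n t @[n --> \oo] --> f0 t.
    exact: (@Rint_dct _ _ _ leb fn f0 (fun t => `|f t|) mfn hc (itg_norm jf) hb).
  rewrite /f0 /fn; have [->|t0] := eqVneq t 0.
    under eq_fun do rewrite normr0 leNgt e0 /=; exact: cvg_cst.
  have [tT|tT] := leP `|t| T; last by under eq_fun do rewrite andbF; rewrite fT ?ltW//; exact: cvg_cst.
  apply: cvg_near_cst; near=> n.
  have -> // : e n <= `|t|.
  near: n; have := cvgr_le _ ecvg `|t|; apply; by rewrite normr_gt0.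
have L0 : (fun n => \int[leb]_t fn n t) @ \oo --> (0 : R).
  have en : (fun n => - e n) @ \oo --> (0 : R) by rewrite -oppr0; exact: cvgN.
  have c1 : (fun n => F (- e n)) @ \oo --> (0 : R) by apply: (cvg_comp _ _ en F0).
  have c2 : (fun n => F (e n)) @ \oo --> (0 : R) by apply: (cvg_comp _ _ ecvg F0).
  rewrite (_ : (fun n => _) = fun n => F (- e n) - F (e n)); last by apply/funext => n; rewrite In.
  by rewrite -(subr0 (0 : R)); exact: cvgB.
have <- : \int[leb]_t f0 t = \int[leb]_t f t.
  have mf0 : measurable_fun setT f0.
    apply: measurable_fun_ifT; [|exact: measurable_cst|exact: itg_meas jf].
    by apply: measurable_fun_eqr; [exact: measurable_id|exact: measurable_cst].
  have h : {ae leb, forall x, f0 x = fine ((EFin \o f) x)}.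
    exists [set (0 : R)]; split; [exact: measurable_set1|exact: lebesgue_measure_set1|].
    by move=> t /= ht; apply: contrapT => tn; apply: ht; rewrite /f0; case: eqP.
  by rewrite /Rintegral; congr fine; have [_ ->] := Rint_eq_ae h jf mf0.
exact: (cvg_unique _ L L0).
Unshelve. all: by end_near. Qed.

End Fourier1.

(** * Weights on the curve and their Fourier transforms *)

Section WeightFourier.
Context {R : realType}.
Local Notation leb := (@lebesgue_measure R).

Lemma cReZ (a : R) (z : R[i]) : complex.Re (a%:C * z) = a * complex.Re z.
Proof. by rewrite cReM /= mul0r subr0. Qed.
Lemma cImZ (a : R) (z : R[i]) : complex.Im (a%:C * z) = a * complex.Im z.
Proof. by rewrite cImM /= mul0r addr0. Qed.

Lemma is_derive_invR (x : R) : x != 0 -> is_derive x (1 : R) (fun y : R => y^-1) (- x ^- 2).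
Proof.
move=> x0; split; first exact: (derivableV x0 (@derivable_id _ _ x (1 : R))).
by rewrite (deriveV x0 (@derivable_id _ _ x (1 : R))) derive_id /GRing.scale /= mulr1.
Qed.

Definition vanishing (V : zmodType) (T : R) (k : R -> V) := forall t, T <= `|t| -> k t = 0.

(* Away from 0 the weight solves t k' = m - b k with m a test function: b is the exponent for
   the power weight, and b = 0 for the logarithm. This equation alone yields the symbol
   estimates of order b - 1 for the Fourier transform. *)
Record weight (b : R) (k m : R -> R[i]) : Prop := Weight {
  weight_cs : exists2 T, 0 < T & vanishing T k;
  weight_citg : citg leb k;
  weight_test : test_function m;
  weight_re : forall t : R, t != 0 ->
    is_derive t (1 : R) (re_fun k) (t^-1 * (re_fun m t - b * re_fun k t));
  weight_im : forall t : R, t != 0 ->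
    is_derive t (1 : R) (im_fun k) (t^-1 * (im_fun m t - b * im_fun k t));
  weight_lim : t * cabs (k t) @[t --> (0 : R)] --> (0 : R) }.

Lemma itg_dom1 (f g : R -> R) : measurable_fun setT f -> itg leb g ->
  (forall x, `|f x| <= g x) -> itg leb f.
Proof. by move=> mf jg H; exact: (@itg_dom _ (measurableTypeR R) R leb f g mf jg H). Qed.

Lemma itg_meas1 (f : R -> R) : itg leb f -> measurable_fun setT f.
Proof. by move=> jf; exact: (@itg_meas _ (measurableTypeR R) R leb f jf). Qed.

Lemma itg_contM (c k : R -> R) (T : R) : continuous c -> itg leb k -> vanishing T k ->
  itg leb (fun t => c t * k t).
Proof.
move=> cc jk kT; have [M M0 HM] := continuous_bound cc (ball1_compact (A := T)).
apply: (itg_dom1 (g := fun t => M * `|k t|)).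
- apply: measurable_funM; [exact: continuous_measurable_fun|exact: itg_meas1 jk].
- by apply: itgZ; exact: itg_norm.
- move=> t; rewrite normrM; have [tT|tT] := leP T `|t|; first by rewrite kT// normr0 !mulr0.
  by rewrite ler_wpM2r// HM// ball1E ltW.
Qed.

Lemma citg_contM (c : R -> R) (k : R -> R[i]) (T : R) : continuous c -> citg leb k -> vanishing T k ->
  citg leb (fun t => (c t)%:C * k t).
Proof.
move=> cc [j1 j2] kT; split.
  rewrite (_ : re_fun _ = fun t => c t * re_fun k t).
    by apply: (itg_contM (T := T)) => // t tT; rewrite /re_fun kT.
  by apply/funext => t; rewrite /re_fun cReM /= mul0r subr0.
rewrite (_ : im_fun _ = fun t => c t * im_fun k t).
  by apply: (itg_contM (T := T)) => // t tT; rewrite /im_fun kT.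
by apply/funext => t; rewrite /im_fun cImM /= mul0r addr0.
Qed.

(** The integrand is the derivative of t (c1 Re k + c2 Im k), which vanishes at 0 and far out. The
    factor t allows t k' to be replaced by m - b k, so that the singular derivative k' disappears.
    Two coefficients are taken since the real part of a complex multiple of k involves both parts of
    k. *)
Lemma weight_Rint (b : R) k m (c1 c2 c1' c2' : R -> R) : weight b k m ->
  (forall t, is_derive t (1 : R) c1 (c1' t)) -> (forall t, is_derive t (1 : R) c2 (c2' t)) ->
  continuous c1' -> continuous c2' ->
  \int[leb]_t ((t * c1' t + (1 - b) * c1 t) * re_fun k t + c1 t * re_fun m t
     + ((t * c2' t + (1 - b) * c2 t) * im_fun k t + c2 t * im_fun m t)) = 0.
Proof.
move=> [[T0 T00 kT0] [jk1 jk2] tm d1 d2 lim] dc1 dc2 cc1' cc2'.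
have [A A0 mA] := cs_bound tm.2.
pose T := T0 + A + 1.
have kT : vanishing T k by move=> t tT; apply: kT0; apply: le_trans tT; rewrite /T; lra.
have mT : vanishing T m by move=> t tT; apply: mA; apply: lt_le_trans tT; rewrite /T; lra.
have rk : vanishing T (re_fun k) by move=> t /kT; rewrite /re_fun => ->.
have ik : vanishing T (im_fun k) by move=> t /kT; rewrite /im_fun => ->.
have rm : vanishing T (re_fun m) by move=> t /mT; rewrite /re_fun => ->.
have im : vanishing T (im_fun m) by move=> t /mT; rewrite /im_fun => ->.
have cc (c c' : R -> R) : (forall t, is_derive t (1 : R) c (c' t)) -> continuous c.
  move=> dc t; apply: differentiable_continuous; apply/derivable1_diffP.
  by have [] := dc t.
have cc1 := cc _ _ dc1; have cc2 := cc _ _ dc2.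
have cm1 := smooth_cont tm.1.1; have cm2 := smooth_cont tm.1.2.
have ct : continuous (fun t : R => t) by move=> t; exact: cvg_id.
have ccb (c c' : R -> R) : continuous c -> continuous c' ->
    continuous (fun t : R => t * c' t + (1 - b) * c t).
  move=> hc hc' t; apply: cvgD; apply: cvgM; [exact: ct|exact: hc'|exact: cvg_cst|exact: hc].
have [jm1 jm2] := test_citg1 tm.
apply: (@Rint_derive0_off0 _ (fun t => t * (c1 t * re_fun k t + c2 t * im_fun k t)) _ T).
- by rewrite /T; lra.
- by move=> t tT; rewrite rk// ik// !mulr0 addr0 mulr0.
- by move=> t tT; rewrite rk// ik// rm// im// !mulr0 !addr0.
- apply: itgD; apply: itgD; apply: (itg_contM (T := T)) => //; exact: ccb.
- move=> t t0; have h := is_deriveMR (is_derive_idR t) (is_deriveDR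
    (is_deriveMR (dc1 t) (d1 t t0)) (is_deriveMR (dc2 t) (d2 t t0))).
  by apply: (is_derive_eqR h); field.
- have ck (k' : R -> R) t a : is_derive t (1 : R) k' a -> {for t, continuous k'}.
    by move=> [dk _]; apply: differentiable_continuous; apply/derivable1_diffP.
  move=> t t0; have ck1 := ck _ _ _ (d1 t t0); have ck2 := ck _ _ _ (d2 t t0).
  apply: cvgD; apply: cvgD; apply: cvgM => //; try exact: ccb; [exact: cc1|exact: cm1|exact: cc2|exact: cm2].
- have lk (k' : R -> R) : (forall t, `|k' t| <= cabs (k t)) -> t * k' t @[t --> (0 : R)] --> (0 : R).
    move=> hk; apply/cvgr0Pnorm_lt => e e0; have /cvgr0Pnorm_lt/(_ e e0) := lim.
    apply: filterS => t; apply: le_lt_trans; rewrite !normrM ler_wpM2l//.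
    by rewrite (le_trans (hk t))// ler_norm.
  rewrite (_ : (fun t => _) = fun t => c1 t * (t * re_fun k t) + c2 t * (t * im_fun k t)); last first.
    by apply/funext => t; ring.
  rewrite [X in _ --> X](_ : _ = c1 0 * 0 + c2 0 * 0); last by rewrite !mulr0 addr0.
  apply: cvgD; apply: cvgM; [exact: cc1| |exact: cc2|].
    by apply: lk => t; exact: Re_le_cabs.
  by apply: lk => t; exact: Im_le_cabs.
Qed.

(** Multiplication by -i t, which corresponds to d/dtheta on the side of [ftm]. *)
Definition twist_wt (k : R -> R[i]) : R -> R[i] := fun t => t%:C * (- 'i * k t).

Lemma vanishing_tw T k : vanishing T k -> vanishing T (twist_wt k).
Proof. by move=> kT t tT; rewrite /twist_wt kT// !mulr0. Qed.

Lemma citg_tw T k : citg leb k -> vanishing T k -> citg leb (twist_wt k).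
Proof.
move=> jk kT; apply: (citg_contM (T := T)); [by move=> t; exact: cvg_id|exact: citgZ|].
by move=> t tT; rewrite kT// mulr0.
Qed.

(** Euler's equation for the transform: theta d/dtheta k^ = (b - 1) k^ - m^. Up to the rapidly
    decreasing m^ the transform is thus homogeneous of degree b - 1, which is the origin of the
    symbol order. *)
Lemma ftm_ibp b k m theta : weight b k m ->
  theta%:C * ftm (twist_wt k) theta = (b - 1)%:C * ftm k theta - ftm m theta.
Proof.
move=> wk; have [T T0 kT] := weight_cs wk; have jk := weight_citg wk.
have J1 := ftm_citg theta (citg_tw jk kT).
have J2 := ftm_citg theta jk.
have J3 := ftm_citg theta (test_citg1 (weight_test wk)).
have dl t : is_derive t (1 : R) (fun t => - (t * theta)) (- theta).
  have h := is_deriveZR (- theta) (is_derive_idR t).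
  rewrite mulr1 in h; suff -> : (fun t : R => - (t * theta)) = fun t => - theta * t by [].
  by apply/funext => y; rewrite mulrC mulNr.
have dc t : is_derive t (1 : R) (fun t => cos (- (t * theta))) (theta * sin (- (t * theta))).
  have h := is_derive_compR (f := fun t => - (t * theta)) (is_derive_cos (- (t * theta))) (dl t).
  by apply: (is_derive_eqR h); ring.
have ds t : is_derive t (1 : R) (fun t => sin (- (t * theta))) (- (theta * cos (- (t * theta)))).
  have h := is_derive_compR (f := fun t => - (t * theta)) (is_derive_sin (- (t * theta))) (dl t).
  by apply: (is_derive_eqR h); ring.
have dns t : is_derive t (1 : R) (fun t => -1 * sin (- (t * theta))) (theta * cos (- (t * theta))).
  by have h := is_deriveZR (-1) (ds t); apply: (is_derive_eqR h); ring.
have cl : continuous (fun t : R => - (t * theta)).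
  by move=> t; apply: cvgN; apply: cvgM; [exact: cvg_id|exact: cvg_cst].
have ccos : continuous (fun t : R => cos (- (t * theta))).
  by move=> t; apply: continuous_comp; [exact: cl|exact: continuous_cos].
have csin : continuous (fun t : R => sin (- (t * theta))).
  by move=> t; apply: continuous_comp; [exact: cl|exact: continuous_sin].
have ctc (f : R -> R) : continuous f -> continuous (fun t => theta * f t).
  by move=> cf t; apply: cvgM; [exact: cvg_cst|exact: cf].
have ctn (f : R -> R) : continuous f -> continuous (fun t => - f t).
  by move=> cf t; apply: cvgN; exact: cf.
have H : cint leb (fun t => theta%:C * (cis (- (t * theta)) * twist_wt k t)
    + ((1 - b)%:C * (cis (- (t * theta)) * k t) + cis (- (t * theta)) * m t)) = 0.
  apply: complexP => /=.
    rewrite -[RHS](weight_Rint wk dc dns (ctc _ csin) (ctc _ ccos)).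
    apply: eq_Rintegral => t _; rewrite /re_fun /im_fun /twist_wt.
    by rewrite !(cReD, cReM, cImM, cReN, cImN) /=; ring.
  rewrite -[RHS](weight_Rint wk ds dc (ctn _ (ctc _ ccos)) (ctc _ csin)).
  apply: eq_Rintegral => t _; rewrite /re_fun /im_fun /twist_wt.
  by rewrite !(cImD, cReM, cImM, cReN, cImN) /=; ring.
have J12 := citgZ theta%:C J1; have J22 := citgZ (1 - b)%:C J2.
move: H; rewrite (cintD J12 (citgD J22 J3)) (cintD J22 J3) (cintZ _ J1) (cintZ _ J2).
rewrite -!/(ftm _ _) => /eqP; rewrite addr_eq0 => /eqP ->.
by rewrite opprD -mulNr; congr (_ * _ - _); rewrite -rmorphN opprB.
Qed.

Lemma ftm_taylor T k theta : citg leb k -> vanishing T k ->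
  exists C : R, forall eta, cabs (ftm k (eta + theta) - ftm k theta - eta%:C * ftm (twist_wt k) theta)
    <= C * eta ^+ 2.
Proof.
move=> jk kT; have ct : continuous (fun t : R => t) by move=> t; exact: cvg_id.
have ct2 : continuous (fun t : R => t ^+ 2) by move=> t; apply: exprn_continuous.
have j2 : itg leb (fun t => t ^+ 2 * cabs (k t)).
  apply: (itg_contM (T := T) ct2 (citg_cabs jk)) => t /kT ->; exact: cabs0.
exists (2 * \int[leb]_t (t ^+ 2 * cabs (k t))) => eta.
have J1 := ftm_citg theta (citg_tw jk kT).
have J2 := ftm_citg theta jk; have J3 := ftm_citg (eta + theta) jk.
rewrite /ftm -(cintZ _ J1) -(cintB J3 J2) -(cintB (citgB J3 J2) (citgZ _ J1)).
rewrite mulrAC -RintegralZl//.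
apply: cint_norm_le => [||t]; [exact: citgB (citgB J3 J2) (citgZ _ J1)|exact: itgZ|].
rewrite (_ : _ - _ = cis (- (t * theta)) * (cis (- (t * eta)) - 1 - 'i * (- (t * eta))%:C) * k t).
  rewrite !cabsM cabs_cis mul1r mulrA ler_wpM2r ?cabs_ge0//.
  by apply: le_trans (cis_taylor _) _; rewrite sqrrN exprMn; rewrite le_eqVlt; apply/orP; left; apply/eqP; ring.
rewrite mulrDr opprD cisD /twist_wt rmorphN rmorphM /=; ring.
Qed.

(** The constant [c] covers the real part (c = 1), the imaginary part (c = -i) and all derivatives
    together: the functions Re (c k^) form a class to which [smooth_class] applies. *)
Lemma ftm_Re_derive T k (c : R[i]) : citg leb k -> vanishing T k ->
  forall theta, differentiable (fun u => complex.Re (c * ftm k u)) theta /\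
  forall v, 'D_v (fun u => complex.Re (c * ftm k u)) theta = v * complex.Re (c * ftm (twist_wt k) theta).
Proof.
move=> jk kT theta; have [C HC] := ftm_taylor theta jk kT.
set d := complex.Re (c * ftm (twist_wt k) theta).
have al : affine_map (fun v : R => v * d) (fun v => v * d).
  by have := affine_scale d (@affine_id R R); congr affine_map; apply/funext => x; rewrite mulrC.
apply: (diff_quad_affine (C := cabs c * C) al) => eta.
rewrite -mulrBl addrK /d.
have -> : eta * complex.Re (c * ftm (twist_wt k) theta) =
    complex.Re (eta%:C * (c * ftm (twist_wt k) theta)) by rewrite [RHS]cReM /= mul0r subr0.
rewrite -!cReN -!cReD (le_trans (Re_le_cabs _))//.
rewrite (_ : _ + _ - _ = c * (ftm k (eta + theta) - ftm k theta - eta%:C * ftm (twist_wt k) theta)); last by ring.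
by rewrite cabsM -mulrA ler_wpM2l ?cabs_ge0// real_normK ?num_real.
Qed.

Lemma csmooth_ftm T k : citg leb k -> vanishing T k -> csmooth (ftm k).
Proof.
move=> jk kT.
pose S f := exists c k, [/\ citg leb k, vanishing T k & f = fun u => complex.Re (c * ftm k u)].
have HS : forall f, S f -> smooth f.
  apply: smooth_class => _ [c [k' [jk' kT' ->]]].
  have D := ftm_Re_derive c jk' kT'; split=> [x|v]; first by have [] := D x.
  exists (c * v%:C), (twist_wt k'); split; [exact: citg_tw kT'|exact: vanishing_tw|].
  apply/funext => x; have [_ ->] := D x.
  by rewrite mulrAC [_ * v%:C]mulrC [RHS]cReM /= mul0r subr0.
split; apply: HS.
  by exists 1, k; split=> //; apply/funext => x; rewrite mul1r.
exists (- 'i), k; split=> //; apply/funext => x.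
by rewrite cReM cReN cImN /= oppr0 mul0r sub0r mulN1r opprK.
Qed.

Lemma cD_ftm T k v : citg leb k -> vanishing T k ->
  cD v (ftm k) = fun x => v%:C * ftm (twist_wt k) x.
Proof.
move=> jk kT; apply/funext => x; apply: complexP.
  rewrite cReM /= mul0r subr0; have [_ /(_ v)] := ftm_Re_derive 1 jk kT x.
  by rewrite mul1r; under eq_fun do rewrite mul1r.
rewrite cImM /= mul0r addr0; have [_ /(_ v)] := ftm_Re_derive (- 'i) jk kT x.
have E z : complex.Re (- 'i * z) = complex.Im z :> R.
  by rewrite cReM cReN cImN /= oppr0 mul0r sub0r mulN1r opprK.
by rewrite E; under eq_fun do rewrite E.
Qed.

(** Euler's equation is integrated from 1 to |theta|. With p the real part of k^ rotated by a
    unimodular constant, H = u^(1-b) p has a derivative of size at most u^-b |m^| <= C u^-2. Hence H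
    + C/u is nonincreasing on u >= 1, and its value at 1 is at most the L^1 norm of k plus C. *)
Lemma ftm_weight_bound b k m : 0 <= b -> b < 1 -> weight b k m ->
  exists2 C : R, 0 < C & forall theta, 1 <= `|theta| -> cabs (ftm k theta) <= C * `|theta| `^ (b - 1).
Proof.
move=> b0 b1 wk; have [T T0 kT] := weight_cs wk; have jk := weight_citg wk.
have [C C0 HC] := ftm_decay 2 (weight_test wk).
set I := \int[leb]_t cabs (k t).
have I0 : 0 <= I by apply: Rintegral_ge0 => t _; exact: cabs_ge0.
exists (C + I) => [|theta th1]; first by rewrite ltr_pwDl.
set a := `|theta|; have a0 : 0 < a by rewrite (lt_le_trans ltr01).
pose e : R := Num.sg theta.
have thE : theta = e * a by rewrite /e /a -numEsg.
have e1 : `|e| = 1 by rewrite /e normr_sg -normr_gt0 a0.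
have [c c1 cE] := unimodular (ftm k theta).
pose sg := 1 - b.
pose p u := complex.Re (c * ftm k (e * u)).
pose p' u := e * complex.Re (c * ftm (twist_wt k) (e * u)).
have dp u : is_derive u (1 : R) p (p' u).
  have [D1 D2] := ftm_Re_derive c jk kT (e * u).
  apply: (is_derive_scaleM (F := fun v => complex.Re (c * ftm k v))).
  by split; [exact: diff_derivable|rewrite D2 mul1r].
pose H u := expR (sg * ln u) * p u.
have dH (u : R) : 1 <= u -> is_derive u (1 : R) H (- (expR (sg * ln u) / u * complex.Re (c * ftm m (e * u)))).
  move=> u1; have u0 : 0 < u by rewrite (lt_le_trans ltr01).
  have dE := is_derive_compR (f := fun u => sg * ln u) (is_derive_expR (sg * ln u)) (is_deriveZR sg (is_derive1_ln u0)).
  apply: (is_derive_eqR (is_deriveMR dE (dp u))).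
  have E : u * p' u = - (sg * p u) - complex.Re (c * ftm m (e * u)).
    have := ftm_ibp (e * u) wk => /(congr1 (fun z => complex.Re (c * z))).
    rewrite mulrCA cReZ mulrBr cReD cReN [c * (_%:C * _)]mulrCA cReZ.
    by rewrite /p' mulrCA mulrA => ->; rewrite /p /sg; ring.
  have -> : p' u = (- (sg * p u) - complex.Re (c * ftm m (e * u))) / u by rewrite -E mulrAC mulfV ?mul1r ?gt_eqF.
  field; exact: lt0r_neq0.
pose G u := H u + C * u^-1.
have dG (u : R) : 1 <= u -> is_derive u (1 : R) G
    (- (expR (sg * ln u) / u * complex.Re (c * ftm m (e * u))) + C * (- (u ^- 2))).
  move=> u1; have u0 : u != 0 by rewrite gt_eqF// (lt_le_trans ltr01).
  apply: is_deriveDR; first exact: dH.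
  apply: is_deriveZR; have h := is_derive_invR u0.
  exact: (is_derive_eqR h).
have Ga : G a <= G 1.
  have i1 : (1 : R) \in `[1, a] by rewrite in_itv /= lexx th1.
  have i2 : a \in `[1, a] by rewrite in_itv /= lexx th1.
  apply: (@ler0_derive1_le_cc _ G 1 a _ _ _ _ _ i2 i1 th1).
  - by move=> u; rewrite in_itv /= => /andP[/ltW u1 _]; have [] := dG u u1.
  - move=> u; rewrite in_itv /= => /andP[/ltW u1 _]; rewrite derive1E.
    have u0 : 0 < u by rewrite (lt_le_trans ltr01).
    have [_ ->] := dG u u1; rewrite mulrN subr_le0 (le_trans (ler_norm _))// normrN normrM.
    have q1 : `|expR (sg * ln u) / u| <= 1.
      have q0 : 0 <= expR (sg * ln u) / u by rewrite divr_ge0 ?expR_ge0// ltW.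
      rewrite (ger0_norm q0) ler_pdivrMr// mul1r.
      rewrite -[X in _ <= X]lnK ?posrE// ler_expR ler_piMl ?ln_ge0// /sg; lra.
    rewrite (le_trans (ler_wpM2r _ q1))// mul1r (le_trans (Re_le_cabs _))// cabsM c1 mul1r.
    have eu : `|e * u| = u by rewrite normrM e1 mul1r ger0_norm// ltW.
    by have := HC (e * u); rewrite eu; apply.
  - apply: continuous_in_subspaceT => u; rewrite inE /= in_itv /= => /andP[u1 _].
    by apply: differentiable_continuous; apply/derivable1_diffP; have [] := dG u u1.
have {}Ga : H a <= H 1 + C.
  move: Ga; rewrite /G invr1 mulr1; apply: le_trans; by rewrite lerDl divr_ge0 ?(ltW C0) ?(ltW a0).
have H1 : H 1 <= I.
  rewrite /H ln1 mulr0 expR0 mul1r /p (le_trans (ler_norm _))// (le_trans (Re_le_cabs _))//.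
  by rewrite cabsM c1 mul1r; exact: ftm_bound.
have Ha : H a = expR (sg * ln a) * cabs (ftm k theta).
  by rewrite /H /p -thE cE.
rewrite -ler_pdivrMr ?powR_gt0// -powRN opprB.
have -> : a `^ (1 - b) = expR (sg * ln a) by rewrite /powR gt_eqF.
by rewrite mulrC -Ha; apply: le_trans Ga _; rewrite addrC lerD2l.
Qed.

(** The equation persists: t (t k)' = t m - (b - 1) t k. Every derivative of k^ is therefore the
    transform of a weight too, with exponents that become negative. *)
Lemma weight_tw b k m : weight b k m -> weight (b - 1) (twist_wt k) (twist_wt m).
Proof.
move=> [[T T0 kT] jk tm d1 d2 lim].
have rE (f : R -> R[i]) t : complex.Re (twist_wt f t) = t * complex.Im (f t).
  by rewrite /twist_wt cReZ cReM cReN cImN /= oppr0 mul0r sub0r mulN1r opprK.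
have iE (f : R -> R[i]) t : complex.Im (twist_wt f t) = t * - complex.Re (f t).
  by rewrite /twist_wt cImZ cImM cReN cImN /= oppr0 mul0r add0r mulN1r.
have rE' (f : R -> R[i]) : re_fun (twist_wt f) = fun t => t * im_fun f t.
  by apply/funext => t; rewrite /re_fun rE.
have iE' (f : R -> R[i]) : im_fun (twist_wt f) = fun t => t * (-1 * re_fun f t).
  by apply/funext => t; rewrite /im_fun iE mulN1r.
split.
- by exists T => //; exact: vanishing_tw.
- exact: citg_tw kT.
- by apply: testM; [exact: csmooth_real smooth_id|exact: testZ].
- move=> t t0; rewrite !rE'; have h := is_deriveMR (is_derive_idR t) (d2 t t0).
  by apply: (is_derive_eqR h); field.
- move=> t t0; rewrite !iE'; have h := is_deriveMR (is_derive_idR t) (is_deriveZR (-1) (d1 t t0)).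
  by apply: (is_derive_eqR h); field.
- rewrite (_ : (fun t => _) = fun t => `|t| * (t * cabs (k t))); last first.
    apply/funext => t; rewrite /twist_wt !cabsM cabs_real cabsN.
    by rewrite [cabs 'i]/cabs /= expr0n /= add0r expr1n sqrtr1 mul1r mulrCA.
  have -> : (0 : R) = `|(0 : R)| * 0 by rewrite mulr0.
  apply: cvgM; last by rewrite mulr0.
  by rewrite mulr0; exact: (@norm_continuous _ R (0 : R)).
Qed.

Lemma weight_iter b k m j : weight b k m ->
  weight (b - j%:R) (iter j twist_wt k) (iter j twist_wt m).
Proof.
move=> wk; elim: j => [|j IH]; first by rewrite subr0.
rewrite !iterS (_ : b - _ = b - j%:R - 1); first exact: weight_tw.
by rewrite -addn1 natrD; ring.
Qed.

(** For j > 0 the exponent b - j is negative and [ftm_weight_bound] does not apply. Instead Euler's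
    equation at level j is read as a formula for the next derivative, which gains a factor
    1/|theta|. *)
Lemma ftm_iter_bound b k m j : 0 <= b -> b < 1 -> weight b k m ->
  exists2 C : R, 0 < C & forall theta, 1 <= `|theta| ->
    cabs (ftm (iter j twist_wt k) theta) <= C * `|theta| `^ (b - 1 - j%:R).
Proof.
move=> b0 b1 wk; elim: j => [|j [C C0 HC]].
  by rewrite subr0; exact: ftm_weight_bound wk.
have wj := weight_iter j wk.
have [C' C'0 HC'] := ftm_decay j.+1 (weight_test wj).
exists (`|b - j%:R - 1| * C + C') => [|theta th1].
  by rewrite ltr_wpDl// mulr_ge0// ltW.
set a := `|theta| in th1 *; have a0 : 0 < a by rewrite (lt_le_trans ltr01).
have := ftm_ibp theta wj => /(congr1 (@cabs R)); rewrite cabsM cabs_real -/a -iterS => E.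
have -> : b - 1 - j.+1%:R = (b - 1 - j%:R) - 1 by rewrite -addn1 natrD; ring.
rewrite powRD ?(gt_eqF a0) ?implybT// powR_inv1 ?(ltW a0)// mulrA ler_pdivlMr// mulrC E.
rewrite (le_trans (cabsB _ _))// mulrDl lerD//.
  by rewrite cabsM cabs_real -mulrA ler_wpM2l// HC.
rewrite (le_trans (HC' _ th1))// ler_wpM2l ?(ltW C'0)// -powR_invn ?(ltW a0)//.
by rewrite ler_powR// -addn1 natrD; lra.
Qed.

Lemma bracket_ge1 (x : R) : 0 <= x -> 1 <= bracket x.
Proof. by move=> x0; rewrite /bracket -{1}(sqrtr1 R) ler_wsqrtr// lerDl. Qed.

Lemma ler_powR_neg (s x y : R) : s <= 0 -> 0 < x -> x <= y -> y `^ s <= x `^ s.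
Proof.
move=> s0 x0 xy; rewrite -[s]opprK powRN [leRHS]powRN lef_pV2 ?posrE ?powR_gt0//.
  by rewrite ge0_ler_powR ?oppr_ge0// nnegrE ltW// (lt_le_trans x0).
exact: lt_le_trans xy.
Qed.

(** For |theta| <= 1 the L^1 norm is a bound. The bracket is at most 2 max(1, |theta|), and a
    negative power of this inequality costs the factor 2^(-s). *)
Lemma ftm_symbol b k m j : 0 <= b -> b < 1 -> weight b k m ->
  exists2 C : R, 0 < C & forall theta,
    cabs (ftm (iter j twist_wt k) theta) <= C * bracket (theta ^+ 2) `^ (b - 1 - j%:R).
Proof.
move=> b0 b1 wk; have [C C0 HC] := ftm_iter_bound j b0 b1 wk.
set s := b - 1 - j%:R; have s0 : s <= 0 by have := ler0n R j; rewrite /s; lra.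
set I := \int[leb]_t cabs (iter j twist_wt k t).
have I0 : 0 <= I by apply: Rintegral_ge0 => t _; exact: cabs_ge0.
exists ((C + I) * 2 `^ (- s)) => [|theta].
  by rewrite mulr_gt0 ?powR_gt0// ltr_pwDl.
set a := Num.max 1 `|theta|.
have a1 : 1 <= a by rewrite le_max lexx.
have a0 : 0 < a by rewrite (lt_le_trans ltr01).
have br1 := bracket_ge1 (sqr_ge0 theta).
have br0 : 0 < bracket (theta ^+ 2) by rewrite (lt_le_trans ltr01).
have ba : bracket (theta ^+ 2) <= 2 * a.
  rewrite -[2 * a]ger0_norm ?mulr_ge0 ?(ltW a0)// -sqrtr_sqr ler_wsqrtr//.
  have ta : theta ^+ 2 <= a ^+ 2 by rewrite -[leLHS]real_normK ?num_real// lerXn2r ?nnegrE ?(ltW a0)// le_max lexx orbT.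
  have a2 : 1 <= a ^+ 2 by rewrite exprn_ege1.
  rewrite exprMn; lra.
have h : cabs (ftm (iter j twist_wt k) theta) <= (C + I) * a `^ s.
  rewrite /a; have [t1|t1] := leP `|theta| 1.
    by rewrite powR1 mulr1 (le_trans (ftm_bound _ (weight_citg (weight_iter j wk))))// lerDr ltW.
  rewrite (le_trans (HC _ (ltW t1)))// ler_wpM2r ?powR_ge0// lerDl//.
apply: le_trans h _; rewrite -mulrA ler_wpM2l//; first by rewrite addr_ge0// ltW.
have h2 : (2 * a) `^ s <= bracket (theta ^+ 2) `^ s by exact: ler_powR_neg.
rewrite powRN ler_pdivlMl ?powR_gt0// -powRM ?(ltW a0)//.
Qed.

End WeightFourier.

Section Fatou.
Context d (T : measurableType d) (R : realType).
Variable mu : {measure set T -> \bar R}.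

Lemma itg_fatou (f_ : nat -> T -> R) (f : T -> R) (C : R) :
  (forall n, itg mu (f_ n)) -> (forall n x, 0 <= f_ n x) ->
  (forall x, f_ ^~ x @ \oo --> f x) -> (forall n, \int[mu]_x f_ n x <= C) ->
  itg mu f /\ \int[mu]_x f x <= C.
Proof.
move=> jf f0 ff fC.
have mf n := itg_meas (jf n).
have m : measurable_fun setT f by apply: (measurable_fun_cvg mf) => x _; exact: ff.
have fx0 x : 0 <= f x.
  by rewrite -(cvg_lim (@Rhausdorff R) (ff x)); apply: limr_ge; [exact: cvgP (ff x)|apply: nearW => n; exact: f0].
have L : (\int[mu]_x (f x)%:E <= C%:E)%E.
  have E x : (f x)%:E = limn_einf (fun n => (f_ n x)%:E).
    have c : (EFin \o f_ ^~ x) @ \oo --> (f x)%:E by apply: cvg_EFin; [exact: nearW|exact: ff].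
    by have [-> _] := cvg_limn_einf_sup c.
  under eq_integral do rewrite E.
  have := @fatou _ T R mu setT measurableT (fun n => EFin \o f_ n).
  move=> /(_ (fun n => (measurable_EFinP _ _).2 (mf n))) h.
  apply: (le_trans (h _)); first by move=> n x _; rewrite lee_fin.
  rewrite limn_einf_lim; apply: lime_le; first exact: is_cvg_einfs.
  apply: nearW => n; apply: (@le_trans _ _ (\int[mu]_x (f_ n x)%:E)%E).
    by apply: ereal_inf_lbound; exists n => //=.
  by rewrite -(fineK (integrable_fin_num measurableT (jf n))) lee_fin; exact: fC.
have jF : itg mu f.
  apply/integrableP; split; first exact/measurable_EFinP.
  under eq_integral do rewrite /= ger0_norm//.
  by apply: le_lt_trans L _; rewrite ltry.
split=> //; rewrite -lee_fin /Rintegral fineK//; exact: integrable_fin_num.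
Qed.

End Fatou.

(** * The power weight and the logarithmic weight *)

Section Weights.
Context {R : realType}.
Local Notation leb := (@lebesgue_measure R).

Lemma is_derive_lnabs (t : R) : t != 0 -> is_derive t (1 : R) (fun t : R => ln `|t|) t^-1.
Proof.
move=> tn; have [t0|t0] := ltP 0 t.
  apply: (near_eq_is_derive _ (is_derive1_ln t0)).
  by near=> y; rewrite gtr0_norm//; near: y; exact: lt_nbhsr.
have {}t0 : t < 0 by rewrite lt_neqAle tn.
have Nt0 : 0 < - t by rewrite oppr_gt0.
have h := is_derive_compR (f := fun y : R => -1 * y) (F := @ln R) (x := t).
rewrite mulN1r in h; have {}h := h _ _ (is_derive1_ln Nt0) (is_deriveZR (-1) (is_derive_idR t)).
apply: (near_eq_is_derive _ (is_derive_eqR h _)).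
  near=> y; rewrite mulN1r ltr0_norm//; near: y; exact: lt_nbhsl.
by rewrite mulr1 invrN mulrN1 opprK.
Unshelve. all: by end_near. Qed.

Lemma is_derive_powabs (b t : R) : t != 0 ->
  is_derive t (1 : R) (fun t : R => `|t| `^ b) (t^-1 * (b * `|t| `^ b)).
Proof.
move=> tn.
have h := is_derive_compR (f := fun y : R => b * ln `|y|) (is_derive_expR (b * ln `|t|))
   (is_deriveZR b (is_derive_lnabs tn)).
have E (y : R) : y != 0 -> expR (b * ln `|y|) = `|y| `^ b by move=> y0; rewrite /powR normr_eq0 (negPf y0).
apply: (near_eq_is_derive _ (is_derive_eqR h _)).
  by near=> y; rewrite E//; near: y; apply: open_nbhs_nbhs; split; [exact: open_neq|].
by rewrite E// mulrC; ring.
Unshelve. all: by end_near. Qed.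

Lemma is_derive_cont (f : R -> R) (t a : R) : is_derive t (1 : R) f a -> {for t, continuous f}.
Proof. by move=> [df _]; apply: differentiable_continuous; apply/derivable1_diffP. Qed.

Lemma measurable_powabs (b : R) : measurable_fun setT (fun t : R => `|t| `^ b).
Proof. exact: (measurableT_comp (measurable_powR b) (@normr_measurable R setT)). Qed.

Lemma itg_powabs (b r : R) : b != 0 -> b < 1 -> 0 < r ->
  itg leb (fun t => box r t * `|t| `^ (- b)) /\
  \int[leb]_t (box r t * `|t| `^ (- b)) <= 2 * r `^ (1 - b) / (1 - b).
Proof.
move=> bn b1 r0; have b10 : 0 < 1 - b by rewrite subr_gt0.
pose F t := (1 - b)^-1 * (t * `|t| `^ (- b)).
have dF (t : R) : t != 0 -> is_derive t (1 : R) F (`|t| `^ (- b)).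
  move=> t0; have h := is_deriveZR (1 - b)^-1 (is_deriveMR (is_derive_idR t) (is_derive_powabs (- b) t0)).
  by apply: (is_derive_eqR h); field; rewrite t0 gt_eqF.
have cf (t : R) : t != 0 -> {for t, continuous (fun t : R => `|t| `^ (- b))}.
  by move=> /(is_derive_powabs (- b)) /is_derive_cont.
pose e (n : nat) : R := r * n.+2%:R^-1.
have e0 n : 0 < e n by rewrite mulr_gt0 ?invr_gt0.
have eT n : e n < r by rewrite /e gtr_pMr// invf_lt1// ltr1n.
have ecvg : e @ \oo --> (0 : R).
  rewrite /e -(mulr0 r); apply: cvgMr.
  have := @cvg_harmonic R; rewrite -(cvg_shiftS _) /=; exact.
pose fn (n : nat) (t : R) : R := if e n <= `|t| <= r then `|t| `^ (- b) else 0.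
have H n := Rint_annulus (e0 n) (eT n) (measurable_powabs (- b)) dF cf.
apply: (@itg_fatou _ _ _ leb fn).
- by move=> n; have [] := H n.
- by move=> n x; rewrite /fn; case: ifP => _ //; exact: powR_ge0.
- move=> t; rewrite /fn boxE; have [->|t0] := eqVneq t 0.
    (* At t = 0 the truncations vanish, and so does the limit, because 0 to a nonzero power is 0 by
       convention; hence the condition that b is not 0. *)
    rewrite normr0 powR0 ?oppr_eq0// mulr0; under eq_fun do rewrite if_same; exact: cvg_cst.
  have [tr|tr] := leP `|t| r; last by under eq_fun do rewrite andbF; rewrite mul0r; exact: cvg_cst.
  rewrite mul1r; apply: cvg_near_cst; near=> n.
  have -> // : e n <= `|t|.
  by near: n; have := cvgr_le _ ecvg `|t|; apply; rewrite normr_gt0.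
- move=> n; have [_ ->] := H n.
  have FN t : F (- t) = - F t by rewrite /F normrN mulNr mulrN.
  have F0 : 0 <= F (e n) by rewrite /F mulr_ge0 ?invr_ge0 ?(ltW b10)// mulr_ge0 ?powR_ge0 ?ltW.
  have Fr : F r = r `^ (1 - b) / (1 - b).
    by rewrite /F (gtr0_norm r0) powRD ?(gt_eqF r0) ?implybT// powRr1 ?(ltW r0)// mulrC.
  by rewrite !FN -mulrA -Fr; lra.
Unshelve. all: by end_near. Qed.

(** Polynomials in 1/t and g. If t g' = c - b g, derivatives off 0 stay in this algebra, for powers
    of |t| and for ln |t| alike. *)
Inductive sing_alg (g : R -> R) : (R -> R) -> Prop :=
| sing_cst c : sing_alg g (fun=> c)
| sing_inv : sing_alg g (fun t => t^-1)
| sing_gen : sing_alg g g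
| sing_add f h : sing_alg g f -> sing_alg g h -> sing_alg g (fun t => f t + h t)
| sing_mul f h : sing_alg g f -> sing_alg g h -> sing_alg g (fun t => f t * h t).

Lemma sing_alg_D (g : R -> R) (b c : R) :
  (forall t : R, t != 0 -> is_derive t (1 : R) g (t^-1 * (c - b * g t))) ->
  forall h, sing_alg g h -> exists2 h', sing_alg g h' &
    forall t : R, t != 0 -> is_derive t (1 : R) h (h' t).
Proof.
move=> dg h; elim => {h}.
- by move=> a; exists (fun=> 0); [exact: sing_cst|move=> t _; exact: is_derive_cst].
- exists (fun t => -1 * (t^-1 * t^-1)).
    by apply: sing_mul; [exact: sing_cst|apply: sing_mul; exact: sing_inv].
  move=> t t0; apply: (is_derive_eqR (is_derive_invR t0)).
  by rewrite mulN1r expr2 invfM.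
- exists (fun t => t^-1 * (c + - b * g t)); last by move=> t t0; rewrite mulNr; exact: dg.
  apply: sing_mul; first exact: sing_inv.
  apply: sing_add; first exact: sing_cst.
  by apply: sing_mul; [exact: sing_cst|exact: sing_gen].
- move=> f h _ [f' sf df] _ [h' sh dh]; exists (fun t => f' t + h' t); first exact: sing_add.
  by move=> t t0; apply: is_deriveDR; [exact: df|exact: dh].
- move=> f h sf0 [f' sf df] sh0 [h' sh dh]; exists (fun t => f t * h' t + f' t * h t).
    by apply: sing_add; exact: sing_mul.
  by move=> t t0; apply: is_deriveMR; [exact: df|exact: dh].
Qed.

Lemma is_derive_smooth (u : R -> R) (t : R) : smooth u -> is_derive t (1 : R) u ('D_1 u t).
Proof. by move=> su; split=> //; apply: diff_derivable; exact: smooth_diff. Qed.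

Lemma near_norm_lt (t r : R) : `|t| < r -> \forall y \near t, `|y| < r.
Proof.
move=> tr; have r0 : 0 < r - `|t| by rewrite subr_gt0.
near=> y; rewrite -(subrK t y) (le_lt_trans (ler_normD _ _))// -ltrBrDr distrC.
near: y; exact: (@cvgr_dist_lt _ _ _ (nbhs t) _ id t cvg_id _ r0).
Unshelve. all: by end_near. Qed.

(** The factor [u] vanishes near 0, where [h] is singular. The derivative u h' + u' h is a sum of
    two products of the same kind, so the algebra argument of [palg_smooth] applies. *)
Lemma smooth_sing (g u h : R -> R) (b c r : R) : 0 < r ->
  (forall t : R, t != 0 -> is_derive t (1 : R) g (t^-1 * (c - b * g t))) ->
  smooth u -> (forall t, `|t| < r -> u t = 0) -> sing_alg g h -> smooth (fun t => u t * h t).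
Proof.
move=> r0 dg su ur sh.
have near0 (t : R) := @near_norm_lt t r.
pose A (f : R -> R) := exists u h : R -> R, [/\ smooth u, (forall t, `|t| < r -> u t = 0), sing_alg g h & f = fun t => u t * h t].
suff : forall f, palg A f -> smooth f by apply; apply: palg_gen; exists u, h.
apply: palg_smooth => {h sh su ur u} _ [u [h [su ur sh ->]]].
have [h' sh' dh] := sing_alg_D dg sh.
have Du (t : R) : `|t| < r -> 'D_1 u t = 0.
  move=> tr; have d0 : is_derive t (1 : R) u 0.
    apply: (near_eq_is_derive _ (is_derive_cst (0 : R) t (1 : R))).
    by near=> y; rewrite ur//; near: y; exact: near0.
  by have [_ ->] := d0.
have df (t : R) : is_derive t (1 : R) (fun t => u t * h t) (u t * h' t + 'D_1 u t * h t).
  have [tr|tr] := ltP `|t| r.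
    rewrite ur// Du// !mul0r addr0.
    apply: (near_eq_is_derive _ (is_derive_cst (0 : R) t (1 : R))).
    by near=> y; rewrite ur ?mul0r//; near: y; exact: near0.
  apply: is_deriveMR; first exact: is_derive_smooth.
  by apply: dh; rewrite -normr_gt0 (lt_le_trans r0).
have dd (t : R) : differentiable (fun t => u t * h t) t.
  by apply/derivable1_diffP; have [] := df t.
split=> // v.
rewrite (_ : 'D_v _ = (fun t => u t * (v * h' t)) + (fun t => v * 'D_1 u t * h t)).
  apply: palg_add; apply: palg_gen.
    by exists u, (fun t => v * h' t); split=> //; apply: sing_mul => //; exact: sing_cst.
  exists (fun t => v * 'D_1 u t), h; split=> //.
    by apply: smoothZ; exact: smooth_D.
  by move=> t tr; rewrite Du ?mulr0.
apply/funext => t; rewrite derive_scale//; have [_ ->] := df t.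
by rewrite !fctE; ring.
Unshelve. all: by end_near. Qed.

Lemma cvg_powabs0 (p : R) : 0 < p -> `|t| `^ p @[t --> (0 : R)] --> (0 : R).
Proof.
move=> p0; apply/cvgr0Pnorm_lt => e e0.
have h : \forall t \near (0 : R), `|t| < e `^ p^-1.
  by apply: (@cvgr0_norm_lt R R R (nbhs (0 : R)) _ id cvg_id); rewrite powR_gt0.
apply: filterS h => t te; rewrite ger0_norm ?powR_ge0//.
have := gt0_ltr_powR p0 _ _ te; rewrite !nnegrE normr_ge0 powR_ge0 => /(_ isT isT).
by rewrite -powRrM mulVf ?gt_eqF// powRr1 ?ltW.
Qed.

Definition sing_weight (chi : R -> R[i]) (g : R -> R) : R -> R[i] := fun t => chi t * (g t)%:C.

(** For k = chi g the right side is m = t k' + b k = t g chi' + c chi, smooth because chi' vanishes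
    near 0. The growth exponent b' is separate from the exponent b of the equation: the logarithm
    has b = 0, but is bounded near 0 only by a negative power of |t|. *)
Lemma sing_weightP (chi : R -> R[i]) (g : R -> R) (b c b' C : R) :
  test_function chi -> (forall t : R, `|t| <= 2^-1 -> chi t = 1) ->
  (forall t : R, t != 0 -> is_derive t (1 : R) g (t^-1 * (c - b * g t))) ->
  measurable_fun setT g -> 0 < b' -> b' < 1 ->
  (forall t, `|g t| <= C * (1 + `|t|) * `|t| `^ (- b')) ->
  exists m, weight b (sing_weight chi g) m.
Proof.
move=> tc chi1 dg mg b'0 b'1 gC; have [A A0 cA] := cs_bound tc.2.
have [M M0 cM] := test_bound tc.
have tD := test_cD (1 : R) tc; have [A' A'0 cA'] := cs_bound tD.2.
have nb t : 0 <= `|t| `^ (- b') :> R by exact: powR_ge0.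
have C0 : 0 <= C.
  have := le_trans (normr_ge0 _) (gC 1); rewrite normr1 powR1 mulr1 pmulr_lge0//; lra.
have kb t : cabs (sing_weight chi g t) <= M * C * (1 + A) * (box A t * `|t| `^ (- b')).
  rewrite /sing_weight cabsM cabs_real boxE; have [tA|tA] := leP `|t| A; last first.
    by rewrite cA// cabs0 !mul0r mulr0.
  rewrite mul1r -!mulrA ler_pM ?cabs_ge0// (le_trans (gC t))// -mulrA ler_wpM2l//.
  by rewrite ler_wpM2r// lerD2l.
exists (fun t => (t * g t)%:C * cD (1 : R) chi t + c%:C * chi t).
have rk : re_fun (sing_weight chi g) = fun t => re_fun chi t * g t.
  by apply/funext => t; rewrite /re_fun /sing_weight cReM /= mulr0 subr0.
have ik : im_fun (sing_weight chi g) = fun t => im_fun chi t * g t.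
  by apply/funext => t; rewrite /im_fun /sing_weight cImM /= mulr0 add0r.
have rm t : complex.Re ((t * g t)%:C * cD (1 : R) chi t + c%:C * chi t) =
    t * 'D_1 (re_fun chi) t * g t + c * re_fun chi t.
  by rewrite cReD !cReZ /=; ring.
have im t : complex.Im ((t * g t)%:C * cD (1 : R) chi t + c%:C * chi t) =
    t * 'D_1 (im_fun chi) t * g t + c * im_fun chi t.
  by rewrite cImD !cImZ /=; ring.
have D0 (f : R -> R) (a : R) : smooth f -> (forall t : R, `|t| <= 2^-1 -> f t = a) ->
    forall t : R, `|t| < 2^-1 -> 'D_1 f t = 0.
  move=> sf fa t t2; have d0 : is_derive t (1 : R) f 0.
    apply: (near_eq_is_derive _ (is_derive_cst a t (1 : R))).
    near=> y; rewrite fa//; apply: ltW; near: y.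
    exact: near_norm_lt.
  by have [_ ->] := d0.
have sm (f : R -> R) (a : R) : smooth f -> (forall t : R, `|t| <= 2^-1 -> f t = a) ->
    smooth (fun t : R => t * 'D_1 f t * g t + c * f t).
  move=> sf fa; apply: smoothD; last exact: smoothZ.
  apply: (smooth_sing (r := 2^-1) _ dg); rewrite ?invr_gt0//.
  - by apply: smoothM; [exact: smooth_id|exact: smooth_D].
  - by move=> t t2; rewrite (D0 f a)// mulr0.
  - exact: sing_gen.
split.
- exists (A + 1); first by rewrite ltr_wpDl// ltW.
  by move=> t tA; rewrite /sing_weight cA ?mul0r// (lt_le_trans _ tA)// ltrDl.
- apply: (citg_dom1 _ (itgZ _ (itg_powabs _ b'1 A0).1) kb); last by rewrite gt_eqF.
  by apply: cmeasM; [exact: csmooth_cmeas1 tc.1|exact: cmeas_real].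
- split; last first.
    apply: (cs_ball1 (A := Num.max A A')) => t; rewrite gt_max => /andP[h1 h2].
    by rewrite cA// cA'// !mulr0 addr0.
  split.
    rewrite (_ : re_fun _ = fun t => t * 'D_1 (re_fun chi) t * g t + c * re_fun chi t); last by apply/funext => t; exact: rm.
    by apply: (sm _ 1 tc.1.1) => t t2; rewrite /re_fun chi1.
  rewrite (_ : im_fun _ = fun t => t * 'D_1 (im_fun chi) t * g t + c * im_fun chi t); last by apply/funext => t; exact: im.
  by apply: (sm _ 0 tc.1.2) => t t2; rewrite /im_fun chi1.
- move=> t t0; rewrite rk /re_fun rm.
  have h := is_deriveMR (is_derive_smooth t tc.1.1) (dg t t0).
  by apply: (is_derive_eqR h); rewrite /re_fun; field.
- move=> t t0; rewrite ik /im_fun im.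
  have h := is_deriveMR (is_derive_smooth t tc.1.2) (dg t t0).
  by apply: (is_derive_eqR h); rewrite /im_fun; field.
- apply/cvgr0Pnorm_lt => e e0.
  set C' := M * C * (1 + A) + 1.
  have C'0 : 0 < C' by rewrite ltr_wpDl// mulr_ge0 ?mulr_ge0 ?addr_ge0 ?(ltW M0) ?(ltW A0).
  have eC : 0 < e / C' by rewrite divr_gt0.
  have b1 : 0 < 1 - b' by rewrite subr_gt0.
  have /cvgr0Pnorm_lt/(_ _ eC) := cvg_powabs0 b1.
  apply: filterS => t; rewrite ger0_norm ?powR_ge0// ltr_pdivlMr// => te.
  have [->|t0] := eqVneq t 0; first by rewrite mul0r normr0.
  apply: le_lt_trans te; rewrite normrM (ger0_norm (cabs_ge0 _)).
  have nt : 0 < `|t| by rewrite normr_gt0.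
  rewrite powRD ?(gt_eqF nt) ?implybT// powRr1 ?(ltW nt)// -mulrA ler_wpM2l//.
  rewrite (le_trans (kb t))// mulrC ler_pM//.
  + by rewrite mulr_ge0 ?box_ge0.
  + by rewrite mulr_ge0 ?mulr_ge0 ?addr_ge0 ?(ltW M0) ?(ltW A0).
  + by rewrite boxE; case: ifP; rewrite ?mul1r ?mul0r.
  + by rewrite /C' lerDl.
Unshelve. all: by end_near. Qed.

End Weights.

(** * The operator as a paired Lagrangian distribution *)

Section CubicShear.
Context {R : realType} {U W : normedModType R}.
Variables (P : W -> U) (L : W -> U) (s : W -> R) (Ls : W -> R) (e : U).
Hypotheses (aP : affine_map P L) (as_ : affine_map s Ls).
Let Phi w := P w + (- s w ^+ 3) *: e.

Lemma derive_cubic (f : U -> R) (v w : W) : smooth f ->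
  differentiable (fun w => f (Phi w)) w /\
  'D_v (fun w => f (Phi w)) w = 'D_(L v) f (Phi w) + (- (3 * s w ^+ 2 * Ls v)) * 'D_e f (Phi w).
Proof.
move=> sf; have [dP eP] := aP w; have [ds es] := as_ w.
have sq : smooth (fun y : R => - y ^+ 3) by apply: smoothN; apply: smoothX; exact: smooth_id.
have dq : is_derive (s w) (1 : R) (fun y : R => - y ^+ 3) (- (3 * s w ^+ 2)).
  have h := is_deriveMR (is_derive_idR (s w)) (is_deriveMR (is_derive_idR (s w)) (is_derive_idR (s w))).
  have h2 := is_deriveZR (-1) h.
  rewrite (_ : (fun y => _) = fun y => -1 * (y * (y * y))); last first.
    by apply/funext => y; rewrite mulN1r !exprS expr0 mulr1.
  by apply: (is_derive_eqR h2); ring.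
have dc : differentiable (fun w => - s w ^+ 3) w.
  exact: (differentiable_comp ds (smooth_diff sq (s w))).
have ec : 'd (fun w => - s w ^+ 3) w v = - (3 * s w ^+ 2 * Ls v).
  rewrite -deriveE//; have := derive_comp v ds (smooth_diff sq (s w)).
  rewrite es derive_scale; last exact: (smooth_diff sq).
  by have [_ ->] := dq; rewrite /comp => ->; ring.
have dce : differentiable (fun w => (- s w ^+ 3) *: e) w by exact: differentiableZl.
have dPhi : differentiable Phi w by exact: (differentiableD dP dce).
have df := smooth_diff sf (Phi w).
split; first exact: (differentiable_comp dPhi df).
have -> : 'D_v (fun w => f (Phi w)) w = 'D_('d Phi w v) f (Phi w) by exact: (derive_comp v dPhi df).
have -> : 'd Phi w v = L v + (- (3 * s w ^+ 2 * Ls v)) *: e.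
  have -> : 'd Phi w v = 'd P w v + 'd (fun w => (- s w ^+ 3) *: e) w v.
    by rewrite -[Phi]/(P + (fun w => (- s w ^+ 3) *: e)) (diffD dP dce).
  by rewrite eP (diffZl _ dc) /= ec.
by rewrite !(deriveE _ df) linearD linearZ.
Qed.

(** A derivative of f o Phi is a sum of terms g o Phi, with g a derivative of f, times polynomials
    in s. The algebra generated by smooth functions and by such pull-backs is therefore closed under
    derivatives. *)
Lemma smooth_cubic (f : U -> R) : smooth f -> smooth (fun w => f (Phi w)).
Proof.
move=> sf; pose A (g : W -> R) := smooth g \/ exists2 f, smooth f & g = fun w => f (Phi w).
suff : forall g, palg A g -> smooth g by apply; apply: palg_gen; right; exists f.
apply: palg_smooth => {f sf} g [sg|[f sf ->]].
  split; first exact: smooth_diff.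
  by move=> v; apply: palg_gen; left; exact: smooth_D.
split=> [w|v]; first by have [] := derive_cubic 0 w sf.
have ss : smooth (fun w => - (3 * s w ^+ 2 * Ls v)).
  apply: (smooth_affine as_ (f := fun y : R => - (3 * y ^+ 2 * Ls v))).
  apply: smoothN; apply: smoothM; last exact: smooth_cst.
  by apply: smoothZ; apply: smoothX; exact: smooth_id.
rewrite (_ : 'D_v _ = (fun w => 'D_(L v) f (Phi w)) +
    (fun w => - (3 * s w ^+ 2 * Ls v)) * (fun w => 'D_e f (Phi w))).
  apply: palg_add; first by apply: palg_gen; right; exists ('D_(L v) f) => //; exact: smooth_D.
  apply: palg_mul; apply: palg_gen; first by left.
  by right; exists ('D_e f) => //; exact: smooth_D.
by apply/funext => w; have [_ ->] := derive_cubic v w sf.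
Qed.

Lemma csmooth_cubic (f : U -> R[i]) : csmooth f -> csmooth (fun w => f (Phi w)).
Proof. by move=> [a b]; split; [exact: (smooth_cubic a)|exact: (smooth_cubic b)]. Qed.

End CubicShear.

Section Shear4.
Context {R : realType}.
Local Notation leb := (@lebesgue_measure R).
Local Notation l2 := (@lebesgue_measure R \x @lebesgue_measure R)%E.
Local Notation R2 := (R * R)%type.
Local Notation e1 := ((1, 0) : R2).
Local Notation e2 := ((0, 1) : R2).

(** Coordinates w for the point y as seen from x: the phase becomes w . theta and the curve through
    x becomes w = (t, 0). *)
Definition curve_pt (x : R2) (w : R2) : R2 := (x.1 - w.1, x.2 - w.2 - w.1 ^+ 3).
Definition sh4 (psi : R2 * R2 -> R[i]) (w : R2 * R2) : R[i] := psi (w.1, curve_pt w.1 w.2).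

Lemma test_sh4 psi : test_function psi -> test_function (sh4 psi).
Proof.
move=> [sp cp].
have a1 := @affine_fst R R2 R2; have a2 := @affine_snd R R2 R2.
have a11 := affine_comp (@affine_fst R R R) a1; have a12 := affine_comp (@affine_snd R R R) a1.
have a21 := affine_comp (@affine_fst R R R) a2; have a22 := affine_comp (@affine_snd R R R) a2.
have aP := affine_pair a1 (affine_pair (affine_add a11 (affine_opp a21)) (affine_add a12 (affine_opp a22))).
split.
  have := csmooth_cubic ((0, (0, 1)) : R2 * R2) aP a21 sp.
  congr csmooth; apply/funext => w; rewrite /sh4 /curve_pt.
  congr psi; transitivity ((w.1 + (- w.2.1 ^+ 3) *: (0 : R2), (w.1.1 - w.2.1 + (- w.2.1 ^+ 3) *: (0 : R),
    w.1.2 - w.2.2 + (- w.2.1 ^+ 3) *: (1 : R))) : R2 * R2) => //.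
  by rewrite !scaler0 !addr0 /GRing.scale /= mulr1.
have [A A0 HA] := cs_bound cp.
apply: (cs_ball4 (A := 2 * A + (2 * A) ^+ 3)) => w wA; rewrite /sh4.
apply: contraTeq wA => nz; rewrite -leNgt.
have : `|(w.1, curve_pt w.1 w.2)| <= A by rewrite leNgt; apply: contraNN nz => /HA /eqP.
rewrite !prod_normE /= !ge_max /curve_pt /= => /andP[/andP[h1 h2] /andP[h3 h4]].
have A3 : 0 <= (2 * A) ^+ 3 by rewrite exprn_ge0// mulr_ge0// ltW.
have s2 : `|w.2.1| <= 2 * A.
  by move: h1 h3; rewrite !ler_norml => /andP[? ?] /andP[? ?]; apply/andP; split; lra.
have s3 : `|w.2.1 ^+ 3| <= (2 * A) ^+ 3 by rewrite normrX lerXn2r// nnegrE// (le_trans _ s2).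
rewrite (le_trans h1) ?(le_trans h2) ?(le_trans s2) /= ?lerDl//; last 2 first.
- by rewrite (le_trans _ (_ : 2 * A <= _)) ?lerDl// ler_peMl ?ler1n// ltW.
- by rewrite (le_trans _ (_ : 2 * A <= _)) ?lerDl// ler_peMl ?ler1n// ltW.
move: s3 h2 h4; rewrite !ler_norml => /andP[? ?] /andP[? ?] /andP[? ?]; apply/andP; split; lra.
Qed.

Definition slice4 (F : R2 * R2 -> R[i]) (x : R2) : R2 -> R[i] := fun w => F (x, w).

Lemma affine_slice4 (x : R2) : affine_map (fun w : R2 => (x, w)) (fun w => (0 : R2, w)).
Proof. exact: (affine_pair (affine_cst (U := R2) x) (@affine_id R R2)). Qed.

Lemma test_slice4 F x : test_function F -> test_function (slice4 F x).
Proof.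
move=> [sF cF]; split; first exact: csmooth_affine (affine_slice4 x) sF.
have [A A0 HA] := cs_bound cF; apply: (cs_ball2 (A := A)) => w wA.
by apply: HA; rewrite prod_normE lt_max wA orbT.
Qed.

Lemma lap_slice4 F x n (v1 v2 : R2) : test_function F ->
  iter n (lap v1 v2) (slice4 F x) = slice4 (iter n (lap ((0, v1) : R2 * R2) (0, v2)) F) x.
Proof.
move=> tF; elim: n => [//|n IH]; rewrite !iterS IH.
set G := iter n _ F; have [sG _] : test_function G by exact: test_iter_lap.
have E (v : R2) (H : R2 * R2 -> R[i]) : csmooth H -> cD v (slice4 H x) = slice4 (cD ((0, v) : R2 * R2) H) x.
  by move=> sH; exact: (cD_affine v (affine_slice4 x) sH).
have s1 := csmooth_cD ((0, v1) : R2 * R2) sG; have s2 := csmooth_cD ((0, v2) : R2 * R2) sG.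
by rewrite /lap (E v1 _ sG) (E v2 _ sG) (E v1 _ s1) (E v2 _ s2).
Qed.

Lemma test_box4 F : test_function F -> exists A M : R, [/\ 0 < A, 0 < M &
  forall x w, cabs (F (x, w)) <= M * (box2 A x * box2 A w)].
Proof.
move=> tF; have [M M0 HM] := test_bound tF; have [A A0 HA] := cs_bound tF.2.
exists A, M; split => // x w.
have [xA|xA] := leP `|(x, w)| A; last first.
  by rewrite HA// cabs0; apply: mulr_ge0; [exact: ltW|apply: mulr_ge0; exact: box2_ge0].
move: xA; rewrite prod_normE ge_max /= !box2E => /andP[-> ->].
by rewrite !mulr1.
Qed.

(** Only derivatives in the second pair of variables are used, so the decay is uniform in x. The
    factor [box2 A x] keeps the compact support, for a later integration over x. *)
Lemma slice4_decay F n : test_function F -> exists A C : R, [/\ 0 < A, 0 < C &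
  forall x xi, cabs (ft (slice4 F x) xi) <= C * box2 A x * (jb xi ^+ n)^-1].
Proof.
move=> tF; have tl := test_iter_lap ((0, e1) : R2 * R2) (0, e2) n tF.
have [A [M [A0 M0 H]]] := test_box4 tl.
set I := \int[l2]_x box2 A x.
have I0 : 0 <= I by apply: Rintegral_ge0 => x _; exact: box2_ge0.
exists A, (M * (I + 1)); split=> [||x xi] //; first by rewrite mulr_gt0// ltr_wpDl.
rewrite ler_pdivlMr ?exprn_gt0 ?jb_gt0//.
have tx := test_slice4 x tF; have := iter_lap_ft xi n tx => /(congr1 (@cabs R)).
rewrite cabsM cabs_real ger0_norm ?exprn_ge0 ?(ltW (jb_gt0 _))// mulrC => <-.
rewrite lap_slice4//; set G := iter n _ F.
apply: (@le_trans _ _ (\int[l2]_w (M * box2 A x * box2 A w))).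
  rewrite /ft cint2E; apply: cint_norm_le.
  - by apply: ft_citg; apply: test_citg2; apply: test_slice4.
  - by apply: itgZ; exact: itg_box2.
  - by move=> w; rewrite cabsM cabs_cis mul1r -mulrA; exact: H.
rewrite RintegralZl//; last exact: itg_box2.
rewrite -/I mulrAC ler_wpM2r ?box2_ge0// ler_wpM2l ?lerDl// ltW//.
Qed.

End Shear4.

Section ProductSymbol.
Context {R : realType}.
Local Notation leb := (@lebesgue_measure R).
Local Notation R2 := (R * R)%type.
Local Notation X := (R2 * R2)%type.

Lemma affine_theta1 : affine_map (fun q : X * R2 => q.2.1) (fun q => q.2.1).
Proof. exact: affine_comp (@affine_fst _ _ _) (@affine_snd _ _ _). Qed.

Lemma citerD_ftm (c : R[i]) (T : R) (k : R -> R[i]) (vs : seq (X * R2)) : citg leb k -> vanishing T k ->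
  citerD vs (fun q : X * R2 => c * ftm k q.2.1) =
  fun q => c * ((\prod_(v <- vs) v.2.1)%:C * ftm (iter (size vs) twist_wt k) q.2.1).
Proof.
move=> jk kT.
have H n : citg leb (iter n twist_wt k) /\ vanishing T (iter n twist_wt k).
  elim: n => // n [j v]; split; [exact: citg_tw v|exact: vanishing_tw].
elim: vs => [|v vs IH].
  by apply/funext => q; rewrite big_nil mul1r /citerD /= /re_fun /im_fun; case: (_ * _).
have -> : citerD (v :: vs) (fun q : X * R2 => c * ftm k q.2.1) =
    cD v (citerD vs (fun q : X * R2 => c * ftm k q.2.1)) by [].
rewrite IH; have [jn vn] := H (size vs); have sf := csmooth_ftm jn vn.
have sa := csmooth_affine affine_theta1 sf.
rewrite (cDZ v c (csmoothM (csmooth_cst _ _) sa)) (cDZ v _ sa) (cD_affine v affine_theta1 sf).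
rewrite (cD_ftm _ jn vn); apply/funext => q; rewrite big_cons /=.
by rewrite rmorphM /=; ring.
Qed.

(** The amplitude depends on theta_1 alone: a derivative in theta_2, x or y kills it, which leaves
    order 0 in the pair (theta_2, theta_1), and each derivative in theta_1 applies [twist_wt]
    once. *)
Lemma paired_symbol b k m (c : R[i]) : 0 <= b -> b < 1 -> weight b k m ->
  product_symbol 0 (b - 1) (fun q : X * R2 => c * ftm k q.2.1).
Proof.
move=> b0 b1 wk; have [T T0 kT] := weight_cs wk; have jk := weight_citg wk.
split.
  apply: csmoothM; first exact: csmooth_cst.
  exact: csmooth_affine affine_theta1 (csmooth_ftm jk kT).
move=> K alpha beta vs _.
have [C C0 HC] := ftm_symbol beta b0 b1 wk.
exists (cabs c * C) => z theta _.
rewrite (citerD_ftm _ _ jk kT) !big_cat /=.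
have pn n (v : X * R2) : \prod_(w <- nseq n v) w.2.1 = v.2.1 ^+ n.
  by elim: n => [|n IH]; rewrite ?big_nil ?big_cons ?expr0 ?IH ?exprS.
rewrite !pn /= expr1n mul1r.
have nn x y : 0 <= cabs c * C * bracket (dot2 theta theta) `^ x * bracket (theta.1 ^+ 2) `^ y.
  by rewrite !mulr_ge0 ?powR_ge0 ?cabs_ge0// ltW.
case: alpha => [|alpha]; last by rewrite expr0n /= mul0r mul0r mulr0 cabs0.
case: vs => [|v vs]; last by rewrite /= big_cons /= mul0r mulr0 mul0r mulr0 cabs0.
rewrite /= big_nil expr0 !mulr1 mul1r subr0 powRr0 mulr1 cats0 /= size_nseq cabsM -mulrA.
by rewrite ler_wpM2l ?cabs_ge0//; exact: HC.
Qed.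

End ProductSymbol.

(** * The Schwartz kernel as an oscillatory integral *)

Section CurveKernel.
Context {R : realType}.
Local Notation leb := (@lebesgue_measure R).
Local Notation l2 := (@lebesgue_measure R \x @lebesgue_measure R)%E.
Local Notation R2 := (R * R)%type.
Local Notation R2m := (measurableTypeR R * measurableTypeR R)%type.
Local Notation X := (R2 * R2)%type.

Definition curve_kernel (k : R -> R[i]) (psi : X -> R[i]) : R[i] :=
  cint2 (fun x => cint1 (fun t => k t * psi (x, (x.1 - t, x.2 - t ^+ 3)))).

Lemma curve_kernelE k psi :
  curve_kernel k psi = cint2 (fun x => cint1 (fun t => k t * sh4 psi (x, (t, 0)))).
Proof.
congr cint2; apply/funext => x; congr cint1; apply/funext => t.
by rewrite /sh4 /curve_pt /= subr0.
Qed.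

Lemma citg_test4 (F : X -> R[i]) : test_function F -> citg (lebR2 \x lebR2)%E F.
Proof.
move=> tF; have [A [M [A0 M0 H]]] := test_box4 tF.
apply: (@citg_dom _ (R2m * R2m)%type R (lebR2 \x lebR2)%E F (fun z => M * (box2 A z.1 * box2 A z.2))).
- exact: csmooth_cmeas4 tF.1.
- by apply: itgZ; apply: itg_prod; exact: itg_box2.
- by move=> [x w]; exact: H.
Qed.

Lemma citg_curve (k : R -> R[i]) (F : X -> R[i]) : citg leb k -> test_function F ->
  citg (lebR2 \x leb)%E (fun z => k z.2 * F (z.1, (z.2, 0))).
Proof.
move=> jk tF; have [A [M [A0 M0 H]]] := test_box4 tF.
have [mF1 mF2] := csmooth_cmeas4 tF.1; have [mk1 mk2] := citg_meas1 jk.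
have mp : measurable_fun setT (fun z : R2m * measurableTypeR R => (z.1, (z.2, 0 : measurableTypeR R))).
  apply: measurable_fun_pair; first exact: measurable_fst.
  by apply: measurable_fun_pair; [exact: measurable_snd|exact: measurable_cst].
apply: (@citg_dom _ (R2m * measurableTypeR R)%type R (lebR2 \x leb)%E _ (fun z => M * (box2 A z.1 * cabs (k z.2)))).
- apply: cmeasM.
    by split; [exact: (measurableT_comp mk1 measurable_snd)|exact: (measurableT_comp mk2 measurable_snd)].
  by split; [exact: (measurableT_comp mF1 mp)|exact: (measurableT_comp mF2 mp)].
- by apply: itgZ; exact: (@itg_prod _ _ R2m (measurableTypeR R) R lebR2 leb _ _ (itg_box2 A) (citg_cabs jk)).
- move=> [x t]; rewrite cabsM /= mulrC.
  rewrite mulrA ler_wpM2r ?cabs_ge0// (le_trans (H _ _))// ler_wpM2l ?(ltW M0)//.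
  by rewrite ler_piMr ?box2_ge0// box2E; case: ifP.
Qed.

Lemma citgM_path (k : R -> R[i]) (f : R2 -> R[i]) (p : R -> R2) : citg leb k -> test_function f ->
  continuous p -> citg leb (fun t => k t * f (p t)).
Proof.
move=> jk tf cp; have [M M0 HM] := test_bound tf.
suff H : citg leb (fun t => f (p t) * k t) by move: H; congr citg; apply/funext => t; exact: mulrC.
apply: (@citgM_bounded _ (measurableTypeR R) R leb k (fun t => f (p t)) M jk) => //; split.
  apply: (continuous_measurable_fun (f := fun t : R => re_fun f (p t))).
  by move=> t; apply: continuous_comp; [exact: cp|exact: (smooth_cont tf.1.1)].
apply: (continuous_measurable_fun (f := fun t : R => im_fun f (p t))).
by move=> t; apply: continuous_comp; [exact: cp|exact: (smooth_cont tf.1.2)].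
Qed.

Lemma curve_kernel_citg (k : R -> R[i]) (F : X -> R[i]) : citg leb k -> test_function F ->
  (forall x, citg leb (fun t => k t * F (x, (t, 0)))) /\
  citg l2 (fun x => cint leb (fun t => k t * F (x, (t, 0)))).
Proof.
move=> jk tF; have [J _] := cint_fubini1 (citg_curve jk tF); split=> // x.
have cs : continuous (fun t : R => (t, 0) : R2).
  by move=> t; have [dt _] := affine_slice1 0 t; exact: differentiable_continuous.
exact: (citgM_path jk (test_slice4 x tF) cs).
Qed.

Lemma curve_kernel_distribution k : citg leb k -> Defs.distribution (curve_kernel k).
Proof.
move=> jk; split.
  move=> c phi psi tp ts; rewrite !curve_kernelE.
  have [j1 J1] := curve_kernel_citg jk (test_sh4 tp); have [j2 J2] := curve_kernel_citg jk (test_sh4 ts).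
  rewrite !cint2E -(cintZ c J1) -(cintD (citgZ c J1) J2).
  apply: eq_cint => x; rewrite -(cintZ c (j1 x)) -(cintD (citgZ c (j1 x)) (j2 x)).
  by apply: eq_cint => t; rewrite /sh4; ring.
move=> K cK; have [A A0 HA] := compact_bound cK.
(* The kernel has order 0: phi itself is integrated over the curves, so that its supremum suffices,
   hence N = 0. *)
exists ((\int[leb]_t cabs (k t)) * \int[l2]_x box2 A x), 0%N => phi tp phiK M HM.
have HM0 z : cabs (phi z) <= M.
  have := HM [::] isT; rewrite /citerD /= => /(_ (fun v => _)) h.
  have {}h := h (fun v => ltac:(by rewrite in_nil)) z.
  by move: h; rewrite /re_fun /im_fun; case: (phi z).
have M0 : 0 <= M := le_trans (cabs_ge0 _) (HM0 0).
have Hb x w : cabs (sh4 phi (x, w)) <= M * box2 A x.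
  have [xA|xA] := leP `|x| A; first by rewrite box2E xA mulr1; exact: HM0.
  rewrite /sh4; have -> : phi (x, curve_pt x w) = 0.
    apply/eqP; apply: contraTT xA => nz; rewrite -leNgt.
    by have := HA _ (phiK _ nz); rewrite prod_normE ge_max => /andP[].
  by rewrite cabs0 mulr_ge0 ?box2_ge0.
rewrite curve_kernelE; have [j1 J1] := curve_kernel_citg jk (test_sh4 tp).
set I := \int[leb]_t cabs (k t).
rewrite cint2E mulrAC [_ * M]mulrC -RintegralZl//; last exact: itg_box2.
apply: cint_norm_le => // [|x]; first by apply: itgZ; exact: itg_box2.
rewrite mulrAC mulrC /I -RintegralZr//; last exact: citg_cabs.
apply: cint_norm_le => // [|t].
  have := itgZ (M * box2 A x) (citg_cabs jk); congr itg; apply/funext => t; exact: mulrC.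
by rewrite cabsM mulrC [_ * (M * _)]mulrC ler_wpM2r ?cabs_ge0//; exact: Hb.
Qed.

Lemma citg_curve_op (k : R -> R[i]) (f : R2 -> R[i]) (x : R2) : citg leb k -> test_function f ->
  citg leb (fun t => f (x.1 - t, x.2 - t ^+ 3) * k t).
Proof.
move=> jk tf.
have cs : continuous (fun t : R => (x.1 - t, x.2 - t ^+ 3) : R2).
  move=> t; have h1 : x.1 - s @[s --> t] --> x.1 - t by apply: cvgB; [exact: cvg_cst|exact: cvg_id].
  have h2 : x.2 - s ^+ 3 @[s --> t] --> x.2 - t ^+ 3.
    by apply: cvgB; [exact: cvg_cst|exact: (@exprn_continuous R 3 t)].
  exact: cvg_pair h1 h2.
have := citgM_path jk tf cs; congr citg; apply/funext => t; exact: mulrC.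
Qed.

Lemma curve_kernel_schwartz k : citg leb k ->
  schwartz_kernel (fun f => dist2_of_fun (curve_op k f)) (curve_kernel k).
Proof.
move=> jk; split; first exact: curve_kernel_distribution.
move=> f psi tf tp; rewrite /dist2_of_fun /curve_kernel !cint2E.
apply: eq_cint => x /=; rewrite /curve_op /cint1 mulrC -cintZ; last exact: citg_curve_op.
by apply: eq_cint => t; ring.
Qed.

(** Near 0 the left side vanishes, elsewhere it is bounded and |y| >= d. It makes the error of the
    regularization by rho(e theta) of order e |theta|. *)
Lemma cutoff_lipschitz (rho : R2 -> R) : cutoff rho ->
  exists2 C : R, 0 < C & forall y, `|rho y - 1| <= C * `|y|.
Proof.
move=> [sr cr r1]; have [A A0 HA] := cs_bound cr.
have [M M0 HM] := continuous_bound (smooth_cont sr) (ball2_compact (A := A)).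
have {}HM y : `|rho y| <= M.
  have [yA|yA] := leP `|y| A; first by apply: HM; exact/ball2E.
  by rewrite HA// normr0 ltW.
have /nbhs_norm0P[d /= d0 Hd] := r1.
exists ((M + 1) / d) => [|y]; first by rewrite divr_gt0// addr_gt0.
have [yd|yd] := ltP `|y| d.
  by rewrite (Hd y)// subrr normr0 mulr_ge0// divr_ge0 ?(ltW d0)// addr_ge0// ltW.
rewrite (le_trans (ler_normB _ _))// normr1 mulrAC ler_pdivlMr// ler_pM ?addr_ge0 ?(ltW d0)//.
by rewrite lerD2r.
Qed.

Lemma norm_le_jb (y : R2) : `|y| <= jb y.
Proof.
have h (a : R) : `|a| <= 1 + a ^+ 2.
  have := sqr_ge0 (`|a| - 1); rewrite sqrrB expr1n mulr1 real_normK ?num_real// => h.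
  have := normr_ge0 a; rewrite -mulr_natl in h *; nra.
rewrite prod_normE ge_max /jb /dot2 -!expr2 (le_trans (h _)) ?(le_trans (h y.2)) //=.
  by rewrite lerD2l lerDr sqr_ge0.
by rewrite lerD2l lerDl sqr_ge0.
Qed.

Section Limit.
Variables (k : R -> R[i]) (T : R).
Hypotheses (jk : citg leb k) (kT : vanishing T k).
Let I := \int[leb]_t cabs (k t).
Let c : R[i] := (((2 * pi) ^+ 2)^-1)%:C.

Let hb theta : cabs (ftm k theta) <= I. Proof. exact: ftm_bound. Qed.

Let hm : cmeas (fun theta : R2 => c * ftm k theta.1).
Proof.
apply: csmooth_cmeas2; apply: csmoothM; first exact: csmooth_cst.
exact: csmooth_affine (@affine_fst R R R) (csmooth_ftm jk kT).
Qed.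

(* The operator in terms of Fourier transforms along the fibres: inversion at the points (t, 0). *)
Lemma curve_fibre (f : R2 -> R[i]) : test_function f ->
  cint leb (fun t => k t * f (t, 0)) = cint2 (fun theta => c * ftm k theta.1 * ft f theta).
Proof.
move=> tf; have jF := ft_test_citg tf.
pose F (z : R * R2) := cis (- (dot2 (z.1, 0) z.2)) * (k z.1 * ft f z.2).
have JF : citg (leb \x lebR2)%E F.
  apply: (citgM_bounded (M := 1)) => [||z]; last by rewrite cabs_cis.
    exact: (@citg_prod _ _ (measurableTypeR R) R2m R leb lebR2 _ _ jk jF).
  apply: cmeas_cis; apply: (measurableT_comp (@oppr_measurable R setT)).
  apply: measurable_dot2; last exact: measurable_snd.
  by apply: measurable_fun_pair; [exact: measurable_fst|exact: measurable_cst].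
have E1 t : cint lebR2 (fun xi => F (t, xi)) = ((2 * pi) ^+ 2)%:C * (k t * f (t, 0)).
  rewrite mulrCA -(ft_inversion (t, 0) tf) cint2L -cintZ.
    by apply: eq_cint => xi; rewrite /F /=; ring.
  apply: (citgM_bounded (M := 1) jF) => [|z]; last by rewrite cabs_cis.
  apply: cmeas_cis; apply: (measurableT_comp (@oppr_measurable R setT)).
  by apply: measurable_dot2; [exact: measurable_cst|exact: measurable_id].
have E2 xi : cint leb (fun t => F (t, xi)) = ftm k xi.1 * ft f xi.
  rewrite /ftm -cintZr; last exact: ftm_citg.
  by apply: eq_cint => t; rewrite /F /dot2 /= mul0r addr0 mulrA.
have := cint_swap JF; under eq_cint => t do rewrite E1.
have jk0 : citg leb (fun t => k t * f (t, 0)).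
  have [J _] := cint_fubini1 JF.
  have := citgZ c J; congr citg; apply/funext => t.
  by rewrite E1 mulrA /c -rmorphM mulVf ?mul1r// expf_neq0// mulf_neq0// Rint_pi.
rewrite cintZ// => E; have := congr1 (fun z => c * z) E.
rewrite mulrA /c -rmorphM mulVf ?mul1r; last by rewrite expf_neq0// mulf_neq0// Rint_pi.
move=> ->; rewrite -cintZ; last first.
  by have [J _] := cint_fubini2 JF; move: J; congr citg; apply/funext => xi; rewrite E2.
by rewrite cint2L; apply: eq_cint => xi; rewrite E2 mulrA.
Qed.

Let reg (rho : R2 -> R) (e : R) (theta : R2) : R[i] := (rho (e *: theta))%:C * (c * ftm k theta.1).

Lemma reg_citg rho e : cutoff rho -> 0 < e -> citg l2 (reg rho e).
Proof.
move=> [sr cr _] e0.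
have ae : affine_map (fun theta : R2 => e *: theta) (fun theta => e *: theta).
  by apply: (@affine_linear R R2 R2 ( *:%R e)) => x; exact: scaler_continuous.
have tr : test_function (fun theta => (rho (e *: theta))%:C).
  split; first by apply: csmooth_real; exact: smooth_affine ae sr.
  have [A A0 HA] := cs_bound cr; apply: (cs_ball2 (A := e^-1 * A)) => x xA.
  by rewrite HA// normrZ (gtr0_norm e0) -ltr_pdivrMl.
have := citgM_bounded (M := cabs c * I) (test_citg2 tr) hm.
have hc (x : R2) : cabs (c * ftm k x.1) <= cabs c * I by rewrite cabsM ler_wpM2l ?cabs_ge0.
by move=> /(_ hc); congr citg; apply/funext => x; rewrite mulrC.
Qed.

(** In y a shear replaces y by [curve_pt] coordinates w, which makes the phase equal to w . theta;
    the integral over theta is then the Fourier transform of the regularized amplitude. *)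
Lemma regularized_fibre psi rho e (x : R2) : test_function psi -> cutoff rho -> 0 < e ->
  cint2 (fun y => cint2 (fun theta => cis (paired_phase ((x, y), theta)) * (rho (e *: theta))%:C
    * (c * ftm k theta.1) * psi (x, y))) =
  cint2 (fun w => slice4 (sh4 psi) x w * ft (reg rho e) w).
Proof.
move=> tp cr e0; have jg := reg_citg cr e0.
have ts := test_slice4 x (test_sh4 tp); have js := test_citg2 ts.
have [j0 _] := ft_mult jg js.
pose f0 w := slice4 (sh4 psi) x w * ft (reg rho e) w.
have jf0 : citg l2 f0 by move: j0; congr citg; apply/funext => w; exact: mulrC.
have n1 : (-1 : R) != 0 by rewrite oppr_eq0 oner_eq0.
have mg : measurable_fun setT (fun y1 : R => x.2 - (x.1 - y1) ^+ 3).
  apply: continuous_measurable_fun => t; apply: cvgB; first exact: cvg_cst.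
  apply: (continuous_comp (f := fun t : R => x.1 - t) (g := fun t : R => t ^+ 3)); last exact: exprn_continuous.
  by apply: cvgB; [exact: cvg_cst|exact: cvg_id].
have [_] := cint2_shear x.1 n1 n1 mg jf0.
rewrite normrN1 mulr1 invr1 mul1r => <-.
congr cint2; apply/funext => y /=.
rewrite /f0 /slice4 /sh4.
have -> : curve_pt x (-1 * y.1 + x.1, -1 * y.2 + (x.2 - (x.1 - y.1) ^+ 3)) = y.
  by rewrite /curve_pt /= [RHS]surjective_pairing; congr (_, _); ring.
rewrite /ft !cint2E -cintZ; last exact: ft_citg.
apply: eq_cint => theta; rewrite /reg /paired_phase.
have -> : dot2 theta (-1 * y.1 + x.1, -1 * y.2 + (x.2 - (x.1 - y.1) ^+ 3)) =
  (x.1 - y.1) * theta.1 + (x.2 - y.2 - (x.1 - y.1) ^+ 3) * theta.2.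
  by rewrite /dot2 /=; ring.
ring.
Qed.

(** On each fibre the regularized integral and its limit differ by the factor rho(e theta) - 1 = O(e
    |theta|). Decay of order [jb]^-3 for the transform of the slice absorbs |theta| and leaves the
    integrable [jb]^-2, so the total error is O(e). *)
Lemma curve_oscillatory :
  oscillatory_integral (@cint2 R) paired_phase
    (fun q : X * R2 => c * ftm k q.2.1) (curve_kernel k).
Proof.
move=> psi rho tp cr.
have [L L0 HL] := cutoff_lipschitz cr.
have tF := test_sh4 tp.
have [A [D [A0 D0 HD]]] := slice4_decay 3 tF.
set W := \int[l2]_x w2 x; set B := \int[l2]_x box2 A x.
pose C := cabs c * I * L * D * W.
have I0 : 0 <= I by apply: Rintegral_ge0 => x _; exact: cabs_ge0.
have main (e : R) : 0 < e -> cabs (cint4 (fun z => cint2 (fun theta =>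
    cis (paired_phase (z, theta)) * (rho (e *: theta))%:C * (c * ftm k theta.1) * psi z))
    - curve_kernel k psi) <= C * B * e.
  move=> e0; have jg := reg_citg cr e0.
  rewrite curve_kernelE /cint4.
  under eq_fun do rewrite regularized_fibre//.
  have [_ J2] := curve_kernel_citg jk tF.
  have J1 : citg l2 (fun x => cint2 (fun w => slice4 (sh4 psi) x w * ft (reg rho e) w)).
    have J : citg (lebR2 \x lebR2)%E (fun z => ft (reg rho e) z.2 * sh4 psi z).
      apply: (@citgM_bounded _ (R2m * R2m)%type R (lebR2 \x lebR2)%E (sh4 psi) (fun z => ft (reg rho e) z.2)
        (\int[l2]_y cabs (reg rho e y)) (citg_test4 tF)).
        have [m1 m2] := ft_meas jg.
        by split; [exact: (measurableT_comp m1 measurable_snd)|exact: (measurableT_comp m2 measurable_snd)].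
      by move=> z; exact: ft_bound.
    have [J' _] := cint_fubini1 J; move: J'; congr citg; apply/funext => x.
    by rewrite cint2L; apply: eq_cint => w; rewrite mulrC.
  rewrite !cint2E -(cintB J1 J2) mulrAC -RintegralZl//; last exact: itg_box2.
  apply: cint_norm_le => [||x]; [exact: citgB J1 J2|by apply: itgZ; exact: itg_box2|].
  have ts := test_slice4 x tF; have jF := ft_test_citg ts.
  have [j1 E1] := ft_mult jg (test_citg2 ts).
  have -> : cint2 (fun w => slice4 (sh4 psi) x w * ft (reg rho e) w) =
      cint l2 (fun theta => reg rho e theta * ft (slice4 (sh4 psi) x) theta).
    by rewrite -cint2E -E1; congr cint2; apply/funext => w; rewrite mulrC.
  rewrite -[X in _ - X]/(cint leb (fun t => k t * slice4 (sh4 psi) x (t, 0))) (curve_fibre ts) cint2E.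
  have jc : citg l2 (fun theta => c * ftm k theta.1 * ft (slice4 (sh4 psi) x) theta).
    apply: (citgM_bounded (M := cabs c * I) jF hm).
    by move=> y; rewrite cabsM ler_wpM2l ?cabs_ge0.
  have jr : citg l2 (fun theta => reg rho e theta * ft (slice4 (sh4 psi) x) theta).
    have := @citgM_bounded _ R2m R l2 _ _ _ jg (ft_meas (test_citg2 ts)) (fun y => ft_bound y (test_citg2 ts)).
    by congr citg; apply/funext => y; exact: mulrC.
  rewrite -(cintB jr jc).
  have -> : C * e * box2 A x = \int[l2]_y ((cabs c * I * L * D * box2 A x * e) * w2 y).
    by rewrite RintegralZl//; [rewrite -/W /C; ring|exact: itg_w2].
  apply: cint_norm_le => [||theta]; [exact: citgB|by apply: itgZ; exact: itg_w2|].
  rewrite /reg -!mulrBl (_ : _ - _ = (rho (e *: theta) - 1)%:C * (c * ftm k theta.1)); last first.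
    by rewrite rmorphB rmorph1 mulrBl mul1r.
  rewrite !cabsM cabs_real.
  have h1 := HL (e *: theta); rewrite normrZ (gtr0_norm e0) in h1.
  have h2 := HD x theta.
  have h3 : `|rho (e *: theta) - 1| * (cabs c * cabs (ftm k theta.1)) * cabs (ft (slice4 (sh4 psi) x) theta)
     <= L * (e * jb theta) * (cabs c * I) * (D * box2 A x * (jb theta ^+ 3)^-1).
    apply: ler_pM => //; rewrite ?mulr_ge0 ?cabs_ge0//.
    apply: ler_pM => //; rewrite ?mulr_ge0 ?cabs_ge0//.
      rewrite (le_trans h1)// ler_wpM2l ?(ltW L0)// ler_wpM2l ?(ltW e0)//; exact: norm_le_jb.
    by rewrite ler_wpM2l ?cabs_ge0.
  apply: le_trans h3 _.
  have -> : L * (e * jb theta) * (cabs c * I) * (D * box2 A x * (jb theta ^+ 3)^-1) =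
     (cabs c * I * L * D * box2 A x * e) * (jb theta ^+ 2)^-1.
    by field; rewrite gt_eqF// jb_gt0.
  apply: ler_wpM2l (jb2_w2 _).
  by rewrite !mulr_ge0 ?cabs_ge0 ?box2_ge0 ?(ltW e0) ?(ltW L0) ?(ltW D0).
apply/cvgr0Pnorm_lt => d d0.
have CB : 0 < `|C * B| + 1 by rewrite ltr_wpDl.
near=> e; have e0 : 0 < e by near: e; exact: nbhs_right_gt.
rewrite ger0_norm ?cabs_ge0// (le_lt_trans (main e e0))//.
rewrite (@le_lt_trans _ _ ((`|C * B| + 1) * e))//.
  by rewrite ler_wpM2r ?(ltW e0)// (le_trans (ler_norm _))// lerDl.
rewrite -ltr_pdivlMl//; near: e; apply: nbhs_right_lt.
by rewrite mulr_gt0// invr_gt0.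
Unshelve. all: by end_near. Qed.

End Limit.

Lemma citerD_0 (U : normedModType R) (vs : seq U) : citerD vs (fun _ : U => 0 : R[i]) = fun=> 0.
Proof.
elim: vs => // v vs IH; have -> : citerD (v :: vs) (fun=> 0 : R[i]) = cD v (citerD vs (fun=> 0)) by [].
by rewrite IH cD_cst.
Qed.

Lemma csmooth_0 (U : normedModType R) : csmooth (fun _ : U => 0 : R[i]).
Proof. exact: csmooth_cst. Qed.

(* With an empty cone there is no condition on the phase. *)
Lemma lagrangian_piece0 (p : R) (Lambda : set (X * X)) : lagrangian_piece p Lambda (fun=> 0).
Proof.
exists 1%N, set0, (fun=> 0), (fun=> 0); split=> //.
- split; first by split => //; exact: open0.
    by move=> q [].
  split; first by move=> q r; rewrite inE => -[].
  by exists set0; [exact: open0|rewrite setI0; apply/seteqP; split => // q [r []]].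
- split; first exact: csmooth_0.
  by move=> K vs ws _; exists 0 => z theta _; rewrite citerD_0 cabs0 mul0r.
- by exists set0; split => // [|q /eqP]; [exact: closed0|].
- move=> psi rho tp cr.
  rewrite (_ : (fun e => _) = fun=> 0); first exact: cvg_cst.
  apply/funext => e; rewrite subr0 /cint4 /cint2.
  rewrite (_ : (fun x => _) = fun=> 0) ?cint0 ?cabs0//; apply/funext => x.
  rewrite (_ : (fun y => _) = fun=> 0) ?cint0//; apply/funext => y.
  rewrite /Defs.cintN /cint1 (_ : (fun t => _) = fun=> 0) ?cint0//; apply/funext => t.
  by rewrite mulr0 mul0r.
Qed.

Lemma FIO_kernel0 (p : R) (C : set ((R2 * R2) * (R2 * R2))) : FIO_kernel p C (fun=> 0).
Proof.
split.
  split=> [c phi psi _ _|K _]; first by rewrite mulr0 addr0.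
  by exists 0, 0%N => phi _ _ M _; rewrite cabs0 mul0r.
exists (fun=> 0), (fun _ _ => 0); split=> [|j|K cK]; [exact: csmooth_0|exact: lagrangian_piece0|].
exists 0%N => n _ psi _ _; rewrite big1// addr0 /dist4_of_fun /cint4 /cint2.
rewrite (_ : (fun x => _) = fun=> 0) ?cint0//; apply/funext => x.
by rewrite (_ : (fun y => _) = fun=> 0) ?cint0//; apply/funext => y; rewrite mul0r.
Qed.

(** For p = -1/2 and l = b - 1/2 the orders p + 1/2 and l - 1/2 required of the amplitude are 0 and
    b - 1, which are those of the transform of the weight. *)
Lemma paired_weight (b : R) (k m : R -> R[i]) : 0 <= b -> b < 1 -> weight b k m ->
  paired_class (- 2^-1) (b - 2^-1) (fun f => dist2_of_fun (curve_op k f)).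
Proof.
move=> b0 b1 wk; have [T T0 kT] := weight_cs wk; have jk := weight_citg wk.
exists (curve_kernel k), (curve_kernel k), (fun=> 0), (fun=> 0).
split; [exact: curve_kernel_schwartz| |exact: FIO_kernel0|exact: FIO_kernel0|by move=> psi _; rewrite !addr0].
exists (fun q : X * R2 => (((2 * pi) ^+ 2)^-1)%:C * ftm k q.2.1); last exact: curve_oscillatory jk kT.
have -> : - 2^-1 + 2^-1 = 0 :> R by rewrite addNr.
have -> : b - 2^-1 - 2^-1 = b - 1 by lra.
exact: paired_symbol wk.
Qed.

Lemma power_weightP (chi : R -> R[i]) (b : R) : test_function chi ->
  (forall t : R, `|t| <= 2^-1 -> chi t = 1) -> 0 < b -> b < 1 ->
  exists m, weight b (power_weight chi b) m.
Proof.
move=> tc c1 b0 b1.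
have -> : power_weight chi b = sing_weight chi (fun t => `|t| `^ (- b)).
  by apply/funext => t; rewrite /power_weight /sing_weight powRN fmorphV.
apply: (sing_weightP (c := 0) (b' := b) (C := 1)) => //.
- by move=> t t0; apply: (is_derive_eqR (is_derive_powabs (- b) t0)); rewrite sub0r mulNr.
- exact: measurable_powabs.
- by move=> t; rewrite ger0_norm ?powR_ge0// mul1r ler_peMl ?powR_ge0// lerDl.
Qed.

Lemma log_weightP (chi : R -> R[i]) : test_function chi ->
  (forall t : R, `|t| <= 2^-1 -> chi t = 1) -> exists m, weight 0 (log_weight chi) m.
Proof.
(* The derivative of the logarithm gives b = 0 and c = 1. The inequality ln y <= y at y = x^(1/2)
   and at y = x^(-1/2) gives |ln x| <= 2 (1 + x) x^(-1/2), hence b' = 1/2 and C = 2. *)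
move=> tc c1; apply: (sing_weightP (g := fun t => ln `|t|) (c := 1) (b' := 2^-1) (C := 2)) => //.
- by move=> t t0; apply: (is_derive_eqR (is_derive_lnabs t0)); rewrite mul0r subr0 mulr1.
- exact: (measurableT_comp (@measurable_ln R) (@normr_measurable R setT)).
- by rewrite invf_lt1// ltr1n.
- move=> t; have [->|t0] := eqVneq t 0.
    by rewrite normr0 ln0// normr0 mulr_ge0 ?powR_ge0// addr0 mulr1.
  set x := `|t|; have x0 : 0 < x by rewrite normr_gt0.
  have lnx (y : R) : 0 < y -> ln y <= y by move=> y0; rewrite ltW// ln_sublinear.
  have p0 y : 0 < x `^ y by exact: powR_gt0.
  have h1 := lnx _ (p0 2^-1); have h2 := lnx _ (p0 (- 2^-1)).
  rewrite !ln_powR in h1 h2.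
  have E : x `^ 2^-1 = x * x `^ (- 2^-1).
    rewrite -{2}(powRr1 (ltW x0)) -powRD ?(gt_eqF x0) ?implybT//; congr powR; lra.
  rewrite ler_norml; apply/andP; split; move: h1 h2 (p0 (- 2^-1)) (p0 2^-1); rewrite E; nra.
Qed.

End CurveKernel.

(** * Decay of the multiplier *)

Section VanDerCorput.
Context {R : realType}.
Local Notation leb := (@lebesgue_measure R).

Lemma measurable_off0 (f : R -> R) : (forall t : R, t != 0 -> {for t, continuous f}) ->
  measurable_fun setT f.
Proof.
move=> cf; pose D := [set t : R | t != 0].
have oD : open D by exact: open_neq.
have mD : measurable D by exact: open_measurable.
have -> : [set: R] = D `|` [set 0].
  by apply/seteqP; split=> t // _; case: (eqVneq t 0) => [->|]; [right|left].
apply/measurable_funU => //; split; last exact: measurable_fun_set1.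
apply: subspace_continuous_measurable_fun => //.
by apply: continuous_in_subspaceT => t; rewrite inE; exact: cf.
Qed.

Section Phase.
Variables (x1 x2 rho : R).
Hypothesis rho0 : 0 < rho.

Definition cphase (t : R) : R := t * x1 + t ^+ 3 * x2.
Definition cphase1 (t : R) : R := x1 + 3 * x2 * t ^+ 2.
(** Denominator of the regularized inverse of the derivative of the phase. In the application rho is
    the cube root of <xi>: when x2 has size rho^3, the phase t^3 x2 is of order 1 for t of size
    1/rho, and its derivative is then of order rho. *)
Definition cden (t : R) : R := rho ^+ 2 + cphase1 t ^+ 2.

Lemma cden_gt0 t : 0 < cden t.
Proof. by rewrite /cden ltr_pwDl ?sqr_ge0// exprn_gt0. Qed.

Lemma is_derive_exprR (t : R) n : is_derive t (1 : R) (fun t : R => t ^+ n.+1) (n.+1%:R * t ^+ n).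
Proof.
elim: n => [|n IH]; first by rewrite expr0 mulr1; exact: is_derive_idR.
have h := is_deriveMR (is_derive_idR t) IH.
rewrite (_ : (fun t : R => t ^+ n.+2) = fun t => t * t ^+ n.+1); last by apply/funext => y; rewrite exprS.
apply: (is_derive_eqR h); rewrite -[n.+2%:R]natr1 exprS; ring.
Qed.

Lemma is_derive_cphase t : is_derive t (1 : R) cphase (cphase1 t).
Proof.
have h1 := is_deriveZR x1 (is_derive_idR t); have h2 := is_deriveZR x2 (is_derive_exprR t 2).
rewrite (_ : cphase = fun t => x1 * t + x2 * t ^+ 3); last by apply/funext => y; rewrite /cphase; ring.
by apply: (is_derive_eqR (is_deriveDR h1 h2)); rewrite /cphase1; ring.
Qed.

Lemma is_derive_cphase1 t : is_derive t (1 : R) cphase1 (6 * x2 * t).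
Proof.
have h1 := is_derive_cst x1 t (1 : R); have h2 := is_deriveZR (3 * x2) (is_derive_exprR t 1).
apply: (is_derive_eqR (is_deriveDR h1 h2)); rewrite expr1; ring.
Qed.

Definition cquot (t : R) : R := cphase1 t * (cden t)^-1.
Definition cquot1 (t : R) : R := 6 * x2 * t * (rho ^+ 2 - cphase1 t ^+ 2) * ((cden t)^-1) ^+ 2.

Lemma is_derive_cquot t : is_derive t (1 : R) cquot (cquot1 t).
Proof.
have h1 := is_derive_cphase1 t.
have h2 := is_deriveDR (is_derive_cst (rho ^+ 2) t (1 : R)) (is_deriveMR h1 h1).
have d0 : cden t != 0 by rewrite gt_eqF// cden_gt0.
have h3 := is_derive_compR (F := fun y : R => y^-1) (f := cden) (x := t) (is_derive_invR d0).
have {}h3 := h3 _ h2.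
apply: (is_derive_eqR (is_deriveMR h1 h3)); rewrite /cquot1 /cden; field.
by rewrite -/(cden t).
Qed.

Lemma cquot_le t : `|cquot t| <= (2 * rho)^-1.
Proof.
rewrite /cquot normrM normfV (gtr0_norm (cden_gt0 t)) ler_pdivrMr ?cden_gt0//.
rewrite ler_pdivlMl ?mulr_gt0// /cden -(real_normK (num_real (cphase1 t))).
have := sqr_ge0 (rho - `|cphase1 t|); rewrite sqrrB; lra.
Qed.

Lemma cquot1_le t : `|cquot1 t| <= 6 * `|x2| * `|t| * (cden t)^-1.
Proof.
have D0 : 0 <= (cden t)^-1 by rewrite invr_ge0 ltW// cden_gt0.
have -> : cquot1 t = (6 * x2 * t) * ((rho ^+ 2 - cphase1 t ^+ 2) * (cden t)^-1) * (cden t)^-1.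
  by rewrite /cquot1; ring.
rewrite normrM (ger0_norm D0) ler_wpM2r// normrM -[leRHS]mulr1 ler_pM//.
  by rewrite !normrM (ger0_norm (_ : 0 <= 6)).
rewrite normrM (ger0_norm D0) ler_pdivrMr ?cden_gt0// mul1r /cden.
have := sqr_ge0 (cphase1 t); have := sqr_ge0 rho; rewrite ler_norml => ? ?; apply/andP; split; lra.
Qed.

Let cont (f f' : R -> R) : (forall t : R, is_derive t (1 : R) f (f' t)) -> continuous f.
Proof. by move=> df t; exact: is_derive_cont (df t). Qed.

Lemma cont_cden_inv : continuous (fun t => (cden t)^-1).
Proof.
move=> t; apply: cvgV; first by rewrite gt_eqF// cden_gt0.
by apply: cvgD; [exact: cvg_cst|apply: cvgM; exact: (cont is_derive_cphase1)].
Qed.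

(** The sign of t, written through a power of |t| so that its derivative off 0 comes from
    [is_derive_powabs]. *)
Definition rsgn (t : R) : R := t * `|t| `^ (-1).

Lemma is_derive_rsgn (t : R) : t != 0 -> is_derive t (1 : R) rsgn 0.
Proof.
move=> t0; apply: (is_derive_eqR (is_deriveMR (is_derive_idR t) (is_derive_powabs (-1) t0))).
by field.
Qed.

Lemma rsgnE (t : R) : 0 < t -> rsgn t = 1 /\ rsgn (- t) = -1.
Proof.
move=> t0; rewrite /rsgn normrN (gtr0_norm t0) powR_inv1 ?(ltW t0)// mulNr mulfV//.
by rewrite gt_eqF.
Qed.

Lemma rsgn_mul (t : R) : t != 0 -> rsgn t * t = `|t|.
Proof.
move=> t0; rewrite /rsgn powR_inv1// mulrAC -expr2 -(real_normK (num_real t)) expr2 mulfK//.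
by rewrite normr_eq0.
Qed.

(** The factor 6 |x2| |t| is the modulus of the second derivative of the phase. On each half-line
    the integrand is thus, up to sign, the derivative of atan(p1/rho)/rho, p1 being the first
    derivative; the four end points contribute at most pi/(2 rho) each. *)
Lemma Rint_cden (e T : R) : 0 < e -> e < T ->
  let g t := if e <= `|t| <= T then 6 * `|x2| * `|t| * (cden t)^-1 else 0 in
  itg leb g /\ \int[leb]_t g t <= 2 * pi / rho.
Proof.
move=> e0 eT.
pose F t := Num.sg x2 / rho * (rsgn t * atan (rho^-1 * cphase1 t)).
have dF t : t != 0 -> is_derive t (1 : R) F (6 * `|x2| * `|t| * (cden t)^-1).
  move=> t0; have h1 := is_deriveZR rho^-1 (is_derive_cphase1 t).
  have h2 := is_derive_compR (f := fun t => rho^-1 * cphase1 t) (is_derive1_atan (rho^-1 * cphase1 t)) h1.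
  apply: (is_derive_eqR (is_deriveZR (Num.sg x2 / rho) (is_deriveMR (is_derive_rsgn t0) h2))).
  rewrite mul0r addr0 -(rsgn_mul t0) -[`|x2|]/`|x2| normrEsg /cden.
  have rn : rho != 0 by rewrite gt_eqF.
  have d0 := cden_gt0 t; rewrite /cden in d0.
  have -> : 1 + (rho^-1 * cphase1 t) ^+ 2 = (rho ^+ 2 + cphase1 t ^+ 2) / rho ^+ 2 by field.
  by field; rewrite rn gt_eqF.
have cf t : t != 0 -> {for t, continuous (fun t => 6 * `|x2| * `|t| * (cden t)^-1)}.
  move=> t0; apply: cvgM; last exact: cont_cden_inv.
  by apply: cvgM; [exact: cvg_cst|exact: norm_continuous].
move=> g; have [j ->] := Rint_annulus e0 eT (measurable_off0 cf) dF cf; split=> //.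
have T0 := lt_trans e0 eT.
have [s1 s2] := rsgnE e0; have [s3 s4] := rsgnE T0.
rewrite /F s1 s2 s3 s4.
have ab y : `|Num.sg x2 / rho * atan y| <= pi / 2 / rho.
  rewrite !normrM normfV (gtr0_norm rho0) mulrAC ler_wpM2r ?invr_ge0 ?(ltW rho0)//.
  have a1 : `|atan y| <= pi / 2 by rewrite ler_norml (ltW (atan_gtNpi2 y)) (ltW (atan_ltpi2 y)).
  by rewrite normr_sg -[pi / 2]mul1r ler_pM// lern1 leq_b1.
have := ab (rho^-1 * cphase1 (- e)); have := ab (rho^-1 * cphase1 (- T)).
have := ab (rho^-1 * cphase1 T); have := ab (rho^-1 * cphase1 e).
rewrite !ler_norml => /andP[? ?] /andP[? ?] /andP[? ?] /andP[? ?].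
rewrite (_ : 2 * pi / rho = 4 * (pi / 2 / rho)); last by field; rewrite gt_eqF.
lra.
Qed.

End Phase.

(** If x1 and x2 have opposite signs there are two critical points t0 and -t0, and the derivative
    factors as 3 x2 (|t| - t0)(|t| + t0). Otherwise its two terms do not cancel, and t0 = 0
    serves. *)
Lemma cphase1_lower (x1 x2 : R) : exists t0, forall t,
  3 * `|x2| * (`|t| - t0) ^+ 2 <= `|cphase1 x1 x2 t|.
Proof.
have [x12|x12] := ltP (x1 * x2) 0.
  have x20 : x2 != 0 by apply: contraTneq x12 => ->; rewrite mulr0 ltxx.
  have y0 : 0 <= - x1 / (3 * x2).
    have -> : - x1 / (3 * x2) = - (x1 * x2) / (3 * x2 ^+ 2) by field.
    apply: divr_ge0; first by rewrite oppr_ge0 ltW.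
    by rewrite mulr_ge0 ?sqr_ge0.
  exists (Num.sqrt (- x1 / (3 * x2))) => t; set s := Num.sqrt _.
  have s0 : 0 <= s by exact: sqrtr_ge0.
  have ss : s ^+ 2 = - x1 / (3 * x2) by rewrite sqr_sqrtr.
  have -> : cphase1 x1 x2 t = 3 * x2 * (`|t| - s) * (`|t| + s).
    have -> : 3 * x2 * (`|t| - s) * (`|t| + s) = 3 * x2 * (`|t| ^+ 2 - s ^+ 2) by ring.
    by rewrite ss real_normK ?num_real// /cphase1; field.
  rewrite !normrM (ger0_norm (_ : 0 <= 3))// -!mulrA ler_wpM2l// ler_wpM2l//.
  rewrite -(real_normK (num_real (`|t| - s))) expr2 ler_wpM2l//.
  rewrite (ger0_norm (addr_ge0 (normr_ge0 _) s0)) ler_norml.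
  by have := normr_ge0 t => t0; apply/andP; split; lra.
exists 0 => t; rewrite subr0 /cphase1.
have h : 0 <= x1 * (3 * x2 * t ^+ 2).
  have -> : x1 * (3 * x2 * t ^+ 2) = 3 * (x1 * x2) * t ^+ 2 by ring.
  by rewrite mulr_ge0 ?sqr_ge0// mulr_ge0.
have -> : 3 * `|x2| * `|t| ^+ 2 = `|3 * x2 * t ^+ 2|.
  by rewrite !normrM (ger0_norm (_ : 0 <= 3))// normrX.
rewrite -ler_sqr ?nnegrE// !real_normK ?num_real// sqrrD.
by have := sqr_ge0 x1; lra.
Qed.

(** If |x2| is at least rho^3/(12 T^2), quadratic growth away from the critical points compares the
    quotient with a Lorentzian of width 1/rho around one of them. Otherwise |x1| >= rho^3/2
    dominates, the derivative is at least rho^3/4 for |t| <= T, and the quotient is at most 16/rho.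
    The constant covers 2 T^2 + 1 from the first case and 16 from the second. *)
Lemma cden_inv_le (T x1 x2 rho : R) : 1 <= T -> 2 <= rho -> rho ^+ 6 = 1 + x1 ^+ 2 + x2 ^+ 2 ->
  exists t0, forall t, `|t| <= T ->
  rho ^+ 2 * (cden x1 x2 rho t)^-1 <=
    (2 * T ^+ 2 + 17) * (w1 (rho * (t - t0)) + w1 (rho * (t + t0)) + rho^-1).
Proof.
move=> T1 r2 r6; have r0 : 0 < rho by lra.
have T2 : 1 <= T ^+ 2 by rewrite exprn_ege1.
have r3 : 8 <= rho ^+ 3 by rewrite (_ : 8 = 2 ^+ 3); [rewrite lerXn2r ?nnegrE//; lra|ring].
have [t0 Ht0] := cphase1_lower x1 x2; exists t0 => t tT.
have d0 := cden_gt0 x1 x2 r0 t.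
set den := cden x1 x2 rho t in d0 *; have denE : den = rho ^+ 2 + `|cphase1 x1 x2 t| ^+ 2.
  by rewrite /den /cden real_normK ?num_real.
have w0 := fun y : R => ltW (w1_gt0 y).
have ri0 : 0 <= rho^-1 by rewrite invr_ge0 ltW.
set P := `|cphase1 x1 x2 t| in denE; have P0 : 0 <= P by exact: normr_ge0.
have [x2l|x2s] := leP (rho ^+ 3) (12 * T ^+ 2 * `|x2|).
  have Hs : rho ^+ 2 * den^-1 <= (2 * T ^+ 2 + 17) * w1 (rho * (`|t| - t0)).
    rewrite /w1 ler_pdivrMr// mulrAC ler_pdivlMr ?ltr_wpDr ?sqr_ge0// denE.
    have := Ht0 t; rewrite -/P; set s2 := (`|t| - t0) ^+ 2.
    rewrite exprMn -/s2; have s20 : 0 <= s2 by exact: sqr_ge0.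
    move=> hP; have h1 : rho ^+ 3 * s2 <= 4 * T ^+ 2 * P.
      apply: (@le_trans _ _ (12 * T ^+ 2 * `|x2| * s2)); first by rewrite ler_wpM2r.
      have -> : 12 * T ^+ 2 * `|x2| * s2 = 4 * T ^+ 2 * (3 * `|x2| * s2) by ring.
      by rewrite ler_wpM2l// mulr_ge0// sqr_ge0.
    have h2 : rho * (rho ^+ 3 * s2) <= rho * (4 * T ^+ 2 * P) by rewrite ler_wpM2l// ltW.
    have h3 : 2 * (rho * P) <= rho ^+ 2 + P ^+ 2 by have := sqr_ge0 (rho - P); rewrite sqrrB; lra.
    have h4 : 2 * T ^+ 2 * (2 * (rho * P)) <= 2 * T ^+ 2 * (rho ^+ 2 + P ^+ 2).
      by rewrite ler_wpM2l// mulr_ge0// sqr_ge0.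
    have q0 : 0 <= rho ^+ 2 + P ^+ 2 by rewrite addr_ge0 ?sqr_ge0.
    have := sqr_ge0 P; have := sqr_ge0 rho.
    have -> : rho ^+ 2 * (1 + rho ^+ 2 * s2) = rho ^+ 2 + rho * (rho ^+ 3 * s2) by ring.
    move=> ? ?; lra.
  have C0 : 0 <= 2 * T ^+ 2 + 17 by rewrite addr_ge0// mulr_ge0// sqr_ge0.
  apply: le_trans Hs _; rewrite ler_wpM2l//.
  have ew (y : R) : w1 (- y) = w1 y by rewrite /w1 sqrrN.
  have := w0 (rho * (t - t0)); have := w0 (rho * (t + t0)).
  have [tp|tn] := ger0P t; first by move=> ? ?; lra.
  by rewrite (_ : rho * (- t - t0) = - (rho * (t + t0))) ?ew; [move=> ? ?; lra|ring].
have x2b : `|x2| <= rho ^+ 3 / (12 * T ^+ 2).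
  have c0 : 0 < 12 * T ^+ 2 by lra.
  by rewrite (ler_pdivlMr _ _ c0) mulrC ltW.
have x2c : `|x2| <= rho ^+ 3 / 12.
  rewrite ler_pdivlMr// mulrC; apply: le_trans (ltW x2s).
  by rewrite ler_wpM2r// ler_peMr.
have x1b : rho ^+ 3 / 2 <= `|x1|.
  rewrite leNgt; apply/negP => x1s.
  have e6 : rho ^+ 6 = rho ^+ 3 * rho ^+ 3 by rewrite -exprD.
  have h1 : x1 ^+ 2 <= (rho ^+ 3 / 2) ^+ 2.
    by rewrite -(real_normK (num_real x1)) lerXn2r ?nnegrE// ?ltW// divr_gt0//; lra.
  have h2 : x2 ^+ 2 <= (rho ^+ 3 / 12) ^+ 2.
    by rewrite -(real_normK (num_real x2)) lerXn2r ?nnegrE// ltW// divr_gt0//; lra.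
  move: r6 h1 h2; rewrite e6; set r := rho ^+ 3 in r3 *; nra.
have Pb : rho ^+ 3 / 4 <= P.
  have h : `|3 * x2 * t ^+ 2| <= rho ^+ 3 / 4.
    rewrite normrM normrM (ger0_norm (_ : 0 <= 3))// normrX.
    have t2 : `|t| ^+ 2 <= T ^+ 2 by rewrite lerXn2r ?nnegrE//; lra.
    have := ler_wpM2l (_ : 0 <= 3 * `|x2|) t2 => /(_ (mulr_ge0 (ler0n _ 3) (normr_ge0 _))).
    move: (ltW x2s); lra.
  rewrite /P /cphase1; have := lerB_dist x1 (- (3 * x2 * t ^+ 2)); rewrite opprK normrN; lra.
have h : rho ^+ 2 * den^-1 <= 16 * rho^-1.
  rewrite ler_pdivrMr// mulrAC ler_pdivlMr// denE -exprSr.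
  have : (rho ^+ 3 / 4) ^+ 2 <= P ^+ 2 by rewrite lerXn2r ?nnegrE//; lra.
  have := sqr_ge0 rho; set r := rho ^+ 3 in r3 *; nra.
apply: le_trans h _.
have := w0 (rho * (t - t0)); have := w0 (rho * (t + t0)).
set u1 := w1 _; set u2 := w1 _ => u10 u20.
by apply: ler_pM => //; lra.
Qed.

Definition ibd (f : R -> R) (B : R) := itg leb f /\ \int[leb]_t f t <= B.

Lemma ibdD f g A B : ibd f A -> ibd g B -> ibd (fun t => f t + g t) (A + B).
Proof. by move=> [jf fA] [jg gB]; split; [exact: itgD|rewrite RintegralD// lerD]. Qed.

Lemma ibdZ (c : R) f A : 0 <= c -> ibd f A -> ibd (fun t => c * f t) (c * A).
Proof. by move=> c0 [jf fA]; split; [exact: itgZ|rewrite RintegralZl// ler_wpM2l]. Qed.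

Lemma ibd_box T : 0 <= T -> ibd (box T) (2 * T).
Proof. by move=> T0; split; [exact: itg_box|rewrite Rint_box]. Qed.

Lemma ibd_w1 (rho a : R) : 0 < rho -> ibd (fun t => w1 (rho * (t + a))) (pi / rho).
Proof.
move=> r0; have [j i] := w1_int (R := R).
have [j' i'] := Rint_aff (rho * a) (lt0r_neq0 r0) j.
have E : (fun t => w1 (rho * (t + a))) = fun t => w1 (rho * t + rho * a).
  by apply/funext => t; rewrite mulrDr.
by split; rewrite E// i' i (gtr0_norm r0) mulrC.
Qed.

(* Integration by parts with p1 / (rho^2 + p1^2) in place of 1 / p1, where p1 is the derivative
   of the phase: the remainder rho^2 / (rho^2 + p1^2) has an integral of order 1 / rho, so that
   the neighbourhoods of the critical points need no separate treatment. *)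
Lemma vdc_real (T M M1 b : R) : 1 <= T -> 0 <= M -> 0 <= M1 -> 0 < b -> b < 1 ->
  exists C : R, forall (z : R -> R[i]) (x1 x2 rho : R), csmooth z -> vanishing T z ->
    (forall t, cabs (z t) <= M) -> (forall t, cabs (cD (1 : R) z t) <= M1) ->
    2 <= rho -> rho ^+ 6 = 1 + x1 ^+ 2 + x2 ^+ 2 ->
    let P t := im_fun z t * cos (cphase x1 x2 t) - re_fun z t * sin (cphase x1 x2 t) in
    itg leb (fun t => P t * `|t| `^ (- b)) ->
    \int[leb]_t (P t * `|t| `^ (- b)) <= C * (rho `^ b / rho).
Proof.
move=> T1 M0 M10 b0 b1.
pose C1 := 2 * T ^+ 2 + 17.
(* One summand for each of the six majorants collected in [iU]: the part |t| < 1/rho, the boundary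
   terms, and four remainders. *)
pose C := M * 2 / (1 - b) + M + M * C1 * (2 * pi + 2 * T) + M1 * T + M * (2 * pi) + M.
exists C => z x1 x2 rho sz zT zM zM1 r2 r6 P jP.
have r0 : 0 < rho by lra.
pose p := cphase x1 x2; pose p1 := cphase1 x1 x2; pose q := cquot x1 x2 rho; pose q1 := cquot1 x1 x2 rho.
(* S and P are the real and imaginary parts of z exp(-i p). Hence S' is p1 P plus the term S1, in
   which only z is differentiated. *)
pose S t := re_fun z t * cos (p t) + im_fun z t * sin (p t).
pose S1 t := 'D_1 (re_fun z) t * cos (p t) + 'D_1 (im_fun z) t * sin (p t).
have dS t : is_derive t (1 : R) S (p1 t * P t + S1 t).
  have dp := is_derive_cphase x1 x2 t.
  have dc := is_derive_compR (f := p) (is_derive_cos (p t)) dp.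
  have ds := is_derive_compR (f := p) (is_derive_sin (p t)) dp.
  have h := is_deriveDR (is_deriveMR (is_derive_smooth t sz.1) dc) (is_deriveMR (is_derive_smooth t sz.2) ds).
  by apply: (is_derive_eqR h); rewrite /S1 /P /p1 /p; ring.
have rot (w : R[i]) t : `|complex.Re w * cos (p t) + complex.Im w * sin (p t)| <= cabs w.
  have -> : complex.Re w * cos (p t) + complex.Im w * sin (p t) = complex.Re (cis (- p t) * w).
    by rewrite cReM /cis /= cosN sinN; ring.
  by rewrite (le_trans (Re_le_cabs _))// cabsM cabs_cis mul1r.
have SM t : `|S t| <= M by rewrite (le_trans (rot (z t) t)).
have S1M t : `|S1 t| <= M1 by rewrite (le_trans (rot (cD (1 : R) z t) t)).
have PM t : `|P t| <= M.
  have -> : P t = complex.Re (- 'i * z t) * cos (p t) + complex.Im (- 'i * z t) * sin (p t).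
    by rewrite cReM cImM cReN cImN /= /P /p /re_fun /im_fun; ring.
  rewrite (le_trans (rot _ t))// cabsM cabsN [cabs 'i]/cabs /= expr0n /= add0r expr1n sqrtr1 mul1r//.
pose g (t : R) : R := `|t| `^ (- b).
pose F t := S t * q t * g t.
pose F' t := ((p1 t * P t + S1 t) * q t + S t * q1 t) * g t + S t * q t * (t^-1 * (- b * g t)).
have dF t : t != 0 -> is_derive t (1 : R) F (F' t).
  move=> t0; have h := is_deriveMR (is_deriveMR (dS t) (is_derive_cquot x1 x2 r0 t)) (is_derive_powabs (- b) t0).
  by apply: (is_derive_eqR h); rewrite /F' /g /q /q1; ring.
pose D := rho `^ b; have D0 : 0 < D by exact: powR_gt0.
(* For |t| < 1/rho absolute values suffice, as |t|^-b has an integral of order rho^b/rho there;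
   outside, |t|^-b is at most D = rho^b. *)
pose e := rho^-1; have e0 : 0 < e by rewrite invr_gt0.
have eT : e < T by rewrite (lt_le_trans _ T1)// invf_lt1//; lra.
have T0 : 0 < T by lra.
have g0 t : 0 <= g t by exact: powR_ge0.
have gD t : e <= `|t| -> g t <= D.
  move=> et; have -> : D = e `^ (- b) by rewrite /e /D -powR_inv1 ?(ltW r0)// -powRrM mulrNN mul1r.
  by apply: ler_powR_neg => //; rewrite oppr_le0 ltW.
have gDe t : `|t| = e -> `|S t * q t * g t| <= M * (2 * rho)^-1 * D.
  move=> te; rewrite normrM (ger0_norm (g0 t)) (normrM (S t)) ler_pM ?mulr_ge0//; last by rewrite gD// te.
  by rewrite ler_pM//; exact: cquot_le.
have contM0 (f h : R -> R) t : {for t, continuous f} -> {for t, continuous h} ->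
    {for t, continuous (fun t => f t * h t)} by move=> cf ch; exact: cvgM.
have contD0 (f h : R -> R) t : {for t, continuous f} -> {for t, continuous h} ->
    {for t, continuous (fun t => f t + h t)} by move=> cf ch; exact: cvgD.
have contN0 (f : R -> R) t : {for t, continuous f} -> {for t, continuous (fun t => - f t)}.
  by move=> cf; exact: cvgN.
have cg t : t != 0 -> {for t, continuous g} by move=> t0; exact: is_derive_cont (is_derive_powabs (- b) t0).
have cp t : {for t, continuous p} by exact: is_derive_cont (is_derive_cphase x1 x2 t).
have ccos t : {for t, continuous (fun t => cos (p t))}.
  by apply: (continuous_comp (f := p) (g := @cos R)); [exact: cp|exact: continuous_cos].
have csin t : {for t, continuous (fun t => sin (p t))}.
  by apply: (continuous_comp (f := p) (g := @sin R)); [exact: cp|exact: continuous_sin].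
have cp1 t : {for t, continuous p1} by exact: is_derive_cont (is_derive_cphase1 x1 x2 t).
have cq t : {for t, continuous q} by exact: is_derive_cont (is_derive_cquot x1 x2 r0 t).
have cS t : {for t, continuous S} by exact: is_derive_cont (dS t).
have cz1 t : {for t, continuous (re_fun z)} by exact: (smooth_cont sz.1).
have cz2 t : {for t, continuous (im_fun z)} by exact: (smooth_cont sz.2).
have cdz1 t : {for t, continuous ('D_1 (re_fun z))} by exact: (smooth_cont (smooth_D (1 : R) sz.1)).
have cdz2 t : {for t, continuous ('D_1 (im_fun z))} by exact: (smooth_cont (smooth_D (1 : R) sz.2)).
have cP t : {for t, continuous P}.
  exact: (contD0 _ _ t (contM0 _ _ t (cz2 t) (ccos t)) (contN0 _ t (contM0 _ _ t (cz1 t) (csin t)))).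
have cS1 t : {for t, continuous S1}.
  exact: (contD0 _ _ t (contM0 _ _ t (cdz1 t) (ccos t)) (contM0 _ _ t (cdz2 t) (csin t))).
have cdi t : {for t, continuous (fun t => (cden x1 x2 rho t)^-1)} by have h := @cont_cden_inv x1 x2 rho r0 t; exact: h.
have ccst (a : R) t : {for t, continuous (fun _ : R => a)} by exact: cvg_cst.
have cid t : {for t, continuous (fun t : R => t)} by exact: cvg_id.
have cq1 t : {for t, continuous q1}.
  exact: (contM0 _ _ t (contM0 _ _ t (contM0 _ _ t (ccst (6 * x2) t) (cid t))
    (contD0 _ _ t (ccst (rho ^+ 2) t) (contN0 _ t (contM0 _ _ t (cp1 t) (cp1 t)))))
    (contM0 _ _ t (cdi t) (cdi t))).
have cinv (t : R) : t != 0 -> {for t, continuous (fun t : R => t^-1)} by move=> t0; exact: inv_continuous.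
have cF' t : t != 0 -> {for t, continuous F'}.
  move=> t0; exact: (contD0 _ _ t (contM0 _ _ t (contD0 _ _ t (contM0 _ _ t
    (contD0 _ _ t (contM0 _ _ t (cp1 t) (cP t)) (cS1 t)) (cq t)) (contM0 _ _ t (cS t) (cq1 t))) (cg t t0))
    (contM0 _ _ t (contM0 _ _ t (cS t) (cq t)) (contM0 _ _ t (cinv t t0) (contM0 _ _ t (ccst (- b) t) (cg t t0))))).
pose gF t := if e <= `|t| <= T then F' t else 0.
have iF : ibd gF (M * D / rho).
  have [j iE] := Rint_annulus e0 eT (measurable_off0 cF') dF cF'; split; first exact: j.
  apply: le_trans (_ : F (- e) - F (- T) + (F T - F e) <= _); first by rewrite -iE.
  have ST t : T <= `|t| -> S t = 0 by move=> /zT; rewrite /S /re_fun /im_fun => ->; rewrite /= !mul0r addr0.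
  have FT t : T <= `|t| -> F t = 0 by move=> /ST; rewrite /F => ->; rewrite !mul0r.
  have aT : `|T| = T by rewrite ger0_norm// ltW.
  rewrite (FT T) ?aT// (FT (- T)) ?normrN ?aT//.
  have ae : `|e| = e by rewrite ger0_norm// ltW.
  have := gDe e ae; have := gDe (- e) (_ : `|- e| = e); rewrite normrN => /(_ ae).
  rewrite -!/(F _) !ler_norml => /andP[? ?] /andP[? ?].
  have -> : M * D / rho = 2 * (M * (2 * rho)^-1 * D) by field; rewrite gt_eqF.
  lra.
pose F3 t := -1 * (rsgn t * g t).
pose f3 t := b * `|t| `^ (-1) * g t.
have dF3 t : t != 0 -> is_derive t (1 : R) F3 (f3 t).
  move=> t0; have h := is_deriveZR (-1) (is_deriveMR (is_derive_rsgn t0) (is_derive_powabs (- b) t0)).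
  by apply: (is_derive_eqR h); rewrite /f3 /rsgn /g; field.
have cf3 t : t != 0 -> {for t, continuous f3}.
  move=> t0; exact: (contM0 _ _ t (contM0 _ _ t (ccst b t)
    (is_derive_cont (is_derive_powabs (-1) t0))) (cg t t0)).
pose g3 t := if e <= `|t| <= T then f3 t else 0.
have i3 : ibd g3 (2 * D).
  have [j iE] := Rint_annulus e0 eT (measurable_off0 cf3) dF3 cf3; split; first exact: j.
  apply: le_trans (_ : F3 (- e) - F3 (- T) + (F3 T - F3 e) <= _); first by rewrite -iE.
  have [s1 s2] := rsgnE e0; have [s3 s4] := rsgnE T0.
  have gN t : g (- t) = g t by rewrite /g normrN.
  have ge : g e <= D by rewrite gD// ger0_norm// ltW.
  by rewrite /F3 s1 s2 s3 s4 !gN; have := g0 T; lra.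
have [t0 Ht0] := cden_inv_le T1 r2 r6.
have i2 := Rint_cden x1 x2 r0 e0 eT; cbv zeta in i2.
set g2 := (fun t => if _ then _ else 0) in i2.
have ibox := ibd_box (ltW T0).
have ig : ibd (fun t => box e t * g t) (2 / (1 - b) * (D / rho)).
  have [j i] := itg_powabs (lt0r_neq0 b0) b1 e0; split=> //; apply: le_trans i _.
  have -> : e `^ (1 - b) = D / rho.
    rewrite /e -powR_inv1 ?(ltW r0)// -powRrM /D.
    by rewrite -powRD ?(gt_eqF r0) ?implybT//; congr powR; ring.
  by rewrite mulrAC.
have D0' := ltW D0; have r0' := ltW r0.
have C10 : 0 <= C1 by rewrite /C1 addr_ge0// mulr_ge0// sqr_ge0.
have ri0 : 0 <= rho^-1 by rewrite invr_ge0.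
have r2i0 : 0 <= (2 * rho)^-1 by rewrite invr_ge0 mulr_ge0.
have iU := ibdD (ibdD (ibdD (ibdD (ibdD (ibdZ M0 ig) iF)
  (ibdZ (mulr_ge0 (mulr_ge0 M0 D0') C10) (ibdD (ibdD (ibd_w1 (- t0) r0) (ibd_w1 t0 r0)) (ibdZ ri0 ibox))))
  (ibdZ (mulr_ge0 (mulr_ge0 M10 r2i0) D0') ibox)) (ibdZ (mulr_ge0 M0 D0') i2))
  (ibdZ (mulr_ge0 M0 r2i0) i3).
have -> : C * (rho `^ b / rho) = M * (2 / (1 - b) * (D / rho)) + M * D / rho +
    M * D * C1 * (pi / rho + pi / rho + rho^-1 * (2 * T)) + M1 * (2 * rho)^-1 * D * (2 * T) +
    M * D * (2 * pi / rho) + M * (2 * rho)^-1 * (2 * D).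
  rewrite /C /D; field; rewrite gt_eqF//= gt_eqF// subr_gt0//.
move: iU => [jU]; apply: le_trans; apply: le_Rint => // t.
have w10 (y : R) : 0 <= w1 y by rewrite ltW// w1_gt0.
have gF3 : 0 <= g3 t by rewrite /g3 /f3; case: ifP => _ //; rewrite !mulr_ge0 ?powR_ge0 ?g0 ?(ltW b0).
have g20 : 0 <= g2 t.
  by rewrite /g2; case: ifP => _ //; rewrite !mulr_ge0 ?invr_ge0 ?(ltW (cden_gt0 _ _ r0 _)).
have B3 : 0 <= M * D * C1 * (w1 (rho * (t - t0)) + w1 (rho * (t + t0)) + rho^-1 * box T t).
  apply: mulr_ge0; first by rewrite mulr_ge0// mulr_ge0.
  by rewrite addr_ge0 ?mulr_ge0 ?box_ge0// addr_ge0.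
have B4 : 0 <= M1 * (2 * rho)^-1 * D * box T t by rewrite !mulr_ge0 ?box_ge0.
have B5 : 0 <= M * D * g2 t by rewrite !mulr_ge0.
have B6 : 0 <= M * (2 * rho)^-1 * g3 t by rewrite !mulr_ge0.
have B1 : 0 <= M * (box e t * g t) by rewrite !mulr_ge0 ?box_ge0 ?g0.
rewrite -/(g t).
have [te|te] := ltP `|t| e.
  have -> : gF t = 0 by rewrite /gF leNgt te.
  have : P t * g t <= M * (box e t * g t).
    by rewrite boxE (ltW te) mul1r ler_wpM2r ?g0// (le_trans (ler_norm _)).
  move=> ?; rewrite addr0; lra.
have [tT|tT] := leP `|t| T; last first.
  have -> : P t = 0 by rewrite /P /re_fun /im_fun zT ?(ltW tT)//= !mul0r subrr.
  have -> : gF t = 0 by rewrite /gF leNgt (ltNge T) in tT *; rewrite (negPf tT) andbF.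
  rewrite mul0r; lra.
have t_n0 : t != 0 by rewrite -normr_gt0 (lt_le_trans e0).
have gFE : gF t = F' t by rewrite /gF te tT.
have g2E : g2 t = 6 * `|x2| * `|t| * (cden x1 x2 rho t)^-1 by rewrite /g2 te tT.
have g3E : g3 t = f3 t by rewrite /g3 te tT.
have bT : box T t = 1 by rewrite boxE tT.
have gtD := gD t te.
have d0 := cden_gt0 x1 x2 r0 t.
pose rr := rho ^+ 2 * (cden x1 x2 rho t)^-1.
have rr0 : 0 <= rr by rewrite /rr mulr_ge0 ?sqr_ge0 ?invr_ge0 ?ltW.
(* Since p1 q = 1 - rr, the derivative F' reproduces P g up to four terms: the regularization rr,
   and the derivatives falling on z, on q and on |t|^-b. They are bounded in [H1], [H2], [H3] and
   [H4]. *)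
have EP : P t * g t = F' t + (P t * g t * rr - S1 t * q t * g t - S t * q1 t * g t
    + S t * q t * (t^-1 * b * g t)).
  have E1 : p1 t * q t = 1 - rr.
    rewrite /rr /p1 /q /cquot /cden; field.
    by rewrite -/(cden x1 x2 rho t) gt_eqF.
  have E2 : p1 t * P t * q t = P t - P t * rr by rewrite mulrAC E1; ring.
  rewrite /F' (mulrDl (p1 t * P t)) E2; ring.
have H1 : P t * g t * rr <= M * D * C1 * (w1 (rho * (t - t0)) + w1 (rho * (t + t0)) + rho^-1 * box T t).
  rewrite bT mulr1 -mulrA -[M * D * C1]mulrA -mulrA.
  apply: (@le_trans _ _ (M * (g t * rr))).
    have gr0 : 0 <= g t * rr by exact: mulr_ge0 (g0 t) rr0.
    by apply: (ler_wpM2r gr0); exact: le_trans (ler_norm _) (PM t).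
  rewrite ler_wpM2l// -mulrA; exact: (ler_pM (g0 t) rr0 gtD (Ht0 t tT)).
have H2 : - (S1 t * q t * g t) <= M1 * (2 * rho)^-1 * D * box T t.
  rewrite bT mulr1 (le_trans (ler_norm _))// normrN normrM (ger0_norm (g0 t)) (normrM (S1 t)).
  by rewrite ler_pM ?mulr_ge0 ?g0// ler_pM//; exact: cquot_le.
have H3 : - (S t * q1 t * g t) <= M * D * g2 t.
  rewrite g2E (le_trans (ler_norm _))// normrN normrM (ger0_norm (g0 t)) (normrM (S t)) [M * D * _]mulrAC.
  by rewrite ler_pM ?mulr_ge0 ?g0// ler_pM//; exact: cquot1_le.
have H4 : S t * q t * (t^-1 * b * g t) <= M * (2 * rho)^-1 * g3 t.
  rewrite g3E (le_trans (ler_norm _))// normrM (normrM (S t)) ler_pM ?mulr_ge0//.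
    by rewrite ler_pM//; exact: cquot_le.
  rewrite !normrM (ger0_norm (g0 t)) normfV (ger0_norm (ltW b0)) /f3 powR_inv1// [b * _]mulrC.
  exact: lexx.
rewrite EP gFE; lra.
Qed.

Definition curve_mult (k : R -> R[i]) (xi : R * R) : R[i] :=
  cint leb (fun t => cis (- cphase xi.1 xi.2 t) * k t).

Lemma curve_mult_citg k xi : citg leb k -> citg leb (fun t => cis (- cphase xi.1 xi.2 t) * k t).
Proof.
move=> jk; apply: (citgM_bounded (M := 1) jk) => [|x]; last by rewrite cabs_cis.
apply: cmeas_cis; apply: (measurableT_comp (@oppr_measurable R setT)).
by apply: continuous_measurable_fun => t; exact: is_derive_cont (is_derive_cphase xi.1 xi.2 t).
Qed.

Lemma curve_mult_bound k xi : citg leb k -> cabs (curve_mult k xi) <= \int[leb]_t cabs (k t).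
Proof.
move=> jk; apply: cint_norm_le; [exact: curve_mult_citg|exact: citg_cabs|].
by move=> x; rewrite cabsM cabs_cis mul1r.
Qed.

(** With rho = <xi>^(1/3) the bound rho^(b-1) is the power (b - 1)/6 of [jb]. For rho <= 2 it holds
    by the L^1 norm of the weight; beyond, [vdc_real] bounds a real integral from above, which
    suffices once the multiplier has been rotated to its modulus. *)
Lemma curve_mult_decay (chi : R -> R[i]) (b : R) : test_function chi -> 0 < b -> b < 1 ->
  citg leb (power_weight chi b) ->
  exists2 C : R, 0 < C & forall xi, cabs (curve_mult (power_weight chi b) xi) <= C * jb xi `^ ((b - 1) / 6).
Proof.
move=> tc b0 b1 jk; have [A A0 cA] := cs_bound tc.2.
have [M M0 cM] := test_bound tc; have [M1 M10 cM1] := test_bound (test_cD (1 : R) tc).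
pose T := A + 1; have T1 : 1 <= T by rewrite /T lerDr ltW.
have cT : vanishing T chi by move=> t tT; apply: cA; apply: lt_le_trans tT; rewrite ltrDl.
have [C0 HC0] := vdc_real T1 (ltW M0) (ltW M10) b0 b1.
set I := \int[leb]_t cabs (power_weight chi b t).
have I0 : 0 <= I by apply: Rintegral_ge0 => t _; exact: cabs_ge0.
exists (`|C0| + I * 2 `^ (1 - b) + 1) => [|xi].
  by rewrite ltr_wpDl// addr_ge0// mulr_ge0 ?powR_ge0.
pose rho := jb xi `^ (6^-1).
have rho0 : 0 < rho by rewrite powR_gt0 ?jb_gt0.
have -> : jb xi `^ ((b - 1) / 6) = rho `^ (b - 1) by rewrite /rho -powRrM mulrC.
have p0 : 0 <= rho `^ (b - 1) by exact: powR_ge0.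
have [r2|r2] := leP rho 2.
  rewrite (le_trans (curve_mult_bound xi jk))// -/I.
  have h : 2 `^ (b - 1) <= rho `^ (b - 1) by apply: ler_powR_neg => //; lra.
  have h2 : 2 `^ (1 - b) * 2 `^ (b - 1) = 1 :> R.
    have e0 : 1 - b + (b - 1) = 0 by ring.
    by rewrite -powRD ?e0 ?powRr0// eqxx /= pnatr_eq0.
  apply: (@le_trans _ _ (I * 2 `^ (1 - b) * rho `^ (b - 1))).
    by rewrite -mulrA ler_peMr// -[leLHS]h2 ler_wpM2l ?powR_ge0.
  by rewrite ler_wpM2r// -addrA [leRHS]addrC -addrA lerDl addr_ge0.
have r6 : rho ^+ 6 = 1 + xi.1 ^+ 2 + xi.2 ^+ 2.
  rewrite -powR_mulrn ?(ltW rho0)// /rho -powRrM mulVf// powRr1 ?(ltW (jb_gt0 _))//.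
  by rewrite /jb /dot2 -!expr2 addrA.
have [c c1 cE] := unimodular (curve_mult (power_weight chi b) xi).
(* The factor i turns the real part of the rotated integrand into the imaginary part P that
   [vdc_real] estimates. *)
pose z t := c * 'i * chi t.
have ci : cabs (c * 'i) = 1 by rewrite cabsM c1 [cabs 'i]/cabs /= expr0n /= add0r expr1n sqrtr1 mul1r.
have sz : csmooth z by apply: csmoothM; [exact: csmooth_cst|exact: tc.1].
have zT : vanishing T z by move=> t tT; rewrite /z cT// mulr0.
have zM t : cabs (z t) <= M by rewrite /z cabsM ci mul1r.
have zM1 t : cabs (cD (1 : R) z t) <= M1.
  by rewrite /z (cDZ (1 : R) (c * 'i) tc.1) cabsM ci mul1r.
have E t : complex.Re (c * (cis (- cphase xi.1 xi.2 t) * power_weight chi b t)) =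
    (im_fun z t * cos (cphase xi.1 xi.2 t) - re_fun z t * sin (cphase xi.1 xi.2 t)) * `|t| `^ (- b).
  rewrite /power_weight -fmorphV -powRN.
  have -> : c * (cis (- cphase xi.1 xi.2 t) * (chi t * (`|t| `^ (- b))%:C)) =
     (`|t| `^ (- b))%:C * (- 'i * (cis (- cphase xi.1 xi.2 t) * z t)).
    have i2 : 'i * 'i = -1 :> R[i] by rewrite -expr2 sqr_i.
    rewrite /z; transitivity (- ('i * 'i) * (c * (cis (- cphase xi.1 xi.2 t) * (chi t * (`|t| `^ (- b))%:C)))).
      by rewrite i2 opprK mul1r.
    ring.
  rewrite cReZ mulrC; congr (_ * _).
  rewrite cReM cReN cImN cImM /cis /= cosN sinN /re_fun /im_fun; ring.
have J := citgZ c (curve_mult_citg xi jk).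
have jP : itg leb (fun t => (im_fun z t * cos (cphase xi.1 xi.2 t) - re_fun z t * sin (cphase xi.1 xi.2 t)) * `|t| `^ (- b)).
  by have := J.1; congr itg; apply/funext => t; rewrite /re_fun E.
have main := HC0 z xi.1 xi.2 rho sz zT zM zM1 (ltW r2) r6 jP.
have -> : cabs (curve_mult (power_weight chi b) xi) =
    \int[leb]_t ((im_fun z t * cos (cphase xi.1 xi.2 t) - re_fun z t * sin (cphase xi.1 xi.2 t)) * `|t| `^ (- b)).
  rewrite -[LHS]/(complex.Re (cabs (curve_mult (power_weight chi b) xi))%:C) -cE /curve_mult -(cintZ _ (curve_mult_citg xi jk)).
  by apply: eq_Rintegral => t _; rewrite E.
apply: le_trans main _.
have -> : rho `^ b / rho = rho `^ (b - 1) by rewrite powRD ?(gt_eqF rho0) ?implybT// powR_inv1 ?ltW.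
by rewrite ler_wpM2r// (le_trans (ler_norm _))// -addrA lerDl addr_ge0// mulr_ge0 ?powR_ge0.
Qed.

End VanDerCorput.

(** * The operator on test functions and its multiplier *)

Section CurveOp.
Context {R : realType}.
Local Notation leb := (@lebesgue_measure R).
Local Notation l2 := (@lebesgue_measure R \x @lebesgue_measure R)%E.
Local Notation R2 := (R * R)%type.
Local Notation R2m := (measurableTypeR R * measurableTypeR R)%type.
Local Notation e1 := ((1, 0) : R2).
Local Notation e2 := ((0, 1) : R2).

Lemma test_ctaylor2 (f : R2 -> R[i]) : test_function f ->
  exists2 C : R, 0 < C & forall x h, cabs (f (h + x) - f x - cD h f x) <= C * `|h| ^+ 2.
Proof.
move=> [[sr si] cf].
have cr : compactly_supported (re_fun f) by apply: (cs_le cf) => x; rewrite /re_fun => ->.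
have ci : compactly_supported (im_fun f) by apply: (cs_le cf) => x; rewrite /im_fun => ->.
have [C C0 HC] := test_taylor2 sr cr; have [C' C'0 HC'] := test_taylor2 si ci.
exists (C + C') => [|x h]; first exact: addr_gt0.
rewrite (le_trans (cabs_le_ReIm _))// mulrDl lerD//.
  by rewrite !cReD !cReN; exact: HC.
by rewrite !cImD !cImN; exact: HC'.
Qed.

Lemma cD_lin2 (f : R2 -> R[i]) (h x : R2) : csmooth f ->
  cD h f x = h.1%:C * cD e1 f x + h.2%:C * cD e2 f x.
Proof.
move=> [sr si]; apply: complexP.
  by rewrite cReD !cReZ; exact: derive_lin2 (smooth_diff sr x).
by rewrite cImD !cImZ; exact: derive_lin2 (smooth_diff si x).
Qed.

Section Fixed.
Variables (k : R -> R[i]) (T : R).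
Hypotheses (T0 : 0 < T) (jk : citg leb k) (kT : vanishing T k).

(** The operator is a superposition of translations and so commutes with derivatives: the Taylor
    remainder of f is uniform and can be integrated against |k|. As for [ftm_Re_derive], the
    constant [c] yields both parts and all derivatives. *)
Lemma curve_op_Re_derive (c : R[i]) (f : R2 -> R[i]) (x : R2) : test_function f ->
  differentiable (fun x => complex.Re (c * curve_op k f x)) x /\
  forall v, 'D_v (fun x => complex.Re (c * curve_op k f x)) x = complex.Re (c * curve_op k (cD v f) x).
Proof.
move=> tf; have [C C0 HC] := test_ctaylor2 tf.
have J g := citg_curve_op x jk (f := g).
have t1 := test_cD e1 tf; have t2 := test_cD e2 tf.
have [A1 [A2 E]] : exists A1 A2, forall v, curve_op k (cD v f) x = v.1%:C * A1 + v.2%:C * A2.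
  exists (curve_op k (cD e1 f) x), (curve_op k (cD e2 f) x) => v.
  rewrite /curve_op /cint1 -(cintZ _ (J _ t1)) -(cintZ _ (J _ t2)) -(cintD (citgZ _ (J _ t1)) (citgZ _ (J _ t2))).
  by apply: eq_cint => t; rewrite (cD_lin2 _ _ tf.1) mulrDl !mulrA.
clear t1 t2; pose p : R2 := (complex.Re (c * A1), complex.Re (c * A2)).
have Ep v : complex.Re (c * curve_op k (cD v f) x) = dot2 v p.
  by rewrite E mulrDr cReD (mulrCA c) (mulrCA c) !cReZ.
set I := \int[leb]_t cabs (k t).
have main h : cabs (curve_op k f (h + x) - curve_op k f x - curve_op k (cD h f) x) <= C * I * `|h| ^+ 2.
  have j1 := citg_curve_op (h + x) jk tf; have j2 := J _ tf; have j3 := J _ (test_cD h tf).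
  rewrite /curve_op /cint1 -(cintB j1 j2) -(cintB (citgB j1 j2) j3) mulrAC -RintegralZl//; last exact: citg_cabs.
  apply: cint_norm_le => [||t]; [exact: citgB (citgB j1 j2) j3|by apply: itgZ; exact: citg_cabs|].
  rewrite -!mulrBl cabsM ler_wpM2r ?cabs_ge0//.
  have -> : ((h + x).1 - t, (h + x).2 - t ^+ 3) = h + (x.1 - t, x.2 - t ^+ 3) :> R2.
    by apply: (f_equal2 (@pair R R)); rewrite /= addrA.
  exact: HC.
pose g y := complex.Re (c * curve_op k f y).
have H (h : R2) : `|g (h + x) - g x - (dot2 (h + x) p - dot2 x p)| <= cabs c * (C * I) * `|h| ^+ 2.
  rewrite dot2Dl addrK -Ep /g -!cReN -!cReD.
  rewrite (_ : _ + _ - _ = c * (curve_op k f (h + x) - curve_op k f x - curve_op k (cD h f) x)); last by ring.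
  by rewrite (le_trans (Re_le_cabs _))// cabsM -mulrA ler_wpM2l ?cabs_ge0//; exact: main.
have [d D] := diff_quad_affine (affine_dot2 p) H.
by split=> // v; rewrite D Ep.
Qed.

Lemma curve_op_test (f : R2 -> R[i]) : test_function f -> test_function (curve_op k f).
Proof.
move=> tf; split.
  pose S g := exists c f, test_function f /\ g = fun x => complex.Re (c * curve_op k f x).
  have HS : forall g, S g -> smooth g.
    apply: smooth_class => _ [c [g [tg ->]]]; split=> [x|v].
      by have [] := curve_op_Re_derive c x tg.
    exists c, (cD v g); split; first exact: test_cD.
    by apply/funext => x; have [_ ->] := curve_op_Re_derive c x tg.
  split; apply: HS.
    by exists 1, f; split=> //; apply/funext => x; rewrite mul1r.
  exists (- 'i), f; split=> //; apply/funext => x.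
  by rewrite cReM cReN cImN /= oppr0 mul0r sub0r mulN1r opprK.
have [A A0 HA] := cs_bound tf.2.
apply: (cs_ball2 (A := A + T + T ^+ 3)) => x xA.
rewrite /curve_op /cint1 (_ : (fun t => _) = fun=> 0) ?cint0//; apply/funext => t.
have [tT|tT] := leP T `|t|; first by rewrite kT// mulr0.
rewrite HA ?mul0r// ltNge; apply/negP; rewrite prod_normE ge_max /= => /andP[h1 h2].
have T3 : 0 <= T ^+ 3 by rewrite exprn_ge0// ltW.
have t3 : `|t ^+ 3| <= T ^+ 3 by rewrite normrX lerXn2r ?nnegrE ?(ltW T0)// ltW.
move: xA; rewrite prod_normE lt_max => /orP[]; apply/negP; rewrite -leNgt.
  by move: h1 tT; rewrite !ler_norml ltr_norml => /andP[? ?] /andP[? ?]; apply/andP; split; lra.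
have TT := ltW T0; move: h2 t3; rewrite !ler_norml => /andP[? ?] /andP[? ?].
by apply/andP; split; lra.
Qed.

Lemma ft_curve_op (f : R2 -> R[i]) (xi : R2) : test_function f ->
  ft (curve_op k f) xi = cint leb (fun t => cis (cphase xi.1 xi.2 t) * k t) * ft f xi.
Proof.
move=> tf; have [A [M [A0 M0 HM]]] := test_box2 tf.
have [mf1 mf2] := csmooth_cmeas2 tf.1; have [mk1 mk2] := citg_meas1 jk.
have mp : measurable_fun setT (fun z : R2m * measurableTypeR R => (z.1.1 - z.2, z.1.2 - z.2 ^+ 3) : R2m).
  have m11 := measurableT_comp (@measurable_fst _ _ (measurableTypeR R) (measurableTypeR R)) (@measurable_fst _ _ R2m (measurableTypeR R)).
  have m12 := measurableT_comp (@measurable_snd _ _ (measurableTypeR R) (measurableTypeR R)) (@measurable_fst _ _ R2m (measurableTypeR R)).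
  have m2 := @measurable_snd _ _ R2m (measurableTypeR R).
  apply: measurable_fun_pair; apply: measurable_funB => //.
  by apply: measurable_funX.
pose G (z : R2m * measurableTypeR R) := cis (dot2 z.1 xi) * (f (z.1.1 - z.2, z.1.2 - z.2 ^+ 3) * k z.2).
have JG : citg (lebR2 \x leb)%E G.
  apply: (@citg_dom _ (R2m * measurableTypeR R)%type R (lebR2 \x leb)%E G
    (fun z => M * (box2 (A + T + T ^+ 3) z.1 * cabs (k z.2)))).
  - apply: cmeasM; first by apply: cmeas_cis; apply: measurable_dot2; [exact: measurable_fst|exact: measurable_cst].
    apply: cmeasM; first by split; [exact: (measurableT_comp mf1 mp)|exact: (measurableT_comp mf2 mp)].
    by split; [exact: (measurableT_comp mk1 measurable_snd)|exact: (measurableT_comp mk2 measurable_snd)].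
  - apply: itgZ; exact: (@itg_prod _ _ R2m (measurableTypeR R) R lebR2 leb _ _ (itg_box2 _) (citg_cabs jk)).
  - move=> [x t]; rewrite /G !cabsM cabs_cis mul1r /= mulrA.
    have [tT|tT] := leP T `|t|; first by rewrite kT// cabs0 !mulr0.
    rewrite ler_wpM2r ?cabs_ge0// (le_trans (HM _))// ler_wpM2l ?(ltW M0)// !box2E.
    case: ifP => // h1; case: ifPn => // /negP[].
    have T3 : 0 <= T ^+ 3 by rewrite exprn_ge0// ltW.
    have t3 : `|t ^+ 3| <= T ^+ 3 by rewrite normrX lerXn2r ?nnegrE ?(ltW T0)// ltW.
    move: h1; rewrite !prod_normE !ge_max /= => /andP[h1 h2].
    move: h1 h2 tT t3; rewrite !ler_norml ltr_norml => /andP[? ?] /andP[? ?] /andP[? ?] /andP[? ?].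
    by apply/andP; split; apply/andP; split; lra.
have E1 x : cint leb (fun t => G (x, t)) = cis (dot2 x xi) * curve_op k f x.
  by rewrite /curve_op /cint1 -(cintZ _ (citg_curve_op x jk tf)).
have n1 : (1 : R) != 0 by rewrite oner_eq0.
have E2 t : cint lebR2 (fun x => G (x, t)) = cis (cphase xi.1 xi.2 t) * k t * ft f xi.
  have jf := ft_citg xi (test_citg2 tf).
  have [j0 i0] := cint2_shear (- t) n1 n1 (measurable_cst (- t ^+ 3)) jf.
  rewrite !normr1 mulr1 invr1 mul1r in i0.
  rewrite /ft -i0 cint2L -cintZ; last exact: j0.
  apply: eq_cint => x; rewrite /G /= !mul1r.
  have -> : dot2 x xi = cphase xi.1 xi.2 t + dot2 (x.1 - t, x.2 - t ^+ 3) xi.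
    by rewrite /cphase /dot2 /=; ring.
  by rewrite cisD; ring.
have := cint_swap JG; under eq_cint => x do rewrite E1.
move=> E; rewrite {1}/ft cint2L E; under eq_cint => t do rewrite E2.
rewrite cintZr//.
have := @citgM_bounded _ (measurableTypeR R) R leb k (fun t => cis (cphase xi.1 xi.2 t)) 1 jk.
apply; last by move=> t; rewrite cabs_cis.
by apply: cmeas_cis; apply: continuous_measurable_fun => t; exact: is_derive_cont (is_derive_cphase xi.1 xi.2 t).
Qed.

End Fixed.

Lemma citg_reflect (k : R -> R[i]) : citg leb k -> citg leb (fun t => k (- t)).
Proof.
move=> jk; have n1 : (-1 : R) != 0 by rewrite oppr_eq0 oner_eq0.
have [j _] := cint_aff 0 n1 jk.
by move: j; congr citg; apply/funext => t; rewrite addr0 mulN1r.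
Qed.

Lemma vanishing_reflect T (k : R -> R[i]) : vanishing T k -> vanishing T (fun t => k (- t)).
Proof. by move=> kT t tT; rewrite kT// normrN. Qed.

(** The phase is odd in t, so that reflecting the weight changes its sign: the multiplier of the
    transposed operator for the + transform is the one with exp(-i(t xi_1 + t^3 xi_2)). *)
Lemma ft_curve_op_reflect (k : R -> R[i]) T (f : R2 -> R[i]) (xi : R2) : 0 < T -> citg leb k ->
  vanishing T k -> test_function f ->
  ft (curve_op (fun t => k (- t)) f) xi = curve_mult k xi * ft f xi.
Proof.
move=> T0 jk kT tf; rewrite (ft_curve_op T0 (citg_reflect jk) (vanishing_reflect kT))//; congr (_ * _).
have n1 : (-1 : R) != 0 by rewrite oppr_eq0 oner_eq0.
have [_] := cint_aff 0 n1 (curve_mult_citg xi jk).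
rewrite normrN1 invr1 mul1r /curve_mult => <-.
apply: eq_cint => t; rewrite addr0 mulN1r; congr (cis _ * _).
by rewrite /cphase; ring.
Qed.

End CurveOp.

(** * Sobolev boundedness *)

Section Sobolev.
Context {R : realType}.
Local Notation leb := (@lebesgue_measure R).
Local Notation l2 := (@lebesgue_measure R \x @lebesgue_measure R)%E.
Local Notation R2 := (R * R)%type.
Local Notation R2m := (measurableTypeR R * measurableTypeR R)%type.

Lemma bracket_powR (xi : R2) (s : R) : bracket (dot2 xi xi) `^ (2 * s) = jb xi `^ s.
Proof. by rewrite /bracket -/(jb xi) -powR12_sqrt ?(ltW (jb_gt0 _))// -powRrM mulrA mulVf// mul1r. Qed.

Lemma jb_sub (xi eta : R2) : jb eta <= 2 * (jb xi * jb (xi - eta)).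
Proof.
rewrite /jb /dot2 /=; case: xi eta => [a b] [c d] /=.
have h1 := sqr_ge0 (2 * a - c); have h2 := sqr_ge0 (2 * b - d).
set u := a * a + b * b; set v := (a - c) * (a - c) + (b - d) * (b - d).
have u0 : 0 <= u by rewrite /u -!expr2 addr_ge0 ?sqr_ge0.
have v0 : 0 <= v by rewrite /v -!expr2 addr_ge0 ?sqr_ge0.
have : c * c + d * d <= 2 * u + 2 * v by move: h1 h2; rewrite /u /v; nra.
have := mulr_ge0 u0 v0; lra.
Qed.

Lemma jb_sym (xi eta : R2) : jb (xi - eta) = jb (eta - xi).
Proof. by rewrite /jb /dot2 /=; ring. Qed.

(** For a < 0 the case of -a is used with xi and eta exchanged and multiplied by both powers. *)
Lemma peetre (a : R) (xi eta : R2) :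
  jb eta `^ a <= 2 `^ `|a| * jb xi `^ a * jb (xi - eta) `^ `|a|.
Proof.
have j0 (z : R2) := jb_gt0 z; have j0' (z : R2) := ltW (j0 z).
have n2 : 0 <= 2 :> R by [].
have [a0|a0] := ger0P a.
  rewrite -powRM ?j0'// -powRM ?mulr_ge0 ?j0'// ge0_ler_powR ?nnegrE ?mulr_ge0 ?j0'//.
  by rewrite -mulrA; exact: jb_sub.
have na : 0 <= - a by rewrite oppr_ge0 ltW.
have h : jb xi `^ (- a) <= 2 `^ (- a) * jb eta `^ (- a) * jb (xi - eta) `^ (- a).
  rewrite -powRM ?j0'// -powRM ?mulr_ge0 ?j0'// ge0_ler_powR ?nnegrE ?mulr_ge0 ?j0'//.
  by rewrite -mulrA jb_sym; exact: jb_sub.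
have p (z : R2) : jb z `^ a * jb z `^ (- a) = 1.
  by rewrite -powRD ?subrr ?powRr0// eqxx /= gt_eqF.
have h2 := ler_wpM2l (powR_ge0 (jb xi) a) h.
have h3 := ler_wpM2l (powR_ge0 (jb eta) a) h2.
rewrite p mulr1 in h3; apply: le_trans h3 _.
rewrite le_eqVlt; apply/orP; left; apply/eqP.
transitivity ((jb eta `^ a * jb eta `^ (- a)) * (2 `^ (- a) * jb xi `^ a * jb (xi - eta) `^ (- a))); first by ring.
by rewrite p mul1r.
Qed.

Lemma w2_le1 (x : R2) : w2 x <= 1.
Proof.
have h (t : R) : w1 t <= 1 by rewrite /w1 invf_le1 ?lerDl ?sqr_ge0// ltr_wpDr ?sqr_ge0.
by rewrite /w2 -[leRHS]mul1r ler_pM// ltW// w1_gt0.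
Qed.

Lemma w2_gt0 (x : R2) : 0 < w2 x.
Proof. by rewrite /w2 mulr_gt0 ?w1_gt0. Qed.

(** Peetre's inequality for [w2]: from 1 + a^2 <= 2 (1 + (a - c)^2)(1 + c^2) in each coordinate. It
    trades decay in xi - eta and eta for integrability in xi. *)
Lemma w2_sub (xi eta : R2) : w2 (xi - eta) * w2 eta <= 4 * w2 xi.
Proof.
have h (a c : R) : w1 (a - c) * w1 c <= 2 * w1 a.
  rewrite /w1 -invfM ler_pdivlMr ?ltr_wpDr ?sqr_ge0// mulrC ler_pdivrMr; last first.
    by rewrite mulr_gt0// ltr_wpDr ?sqr_ge0.
  have := sqr_ge0 (a - 2 * c); have := sqr_ge0 ((a - c) * c); nra.
rewrite /w2 /= (_ : _ * _ * _ = (w1 (xi.1 - eta.1) * w1 eta.1) * (w1 (xi.2 - eta.2) * w1 eta.2)); last by ring.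
rewrite (_ : 4 * _ = (2 * w1 xi.1) * (2 * w1 xi.2)); last by ring.
by rewrite ler_pM// mulr_ge0// ltW// w1_gt0.
Qed.

Lemma w2_sym (xi eta : R2) : w2 (xi - eta) = w2 (eta - xi).
Proof. by rewrite /w2 /w1 /= -(sqrrN (xi.1 - eta.1)) -(sqrrN (xi.2 - eta.2)) !opprB. Qed.

Lemma itg_w2_shift (eta : R2) : itg l2 (fun xi => w2 (xi - eta)) /\
  \int[l2]_xi w2 (xi - eta) = \int[l2]_xi w2 xi.
Proof.
have n1 : (1 : R) != 0 by rewrite oner_eq0.
have [j i] := Rint2_shear (- eta.1) n1 n1 (measurable_cst (- eta.2)) itg_w2.
rewrite !normr1 mulr1 invr1 mul1r in i.
have E : (fun xi : R2 => w2 (xi - eta)) = fun z => w2 (1 * z.1 - eta.1, 1 * z.2 - eta.2).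
  by apply/funext => z; rewrite !mul1r.
by rewrite E; split; [exact: j|rewrite -i].
Qed.

(** The integral of (f - m)^2 w is nonnegative, where m is the mean of f for the weight w. *)
Lemma cauchy_schwarz (f w : R2 -> R) : itg l2 w -> itg l2 (fun x => f x * w x) ->
  itg l2 (fun x => f x ^+ 2 * w x) -> (forall x, 0 <= w x) -> 0 < \int[l2]_x w x ->
  (\int[l2]_x (f x * w x)) ^+ 2 <= \int[l2]_x w x * \int[l2]_x (f x ^+ 2 * w x).
Proof.
move=> jw j1 j2 w0 W0; set W := \int[l2]_x w x in W0 *.
set a := \int[l2]_x (f x * w x); set b := \int[l2]_x (f x ^+ 2 * w x).
have : 0 <= \int[l2]_x (f x ^+ 2 * w x + (- (2 * (a / W)) * (f x * w x) + (a / W) ^+ 2 * w x)).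
  apply: Rintegral_ge0 => x _.
  rewrite (_ : _ + _ = (f x - a / W) ^+ 2 * w x); last by ring.
  by rewrite mulr_ge0 ?sqr_ge0.
rewrite (RintegralD measurableT j2 (itgD (itgZ _ j1) (itgZ _ jw))).
rewrite (RintegralD measurableT (itgZ _ j1) (itgZ _ jw)) !RintegralZl// -/a -/b -/W.
rewrite (_ : b + _ = b - a ^+ 2 / W); last by field; rewrite gt_eqF.
by rewrite subr_ge0 ler_pdivrMr// mulrC.
Qed.

(** The convolution theorem as a case of Parseval: the exponential is absorbed into f, whose
    transform it shifts by xi. *)
Lemma ft_testM (f g : R2 -> R[i]) (xi : R2) : test_function f -> test_function g ->
  ((2 * pi) ^+ 2)%:C * ft (fun x => f x * g x) xi = cint2 (fun eta => ft f (xi - eta) * ft g eta).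
Proof.
move=> tf tg; have th := testM (csmooth_cis (affine_dot2 xi)) tf.
have -> : ft (fun x => f x * g x) xi = cint2 (fun x => (cis (dot2 x xi) * f x) * g x).
  by congr cint2; apply/funext => x; rewrite mulrA.
rewrite -(ft_test_mult th tg); congr cint2; apply/funext => eta; congr (_ * _).
congr cint2; apply/funext => x; rewrite mulrA -cisD; congr (cis _ * _).
by rewrite /dot2 /=; ring.
Qed.

Lemma ft_testM_conv (f g : R2 -> R[i]) (xi : R2) : test_function f -> test_function g ->
  ft (fun x => f x * g x) xi =
    (((2 * pi) ^+ 2)^-1)%:C * cint2 (fun eta => ft f (xi - eta) * ft g eta).
Proof.
move=> tf tg; rewrite -(ft_testM xi tf tg); set h := ft _ xi.
have : (2 * pi : R) ^+ 2 != 0 by rewrite expf_eq0 mulf_eq0 pnatr_eq0 /= gt_eqF// pi_gt0.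
by move: (_ ^+ 2) => p p0; rewrite mulrA -rmorphM /= mulVf// rmorph1 mul1r.
Qed.

Lemma curve_mult_meas (k : R -> R[i]) : citg leb k -> cmeas (curve_mult k).
Proof.
move=> jk.
have J : citg (lebR2 \x leb)%E (fun z => cis (- cphase z.1.1 z.1.2 z.2) * ((w2 z.1)%:C * k z.2)).
  apply: (citgM_bounded (M := 1)) => [||z]; last by rewrite cabs_cis.
    exact: (@citg_prod _ _ R2m (measurableTypeR R) R lebR2 leb _ _ (citg_real itg_w2) jk).
  apply: cmeas_cis; apply: (measurableT_comp (@oppr_measurable R setT)).
  have m11 := measurableT_comp (@measurable_fst _ _ (measurableTypeR R) (measurableTypeR R)) (@measurable_fst _ _ R2m (measurableTypeR R)).
  have m12 := measurableT_comp (@measurable_snd _ _ (measurableTypeR R) (measurableTypeR R)) (@measurable_fst _ _ R2m (measurableTypeR R)).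
  have m2 := @measurable_snd _ _ R2m (measurableTypeR R).
  by apply: measurable_funD; apply: measurable_funM => //; exact: measurable_funX.
have [[m1 m2] _] := cint_fubini1 J.
have {m1 m2}jm : cmeas (fun x => (w2 x)%:C * curve_mult k x).
  have := citg_meas2 (conj m1 m2); congr cmeas; apply/funext => x.
  rewrite /curve_mult -cintZ; last exact: curve_mult_citg.
  by apply: eq_cint => t /=; ring.
have := cmeasM jm cmeas_w2_inv; congr cmeas; apply/funext => x.
by rewrite mulrAC -rmorphM mulfV ?mul1r// gt_eqF// w2_gt0.
Qed.

Lemma jb_cont : continuous (@jb R).
Proof.
move=> x; have c1 : continuous (@fst R R) by move=> y; exact: cvg_fst.
have c2 : continuous (@snd R R) by move=> y; exact: cvg_snd.
by apply: cvgD; [exact: cvg_cst|apply: cvgD; apply: cvgM; [exact: c1|exact: c1|exact: c2|exact: c2]].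
Qed.

Lemma jb_powR_meas (a : R) : measurable_fun setT (fun xi : R2 => jb xi `^ a).
Proof. exact: (measurableT_comp (measurable_powR a) (continuous_measurable2 jb_cont)). Qed.

Lemma ft_decay_powR (f : R2 -> R[i]) (a : R) : test_function f ->
  exists2 C : R, 0 < C & forall xi, cabs (ft f xi) <= C * jb xi `^ (- a).
Proof.
move=> tf; pose n := (Num.truncn `|a|).+1.
have [C C0 HC] := ft_decay n tf; exists C => // xi.
rewrite (le_trans (HC xi))// ler_wpM2l ?(ltW C0)// -powR_invn ?(ltW (jb_gt0 _))//.
rewrite ler_powR ?jb_ge1// lerN2 (le_trans (ler_norm a))// ltW//.
exact: truncnS_gt.
Qed.

Lemma jb_w2 (xi : R2) : jb xi `^ (- 2) <= w2 xi.
Proof.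
have := jb2_w2 xi; rewrite -powR_invn ?(ltW (jb_gt0 _))//.
Qed.

Section Bounded.
Variables (k : R -> R[i]) (T C0 sigma s : R) (kap : R2 -> R[i]).
Hypotheses (T0 : 0 < T) (jk : citg leb k) (kT : vanishing T k) (C00 : 0 < C0).
Hypothesis kC : forall xi, cabs (curve_mult k xi) <= C0 * jb xi `^ (- (sigma / 2)).
Hypothesis tk : test_function kap.
Let s' := s + sigma.

(** Localization by kap is a convolution on the Fourier side, and the integral of this kernel over
    xi is (2 pi)^2 times the transform of kap T u at eta. The argument is xi - eta since [ft] has
    the sign opposite to that of F. *)
Let Kern (F : R2 -> R[i]) (eta xi : R2) : R[i] := F xi * curve_mult k xi * ft kap (xi - eta).
Let fs (F : R2 -> R[i]) (xi : R2) : R := jb xi `^ (s / 2) * cabs (F xi).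

(** The weight in eta is moved to xi by Peetre's inequality, at the price of a power of
    [jb (xi - eta)] which the decay of [ft kap] pays, with two powers to spare for [w2]. The decay
    of the multiplier turns the order s' into s. *)
Lemma kern_bound : exists2 C, 0 < C & forall F eta xi,
  jb eta `^ (s' / 2) * cabs (Kern F eta xi) <= C * (fs F xi * w2 (xi - eta)).
Proof.
have [C1 C10 HC1] := ft_decay_powR (`|s' / 2| + 2) tk.
exists (2 `^ `|s' / 2| * C0 * C1) => [|F eta xi]; first by rewrite !mulr_gt0// powR_gt0.
set z := xi - eta; have jz := jb_gt0 z; have jx := jb_gt0 xi.
have p0 (x a : R) : 0 <= x `^ a by exact: powR_ge0.
have c0 (w : R[i]) : 0 <= cabs w by exact: cabs_ge0.
have hz : jb z `^ `|s' / 2| * cabs (ft kap z) <= C1 * w2 z.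
  apply: (@le_trans _ _ (jb z `^ `|s' / 2| * (C1 * jb z `^ (- (`|s' / 2| + 2))))).
    by rewrite ler_wpM2l.
  rewrite mulrCA -powRD ?(gt_eqF jz) ?implybT// ler_wpM2l ?(ltW C10)//.
  by rewrite (_ : _ + _ = - 2) ?jb_w2//; ring.
have hx : jb xi `^ (s' / 2) * cabs (curve_mult k xi) <= C0 * jb xi `^ (s / 2).
  apply: (@le_trans _ _ (jb xi `^ (s' / 2) * (C0 * jb xi `^ (- (sigma / 2))))).
    by rewrite ler_wpM2l.
  rewrite mulrCA -powRD ?(gt_eqF jx) ?implybT//.
  by rewrite (_ : s' / 2 + _ = s / 2)// /s'; field.
rewrite /Kern !cabsM /fs.
apply: (@le_trans _ _ (2 `^ `|s' / 2| * jb xi `^ (s' / 2) * jb z `^ `|s' / 2| *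
   (cabs (F xi) * cabs (curve_mult k xi) * cabs (ft kap z)))).
  by rewrite ler_wpM2r ?mulr_ge0//; exact: peetre.
rewrite (_ : _ * _ * _ * _ = 2 `^ `|s' / 2| * cabs (F xi) *
  ((jb xi `^ (s' / 2) * cabs (curve_mult k xi)) * (jb z `^ `|s' / 2| * cabs (ft kap z)))); last by ring.
rewrite (_ : _ * (_ * w2 z) = 2 `^ `|s' / 2| * cabs (F xi) * ((C0 * jb xi `^ (s / 2)) * (C1 * w2 z))); last by ring.
by rewrite ler_wpM2l ?mulr_ge0// ler_pM ?mulr_ge0.
Qed.

Variables (F : R2 -> R[i]).
Hypotheses (mF : cmeas F) (jF : itg l2 (fun xi => jb xi `^ s * cabs (F xi) ^+ 2)).

Let fsE xi : fs F xi ^+ 2 = jb xi `^ s * cabs (F xi) ^+ 2.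
Proof.
rewrite /fs exprMn; congr (_ * _).
by rewrite -powR_mulrn ?powR_ge0// -powRrM -mulrA mulVf// mulr1.
Qed.

Let jf2 : itg l2 (fun xi => fs F xi ^+ 2).
Proof. by under eq_fun do rewrite fsE. Qed.

Let fs0 xi : 0 <= fs F xi. Proof. by rewrite /fs mulr_ge0 ?powR_ge0 ?cabs_ge0. Qed.

Let mfs : measurable_fun setT (fs F).
Proof. by apply: measurable_funM; [exact: jb_powR_meas|exact: cmeas_cabs]. Qed.

Let mw eta : measurable_fun setT (fun xi : R2 => w2 (xi - eta)).
Proof. exact: itg_meas (itg_w2_shift eta).1. Qed.

Let itg_dom2 (f g : R2 -> R) : measurable_fun setT f -> itg l2 g ->
  (forall x, `|f x| <= g x) -> itg l2 f.
Proof. by move=> mf jg H; exact: (@itg_dom _ R2m R l2 f g mf jg H). Qed.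

Let j1 eta : itg l2 (fun xi => fs F xi ^+ 2 * w2 (xi - eta)).
Proof.
apply: (itg_dom2 _ jf2); first by apply: measurable_funM; [exact: itg_meas jf2|exact: mw].
move=> x; have h1 := sqr_ge0 (fs F x).
have h0 : 0 <= fs F x ^+ 2 * w2 (x - eta) := mulr_ge0 h1 (w2_ge0 _).
by rewrite (ger0_norm h0); exact: ler_piMr h1 (w2_le1 _).
Qed.

Let j2 eta : itg l2 (fun xi => fs F xi * w2 (xi - eta)).
Proof.
apply: (itg_dom2 _ (itgD (j1 eta) (itg_w2_shift eta).1)).
  by apply: measurable_funM; [exact: mfs|exact: mw].
move=> x; have h1 := sqr_ge0 (fs F x - 1); have h2 := w2_ge0 (x - eta).
have h0 : 0 <= fs F x * w2 (x - eta) := mulr_ge0 (fs0 _) h2.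
have h3 := fs0 x.
rewrite (ger0_norm h0); set w := w2 _ in h2 *; set u := fs F x in h1 h3 *; nra.
Qed.

Let W := \int[l2]_xi w2 (xi : R2).

Let W0 : 0 < W.
Proof.
rewrite /W; have [j i] := w1_int (R := R); have P0 : 0 < pi * pi :> R by rewrite mulr_gt0 ?pi_gt0.
suff -> : \int[l2]_xi w2 xi = (pi * pi : R) by [].
have [_ ->] := @Rint_fubini1 _ _ (measurableTypeR R) (measurableTypeR R) R leb leb _ itg_w2.
under eq_Rintegral do rewrite /w2 /= RintegralZl// i.
by rewrite RintegralZr// i.
Qed.

Lemma kern_citg eta : citg l2 (Kern F eta).
Proof.
have [C C1 HC] := kern_bound.
have jp : 0 < jb eta `^ (s' / 2) by rewrite powR_gt0// jb_gt0.
apply: (citg_dom2 _ (itgZ ((jb eta `^ (s' / 2))^-1 * C) (j2 eta))) => [|xi]; last first.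
  by rewrite -mulrA -ler_pdivrMl ?invr_gt0// invrK.
apply: cmeasM; first by apply: cmeasM => //; exact: curve_mult_meas.
have [m1 m2] := ft_meas (test_citg2 tk).
have ms : measurable_fun setT (fun xi : R2m => (xi.1 - eta.1, xi.2 - eta.2) : R2m).
  by apply: measurable_fun_pair; apply: measurable_funB => //; exact: measurable_cst.
by split; [exact: (measurableT_comp m1 ms)|exact: (measurableT_comp m2 ms)].
Qed.

Let G (eta : R2) : R[i] := (((2 * pi) ^+ 2)^-1)%:C * cint2 (Kern F eta).

(** Integrability over both frequencies, for Fubini. With u = [fs F xi] and v = w2(xi - eta)
    w2(eta), the bounds v <= 1 and v <= 4 w2(xi) give u v <= u^2 + 4 w2(xi); the second factor
    w2(eta) then makes the majorant integrable in eta. *)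
Lemma kern_pair (g : R2 -> R[i]) D : cmeas g ->
  (forall eta, cabs (g eta) <= D * (jb eta `^ (s' / 2) * w2 eta ^+ 2)) ->
  citg (lebR2 \x lebR2)%E (fun z => Kern F z.2 z.1 * g z.2).
Proof.
move=> mg gD; have [C C1 HC] := kern_bound.
have D0 : 0 <= D.
  have := le_trans (cabs_ge0 _) (gD 0); rewrite pmulr_lge0//.
  by rewrite mulr_gt0 ?powR_gt0 ?jb_gt0// exprn_gt0// w2_gt0.
apply: (@citg_dom _ (R2m * R2m)%type R (lebR2 \x lebR2)%E _
  (fun z => D * C * (fs F z.1 ^+ 2 * w2 z.2 + 4 * (w2 z.1 * w2 z.2)))).
- have [mF1 mF2] := mF; have [mk1 mk2] := curve_mult_meas jk; have [mg1 mg2] := mg.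
  have [m1 m2] := ft_meas (test_citg2 tk).
  have ms : measurable_fun setT (fun z : R2m * R2m => (z.1.1 - z.2.1, z.1.2 - z.2.2) : R2m).
    have f1 := @measurable_fst _ _ R2m R2m; have f2 := @measurable_snd _ _ R2m R2m.
    have g1 := @measurable_fst _ _ (measurableTypeR R) (measurableTypeR R).
    have g2 := @measurable_snd _ _ (measurableTypeR R) (measurableTypeR R).
    apply: measurable_fun_pair; apply: measurable_funB.
    + exact: (measurableT_comp g1 f1).
    + exact: (measurableT_comp g1 f2).
    + exact: (measurableT_comp g2 f1).
    + exact: (measurableT_comp g2 f2).
  apply: cmeasM; last by split; [exact: (measurableT_comp mg1 measurable_snd)|exact: (measurableT_comp mg2 measurable_snd)].
  apply: cmeasM; last by split; [exact: (measurableT_comp m1 ms)|exact: (measurableT_comp m2 ms)].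
  apply: cmeasM; first by split; [exact: (measurableT_comp mF1 measurable_fst)|exact: (measurableT_comp mF2 measurable_fst)].
  by split; [exact: (measurableT_comp mk1 measurable_fst)|exact: (measurableT_comp mk2 measurable_fst)].
- apply: itgZ; apply: itgD; first exact: (@itg_prod _ _ R2m R2m R lebR2 lebR2 _ _ jf2 itg_w2).
  by apply: itgZ; exact: (@itg_prod _ _ R2m R2m R lebR2 lebR2 _ _ itg_w2 itg_w2).
- move=> [xi eta] /=; rewrite cabsM.
  have w0 (x : R2) := w2_ge0 x.
  apply: (@le_trans _ _ (cabs (Kern F eta xi) * (D * (jb eta `^ (s' / 2) * w2 eta ^+ 2)))).
    by rewrite ler_wpM2l ?cabs_ge0.
  rewrite (_ : _ * (D * _) = D * w2 eta ^+ 2 * (jb eta `^ (s' / 2) * cabs (Kern F eta xi))); last by ring.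
  apply: (@le_trans _ _ (D * w2 eta ^+ 2 * (C * (fs F xi * w2 (xi - eta))))).
    by rewrite ler_wpM2l// mulr_ge0// sqr_ge0.
  rewrite (_ : D * _ * _ = D * C * (fs F xi * (w2 (xi - eta) * w2 eta) * w2 eta)); last by ring.
  apply: ler_wpM2l; first by rewrite mulr_ge0// ltW.
  rewrite [4 * _]mulrA -mulrDl ler_wpM2r//.
  have h1 : w2 (xi - eta) * w2 eta <= 1 by rewrite -[leRHS]mul1r ler_pM// w2_le1.
  have h2 := w2_sub xi eta; have h3 : 0 <= w2 (xi - eta) * w2 eta by rewrite mulr_ge0.
  have := sqr_ge0 (fs F xi - 1); have := fs0 xi; set u := fs F xi; set v := w2 (xi - eta) * w2 eta in h1 h2 h3 *.
  nra.
Qed.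

(** As in [ft_meas]: Fubini applies after multiplication by a positive weight v of enough decay,
    which is divided out afterwards. *)
Lemma G_meas : cmeas G.
Proof.
pose v (eta : R2) : R := jb eta `^ (s' / 2) * w2 eta ^+ 2.
have v0 eta : 0 < v eta by rewrite /v mulr_gt0 ?powR_gt0 ?jb_gt0// exprn_gt0// w2_gt0.
have mv : measurable_fun setT v.
  by apply: measurable_funM; [exact: jb_powR_meas|apply: measurable_funX; exact: itg_meas itg_w2].
have J := @kern_pair (fun eta => (v eta)%:C) 1 (cmeas_real mv) (fun eta => ltac:(
  by rewrite cabs_real mul1r (gtr0_norm (v0 eta)))).
have [J2 _] := cint_fubini2 J.
have jb0 (e : R2) := ltW (jb_gt0 e).
have mi : cmeas (fun eta : R2 => (jb eta `^ (- (s' / 2)))%:C) by apply: cmeas_real; exact: jb_powR_meas.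
have m1 := cmeasM (cmeasM (cmeasM (citg_meas2 J2) mi) cmeas_w2_inv) cmeas_w2_inv.
have mc : cmeas (fun _ : R2 => (((2 * pi) ^+ 2)^-1 : R)%:C) by split; exact: measurable_cst.
have := cmeasM mc m1; congr cmeas; apply/funext => eta.
rewrite /G; congr (_ * _).
rewrite [X in X * _ * _ * _ = _](_ : _ = cint l2 (Kern F eta) * (v eta)%:C); last first.
  by rewrite -(cintZr _ (kern_citg eta)).
rewrite -!mulrA -!rmorphM /= (_ : v eta * _ = 1) ?mulr1//.
rewrite /v powRN; field; rewrite (gt_eqF (w2_gt0 _)) (gt_eqF (powR_gt0 _ (jb_gt0 _))); done.
Qed.

(** Young's inequality in its L^2 form: Cauchy-Schwarz in xi for the weight w2(xi - eta), of mass W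
    for every eta, then Fubini with mass W again in eta. Hence W enters squared. *)
Lemma G_bound C : 0 < C -> (forall eta xi,
    jb eta `^ (s' / 2) * cabs (Kern F eta xi) <= C * (fs F xi * w2 (xi - eta))) ->
  let D := (((2 * pi) ^+ 2)^-1 * (C * W)) ^+ 2 in
  itg l2 (fun eta : R2 => jb eta `^ s' * cabs (G eta) ^+ 2) /\
  \int[l2]_eta (jb eta `^ s' * cabs (G eta) ^+ 2) <=
    D * \int[l2]_xi (jb xi `^ s * cabs (F xi) ^+ 2).
Proof.
move=> C1 HC D; set c : R := ((2 * pi) ^+ 2)^-1 in D *.
have c0 : 0 <= c by rewrite invr_ge0 sqr_ge0.
have wi (x : R2) : itg l2 (fun y => w2 (x - y)) /\ \int[l2]_y w2 (x - y) = W.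
  rewrite (_ : (fun y => w2 (x - y)) = fun y => w2 (y - x)); last by apply/funext => y; exact: w2_sym.
  exact: itg_w2_shift.
have jj : itg (lebR2 \x lebR2)%E (fun z => fs F z.1 ^+ 2 * w2 (z.1 - z.2)).
  have m : measurable_fun setT (fun z : R2m * R2m => fs F z.1 ^+ 2 * w2 (z.1 - z.2)).
    have ms : measurable_fun setT (fun z : R2m * R2m => (z.1.1 - z.2.1, z.1.2 - z.2.2) : R2m).
      have f1 := @measurable_fst _ _ R2m R2m; have f2 := @measurable_snd _ _ R2m R2m.
      have g1 := @measurable_fst _ _ (measurableTypeR R) (measurableTypeR R).
      have g2 := @measurable_snd _ _ (measurableTypeR R) (measurableTypeR R).
      apply: measurable_fun_pair; apply: measurable_funB.
      + exact: (measurableT_comp g1 f1).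
      + exact: (measurableT_comp g1 f2).
      + exact: (measurableT_comp g2 f1).
      + exact: (measurableT_comp g2 f2).
    apply: measurable_funM; first exact: (measurableT_comp (itg_meas jf2) measurable_fst).
    exact: (measurableT_comp (itg_meas itg_w2) ms).
  apply: (@itg_Tonelli _ _ R2m R2m R lebR2 lebR2 _ m) => [x|].
    exact: (@itgZ _ R2m R lebR2 (fs F x ^+ 2) _ (wi x).1).
  have := itgZ W jf2; congr itg; apply/funext => x.
  under eq_Rintegral => y _.
    rewrite ger0_norm; last exact: mulr_ge0 (sqr_ge0 _) (w2_ge0 _).
    over.
  rewrite -(wi x).2 mulrC -(RintegralZl (fs F x ^+ 2) measurableT (wi x).1).
  by apply: eq_Rintegral.
have [jY eY] := @Rint_fubini2 _ _ R2m R2m R lebR2 lebR2 _ jj.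
have [_ eX] := @Rint_fubini1 _ _ R2m R2m R lebR2 lebR2 _ jj.
pose Y (y : R2m) : R := \int[lebR2]_x (fs F (x, y).1 ^+ 2 * w2 ((x, y).1 - (x, y).2)).
have iY : \int[lebR2]_eta Y eta = W * \int[l2]_xi (jb xi `^ s * cabs (F xi) ^+ 2).
  rewrite -eY eX.
  under eq_Rintegral => x _.
    rewrite (_ : Rintegral _ _ _ = W * fs F x ^+ 2); last first.
      by rewrite -(wi x).2 mulrC -(RintegralZl (fs F x ^+ 2) measurableT (wi x).1).
    over.
  rewrite RintegralZl; [|exact: measurableT|exact: jf2].
  by congr (_ * _); apply: eq_Rintegral => x _; exact: fsE.
have b eta : jb eta `^ s' * cabs (G eta) ^+ 2 <= (c * C) ^+ 2 * W * Y eta.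
  have jp : 0 < jb eta `^ (s' / 2) by rewrite powR_gt0// jb_gt0.
  have jE : jb eta `^ s' = (jb eta `^ (s' / 2)) ^+ 2.
    by rewrite -powR_mulrn ?powR_ge0// -powRrM -mulrA mulVf// mulr1.
  have h1 := cint_norm_le (kern_citg eta) (citg_cabs (kern_citg eta)) (fun x => lexx _).
  have h2 : jb eta `^ (s' / 2) * \int[l2]_xi cabs (Kern F eta xi) <= C * \int[l2]_xi (fs F xi * w2 (xi - eta)).
    have jc := citg_cabs (kern_citg eta); have jw := j2 eta.
    rewrite -!RintegralZl//; apply: le_Rint; [exact: itgZ|exact: itgZ|exact: HC].
  have h3 := cauchy_schwarz (itg_w2_shift eta).1 (j2 eta) (j1 eta) (fun x => w2_ge0 _).
  rewrite (itg_w2_shift eta).2 in h3; have {}h3 := h3 W0.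
  have p0 : 0 <= \int[l2]_xi (fs F xi * w2 (xi - eta)).
    by apply: Rintegral_ge0 => x _; exact: mulr_ge0 (fs0 _) (w2_ge0 _).
  have YE : Y eta = \int[l2]_xi (fs F xi ^+ 2 * w2 (xi - eta)) by [].
  rewrite YE; set a := \int[l2]_xi (fs F xi * _) in h2 h3 p0.
  set y := \int[l2]_xi (fs F xi ^+ 2 * _) in h3 *.
  rewrite jE -exprMn /G cabsM cabs_real -/c (ger0_norm c0).
  apply: (@le_trans _ _ ((c * (C * a)) ^+ 2)).
    rewrite ler_sqr ?nnegrE; first last.
    - by rewrite !mulr_ge0// ltW.
    - by rewrite !mulr_ge0 ?cabs_ge0// ltW.
    rewrite mulrCA; apply: (ler_wpM2l c0); apply: le_trans h2.
    by apply: (ler_wpM2l (ltW jp)).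
  rewrite (_ : _ ^+ 2 = (c * C) ^+ 2 * a ^+ 2); last by ring.
  by rewrite -mulrA; apply: (ler_wpM2l (sqr_ge0 _)).
have mG := G_meas.
have jG : itg l2 (fun eta : R2 => jb eta `^ s' * cabs (G eta) ^+ 2).
  apply: (itg_dom2 _ (itgZ ((c * C) ^+ 2 * W) jY)) => [|eta].
    apply: measurable_funM; [exact: jb_powR_meas|exact: (measurable_funX _ (cmeas_cabs mG))].
  by rewrite ger0_norm; [exact: b|exact: mulr_ge0 (powR_ge0 _ _) (sqr_ge0 _)].
split=> //; apply: (@le_trans _ _ (\int[lebR2]_x ((c * C) ^+ 2 * W * Y x))).
  exact: (@le_Rint _ R2m R lebR2 _ _ jG (itgZ ((c * C) ^+ 2 * W) jY) b).
have := @RintegralZl _ R2m R lebR2 setT Y ((c * C) ^+ 2 * W) measurableT jY.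
by move=> ->; rewrite iY /D le_eqVlt; apply/orP; left; apply/eqP; ring.
Qed.

(** By duality u is evaluated at the transposed operator applied to kap phi. Its transform is the
    multiplier times a convolution, and exchanging the integrations leaves the transform of phi
    outside. *)
Lemma G_pair (u : functional R2) phi :
  (forall psi, test_function psi -> u psi = (((2 * pi) ^+ 2)^-1)%:C * cint2 (fun xi => F xi * ft psi xi)) ->
  test_function phi ->
  mul_dist kap (curve_op_dist k u) phi =
    (((2 * pi) ^+ 2)^-1)%:C * cint2 (fun eta => G eta * ft phi eta).
Proof.
move=> Hu tp; have tkp := testM tk.1 tp; rewrite /mul_dist /curve_op_dist.
rewrite Hu; last exact: (curve_op_test T0 (citg_reflect jk) (vanishing_reflect kT) tkp).
rewrite /G; set c := (((2 * pi) ^+ 2)^-1 : R)%:C; apply: (congr1 (fun z => c * z)).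
have [D D0 HD] := ft_decay_powR (`|s' / 2| + 4) tp.
have J := @kern_pair (ft phi) D (ft_meas (test_citg2 tp)) _.
have {J}J : citg (lebR2 \x lebR2)%E (fun z => Kern F z.2 z.1 * ft phi z.2).
  apply: J => eta; apply: (le_trans (HD eta)); apply: (ler_wpM2l (ltW D0)).
  have jp := jb_gt0 eta.
  rewrite (_ : - _ = - `|s' / 2| + (- 2 + - 2)); last by ring.
  rewrite powRD ?(gt_eqF jp) ?implybT// powRD ?(gt_eqF jp) ?implybT//.
  apply: ler_pM; [exact: powR_ge0|by rewrite mulr_ge0// powR_ge0| |].
    by apply: ler_powR; [exact: jb_ge1|have := ler_norm (- (s' / 2)); rewrite normrN; lra].
  by rewrite expr2; apply: ler_pM; rewrite ?powR_ge0 ?jb_w2.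
have := cint_swap J => E.
transitivity (cint2 (fun xi => c * cint2 (fun eta => Kern F eta xi * ft phi eta))).
  apply: eq_cint => xi; rewrite (ft_curve_op_reflect _ T0 jk kT tkp).
  have E1 : ft (fun x => kap x * phi x) xi = c * _ := ft_testM_conv xi tk tp.
  rewrite E1 [LHS](_ : _ = c * ((F xi * curve_mult k xi) * cint2 (fun eta => ft kap (xi - eta) * ft phi eta))); last by ring.
  congr (_ * _); rewrite -cintZ; last first.
    set C1 := \int[l2]_x cabs (kap x); have H1 z : cabs (ft kap z) <= C1 := ft_bound z (test_citg2 tk).
    have [C2 C20 H2] := ft_decay_powR 2 tp.
    apply: (citg_dom2 _ (itgZ (C1 * C2) itg_w2)) => [|eta].
      apply: cmeasM; last exact: ft_meas (test_citg2 tp).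
      have [m1 m2] := ft_meas (test_citg2 tk).
      have ms : measurable_fun setT (fun eta : R2m => (xi.1 - eta.1, xi.2 - eta.2) : R2m).
        by apply: measurable_fun_pair; apply: measurable_funB => //; exact: measurable_cst.
      by split; [exact: (measurableT_comp m1 ms)|exact: (measurableT_comp m2 ms)].
    have h2 := le_trans (H2 eta) (ler_wpM2l (ltW C20) (jb_w2 eta)).
    by rewrite cabsM -mulrA; exact: (ler_pM (cabs_ge0 _) (cabs_ge0 _) (H1 _) h2).
  by apply: eq_cint => eta; rewrite /Kern; ring.
have J1 := (cint_fubini1 J).1; have J2 := (cint_fubini2 J).1.
apply: (etrans (cintZ c J1)); apply: (etrans (congr1 (fun z => c * z) E)).
apply: (etrans (esym (cintZ c J2))).
apply: eq_cint => eta /=; rewrite -mulrA; congr (_ * _).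
by rewrite -(cintZr (ft phi eta) (kern_citg eta)).
Qed.

End Bounded.

Lemma itg_ltyP d (X : measurableType d) (mu : {measure set X -> \bar R}) (f : X -> R) :
  measurable_fun setT f -> (forall x, 0 <= f x) ->
  itg mu f <-> (\int[mu]_x (f x)%:E < +oo)%E.
Proof.
move=> mf f0; have E : (\int[mu]_x `|(f x)%:E| = \int[mu]_x (f x)%:E)%E.
  by apply: eq_integral => x _; rewrite gee0_abs// lee_fin.
split; first by move=> /integrableP[_]; rewrite E.
by move=> H; apply/integrableP; split; [exact/measurable_EFinP|rewrite E].
Qed.

Theorem curve_op_bounded (k : R -> R[i]) (T C0 sigma s : R) : 0 < T -> citg leb k ->
  vanishing T k -> 0 < C0 ->
  (forall xi, cabs (curve_mult k xi) <= C0 * jb xi `^ (- (sigma / 2))) ->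
  bounded_comp_loc (curve_op_dist k) s (s + sigma).
Proof.
move=> T0 jk kT C00 kC K kap _ tk; have [C C1 HC] := kern_bound s C00 kC tk.
set D := (((2 * pi) ^+ 2)^-1 * (C * \int[l2]_xi w2 (xi : R2))) ^+ 2 : R.
exists (Num.sqrt D) => u F _ _ [mF1 mF2 iF Hu].
have mj (a : R) (H : R2 -> R[i]) : cmeas H -> itg l2 (fun xi : R2 => jb xi `^ a * cabs (H xi) ^+ 2) <->
    (\int[l2]_xi (jb xi `^ a * cabs (H xi) ^+ 2)%:E < +oo)%E.
  move=> mH; apply: (@itg_ltyP _ R2m l2) => [|x]; last exact: mulr_ge0 (powR_ge0 _ _) (sqr_ge0 _).
  by apply: measurable_funM; [exact: jb_powR_meas|exact: (measurable_funX _ (cmeas_cabs mH))].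
have mF : cmeas F by split.
have jF : itg l2 (fun xi : R2 => jb xi `^ s * cabs (F xi) ^+ 2).
  apply/(mj s F mF); move: iF; under eq_integral do rewrite bracket_powR; exact.
have [jG bG] := G_bound jk C00 kC tk mF jF C1 (HC F).
eexists; last first.
  rewrite /sobolev_norm; under [X in Num.sqrt X <= _]eq_Rintegral do rewrite bracket_powR.
  under [X in _ <= _ * Num.sqrt X]eq_Rintegral do rewrite bracket_powR.
  rewrite -sqrtrM ?sqr_ge0//; apply: ler_wsqrtr; exact: bG.
have mG := G_meas (s:=s) jk C00 kC tk mF jF; have [mG1 mG2] := mG.
split=> //; last by move=> phi; exact: (G_pair T0 jk kT C00 kC tk mF jF Hu).
by under eq_integral do rewrite bracket_powR; exact/(mj _ _ mG).
Qed.

End Sobolev.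

(** * Optimality of the exponent *)

Section Profile.
Context {R : realType}.
Local Notation leb := (@lebesgue_measure R).
Local Notation R1m := (measurableTypeR R).
Lemma is_derive_translate (w : R -> R) (r t : R) : smooth w -> is_derive t (1 : R) (fun t => w (t + r)) ('D_1 w (t + r)).
Proof.
move=> sw; apply: (is_derive_eqR (is_derive_compR (f := fun t => t + r) (is_derive_smooth (t + r) sw)
  (is_deriveDR (is_derive_idR t) (is_derive_cst r t 1)))).
by rewrite addr0 mulr1.
Qed.

Lemma affine_shift (c r : R) : affine_map (fun t : R => c * t + r) (fun t => c * t).
Proof.
have := affine_add (affine_scale c (@affine_id R R)) (@affine_cst R R R r).
by congr affine_map; apply/funext => t; rewrite addr0.
Qed.

Variable T : R.
Hypothesis T0 : 0 < T.
Let a : R := 1 + 3 * T.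

Definition bumpf (v : R -> R) := smooth v /\ forall t, T < `|t| -> v t = 0.

Lemma bump_D v : bumpf v -> bumpf ('D_1 v).
Proof.
move=> [sv vT]; split=> [|t tT]; first exact: smooth_D.
have d0 : is_derive t (1 : R) v 0.
  apply: (near_eq_is_derive _ (is_derive_cst (0 : R) t (1 : R))).
  have r0 : 0 < `|t| - T by rewrite subr_gt0.
  near=> y; rewrite vT//.
  have h : `|t - y| < `|t| - T by near: y; exact: (@cvgr_dist_lt _ _ _ (nbhs t) _ id t cvg_id _ r0).
  by have := lerB_dist t y; lra.
by have [_ ->] := d0.
Unshelve. all: by end_near. Qed.

Lemma bump_iter v n : bumpf v -> bumpf (iter n (fun f : R -> R => 'D_(1 : R) f) v).
Proof. by move=> bv; elim: n => //= n; exact: bump_D. Qed.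

Lemma bump_bound v : bumpf v -> exists2 M, 0 < M & forall t, `|v t| <= M * box T t.
Proof.
move=> [sv vT].
have [M M0 HM] := continuous_bound (smooth_cont sv) (@ball1_compact R T).
exists M => // t.
rewrite boxE; case: ifPn => [tT|]; last by rewrite -ltNge => /vT ->; rewrite normr0 mulr0.
by rewrite mulr1 HM//; exact/ball1E.
Qed.

Lemma bump_cont v : bumpf v -> continuous v. Proof. by move=> [sv _]; exact: smooth_cont. Qed.

(** If |y| <= T and v does not vanish, then t^3 lies in [a^3 - 2T, a^3 + 2T]. The choice a = 1 + 3T
    puts this interval inside [1, (a + 1)^3]. *)
Lemma cubic_support v (y t : R) : bumpf v -> `|y| <= T -> ~~ (1 <= t <= a + 1) ->
  v (y + t ^+ 3 - a ^+ 3) = 0.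
Proof.
move=> [_ vT] yT nt; apply: vT; rewrite ltNge; apply: contra nt.
rewrite !ler_norml in yT *; move: yT => /andP[y1 y2] /andP[u1 u2].
have h1 : a ^+ 3 - 2 * T <= t ^+ 3 by lra.
have h2 : t ^+ 3 <= a ^+ 3 + 2 * T by lra.
have a1 : 1 + 2 * T <= a ^+ 3.
  rewrite (_ : a ^+ 3 = 1 + 9 * T + 27 * T ^+ 2 + 27 * T ^+ 3); last by rewrite /a; ring.
  by have := exprn_ge0 2 (ltW T0); have := exprn_ge0 3 (ltW T0); have := T0; lra.
have a0 : 0 <= a by rewrite /a; have := T0; lra.
have a2 : a ^+ 3 + 2 * T <= (a + 1) ^+ 3.
  rewrite (_ : (a + 1) ^+ 3 = a ^+ 3 + 3 * a ^+ 2 + 3 * a + 1); last by ring.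
  by have := sqr_ge0 a; rewrite /a; have := T0; lra.
have t1 : 1 <= t ^+ 3 by lra.
have t2 : t ^+ 3 <= (a + 1) ^+ 3 by lra.
apply/andP; split.
  rewrite leNgt; apply/negP => tlt.
  have t0 : 0 <= t by rewrite leNgt; apply/negP => tn; have : t ^+ 3 <= 0 := ltW (_ : t ^+ 3 < 0); nra.
  have : t ^+ 3 < 1 by rewrite exprn_ilt1.
  lra.
rewrite leNgt; apply/negP => tlt.
have : (a + 1) ^+ 3 < t ^+ 3 by rewrite ltr_pXn2r// nnegrE; lra.
lra.
Qed.

Lemma measurable_cubic (q v : R -> R) : measurable_fun setT q -> bumpf v ->
  measurable_fun setT (fun z : R1m * R1m => q z.2 * v (z.1 + z.2 ^+ 3 - a ^+ 3)).
Proof.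
move=> mq bv; have f1 := @measurable_fst _ _ R1m R1m; have f2 := @measurable_snd _ _ R1m R1m.
apply: measurable_funM; first exact: (measurableT_comp mq f2).
have mv : measurable_fun setT v := continuous_measurable_fun (bump_cont bv).
apply: (measurableT_comp mv); apply: measurable_funB; last exact: measurable_cst.
by apply: measurable_funD => //; exact: measurable_funX.
Qed.

Definition cubic_weight (q : R -> R) :=
  measurable_fun setT q /\ exists2 Q, 0 < Q & forall t, 1 <= t <= a + 1 -> `|q t| <= Q.

Lemma cubic_bound q w : cubic_weight q -> bumpf w ->
  exists2 M, 0 < M & forall y t, `|y| <= T -> `|q t * w (y + t ^+ 3 - a ^+ 3)| <= M * box (a + 1) t.
Proof.
move=> [mq [Q Q0 Hq]] bw; have [M M0 Hw] := bump_bound bw.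
exists (Q * M) => [|y t yT]; first exact: mulr_gt0.
have [/andP[t1 t2]|nt] := boolP (1 <= t <= a + 1); last first.
  by rewrite cubic_support// mulr0 normr0; apply: mulr_ge0 (box_ge0 _ _); apply: mulr_ge0; exact: ltW.
have tn : `|t| = t by rewrite ger0_norm//; lra.
rewrite normrM boxE tn t2 mulr1; apply: ler_pM; rewrite ?normr_ge0//.
  by apply: Hq; rewrite t1.
by apply: (le_trans (Hw _)); rewrite boxE; case: ifP => _; rewrite ?mulr1// mulr0 ltW.
Qed.

Lemma itg_cubic q w y : cubic_weight q -> bumpf w -> `|y| <= T ->
  itg leb (fun t => q t * w (y + t ^+ 3 - a ^+ 3)).
Proof.
move=> wq bw yT; have [M _ Hw] := cubic_bound wq bw.
apply: (itg_dom1 _ (itgZ M (itg_box (a + 1)))); last by move=> t; exact: Hw.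
apply: measurable_funM; first exact: wq.1.
apply: (measurableT_comp (continuous_measurable_fun (bump_cont bw))).
apply: measurable_funB; last exact: measurable_cst.
by apply: measurable_funD; [exact: measurable_cst|exact: measurable_funX].
Qed.

(* The translation by a^3 confines t to [1, a + 1], away from the singularity of the weight, when
   v and w vanish off [-T, T]. *)
Definition cubic_pairing (q v w : R -> R) : R :=
  \int[leb]_y (v y * \int[leb]_t (q t * w (y + t ^+ 3 - a ^+ 3))).

Lemma cubic_prod q v w : cubic_weight q -> bumpf v -> bumpf w ->
  itg (leb \x leb)%E (fun z : R1m * R1m => v z.1 * (q z.2 * w (z.1 + z.2 ^+ 3 - a ^+ 3))).
Proof.
move=> wq bv bw; have [Mv Mv0 Hv] := bump_bound bv; have [M M0 Hw] := cubic_bound wq bw.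
have jb := @itg_prod _ _ R1m R1m R leb leb _ _ (itgZ Mv (itg_box T)) (itgZ M (itg_box (a + 1))).
apply: (@itg_dom _ (R1m * R1m)%type R (leb \x leb)%E _ _ _ jb) => [|[y t] /=].
  apply: measurable_funM; last exact: (measurable_cubic wq.1 bw).
  exact: (measurableT_comp (continuous_measurable_fun (bump_cont bv)) (@measurable_fst _ _ R1m R1m)).
rewrite normrM; have [yT|yT] := leP `|y| T.
  by apply: ler_pM; rewrite ?normr_ge0//; exact: Hw.
rewrite bv.2// normr0 mul0r; apply: mulr_ge0; apply: mulr_ge0; rewrite ?box_ge0//; exact: ltW.
Qed.

Lemma cubic_pairing_inner q v w y : cubic_weight q -> bumpf v -> bumpf w ->
  v y * \int[leb]_t (q t * w (y + t ^+ 3 - a ^+ 3)) =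
  \int[leb]_t (v y * (q t * w (y + t ^+ 3 - a ^+ 3))).
Proof.
move=> wq bv bw; have [yT|yT] := leP `|y| T.
  by rewrite RintegralZl//; exact: itg_cubic.
rewrite bv.2// mul0r; under eq_Rintegral do rewrite mul0r.
by rewrite Rintegral_cst// mul0r.
Qed.

Lemma cubic_pairing_itg q v w : cubic_weight q -> bumpf v -> bumpf w ->
  itg leb (fun y => v y * \int[leb]_t (q t * w (y + t ^+ 3 - a ^+ 3))).
Proof.
move=> wq bv bw; have [+ _] := @Rint_fubini1 _ _ R1m R1m R leb leb _ (cubic_prod wq bv bw).
by congr itg; apply/funext => y; rewrite cubic_pairing_inner.
Qed.

Lemma cubic_weightD q q' v w : cubic_weight q -> cubic_weight q' -> bumpf v -> bumpf w ->
  cubic_pairing (fun t => q t + q' t) v w = cubic_pairing q v w + cubic_pairing q' v w.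
Proof.
move=> wq wq' bv bw; rewrite /cubic_pairing -RintegralD//; [|exact: cubic_pairing_itg|exact: cubic_pairing_itg].
apply: eq_Rintegral => y _; rewrite -mulrDr; have [yT|yT] := leP `|y| T; last by rewrite bv.2// !mul0r.
rewrite -RintegralD//; [|exact: itg_cubic|exact: itg_cubic].
by congr (_ * _); apply: eq_Rintegral => t _; rewrite mulrDl.
Qed.

Lemma cubic_weightZ (c : R) q v w : cubic_weight q -> bumpf v -> bumpf w ->
  cubic_pairing (fun t => c * q t) v w = c * cubic_pairing q v w.
Proof.
move=> wq bv bw; rewrite /cubic_pairing -RintegralZl//; last exact: cubic_pairing_itg.
apply: eq_Rintegral => y _; rewrite mulrCA; have [yT|yT] := leP `|y| T; last by rewrite bv.2// !mul0r.
congr (_ * _); rewrite -(RintegralZl c measurableT (itg_cubic wq bw yT)).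
by apply: eq_Rintegral => t _; rewrite mulrA.
Qed.

Lemma powabs_cubic c : 0 <= c -> cubic_weight (fun t => `|t| `^ (- c)).
Proof.
move=> c0; split; first exact: measurable_powabs.
exists 1 => // t /andP[t1 t2]; rewrite ger0_norm ?powR_ge0// ger0_norm; last by lra.
by rewrite -(powRr0 t); apply: ler_powR => //; lra.
Qed.

Definition profile (c : R) (v w : R -> R) : R := cubic_pairing (fun t => `|t| `^ (- c)) v w.

Lemma itg_powabs_cubic w (c : R) y : 0 <= c -> bumpf w -> `|y| <= T ->
  itg leb (fun t => `|t| `^ (- c) * w (y + t ^+ 3 - a ^+ 3)).
Proof. by move=> c0; exact: itg_cubic (powabs_cubic c0). Qed.

Lemma profile_prod c v w : 0 <= c -> bumpf v -> bumpf w ->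
  itg (leb \x leb)%E (fun z : R1m * R1m => v z.1 * (`|z.2| `^ (- c) * w (z.1 + z.2 ^+ 3 - a ^+ 3))).
Proof. by move=> c0; exact: cubic_prod (powabs_cubic c0). Qed.

Lemma profileE c v w : 0 <= c -> bumpf v -> bumpf w ->
  profile c v w = \int[leb]_y \int[leb]_t (v y * (`|t| `^ (- c) * w (y + t ^+ 3 - a ^+ 3))).
Proof.
by move=> c0 bv bw; apply: eq_Rintegral => y _; exact: (cubic_pairing_inner _ (powabs_cubic c0)).
Qed.

Lemma itg_bump_shift v w (r : R) : bumpf v -> bumpf w -> itg leb (fun y => v y * w (y + r)).
Proof.
move=> bv bw; have [Mv Mv0 Hv] := bump_bound bv; have [M M0 Hw] := bump_bound bw.
apply: (itg_dom1 _ (itgZ (Mv * M) (itg_box T))) => [|y].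
  apply: measurable_funM; first exact: continuous_measurable_fun (bump_cont bv).
  apply: (measurableT_comp (continuous_measurable_fun (bump_cont bw))).
  by apply: measurable_funD => //; exact: measurable_cst.
rewrite normrM mulrAC; apply: ler_pM; rewrite ?normr_ge0//; apply: (le_trans (Hw _)).
by rewrite boxE; case: ifP => _; rewrite ?mulr1// mulr0 ltW.
Qed.

Lemma profile_swap c v w : 0 <= c -> bumpf v -> bumpf w ->
  let f t := `|t| `^ (- c) * \int[leb]_y (v y * w (y + (t ^+ 3 - a ^+ 3))) in
  itg leb f /\ profile c v w = \int[leb]_t f t.
Proof.
move=> c0 bv bw f; have jj := profile_prod c0 bv bw; rewrite profileE//.
have [j2 e2] := @Rint_fubini2 _ _ R1m R1m R leb leb _ jj.
rewrite -(@Rint_fubini1 _ _ R1m R1m R leb leb _ jj).2 e2.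
have E : (fun t => \int[leb]_y (v y * (`|t| `^ (- c) * w (y + t ^+ 3 - a ^+ 3)))) = f.
  apply/funext => t; rewrite /f -RintegralZl//; last exact: itg_bump_shift.
  by apply: eq_Rintegral => y _; rewrite addrA mulrCA.
by rewrite -E.
Qed.

Lemma ibp_bump v w (r : R) : bumpf v -> bumpf w ->
  \int[leb]_y ('D_1 v y * w (y + r)) = - \int[leb]_y (v y * 'D_1 w (y + r)).
Proof.
move=> bv bw; have sw : smooth (fun y => w (y + r)).
  by have := smooth_affine (affine_shift 1 r) bw.1; under eq_fun do rewrite mul1r.
have h0 (y : R) : T < `|y| -> v y * w (y + r) = 0 by move=> yT; rewrite bv.2// mul0r.
have := Rint_derive0 (smoothM bv.1 sw) h0.
rewrite (_ : 'D_(1 : R) _ = fun y : R => 'D_1 v y * w (y + r) + v y * 'D_1 w (y + r)); last first.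
  apply/funext => y; have [_ ->] := is_deriveMR (is_derive_smooth y bv.1) (is_derive_translate r y bw.1).
  ring.
have j1 := itg_bump_shift r (bump_D bv) bw; have j2 := itg_bump_shift r bv (bump_D bw).
by rewrite (RintegralD measurableT j1 j2); lra.
Qed.

Lemma profile_ibp c v w : 0 <= c -> bumpf v -> bumpf w ->
  profile c ('D_1 v) w = - profile c v ('D_1 w).
Proof.
move=> c0 bv bw; have [_ ->] := profile_swap c0 (bump_D bv) bw.
have [j ->] := profile_swap c0 bv (bump_D bw).
rewrite -[RHS]mulN1r -[RHS](RintegralZl (-1) measurableT j).
by apply: eq_Rintegral => t _; rewrite ibp_bump// mulN1r mulrN.
Qed.

(** Integral of the derivative of |t|^-(c+2) w(y + t^3 - a^3), which vanishes off [1, a + 1]. The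
    chain rule contributes 3 t^2, whence |t|^-c on one side and |t|^-(c+3) on the other. *)
Lemma powabs_cubic_ibp w (c y : R) : 0 <= c -> bumpf w -> `|y| <= T ->
  3 * \int[leb]_t (`|t| `^ (- c) * 'D_1 w (y + t ^+ 3 - a ^+ 3)) =
  (c + 2) * \int[leb]_t (`|t| `^ (- (c + 3)) * w (y + t ^+ 3 - a ^+ 3)).
Proof.
move=> c0 bw yT; have bD := bump_D bw; have c3 : 0 <= c + 3 by lra.
have far t : a + 2 <= `|t| -> ~~ (1 <= t <= a + 1).
  move=> ta; apply/negP => /andP[t1 t2].
  by have : `|t| = t; [rewrite ger0_norm//; lra|lra].
have J1 := itg_powabs_cubic c0 bD yT; have J2 := itg_powabs_cubic c3 bw yT.
rewrite -!RintegralZl//; apply/eqP; rewrite -subr_eq0 -RintegralB//; [|exact: itgZ|exact: itgZ].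
apply/eqP; apply: (@Rint_derive0_off0 R (fun t => `|t| `^ (- (c + 2)) * w (y + t ^+ 3 - a ^+ 3)) _ (a + 2)).
- by rewrite /a; have := T0; lra.
- by move=> t ta; rewrite cubic_support ?mulr0//; exact: far.
- by move=> t ta; have nt := far t ta; rewrite (cubic_support bD yT nt) (cubic_support bw yT nt) !mulr0 subr0.
- by apply: itgB; exact: itgZ.
- move=> t t0; have dp := is_derive_powabs (- (c + 2)) t0.
  have dq : is_derive t (1 : R) (fun t : R => y + t ^+ 3 - a ^+ 3) (3 * t ^+ 2).
    apply: (is_derive_eqR (is_deriveDR (is_deriveDR (is_derive_cst y t 1) (is_derive_exprR t 2)) (is_derive_cst (- a ^+ 3) t 1))).
    by rewrite addr0 add0r.
  have dw := is_derive_compR (f := fun t : R => y + t ^+ 3 - a ^+ 3) (is_derive_smooth _ bw.1) dq.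
  apply: (is_derive_eqR (is_deriveMR dp dw)) => /=.
  have [/andP[t1 t2]|nt] := boolP (1 <= t <= a + 1); last first.
    by rewrite (cubic_support bD yT nt) (cubic_support bw yT nt) !(mulr0, mul0r) subr0 addr0.
  have tp : 0 < t by lra.
  rewrite (gtr0_norm tp) -[t^-1]powR_inv1 ?(ltW tp)//.
  set u := 'D_1 w _; set x := w _.
  have tn : t != 0 := t0.
  have E1 : t `^ (-1) * t `^ (- (c + 2)) = t `^ (- (c + 3)).
    by rewrite -powRD ?(gt_eqF tp) ?implybT//; congr (_ `^ _); ring.
  have E2 : t `^ (- (c + 2)) * t ^+ 2 = t `^ (- c).
    by rewrite -powR_mulrn ?(ltW tp)// -powRD ?(gt_eqF tp) ?implybT//; congr (_ `^ _); ring.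
  rewrite -E1 -E2; ring.
- move=> t t0; have cp q : {for t, continuous (fun t : R => `|t| `^ q)} := is_derive_cont (is_derive_powabs q t0).
  have cc (u : R -> R) : bumpf u -> {for t, continuous (fun t : R => u (y + t ^+ 3 - a ^+ 3))}.
    move=> bu; have cq : {for t, continuous (fun t : R => y + t ^+ 3 - a ^+ 3)}.
      by apply: cvgB; [apply: cvgD; [exact: cvg_cst|exact: exprn_continuous]|exact: cvg_cst].
    by apply: (continuous_comp cq); exact: bump_cont.
  have cM (f g : R -> R) : {for t, continuous f} -> {for t, continuous g} -> {for t, continuous (fun x => f x * g x)}.
    by move=> hf hg; exact: cvgM hf hg.
  have cK (q : R) : {for t, continuous (fun _ : R => q)} by exact: cvg_cst.
  have h1 := cM _ _ (cK 3) (cM _ _ (cp (- c)) (cc _ bD)).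
  have h2 := cM _ _ (cK (c + 2)) (cM _ _ (cp (- (c + 3))) (cc _ bw)).
  exact: cvgB h1 h2.
- apply: cvg_near_cst; near=> t; rewrite cubic_support ?mulr0//; apply/negP => /andP[t1 t2].
  have : `|t| < 1 by near: t; apply: near_norm_lt; rewrite normr0.
  by rewrite ltNge (le_trans t1)// ler_norm.
Unshelve. all: by end_near. Qed.

Lemma profile_ibp_cubic c v w : 0 <= c -> bumpf v -> bumpf w ->
  3 * profile c v ('D_1 w) = (c + 2) * profile (c + 3) v w.
Proof.
move=> c0 bv bw; have c3 : 0 <= c + 3 by lra.
have J1 := (@Rint_fubini1 _ _ R1m R1m R leb leb _ (profile_prod c0 bv (bump_D bw))).1.
have J2 := (@Rint_fubini1 _ _ R1m R1m R leb leb _ (profile_prod c3 bv bw)).1.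
rewrite (profileE c0 bv (bump_D bw)) (profileE c3 bv bw).
rewrite -(RintegralZl 3 measurableT J1) -(RintegralZl (c + 2) measurableT J2); apply: eq_Rintegral => y _; have [yT|yT] := leP `|y| T; last first.
  have z (g : R -> R) : \int[leb]_t (v y * g t) = 0.
    by rewrite bv.2//; under eq_Rintegral do rewrite mul0r; rewrite Rintegral_cst// mul0r.
  by rewrite /= !z !mulr0.
rewrite (RintegralZl (v y) measurableT (itg_powabs_cubic c0 (bump_D bw) yT)).
rewrite (RintegralZl (v y) measurableT (itg_powabs_cubic c3 bw yT)).
by rewrite mulrCA powabs_cubic_ibp// mulrCA.
Qed.

(** The integrand is nonnegative, and near y = 0, t = a both bumps equal 1: the integral over a
    small rectangle is already positive. *)
Lemma profile_gt0 c v (d : R) : 0 <= c -> bumpf v -> (forall t, 0 <= v t) ->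
  0 < d -> (forall t, `|t| <= d -> v t = 1) -> 0 < profile c v v.
Proof.
move=> c0 bv v0 d0 v1; have jj := profile_prod c0 bv bv.
have a1 : 1 <= a by rewrite /a; have := T0; lra.
pose e := d / 2; have e0 : 0 < e by rewrite divr_gt0.
(* On |t - a| <= r <= 1 one has t <= a + 1, so that |t^3 - a^3| <= 3 (a + 1)^2 r <= e = d/2;
   together with |y| <= d/2 the argument stays within d. *)
pose r := Num.min 1 (e / (3 * (a + 1) ^+ 2)).
have q0 : 0 < 3 * (a + 1) ^+ 2 by rewrite mulr_gt0// exprn_gt0//; lra.
have r0 : 0 < r by rewrite lt_min ltr01 divr_gt0.
have r1 : r <= 1 by rewrite ge_min lexx.
have rd : r * (3 * (a + 1) ^+ 2) <= e by rewrite -ler_pdivlMr// ge_min lexx orbT.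
pose m := (a + 1) `^ (- c).
have m0 : 0 < m by rewrite powR_gt0//; lra.
have jb : itg leb (box e) := itg_box e.
have [js es] := Rint_aff (- a) (oner_neq0 R) (itg_box r).
have jp := itgZ m (@itg_prod _ _ R1m R1m R leb leb _ _ jb js).
apply: (@lt_le_trans _ _ ((m * (2 * r)) * (2 * e))); first by rewrite !mulr_gt0.
rewrite profileE// -(@Rint_fubini1 _ _ R1m R1m R leb leb _ jj).2.
have E : \int[(leb \x leb)%E]_z (m * (box e (z : R1m * R1m).1 * box r (1 * z.2 + - a))) = (m * (2 * r)) * (2 * e).
  rewrite (@Rint_fubini1 _ _ R1m R1m R leb leb _ jp).2 /=.
  have ex (y : R) : \int[leb]_t (m * (box e y * box r (1 * t - a))) = (m * (2 * r)) * box e y.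
    under eq_Rintegral do rewrite mulrA.
    by rewrite RintegralZl// es normr1 invr1 mul1r Rint_box ?(ltW r0)//; ring.
  under eq_Rintegral do rewrite ex.
  by rewrite RintegralZl// Rint_box// ltW.
rewrite -E; apply: (@le_Rint _ (R1m * R1m)%type R (leb \x leb)%E _ _ jp jj) => -[y t] /=.
have g0 : 0 <= v y * (`|t| `^ (- c) * v (y + t ^+ 3 - a ^+ 3)).
  by apply: mulr_ge0 => //; apply: mulr_ge0 => //; exact: powR_ge0.
rewrite !boxE; case: ifPn => yd; last by rewrite mul0r mulr0.
case: ifPn => tr; last by rewrite !mulr0.
rewrite v1 ?v1; first last.
- by rewrite /e in yd; lra.
- have y3 : `|t ^+ 3 - a ^+ 3| <= e.
    rewrite (_ : _ - _ = (1 * t - a) * (t ^+ 2 + t * a + a ^+ 2)); last by ring.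
    rewrite normrM (le_trans _ rd)//; apply: ler_pM; rewrite ?normr_ge0//.
    move: tr; rewrite !ler_norml mul1r => /andP[t1 t2]; apply/andP; split; nra.
  rewrite -addrA (le_trans (ler_normD _ _))//; rewrite /e in y3 yd; lra.
rewrite !mulr1 mul1r /m; move: tr; rewrite ler_norml mul1r => /andP[t1 t2].
have tp : 0 < t by have := T0; rewrite /a in t1; lra.
by rewrite gtr0_norm//; apply: ler_powR_neg; [lra|exact: tp|lra].
Qed.

(* Integrating by parts in y and in t trades a derivative for the factor (c + 2) / 3 and a weight
   of exponent c + 3, which reduces the claim to v and w themselves. *)
Lemma profile_neq0 c v w m n : 0 <= c -> bumpf v -> bumpf w ->
  (forall c', 0 <= c' -> profile c' v w != 0) ->
  profile c (iter m (fun f : R -> R => 'D_(1 : R) f) v) (iter n (fun f : R -> R => 'D_(1 : R) f) w) != 0.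
Proof.
move=> c0 bv bw H; have iD u k : iter k.+1 (fun f : R -> R => 'D_(1 : R) f) u =
    'D_1 (iter k (fun f : R -> R => 'D_(1 : R) f) u) by [].
have step c' v' w' : 0 <= c' -> bumpf v' -> bumpf w' -> profile (c' + 3) v' w' != 0 -> profile c' v' ('D_1 w') != 0.
  move=> h0 bv' bw' h; have := profile_ibp_cubic h0 bv' bw' => E.
  apply/eqP => h1; move: E; rewrite h1 mulr0 => /esym/eqP; rewrite mulf_eq0 (negPf h) orbF.
  by rewrite gt_eqF//; lra.
elim: m c c0 => [|m IH] c c0.
  elim: n c c0 => [|n IH] c c0; first exact: H.
  by rewrite iD; apply: step => //; [exact: bump_iter|apply: IH; lra].
rewrite iD profile_ibp//; [|exact: bump_iter|exact: bump_iter].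
rewrite oppr_eq0; apply: step => //; [exact: bump_iter|exact: bump_iter|apply: IH; lra].
Qed.

End Profile.

(** * Sobolev norms of functions squeezed in the second variable *)

Section Scaled.
Context {R : realType}.
Local Notation leb := (@lebesgue_measure R).
Local Notation l2 := (@lebesgue_measure R \x @lebesgue_measure R)%E.
Local Notation R2 := (R * R)%type.
Local Notation R2m := (measurableTypeR R * measurableTypeR R)%type.
Local Notation e2 := ((0, 1) : R2).
Local Notation D n g := (iter n (fun u : R -> R => 'D_(1 : R) u) g).

Definition tens (f g : R -> R) : R2 -> R[i] := fun x => (f x.1 * g x.2)%:C.

Lemma tens_test A f g : bumpf A f -> bumpf A g -> test_function (tens f g).
Proof.
move=> [sf fA] [sg gA]; split.
  by apply: csmooth_real; apply: smoothM; [exact: (smooth_affine (@affine_fst R R R) sf)|exact: (smooth_affine (@affine_snd R R R) sg)].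
apply: (cs_ball2 (A := A)) => x; rewrite prod_normE lt_max => /orP[h|h].
  by rewrite /tens fA// mul0r.
by rewrite /tens gA// mulr0.
Qed.

Lemma cD_tens (f g : R -> R) : smooth f -> smooth g -> cD e2 (tens f g) = tens f ('D_1 g).
Proof.
move=> sf sg; have E : forall v : R2, v.1 = 0 -> cD v (tens f g) = fun x => (v.2 * (f x.1 * 'D_1 g x.2))%:C.
  move=> v v1; apply/funext => x; apply: complexP => /=; last first.
    rewrite (_ : im_fun _ = fun=> 0); last by apply/funext => y.
    by rewrite derive_cst.
  have d1 := derive_affine v (@affine_fst R R R) sf.
  have d2 := derive_affine v (@affine_snd R R R) sg.
  have s1 := smooth_affine (@affine_fst R R R) sf.
  have s2 := smooth_affine (@affine_snd R R R) sg.
  rewrite (_ : re_fun _ = fun y : R2 => f y.1 * g y.2); last by apply/funext => y.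
  rewrite derive_mulR; [|exact: diff_derivable (smooth_diff s1 x)|exact: diff_derivable (smooth_diff s2 x)].
  rewrite (congr1 (fun u => u x) d1) (congr1 (fun u => u x) d2) /= v1.
  rewrite (derive_scale 0 (smooth_diff sf _)) (derive_scale v.2 (smooth_diff sg _)).
  ring.
rewrite E//; apply/funext => x; rewrite /tens; congr (_%:C); exact: mul1r.
Qed.

Lemma cabs_ft_tens A f g n xi : bumpf A f -> bumpf A g ->
  cabs (ft (tens f (D n g)) xi) = `|xi.2| ^+ n * cabs (ft (tens f g) xi).
Proof.
move=> bf bg; elim: n => [|n IH]; first by rewrite expr0 mul1r.
have bn := bump_iter n bg.
rewrite iterS -(cD_tens bf.1 bn.1) ft_cD2; last exact: tens_test bf bn.
rewrite cabsM IH mulrA exprS; congr (_ * _ * _).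
by rewrite -mulNr cabsM cabs_real /cabs /= oppr0 expr0n /= sqrrN expr1n add0r sqrtr1 mul1r.
Qed.

Definition squeeze (d : R) (F : R2 -> R[i]) : R2 -> R[i] := fun x => F (x.1, d^-1 * x.2).

Lemma squeeze_test d F : 0 < d -> test_function F -> test_function (squeeze d F).
Proof.
move=> d0 tF; have ai := affine_pair (@affine_fst R R R) (affine_scale d^-1 (@affine_snd R R R)).
split; first exact: csmooth_affine ai tF.1.
have [A A0 HA] := cs_bound tF.2.
apply: (cs_ball2 (A := A + d * A)) => x; rewrite prod_normE lt_max => h.
apply: HA; rewrite prod_normE lt_max /=; have dA : 0 < d * A by rewrite mulr_gt0.
case/orP: h => h; apply/orP; [left|right]; first by lra.
by rewrite normrM normfV (gtr0_norm d0) mulrC ltr_pdivlMr//; lra.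
Qed.

Lemma ft_squeeze d F xi : 0 < d -> citg l2 F ->
  ft (squeeze d F) xi = d%:C * ft F (xi.1, d * xi.2).
Proof.
move=> d0 jF; have n1 : (1 : R) != 0 := oner_neq0 R.
have dn : d^-1 != 0 by rewrite invr_eq0 gt_eqF.
have [_] := cint2_shear 0 n1 dn (@measurable_cst _ _ (measurableTypeR R) (measurableTypeR R) setT 0) (ft_citg (xi.1, d * xi.2) jF).
rewrite normr1 mul1r normfV invrK (gtr0_norm d0) => <-.
apply: eq_cint => x; rewrite /squeeze mul1r !addr0; congr (cis _ * _).
by rewrite /dot2 /=; field; rewrite gt_eqF.
Qed.

(* The M derivatives provide the factor |xi_2|^M, which absorbs the low frequencies when s < 0. *)
Lemma sobolev_squeeze A f g M (s : R) : bumpf A f -> bumpf A g -> 0 <= M%:R + s ->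
  exists2 C, 0 < C & forall d, 0 < d -> d <= 1 -> forall xi : R2,
    jb xi `^ s * cabs (ft (squeeze d (tens f (D M g))) xi) ^+ 2
      <= C * d `^ (2 - 2 * s) * w2 (xi.1, d * xi.2).
Proof.
move=> bf bg Ms; have bM := bump_iter M bg.
have [C1 C10 HC] := ft_decay_powR ((M%:R + s + 2) / 2) (tens_test bf bg).
exists (C1 ^+ 2) => [|d d0 d1 xi]; first exact: exprn_gt0.
rewrite ft_squeeze//; last exact: test_citg2 (tens_test bf bM).
set z := (xi.1, d * xi.2) : R2.
rewrite cabsM cabs_real (gtr0_norm d0) (cabs_ft_tens _ _ bf bg).
have jz := jb_gt0 z; have jx := jb_gt0 xi.
(* The intermediate quantity y satisfies z_2^2 <= y <= [jb z], and the power s of [jb xi] is d^(-2s)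
   y^s. Then y^s |z_2|^(2M) <= y^(M+s), where the exponent is nonnegative whatever the sign of s, so
   y may be replaced by [jb z]. *)
pose y := d ^+ 2 * jb xi; have y0 : 0 < y by rewrite mulr_gt0// exprn_gt0.
have zy : z.2 ^+ 2 <= y.
  rewrite /y /jb /dot2 /z /= exprMn ler_pM2l ?exprn_gt0// -!expr2.
  by have := sqr_ge0 xi.1; lra.
have yj : y <= jb z.
  have dd : d ^+ 2 <= 1 by rewrite exprn_ile1// ltW.
  have := sqr_ge0 xi.1; rewrite /y /jb /dot2 /z /=; nra.
have E1 : jb xi `^ s = d `^ (- (2 * s)) * y `^ s.
  rewrite /y powRM ?sqr_ge0 ?(ltW jx)// -powR_mulrn ?(ltW d0)// -powRrM mulrA -powRD ?(gt_eqF d0) ?implybT//.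
  by rewrite addNr powRr0 mul1r.
have E2 : d `^ (2 - 2 * s) = d `^ (- (2 * s)) * d ^+ 2.
  by rewrite -powR_mulrn ?(ltW d0)// -powRD ?(gt_eqF d0) ?implybT//; congr (_ `^ _); ring.
have h1 : y `^ s * (`|z.2| ^+ M) ^+ 2 <= jb z `^ (M%:R + s).
  rewrite exprAC real_normK ?num_real//.
  apply: (@le_trans _ _ (y `^ s * y ^+ M)).
    by rewrite ler_wpM2l ?powR_ge0// lerXn2r ?nnegrE ?sqr_ge0 ?(ltW y0).
  rewrite -powR_mulrn ?(ltW y0)// -powRD ?(gt_eqF y0) ?implybT// addrC.
  by rewrite ge0_ler_powR// nnegrE ltW.
have h2 : cabs (ft (tens f g) z) ^+ 2 <= C1 ^+ 2 * jb z `^ (- (M%:R + s + 2)).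
  apply: (@le_trans _ _ ((C1 * jb z `^ (- ((M%:R + s + 2) / 2))) ^+ 2)).
    by rewrite ler_sqr ?nnegrE ?cabs_ge0//; rewrite mulr_ge0 ?powR_ge0// ltW.
  rewrite exprMn; apply: ler_wpM2l; first exact: sqr_ge0.
  rewrite -powR_mulrn ?powR_ge0// -powRrM (_ : _ * 2%:R = - (M%:R + s + 2))//; by field.
rewrite E1 E2 !exprMn.
set P := d `^ _; set Q := cabs _ ^+ 2; set V := y `^ s; set L := _ ^+ 2 in h1 *.
rewrite (_ : P * V * _ = P * d ^+ 2 * (V * L * Q)); last by ring.
rewrite (_ : C1 ^+ 2 * _ * _ = P * d ^+ 2 * (C1 ^+ 2 * w2 z)); last by ring.
apply: ler_wpM2l; first by rewrite mulr_ge0 ?powR_ge0 ?sqr_ge0.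
apply: (@le_trans _ _ (jb z `^ (M%:R + s) * (C1 ^+ 2 * jb z `^ (- (M%:R + s + 2))))).
  exact: (ler_pM (mulr_ge0 (powR_ge0 _ _) (sqr_ge0 _)) (sqr_ge0 _) h1 h2).
rewrite mulrCA; apply: ler_wpM2l; first exact: sqr_ge0.
by rewrite -powRD ?(gt_eqF jz) ?implybT// (_ : _ + _ = - 2) ?jb_w2//; ring.
Qed.

Lemma itg_w2_squeeze d : 0 < d -> itg l2 (fun xi : R2 => w2 (xi.1, d * xi.2)) /\
  \int[l2]_xi w2 ((xi : R2).1, d * xi.2) = d^-1 * \int[l2]_xi w2 (xi : R2).
Proof.
move=> d0; have n1 : (1 : R) != 0 := oner_neq0 R.
have dn : d != 0 by rewrite gt_eqF.
have [j e] := Rint2_shear 0 n1 dn (@measurable_cst _ _ (measurableTypeR R) (measurableTypeR R) setT 0) itg_w2.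
rewrite normr1 mul1r (gtr0_norm d0) in e.
have E : (fun z : R2 => w2 (1 * z.1 + 0, d * z.2 + 0)) = (fun xi : R2 => w2 (xi.1, d * xi.2)).
  by apply/funext => x; rewrite mul1r !addr0.
by rewrite -E; split => //.
Qed.

Lemma dist2_of_test (U : R2 -> R[i]) : test_function U -> Defs.distribution (dist2_of_fun U).
Proof.
move=> tU; have jU := test_citg2 tU; split.
  move=> c phi psi tp ts; rewrite /dist2_of_fun.
  have j1 := test_citg2 (testM tU.1 tp); have j2 := test_citg2 (testM tU.1 ts).
  rewrite -(cintZ c j1) -(cintD (citgZ c j1) j2).
  by apply: eq_cint => x; ring.
move=> K cK; exists (\int[l2]_x cabs (U x)), 0%N => phi tp phiK M HM.
have HM0 z : cabs (phi z) <= M.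
  have := HM [::] isT; rewrite /citerD /= => /(_ (fun v => _)) h.
  have {}h := h (fun v => ltac:(by rewrite in_nil)) z.
  by move: h; rewrite /re_fun /im_fun; case: (phi z).
rewrite mulrC -RintegralZl//; last exact: citg_cabs.
apply: cint_norm_le; [exact: test_citg2 (testM tU.1 tp)|exact: itgZ (citg_cabs jU)|].
by move=> x; rewrite cabsM mulrC; apply: ler_wpM2r; rewrite ?cabs_ge0.
Qed.

End Scaled.

(** * Duality and the upper bound for the pairing *)

Section Upper.
Context {R : realType}.
Local Notation leb := (@lebesgue_measure R).
Local Notation l2 := (@lebesgue_measure R \x @lebesgue_measure R)%E.
Local Notation R2 := (R * R)%type.
Local Notation R2m := (measurableTypeR R * measurableTypeR R)%type.
Local Notation D n g := (iter n (fun u : R -> R => 'D_(1 : R) u) g).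

Lemma jb_opp (xi : R2) : jb (- xi) = jb xi.
Proof. by rewrite /jb /dot2 /= !mulrNN. Qed.

(* The duality between H^s and H^(-s), with a weight lam in place of the
   Cauchy-Schwarz inequality. *)
Lemma sobolev_duality (s lam : R) (G H : R2 -> R[i]) : 0 < lam -> cmeas G -> cmeas H ->
  itg l2 (fun xi => jb xi `^ s * cabs (G xi) ^+ 2) ->
  itg l2 (fun xi => jb xi `^ (- s) * cabs (H xi) ^+ 2) ->
  cabs (cint2 (fun xi => G xi * H xi)) <=
    lam * \int[l2]_xi (jb xi `^ s * cabs (G xi) ^+ 2) +
    lam^-1 * \int[l2]_xi (jb xi `^ (- s) * cabs (H xi) ^+ 2).
Proof.
move=> l0 mG mH jG jH; have jj := itgD (itgZ lam jG) (itgZ lam^-1 jH).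
have b (xi : R2) : cabs (G xi * H xi) <=
    lam * (jb xi `^ s * cabs (G xi) ^+ 2) + lam^-1 * (jb xi `^ (- s) * cabs (H xi) ^+ 2).
  have p0 : 0 < jb xi `^ s by rewrite powR_gt0// jb_gt0.
  rewrite cabsM powRN; set u := cabs _; set v := cabs _; set p := jb xi `^ s in p0 *.
  have q0 : 0 < lam * p by rewrite mulr_gt0.
  have u0 : 0 <= u := cabs_ge0 _; have v0 : 0 <= v := cabs_ge0 _.
  have := sqr_ge0 (lam * p * u - v) => h.
  rewrite -(ler_pM2l q0) (_ : lam * p * (_ + _) = (lam * p * u) ^+ 2 + v ^+ 2); last first.
    by field; rewrite !gt_eqF.
  have := mulr_ge0 (mulr_ge0 (ltW q0) u0) v0; nra.
rewrite -!RintegralZl// -RintegralD//; [|exact: itgZ|exact: itgZ].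
apply: cint_norm_le => //; apply: (citg_dom2 (cmeasM mG mH) jj b).
Qed.

(** The function [H] is the transform itself for the test function (z = xi) and its reflection for u
    (z = -xi). Of the factor d^(2-2s) one power of d is lost to the integral of w2 stretched by
    1/d. *)
Lemma squeeze_norm A f g M (s : R) : bumpf A f -> bumpf A g -> 0 <= M%:R + s ->
  exists2 C, 0 < C & forall d, 0 < d -> d <= 1 -> forall H : R2 -> R[i], cmeas H ->
    (forall xi, exists2 z, z = xi \/ z = - xi & cabs (H xi) = cabs (ft (squeeze d (tens f (D M g))) z)) ->
    itg l2 (fun xi => jb xi `^ s * cabs (H xi) ^+ 2) /\
    \int[l2]_xi (jb xi `^ s * cabs (H xi) ^+ 2) <= C * d `^ (1 - 2 * s).
Proof.
move=> bf bg Ms; have [C C0 HC] := sobolev_squeeze bf bg Ms.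
have W0 : 0 <= \int[l2]_xi w2 (xi : R2) by apply: Rintegral_ge0 => x _; exact: w2_ge0.
exists (C * (\int[l2]_xi w2 (xi : R2)) + 1) => [|d d0 d1 H mH HE].
  by rewrite ltr_wpDl// mulr_ge0// ltW.
have [jw ew] := itg_w2_squeeze d0; have b := HC d d0 d1.
have mm : measurable_fun setT (fun xi : R2 => jb xi `^ s * cabs (H xi) ^+ 2).
  by apply: measurable_funM; [exact: jb_powR_meas|exact: (measurable_funX _ (cmeas_cabs mH))].
have b' (xi : R2) : jb xi `^ s * cabs (H xi) ^+ 2 <= C * d `^ (2 - 2 * s) * w2 (xi.1, d * xi.2).
  have [z zE ->] := HE xi; have {b} := b z; case: zE => ->//.
  rewrite jb_opp (_ : w2 _ = w2 (xi.1, d * xi.2))//.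
  by rewrite /w2 /w1 /= mulrN !sqrrN.
have jH : itg l2 (fun xi : R2 => jb xi `^ s * cabs (H xi) ^+ 2).
  apply: (@itg_dom _ R2m R l2 _ _ mm (itgZ (C * d `^ (2 - 2 * s)) jw)) => xi.
  by rewrite ger0_norm; [exact: b'|exact: mulr_ge0 (powR_ge0 _ _) (sqr_ge0 _)].
split=> //; apply: (le_trans (le_Rint jH (itgZ (C * d `^ (2 - 2 * s)) jw) b')).
rewrite RintegralZl// ew.
have E : d `^ (2 - 2 * s) = d `^ (1 - 2 * s) * d.
  by rewrite -{3}(powRr1 (ltW d0)) -powRD ?(gt_eqF d0) ?implybT//; congr (_ `^ _); ring.
rewrite E (_ : C * _ * _ = C * \int[l2]_xi w2 (xi : R2) * d `^ (1 - 2 * s)); last first.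
  by field; rewrite gt_eqF.
by rewrite ler_wpM2r ?powR_ge0// lerDl.
Qed.

Lemma pairing_upper (k : R -> R[i]) (s s' A : R) (kap : R2 -> R[i]) (f g h j : R -> R) M :
  bounded_comp_loc (curve_op_dist k) s s' -> test_function kap -> 0 < A ->
  bumpf A f -> bumpf A g -> bumpf A h -> bumpf A j -> 0 <= M%:R + s -> 0 <= M%:R - s' ->
  exists C : R, forall d, 0 < d -> d <= 1 ->
    cabs (cint2 (fun x => squeeze d (tens f (D M g)) x *
      curve_op (fun t => k (- t)) (fun y => kap y * squeeze d (tens h (D M j)) y) x))
    <= C * d `^ (1 + s' - s).
Proof.
move=> bk tk A0 bf bg bh bj Ms Ms'.
have bgM := bump_iter M bg; have bjM := bump_iter M bj.
have [C HC] := bk _ kap (@ball2_compact R A) tk.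
have [C1 C10 H1] := squeeze_norm bf bg Ms.
have [C2 C20 H2] := squeeze_norm bh bj Ms'.
set c : R := cabs ((((2 * pi) ^+ 2)^-1 : R)%:C).
exists (c * (C ^+ 2 * C1 + C2)) => d d0 d1.
set U := squeeze d _; set Phi := squeeze d (tens h _).
have tU : test_function U by apply: squeeze_test => //; exact: tens_test bf bgM.
have tP : test_function Phi by apply: squeeze_test => //; exact: tens_test bh bjM.
pose F (xi : R2) : R[i] := ft U (- xi).
have [mU1 mU2] := ft_meas (test_citg2 tU).
have mopp : measurable_fun setT (fun xi : R2m => (- xi.1, - xi.2) : R2m).
  by apply: measurable_fun_pair; exact: (measurableT_comp (@oppr_measurable R setT)).
have mF : cmeas F by split; [exact: (measurableT_comp mU1 mopp)|exact: (measurableT_comp mU2 mopp)].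
have [jF bF] := H1 d d0 d1 F mF (fun xi => ex_intro2 _ _ (- xi) (or_intror erefl) erefl).
have [jP bP] := H2 d d0 d1 (ft Phi) (ft_meas (test_citg2 tP)) (fun xi => ex_intro2 _ _ xi (or_introl erefl) erefl).
have jl (a : R) (H : R2 -> R[i]) : cmeas H -> itg l2 (fun xi : R2 => jb xi `^ a * cabs (H xi) ^+ 2) <->
    (\int[l2]_xi (jb xi `^ a * cabs (H xi) ^+ 2)%:E < +oo)%E.
  move=> mH; apply: (@itg_ltyP R _ R2m l2) => [|x]; last exact: mulr_ge0 (powR_ge0 _ _) (sqr_ge0 _).
  by apply: measurable_funM; [exact: jb_powR_meas|exact: (measurable_funX _ (cmeas_cabs mH))].
have [G [mG1 mG2 iG HG] nG] : exists2 G, sobolev_transform s' (mul_dist kap (curve_op_dist k (dist2_of_fun U))) G &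
    sobolev_norm s' G <= C * sobolev_norm s F.
  apply: HC; first exact: dist2_of_test.
    move=> phi tp Hp; rewrite /dist2_of_fun (_ : (fun x => _) = fun=> 0).
      by rewrite /cint2 /cint !Rintegral_cst// !mul0r.
    apply/funext => x; have [xA|xA] := leP `|x| A.
      suff -> : phi x = 0 by rewrite mulr0.
      apply/eqP; apply: contrapT => /negP nz.
      have nx : closure [set x | phi x != 0] x by apply: subset_closure.
      by apply: (Hp x nx); exact/ball2E.
    move: xA; rewrite prod_normE lt_max => /orP[h1|h1].
      by rewrite /U /squeeze /tens /= bf.2// !mul0r.
    rewrite /U /squeeze /tens /= bgM.2 ?mulr0 ?mul0r//.
    rewrite normrM normfV (gtr0_norm d0) mulrC ltr_pdivlMr// (le_lt_trans _ h1)//.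
    by rewrite ger_pMr.
  split; [exact: mF.1|exact: mF.2| |].
    by under eq_integral do rewrite bracket_powR; exact/(jl _ _ mF).
  move=> phi tp; have := ft_test_mult tU tp; rewrite /dist2_of_fun.
  set p := (2 * pi : R) ^+ 2; have p0 : p != 0.
    by rewrite expf_eq0 mulf_eq0 pnatr_eq0 /= gt_eqF// pi_gt0.
  move: p p0 => p p0 E; rewrite [X in _ = _ * X]E mulrA -rmorphM /= mulVf//.
  by rewrite rmorph1 mul1r.
have mG : cmeas G by split.
have jG : itg l2 (fun xi : R2 => jb xi `^ s' * cabs (G xi) ^+ 2).
  by apply/(jl _ _ mG); move: iG; under eq_integral do rewrite bracket_powR.
have := HG Phi tP; rewrite /mul_dist /curve_op_dist /dist2_of_fun => ->.
rewrite cabsM -/c -mulrA; apply: ler_wpM2l; first exact: cabs_ge0.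
have nF0 : 0 <= sobolev_norm s F by exact: sqrtr_ge0.
have bG : \int[l2]_xi (jb xi `^ s' * cabs (G xi) ^+ 2) <= C ^+ 2 * (C1 * d `^ (1 - 2 * s)).
  have G0 : 0 <= \int[l2]_xi (jb xi `^ s' * cabs (G xi) ^+ 2).
    by apply: Rintegral_ge0 => x _; exact: mulr_ge0 (powR_ge0 _ _) (sqr_ge0 _).
  have F0 : 0 <= \int[l2]_xi (jb xi `^ s * cabs (F xi) ^+ 2).
    by apply: Rintegral_ge0 => x _; exact: mulr_ge0 (powR_ge0 _ _) (sqr_ge0 _).
  have nE (a : R) (H : R2 -> R[i]) : sobolev_norm a H = Num.sqrt (\int[l2]_xi (jb xi `^ a * cabs (H xi) ^+ 2)).
    by rewrite /sobolev_norm; under eq_Rintegral do rewrite bracket_powR.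
  move: nG nF0; rewrite !nE => nG nF0; have q0 := sqrtr_ge0 (\int[l2]_xi (jb xi `^ s' * cabs (G xi) ^+ 2)).
  rewrite -(sqr_sqrtr G0); apply: (@le_trans _ _ ((C * Num.sqrt (\int[l2]_xi (jb xi `^ s * cabs (F xi) ^+ 2))) ^+ 2)).
    by rewrite ler_sqr ?nnegrE//; exact: le_trans nG.
  by rewrite exprMn (sqr_sqrtr F0); apply: ler_wpM2l => //; exact: sqr_ge0.
(* This weight balances the two terms of the duality bound: d^(s+s') d^(1-2s) and d^-(s+s')
   d^(1+2s') both equal d^(1+s'-s). *)
have l0 : 0 < d `^ (s + s') by rewrite powR_gt0.
have {}mP := ft_meas (test_citg2 tP).
apply: (le_trans (sobolev_duality l0 mG mP jG jP)).
rewrite mulrDl; apply: lerD.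
  apply: (le_trans (ler_wpM2l (ltW l0) bG)).
  rewrite (_ : d `^ _ * _ = C ^+ 2 * C1 * (d `^ (s + s') * d `^ (1 - 2 * s))); last by ring.
  rewrite -powRD ?(gt_eqF d0) ?implybT// (_ : s + s' + _ = 1 + s' - s)//; ring.
rewrite -powRN; apply: (le_trans (ler_wpM2l (powR_ge0 _ _) bP)).
rewrite mulrCA -powRD ?(gt_eqF d0) ?implybT// (_ : - (s + s') + _ = 1 + s' - s)//; ring.
Qed.

End Upper.

(** * The exact value of the pairing and the contradiction *)

Section Lower.
Context {R : realType}.
Local Notation leb := (@lebesgue_measure R).
Local Notation l2 := (@lebesgue_measure R \x @lebesgue_measure R)%E.
Local Notation R2 := (R * R)%type.
Local Notation R1m := (measurableTypeR R).
Local Notation R2m := (measurableTypeR R * measurableTypeR R)%type.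
Local Notation D n g := (iter n (fun u : R -> R => 'D_(1 : R) u) g).

Lemma D_shift (g : R -> R) (r : R) n : smooth g -> D n (fun t => g (t + r)) = fun t => D n g (t + r).
Proof.
move=> sg; elim: n => // n IH; rewrite !iterS IH; apply/funext => t.
have sn : smooth (D n g) by elim: (n) => // m; rewrite iterS; exact: smooth_D.
by have [_ ->] := is_derive_translate r t sn.
Qed.

Lemma lower_bound_absurd (N P L C : R) : 0 <= N -> `|C| + `|L| + 1 <= N * `|P| ->
  `|- N * P + L| <= C -> False.
Proof.
move=> N0; have := lerB_normD (- N * P) L; rewrite normrM normrN (ger0_norm N0); have := ler_norm C; lra.
Qed.

Variables (chi : R -> R[i]) (T : R).
Hypotheses (tchi : test_function chi) (chi1 : forall t : R, `|t| <= 2^-1 -> chi t = 1).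
Hypotheses (T0 : 0 < T) (chiT : forall t, T < `|t| -> chi t = 0).
Let a : R := 1 + 3 * T.

(** The squared modulus of chi: a real nonnegative bump with the support of chi, equal to 1 for |t|
    <= 1/2. *)
Definition beta (t : R) : R := re_fun chi t ^+ 2 + im_fun chi t ^+ 2.

Lemma beta_ge0 t : 0 <= beta t. Proof. by rewrite addr_ge0// sqr_ge0. Qed.

Lemma beta1 t : `|t| <= 2^-1 -> beta t = 1.
Proof. by move=> /chi1 h; rewrite /beta /re_fun /im_fun h /= expr1n expr0n /= addr0. Qed.

Lemma beta_bump : bumpf T beta.
Proof.
split; first by apply: smoothD; apply: smoothX; [exact: tchi.1.1|exact: tchi.1.2].
by move=> t tT; rewrite /beta /re_fun /im_fun chiT//= expr0n addr0.
Qed.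

Lemma beta_aff (A c r : R) : smooth (fun t => beta (c * t + r)) /\
  ((forall t, A < `|t| -> T < `|c * t + r|) -> bumpf A (fun t => beta (c * t + r))).
Proof.
have sb := smooth_affine (affine_shift c r) beta_bump.1.
by split=> // H; split=> // t /H /(beta_bump.2).
Qed.

Let H := 2 * (T + 1).
(** B bounds the supports of [beta], [h] and [j]. The localization [kap] is 1 where both coordinates
    are at most B and so disappears in [kap_id]. Likewise H makes [h] equal to 1 for |t| <= T +
    1. *)
Let B := H * T + T + a ^+ 3.
(* h is 1 at the points x1 - t that occur in the pairing, so that the shift in x1 is invisible. *)
Let h (t : R) := beta (H^-1 * t + 0).
Let j (t : R) := beta (t + - a ^+ 3).
Let q (t : R) := beta ((2 * B)^-1 * t + 0).
Let kap := tens q q.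

Let H1 : 2 <= H. Proof. by rewrite /H; have := T0; lra. Qed.
Let H0 : 0 < H. Proof. by have := H1; lra. Qed.
Let a1 : 1 <= a. Proof. by rewrite /a; have := T0; lra. Qed.
Let a3 : 1 <= a ^+ 3. Proof. by rewrite exprn_ege1. Qed.
Let HT : 0 < H * T. Proof. by rewrite mulr_gt0. Qed.
Let B1 : 1 <= B. Proof. by rewrite /B; have := a3; have := HT; have := T0; lra. Qed.
Let B0 : 0 < B. Proof. by have := B1; lra. Qed.
Let B20 : 0 < 2 * B. Proof. by have := B1; lra. Qed.

Let bbeta : bumpf B beta.
Proof.
have [sb bT] := beta_bump; split=> // t tB; apply: bT; apply: le_lt_trans tB.
by rewrite /B; have := a3; have := HT; lra.
Qed.

Let bh : bumpf (H * T) h.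
Proof.
apply: (beta_aff _ _ _).2 => t tH; rewrite addr0 normrM normfV (gtr0_norm H0).
by rewrite mulrC ltr_pdivlMr// mulrC.
Qed.

Let bhB : bumpf B h.
Proof.
have [sb bT] := bh; split=> // t tB; apply: bT; apply: le_lt_trans tB.
by rewrite /B; have := a3; have := T0; lra.
Qed.

Let bj : bumpf B j.
Proof.
have E : j = fun t => beta (1 * t + - a ^+ 3) by apply/funext => t; rewrite mul1r.
rewrite E; apply: (beta_aff _ _ _).2 => t tB; rewrite mul1r.
have := lerB_dist t (a ^+ 3); rewrite (ger0_norm (le_trans ler01 a3)).
by move: tB; rewrite /B; have := HT; lra.
Qed.

Let q1 t : `|t| <= B -> q t = 1.
Proof.
move=> tB; apply: beta1; rewrite addr0 normrM normfV (gtr0_norm B20).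
by rewrite mulrC ler_pdivrMr//; lra.
Qed.

Let tkap : test_function kap.
Proof.
have b : bumpf (2 * B * T) q.
  apply: (beta_aff _ _ _).2 => t tH; rewrite addr0 normrM normfV (gtr0_norm B20).
  by rewrite mulrC ltr_pdivlMr// mulrC.
exact: (tens_test b b).
Qed.

Let Djv n (t : R) : D n j t = D n beta (t - a ^+ 3).
Proof. by rewrite /j (D_shift _ _ beta_bump.1). Qed.

Lemma kap_id d M : 0 < d -> d <= 1 ->
  (fun y => kap y * squeeze d (tens h (D M j)) y) = squeeze d (tens h (D M j)).
Proof.
move=> d0 d1; apply/funext => y; rewrite /kap /squeeze /tens /=.
have [y1|y1] := leP `|y.1| B; last by rewrite (bhB.2 _ y1) mul0r mulr0.
have [y2|y2] := leP `|y.2| B; first by rewrite !q1// mul1r mul1r.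
rewrite (bump_iter M bj).2 ?mulr0 ?mulr0// normrM normfV (gtr0_norm d0) mulrC ltr_pdivlMr//.
by apply: le_lt_trans y2; rewrite ger_pMr.
Qed.

(** The factor e^4 is e from t = -e s times e^3 from x2 = e^3 y. The sign undoes the reflection of
    the weight: k(-t) becomes k(e s), and x2 - t^3 becomes e^3 (y + s^3). All s that matter lie in
    [1, a + 1], where [p] is the rescaled weight. *)
Lemma pairing_value (k : R -> R[i]) (p : R -> R) (e : R) M : cubic_weight T p ->
  0 < e -> e * (a + 1) <= 2^-1 -> (forall t, 1 <= t <= a + 1 -> k (e * t) = (p t)%:C) ->
  cint2 (fun x => squeeze (e ^+ 3) (tens beta (D M beta)) x *
    curve_op (fun t => k (- t)) (squeeze (e ^+ 3) (tens h (D M j))) x) =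
  (e ^+ 4 * (\int[leb]_t beta t) * cubic_pairing T p (D M beta) (D M beta))%:C.
Proof.
move=> wp e0 ea kp; have bM := bump_iter M beta_bump.
have d0 : 0 < e ^+ 3 by rewrite exprn_gt0.
have en : e != 0 by rewrite gt_eqF.
pose w (y : R) : R := D M beta y * \int[leb]_t (p t * D M beta (y + t ^+ 3 - a ^+ 3)).
have jw : itg leb w := cubic_pairing_itg T0 wp bM bM.
have jb : itg leb beta.
  have [m m0 Hm] := bump_bound beta_bump.
  apply: (itg_dom1 _ (itgZ m (itg_box T)) Hm).
  exact: continuous_measurable_fun (bump_cont beta_bump).
have E x : squeeze (e ^+ 3) (tens beta (D M beta)) x *
    curve_op (fun t => k (- t)) (squeeze (e ^+ 3) (tens h (D M j))) x =
    (e * (beta x.1 * w ((e ^+ 3)^-1 * x.2)))%:C.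
  set y := (e ^+ 3)^-1 * x.2.
  have [x1|x1] := leP `|x.1| T; last first.
    by rewrite /squeeze /tens /= (beta_bump.2 _ x1) !mul0r mulr0.
  have [yT|yT] := leP `|y| T; last first.
    by rewrite /squeeze /tens /= -/y /w (bM.2 _ yT) !(mulr0, mul0r).
  pose F (t : R) : R := p t * D M beta (y + t ^+ 3 - a ^+ 3).
  have jF : itg leb F := itg_cubic T0 wp bM yT.
  have ne : - e^-1 != 0 by rewrite oppr_eq0 invr_eq0.
  have [_ eF] := Rint_aff 0 ne jF.
  have -> : curve_op (fun t => k (- t)) (squeeze (e ^+ 3) (tens h (D M j))) x = (e * \int[leb]_t F t)%:C.
    rewrite -[e * _](_ : \int[leb]_t F (- e^-1 * t + 0) = _); last first.
      by rewrite eF normrN normfV invrK (gtr0_norm e0).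
    rewrite -cint_real; apply: eq_cint => t; rewrite /squeeze /tens /= /F.
    set s := - e^-1 * t + 0; have ts : - t = e * s by rewrite /s; field.
    have -> : (e ^+ 3)^-1 * (x.2 - t ^+ 3) = y + s ^+ 3 by rewrite /y /s; field.
    rewrite Djv; have [s1|ns] := boolP (1 <= s <= a + 1); last first.
      by rewrite (cubic_support T0 bM yT ns) !mulr0 mul0r.
    have h1 : h (x.1 - t) = 1.
      have tn : `|t| <= 2^-1.
        rewrite -normrN ts normrM (gtr0_norm e0) (le_trans _ ea)// ler_pM2l//.
        by move/andP: s1 => [u1 u2]; rewrite ger0_norm; lra.
      apply: beta1; rewrite addr0 normrM normfV (gtr0_norm H0) mulrC ler_pdivrMr//.
      by have := ler_normB x.1 t; rewrite /H; lra.
    by rewrite h1 mul1r ts kp// mulrC -rmorphM.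
  by rewrite /squeeze /tens /= -/y -rmorphM /= /w; congr (_%:C); ring.
have n1 : (1 : R) != 0 := oner_neq0 R.
have dn : (e ^+ 3)^-1 != 0 by rewrite invr_eq0 gt_eqF.
have jj := @itg_prod _ _ R1m R1m R leb leb _ _ jb jw.
have [_ e2] := Rint2_shear 0 n1 dn (@measurable_cst _ _ R1m R1m setT 0) jj.
have E3 : (fun z : R2 => beta (1 * z.1 + 0) * w ((e ^+ 3)^-1 * z.2 + 0)) =
    fun z : R2 => beta z.1 * w ((e ^+ 3)^-1 * z.2).
  by apply/funext => z; rewrite mul1r !addr0.
have j1 := (Rint2_shear 0 n1 dn (@measurable_cst _ _ R1m R1m setT 0) jj).1.
rewrite E3 in j1; rewrite [X in Rintegral _ _ X]E3 in e2.
transitivity (cint2 (fun x : R2 => (e * (beta x.1 * w ((e ^+ 3)^-1 * x.2)))%:C)); first by apply: (congr1 (@cint2 R)); apply/funext => x; exact: E.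
rewrite /cint2 cint_real; congr (_%:C); rewrite [LHS](RintegralZl e measurableT j1) [X in e * X]e2.
rewrite (@Rint_fubini1 _ _ R1m R1m R leb leb _ jj).2 /=.
under eq_Rintegral do rewrite (RintegralZl _ measurableT jw).
rewrite (RintegralZr _ measurableT jb) normr1 mul1r normfV invrK (gtr0_norm d0) /cubic_pairing -/w.
set u := (X in e * (_ * (X * _))); set v := (X in e * (_ * (_ * X))).
change (e * (e ^+ 3 * (u * v)) = e ^+ 4 * u * v); ring.
Qed.

Let Ibeta := \int[leb]_t beta t.

Lemma Ibeta_gt0 : 0 < Ibeta.
Proof.
have [m m0 Hm] := bump_bound beta_bump.
have jb : itg leb beta.
  apply: (itg_dom1 _ (itgZ m (itg_box T)) Hm).
  exact: continuous_measurable_fun (bump_cont beta_bump).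
apply: (@lt_le_trans _ _ (\int[leb]_t box 2^-1 t)); first by rewrite Rint_box// mulfV.
apply: le_Rint => // [|t]; first exact: itg_box.
by rewrite boxE; case: ifPn => [/beta1->//|_]; exact: beta_ge0.
Qed.

Lemma profile_beta_neq0 c M : 0 <= c -> profile T c (D M beta) (D M beta) != 0.
Proof.
move=> c0; apply: profile_neq0 => //; try exact: beta_bump.
move=> c' c'0; rewrite gt_eqF//; apply: (@profile_gt0 R T T0 c' beta 2^-1) => //.
- exact: beta_bump.
- exact: beta_ge0.
- exact: beta1.
Qed.

(** The consequence of boundedness that will be contradicted. Neither M nor C depends on e or p, so
    that e can tend to 0 with p depending on e, as the logarithm requires. *)
Lemma curve_op_unbounded (k : R -> R[i]) (s s' : R) : bounded_comp_loc (curve_op_dist k) s s' ->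
  exists M, exists C, forall e p, 0 < e -> e * (a + 1) <= 2^-1 -> cubic_weight T p ->
    (forall t, 1 <= t <= a + 1 -> k (e * t) = (p t)%:C) ->
    e ^+ 4 * `|cubic_pairing T p (D M beta) (D M beta)| <= C * e `^ (3 * (1 + s' - s)).
Proof.
move=> bk; pose M := (Num.truncn (`|s| + `|s'|)).+1; exists M.
have Ms : `|s| + `|s'| <= M%:R by rewrite ltW// truncnS_gt.
have M1 : 0 <= M%:R + s by have := ler_norm (- s); rewrite normrN; have := normr_ge0 s'; lra.
have M2 : 0 <= M%:R - s' by have := ler_norm s'; have := normr_ge0 s; lra.
have [C HC] := pairing_upper bk tkap B0 bbeta bbeta bhB bj M1 M2.
exists (Ibeta^-1 * C) => e p e0 ea wp kp.
have e1 : e <= 1.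
  have : e * 1 <= e * (a + 1) by rewrite ler_pM2l//; have := a1; lra.
  by rewrite mulr1; lra.
have d0 : 0 < e ^+ 3 by rewrite exprn_gt0.
have d1 : e ^+ 3 <= 1 by rewrite exprn_ile1// ltW.
have := HC (e ^+ 3) d0 d1; rewrite (kap_id M d0 d1) (pairing_value M wp e0 ea kp) cabs_real.
have -> : (e ^+ 3) `^ (1 + s' - s) = e `^ (3 * (1 + s' - s)).
  by rewrite powRrM -(powR_mulrn 3 (ltW e0)).
have i0 : 0 <= e ^+ 4 * Ibeta by rewrite mulr_ge0 ?exprn_ge0// ltW// Ibeta_gt0.
rewrite -/Ibeta normrM (ger0_norm i0).
move=> h1; rewrite -[Ibeta^-1 * C * _]mulrA ler_pdivlMl ?Ibeta_gt0//.
by apply: le_trans h1; rewrite mulrCA mulrA.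
Qed.

Lemma cubic_range t : 1 <= t <= a + 1 -> 0 < t. Proof. by move=> /andP[t1 _]; lra. Qed.

Lemma chi_small e t : 0 < e -> e * (a + 1) <= 2^-1 -> 1 <= t <= a + 1 -> chi (e * t) = 1.
Proof.
move=> e0 ea ht; have tp := cubic_range ht; apply: chi1; rewrite gtr0_norm ?mulr_gt0//.
by apply: le_trans ea; rewrite ler_pM2l//; case/andP: ht.
Qed.

Lemma power_unbounded (b s s' : R) : 0 < b -> b < 1 -> 1 - b < 3 * (s' - s) ->
  ~ bounded_comp_loc (curve_op_dist (power_weight chi b)) s s'.
Proof.
move=> b0 b1 bs /curve_op_unbounded[M [C HC]].
have P0 := profile_beta_neq0 M (ltW b0); set P := profile T b _ _ in P0.
have nP : 0 < `|P| by rewrite normr_gt0.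
(* The excess in the exponent: e^(4-b) |P| <= C e^(4-b+r) would follow for all small e. The value
   [e2] is chosen to make C e^r at most |P|/2. *)
pose r := 3 * (s' - s) - (1 - b); have r0 : 0 < r by rewrite /r; lra.
have C1 : 0 < `|C| + 1 by rewrite ltr_wpDl.
pose e1 := (2 * (a + 1))^-1; have a10 : 0 < a + 1 by have := a1; lra.
pose e2 := (`|P| / (2 * (`|C| + 1))) `^ r^-1.
have q0 : 0 < `|P| / (2 * (`|C| + 1)) by rewrite divr_gt0// mulr_gt0.
pose e := Num.min e1 e2.
have e0 : 0 < e by rewrite lt_min invr_gt0 mulr_gt0//= powR_gt0.
have ea : e * (a + 1) <= 2^-1.
  apply: (@le_trans _ _ (e1 * (a + 1))); first by rewrite ler_pM2r// ge_min lexx.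
  by rewrite /e1 invfM -mulrA mulVf ?mulr1// gt_eqF.
have wb := @powabs_cubic R T b (ltW b0).
have wp : cubic_weight T (fun t => e `^ (- b) * `|t| `^ (- b)).
  split; first by apply: measurable_funM; [exact: measurable_cst|exact: wb.1].
  have [Q Q0 HQ] := wb.2; exists (e `^ (- b) * Q) => [|t ht]; first by rewrite mulr_gt0// powR_gt0.
  by rewrite normrM ger0_norm ?powR_ge0// ler_wpM2l ?powR_ge0//; exact: HQ.
have kp t : 1 <= t <= a + 1 -> power_weight chi b (e * t) = (e `^ (- b) * `|t| `^ (- b))%:C.
  move=> ht; have tp := cubic_range ht; rewrite /power_weight (chi_small e0 ea ht) mul1r.
  rewrite normrM (gtr0_norm e0) powRM ?(ltW e0)// !powRN -invfM.
  by rewrite fmorphV.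
have := HC e _ e0 ea wp kp.
have bM := bump_iter M beta_bump; rewrite (cubic_weightZ T0 _ wb bM bM) -/(profile T b _ _) -/P.
rewrite normrM ger0_norm ?powR_ge0// mulrA -(powR_mulrn 4 (ltW e0)) -powRD ?(gt_eqF e0) ?implybT//.
rewrite (_ : 3 * (1 + s' - s) = (4%:R - b) + r); last by rewrite /r; ring.
rewrite [X in C * X]powRD ?(gt_eqF e0) ?implybT// mulrCA ler_pM2l ?powR_gt0//.
move=> h1; have er : e `^ r <= `|P| / (2 * (`|C| + 1)).
  apply: (@le_trans _ _ (e2 `^ r)).
    by apply: ge0_ler_powR; rewrite ?nnegrE ?(ltW r0) ?(ltW e0) ?powR_ge0// ge_min lexx orbT.
  by rewrite /e2 -powRrM mulVf ?gt_eqF// powRr1// ltW.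
have : C * e `^ r <= `|P| / 2.
  apply: (@le_trans _ _ ((`|C| + 1) * (`|P| / (2 * (`|C| + 1))))).
    apply: (@le_trans _ _ ((`|C| + 1) * e `^ r)); last by rewrite ler_pM2l.
    by rewrite ler_wpM2r ?powR_ge0//; have := ler_norm C; lra.
  by rewrite le_eqVlt; apply/orP; left; apply/eqP; field; rewrite gt_eqF.
lra.
Qed.

Lemma log_unbounded (s : R) : ~ bounded_comp_loc (curve_op_dist (log_weight chi)) s (s + 3^-1).
Proof.
move=> /curve_op_unbounded[M [C HC]].
have P0 := profile_beta_neq0 M (lexx 0); set P := profile T 0 _ _ in P0.
have nP : 0 < `|P| by rewrite normr_gt0.
have w0 := @powabs_cubic R T 0 (lexx 0).
have a10 : 0 < a + 1 by have := a1; lra.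
have wl : cubic_weight T (fun t => ln `|t|).
  split; first by apply: measurable_off0 => t t0; exact: is_derive_cont (is_derive_lnabs t0).
  exists (a + 1) => // t ht; have tp := cubic_range ht; case/andP: ht => t1 t2.
  rewrite (gtr0_norm tp) ger0_norm ?ln_ge0// (le_trans _ t2)//.
  have h1 : -1 < t - 1 by lra.
  by have := le_ln1Dx h1; rewrite (_ : 1 + (t - 1) = t); [lra|ring].
set L := cubic_pairing T (fun t => ln `|t|) (D M beta) (D M beta).
(* Here ln e = -N, and the rescaled weight is ln e + ln t. The first entry ensures e (a + 1) <= 1/2,
   where chi = 1; the second makes N |P| - |L| exceed C. *)
pose N := Num.max (ln (2 * (a + 1))) ((`|C| + `|L| + 1) / `|P|).
have N0 : 0 <= N by rewrite le_max ln_ge0//; have := a1; lra.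
pose e := expR (- N); have e0 : 0 < e := expR_gt0 _.
have ea : e * (a + 1) <= 2^-1.
  rewrite /e expRN mulrC ler_pdivrMr ?expR_gt0// -ler_pdivrMl ?invr_gt0// invrK.
  rewrite -[leLHS]lnK ?posrE ?mulr_gt0//; rewrite ler_expR.
  by rewrite le_max lexx.
have lne : ln e = - N by rewrite /e expRK.
have wp : cubic_weight T (fun t => ln e * `|t| `^ (- 0) + ln `|t|).
  split; first by apply: measurable_funD; [apply: measurable_funM; [exact: measurable_cst|exact: w0.1]|exact: wl.1].
  have [Q Q0 HQ] := w0.2; have [Q' Q'0 HQ'] := wl.2; exists (`|ln e| * Q + Q') => [|t ht].
    by rewrite ltr_wpDl// mulr_ge0// ltW.
  by rewrite (le_trans (ler_normD _ _))// lerD//; [rewrite normrM ler_wpM2l//; exact: HQ|exact: HQ'].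
have kp t : 1 <= t <= a + 1 -> log_weight chi (e * t) = (ln e * `|t| `^ (- 0) + ln `|t|)%:C.
  move=> ht; have tp := cubic_range ht; rewrite /log_weight (chi_small e0 ea ht) mul1r.
  by rewrite oppr0 powRr0 mulr1 (gtr0_norm tp) gtr0_norm ?mulr_gt0// lnM ?posrE.
have := HC e _ e0 ea wp kp.
have bM := bump_iter M beta_bump.
have wz : cubic_weight T (fun t => ln e * `|t| `^ (- 0)).
  split; first by apply: measurable_funM; [exact: measurable_cst|exact: w0.1].
  have [Q Q0 HQ] := w0.2; exists (`|ln e| * Q + 1) => [|t ht].
    by rewrite ltr_wpDl// mulr_ge0// ltW.
  by rewrite normrM (le_trans (ler_wpM2l (normr_ge0 _) (HQ t ht)))// lerDl.
rewrite (cubic_weightD T0 wz wl bM bM) (cubic_weightZ T0 _ w0 bM bM) -/(profile T 0 _ _) -/P -/L.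
rewrite (_ : 3 * (1 + (s + 3^-1) - s) = 4%:R); last by field.
rewrite powR_mulrn ?(ltW e0)// [C * _]mulrC ler_pM2l ?exprn_gt0// lne.
have : (`|C| + `|L| + 1) <= N * `|P| by rewrite -ler_pdivrMr// le_max lexx orbT.
exact: lower_bound_absurd.
Qed.

End Lower.

Theorem mainTheorem3 (R : realType) (chi : R -> R[i])
    (chi_test : test_function chi)
    (chi1 : forall t : R, `|t| <= 2^-1 -> chi t = 1) :
  (forall l : R, - 2^-1 < l -> l < 2^-1 ->
     let k := power_weight chi (l + 2^-1) in
     [/\ paired_class (- 2^-1) l (fun f => dist2_of_fun (curve_op k f)),
         (forall s : R,
            bounded_comp_loc (curve_op_dist k) s (s - (2 * l - 1) / 6)) &
         ~ (exists s r' : R, r' < (2 * l - 1) / 6 /\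
              bounded_comp_loc (curve_op_dist k) s (s - r'))]) /\
  (paired_class (- 2^-1) (- 2^-1)
     (fun f => dist2_of_fun (curve_op (log_weight chi) f)) /\
   forall s : R,
     ~ bounded_comp_loc (curve_op_dist (log_weight chi)) s (s + 3^-1)).
Proof.
have [T T0 chiT] := cs_bound chi_test.2.
split=> [l l1 l2 k|]; last first.
  split; last by move=> s; exact: log_unbounded chi_test chi1 T0 chiT s.
  have [m wm] := log_weightP chi_test chi1.
  by have := paired_weight (lexx 0) ltr01 wm; rewrite sub0r.
have b0 : 0 < l + 2^-1 by lra.
have b1 : l + 2^-1 < 1 by lra.
have [m wm] := power_weightP chi_test chi1 b0 b1.
split.
- by have := paired_weight (ltW b0) b1 wm; rewrite addrK.
- move=> s; have [T' T'0 kT] := weight_cs wm; have jk := weight_citg wm.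
  have [C C0 HC] := curve_mult_decay chi_test b0 b1 jk.
  (* For b = l + 1/2 the gain sigma is (1 - b)/3. As [jb] is the squared bracket, the multiplier
     must decay with exponent -sigma/2 = (b - 1)/6. *)
  apply: (curve_op_bounded (sigma := - ((2 * l - 1) / 6)) s T'0 jk kT C0) => xi.
  by rewrite (_ : - (_ / 2) = (l + 2^-1 - 1) / 6) ?HC//; field.
- move=> [s [r' [rr]]]; apply: (power_unbounded chi_test chi1 T0 chiT b0 b1).
  lra.
Qed.
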